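(* Let $(M,\lambda,J)$ be a contact triad with $M$ compact. Let $w:[0,\infty)\times S^1\to M$ be a contact instanton such that $$ \int_{[0,\infty)\times S^1}|d^\pi w|^2\,d\tau\,dt<\infty,\qquad \|dw\|_{C^0([0,\infty)\times S^1)}<\infty, $$ and let $T$, $Q$ be its asymptotic contact action and asymptotic contact charge. Then for any sequence $s_k\to\infty$ there exist a subsequence, still denoted by $s_k$, and a massless instanton $w_\infty(\tau,t)$ (i.e. a contact instanton with $E^\pi(w_\infty)=0$) on the cylinder $\mathbb{R}\times S^1$ such that $$ \lim_{k\to\infty}w(s_k+\tau,t)=w_\infty(\tau,t) $$ in the $C^l(K\times S^1,M)$ sense for any $l$, where $K\subset[0,\infty)$ is an arbitrary compact set. Furthermore, $w_\infty$ has the formula $w_\infty(\tau,t)=\gamma(-Q\,\tau+T\,t)$, where $\gamma$ is some Reeb trajectory, and in the case $T\neq0$ the trajectory $\gamma$ is a closed Reeb orbit of $X_\lambda$ with period $T$.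
   Context: Contact triad: $M$ is a smooth $(2n+1)$-dimensional manifold with a co-oriented contact structure $\xi=\ker\lambda$, where $\lambda$ is a contact form. The Reeb vector field $X_\lambda$ is defined by $\lambda(X_\lambda)=1$, $X_\lambda\rfloor d\lambda=0$; a Reeb trajectory is a curve $\gamma:\mathbb{R}\to M$ with $\dot\gamma=X_\lambda(\gamma)$. $J:\xi\to\xi$ is an endomorphism with $J^2=-\mathrm{id}$, compatible with $d\lambda$ in the sense that $g_\xi=d\lambda(\cdot,J\cdot)$ makes $(\xi,J,g_\xi)$ a Hermitian vector bundle. The triple $(M,\lambda,J)$ is called a contact triad and $M$ carries the triad metric $g=g_\xi+\lambda\otimes\lambda$. $\pi:TM\to\xi$ is the projection along $X_\lambda$. $S^1=\mathbb{R}/\mathbb{Z}$; cylinders have coordinates $(\tau,t)$, the metric $d\tau^2+dt^2$ and the complex structure $j\,\partial_\tau=\partial_t$. A contact instanton is a smooth map $w$ with $\overline{\partial}^\pi w:=\frac12(\pi dw+J\pi dw\circ j)=0$ and $d(w^*\lambda\circ j)=0$. Here $d^\pi w=\pi\,dw$ and the $\pi$-harmonic energy is $E^\pi(w)=\frac12\int|d^\pi w|^2$. The asymptotic contact action and charge of $w:[0,\infty)\times S^1\to M$ are $$T=\frac12\int_{[0,\infty)\times S^1}|d^\pi w|^2+\int_{\{0\}\times S^1}(w|_{\{0\}\times S^1})^*\lambda,\qquad Q=\int_{\{0\}\times S^1}(w^*\lambda\circ j)|_{\{0\}\times S^1}.$$ ''Period $T$'' means $\gamma(s+T)=\gamma(s)$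 for all $s$ ($T$ may be negative). *)

(* Defs.v *)
From HB Require Import structures.
From mathcomp Require Import all_boot all_order all_algebra all_fingroup.
From mathcomp Require Import all_classical all_reals all_analysis.

Set Implicit Arguments.
Unset Strict Implicit.
Unset Printing Implicit Defensive.

Import Order.TTheory GRing.Theory Num.Theory numFieldNormedType.Exports.
Local Open Scope classical_set_scope.
Local Open Scope ring_scope.

(** * Differential calculus *)

Fixpoint iterD (R : realType) (V W : normedModType R) (vs : seq V)
    (f : V -> W) : V -> W :=
  if vs is v :: vs' then 'D_v (iterD vs' f) else f.

(** [f] is of class C^k on [A]. This is meaningful for open [A] and
    finite-dimensional [V], where quantifying over all directions amounts to
    quantifying over the directions of a basis. *)
Fixpoint Ck (R : realType) (V W : normedModType R) (k : nat) (A : set V)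
    (f : V -> W) : Prop :=
  (forall x, A x -> {for x, continuous f}) /\
  (if k is k'.+1 then
     forall v, (forall x, A x -> derivable f x v) /\ Ck k' A ('D_v f)
   else True).

Definition smooth_on (R : realType) (V W : normedModType R) (A : set V)
    (f : V -> W) : Prop := forall k, Ck k A f.

(** Directional derivative at [p] of a function that is only meaningful on [D]:
    the difference quotient is restricted to [D], so that the derivative is
    one-sided at the boundary of a half-space; it is ['D_v f p] when [p] is
    interior to [D]. *)
Definition derive_in (R : realType) (V W : normedModType R) (D : set V)
    (v : V) (f : V -> W) (p : V) : W :=
  lim ((fun h : R => h^-1 *: (f (p + h *: v) - f p)) @
       within [set h : R | D (p + h *: v)] (0 : R)^').

(** [(d alpha)_p(u, v)], for a 1-form [p, v |-> alpha p v] on the domain [D] of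
    a vector space: the constant vector fields [u] and [v] commute, whence
    [d alpha (u, v) = u (alpha v) - v (alpha u)]. *)
Definition ext_d (R : realType) (V : normedModType R) (D : set V)
    (alpha : V -> V -> R) (p u v : V) : R :=
  derive_in D u (fun q => alpha q v) p - derive_in D v (fun q => alpha q u) p.

(** * Smooth manifolds *)

(** [chart_at] is the statement that the charts cover the manifold, in
    skolemized form. [param a] inverts [coord a] on [dom a]. *)
Record manifold (R : realType) (m : nat) := Manifold {
  carrier :> topologicalType ;
  index : Type ;
  dom : index -> set carrier ;
  coord : index -> carrier -> 'rV[R]_m ;
  param : index -> 'rV[R]_m -> carrier ;
  chart_at : carrier -> index ;
  manifold_hausdorff : hausdorff_space carrier ;
  manifold_second_countable : @second_countable carrier ;
  chart_at_dom : forall p, dom (chart_at p) p ;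
  dom_open : forall a, open (dom a) ;
  coord_open : forall a, open (coord a @` dom a) ;
  coordK : forall a p, dom a p -> param a (coord a p) = p ;
  coord_continuous : forall a p, dom a p -> {for p, continuous (coord a)} ;
  param_continuous : forall a x, (coord a @` dom a) x ->
    {for x, continuous (param a)} ;
  transition_smooth : forall a b,
    smooth_on (coord a @` (dom a `&` dom b)) (coord b \o param a)
}.

Definition cdom (R : realType) (m : nat) (M : manifold R m) (a : index M) :
  set 'rV[R]_m := @coord R m M a @` dom a.

Definition overlap (R : realType) (m : nat) (M : manifold R m)
  (a b : index M) : set 'rV[R]_m := @coord R m M a @` (dom a `&` dom b).

Definition transition (R : realType) (m : nat) (M : manifold R m)
  (a b : index M) : 'rV[R]_m -> 'rV[R]_m := @coord R m M b \o @param R m M a.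

(** Tensor fields are given by their representatives in the charts, subject to
    the transformation law. A tangent vector at [p] is represented by its
    components in a chart around [p]. *)
Record one_form (R : realType) (m : nat) (M : manifold R m) := OneForm {
  form_rep :> index M -> 'rV[R]_m -> {scalar 'rV[R]_m} ;
  form_smooth : forall a v, smooth_on (cdom a) (fun x => form_rep a x v) ;
  form_transition : forall a b x v, overlap a b x ->
    form_rep a x v = form_rep b (transition a b x) ('D_v (transition a b) x)
}.

Record endo_field (R : realType) (m : nat) (M : manifold R m) := EndoField {
  endo_rep :> index M -> 'rV[R]_m -> {linear 'rV[R]_m -> 'rV[R]_m} ;
  endo_smooth : forall a v, smooth_on (cdom a) (fun x => endo_rep a x v) ;
  endo_transition : forall a b x v, overlap a b x ->
    'D_(endo_rep a x v) (transition a b) x =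
    endo_rep b (transition a b x) ('D_v (transition a b) x)
}.

(** * Contact triads *)

Definition dform (R : realType) (m : nat) (M : manifold R m)
    (lam : one_form M) (a : index M) (x u v : 'rV[R]_m) : R :=
  ext_d (cdom a) (fun y w => lam a y w) x u v.

(** [2 ^ n] times the value of [lam /\ (d lam)^n] on the coordinate frame. *)
Definition contact_volume (R : realType) (n : nat)
    (M : manifold R n.*2.+1) (lam : one_form M) (a : index M)
    (x : 'rV[R]_n.*2.+1) : R :=
  let e (s : 'S_n.*2.+1) (k : nat) : 'rV[R]_n.*2.+1 :=
    delta_mx 0 (s (inord k)) in
  \sum_(s : 'S_n.*2.+1) (-1) ^+ s * (lam a x (e s 0%N) *
    \prod_(i < n) dform lam a x (e s i.*2.+1) (e s i.*2.+2)).

Definition contact_form (R : realType) (n : nat) (M : manifold R n.*2.+1)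
    (lam : one_form M) : Prop :=
  forall a x, cdom a x -> contact_volume lam a x != 0.

(** The vector determined by [lam(X) = 1] and [X _| d lam = 0]. *)
Definition reeb (R : realType) (m : nat) (M : manifold R m)
    (lam : one_form M) (a : index M) (x : 'rV[R]_m) : 'rV[R]_m :=
  xget 0 [set X | lam a x X = 1 /\ forall u, dform lam a x X u = 0].

(** The projection [TM -> xi] along the Reeb vector field. *)
Definition xi_proj (R : realType) (m : nat) (M : manifold R m)
    (lam : one_form M) (a : index M) (x v : 'rV[R]_m) : 'rV[R]_m :=
  v - lam a x v *: reeb lam a x.

(** An endomorphism [J] of [xi] is encoded by its unique extension to [TM] that
    vanishes on the Reeb vector field. *)
Definition contact_triad (R : realType) (n : nat) (M : manifold R n.*2.+1)
    (lam : one_form M) (J : endo_field M) : Prop :=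
  contact_form lam /\
  forall a x, cdom a x ->
    [/\ J a x (reeb lam a x) = 0,
        forall v, lam a x (J a x v) = 0,
        forall v, lam a x v = 0 -> J a x (J a x v) = - v &
        let g u v := dform lam a x u (J a x v) in
        [/\ forall u v, lam a x u = 0 -> lam a x v = 0 -> g u v = g v u,
            forall v, lam a x v = 0 -> v != 0 -> 0 < g v v &
            forall u v, lam a x u = 0 -> lam a x v = 0 ->
              g (J a x u) (J a x v) = g u v]].

Definition triad_metric (R : realType) (m : nat) (M : manifold R m)
    (lam : one_form M) (J : endo_field M) (a : index M)
    (x u v : 'rV[R]_m) : R :=
  dform lam a x (xi_proj lam a x u) (J a x (xi_proj lam a x v)) +
  lam a x u * lam a x v.

Definition reeb_trajectory (R : realType) (m : nat) (M : manifold R m)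
    (lam : one_form M) (gamma : R -> M) : Prop :=
  continuous gamma /\
  forall s a, dom a (gamma s) ->
    is_derive s (1 : R) (@coord R m M a \o gamma)
      (reeb lam a (coord a (gamma s))).

(** * Maps on cylinders *)

(** Points of a cylinder are pairs [(tau, t)] with [t] in the universal cover of
    [S^1 = R/Z]; maps on a cylinder are 1-periodic in [t], and integrals over
    [S^1] are taken over [[0, 1[]. Values of maps outside of [D] are junk. *)
Definition half_cylinder (R : realType) : set (R * R) := [set p | 0 <= p.1].
Definition full_cylinder (R : realType) : set (R * R) := setT.

Definition d_tau (R : realType) : R * R := (1, 0).
Definition d_t (R : realType) : R * R := (0, 1).
Definition cyl_j (R : realType) (v : R * R) : R * R := (- v.2, v.1).

(** Smoothness on a half-cylinder is smoothness up to the boundary: local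
    existence of smooth extensions. *)
Definition smooth_cylinder_map (R : realType) (m : nat) (M : manifold R m)
    (D : set (R * R)) (w : R * R -> M) : Prop :=
  (forall p, D p -> w (p + d_t R) = w p) /\
  (forall p a, D p -> dom a (w p) ->
    exists (U : set (R * R)) (F : R * R -> 'rV[R]_m),
      [/\ open U, U p, smooth_on U F &
          forall q, D q -> U q -> dom a (w q) /\ coord a (w q) = F q]).

(** [dw_p(v)], in the preferred chart at [w p]. *)
Definition dmap (R : realType) (m : nat) (M : manifold R m)
    (D : set (R * R)) (w : R * R -> M) (p v : R * R) : 'rV[R]_m :=
  derive_in D v (@coord R m M (chart_at (w p)) \o w) p.

Definition dpi (R : realType) (m : nat) (M : manifold R m)
    (lam : one_form M) (D : set (R * R)) (w : R * R -> M) (p v : R * R) :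
    'rV[R]_m :=
  let a := chart_at (w p) in xi_proj lam a (coord a (w p)) (dmap D w p v).

Definition pullback (R : realType) (m : nat) (M : manifold R m)
    (lam : one_form M) (D : set (R * R)) (w : R * R -> M) (p v : R * R) : R :=
  let a := chart_at (w p) in lam a (coord a (w p)) (dmap D w p v).

Definition delbar_pi (R : realType) (m : nat) (M : manifold R m)
    (lam : one_form M) (J : endo_field M) (D : set (R * R))
    (w : R * R -> M) (p v : R * R) : 'rV[R]_m :=
  let a := chart_at (w p) in
  2^-1 *: (dpi lam D w p v +
           J a (coord a (w p)) (dpi lam D w p (cyl_j v))).

Definition contact_instanton (R : realType) (m : nat) (M : manifold R m)
    (lam : one_form M) (J : endo_field M) (D : set (R * R))
    (w : R * R -> M) : Prop :=
  [/\ smooth_cylinder_map D w,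
      forall p v, D p -> delbar_pi lam J D w p v = 0 &
      forall p u v, D p ->
        ext_d D (fun q z => pullback lam D w q (cyl_j z)) p u v = 0].

(** [|L|^2] for a linear map [L] from the tangent plane of the cylinder to the
    tangent space at [q] with the triad metric. *)
Definition norm_sq_at (R : realType) (m : nat) (M : manifold R m)
    (lam : one_form M) (J : endo_field M) (q : M)
    (L : R * R -> 'rV[R]_m) : R :=
  let a := chart_at q in
  let g := triad_metric lam J a (coord a q) in
  g (L (d_tau R)) (L (d_tau R)) + g (L (d_t R)) (L (d_t R)).

(** The integral of [|d^pi w|^2 dtau dt] over the cylinder. *)
Definition dpi_sq_integral (R : realType) (m : nat) (M : manifold R m)
    (lam : one_form M) (J : endo_field M) (D : set (R * R))
    (w : R * R -> M) : \bar R :=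
  (\int[(@lebesgue_measure R) \x (@lebesgue_measure R)]_(p in
       D `&` (setT `*` `[0%R, 1%R[))
     (norm_sq_at lam J (w p) (dpi lam D w p))%:E)%E.

Definition pi_energy (R : realType) (m : nat) (M : manifold R m)
    (lam : one_form M) (J : endo_field M) (D : set (R * R))
    (w : R * R -> M) : \bar R :=
  ((2^-1)%:E * dpi_sq_integral lam J D w)%E.

Definition massless_instanton (R : realType) (m : nat) (M : manifold R m)
    (lam : one_form M) (J : endo_field M) (w : R * R -> M) : Prop :=
  contact_instanton lam J (@full_cylinder R) w /\
  pi_energy lam J (@full_cylinder R) w = 0%E.

Definition bounded_differential (R : realType) (m : nat) (M : manifold R m)
    (lam : one_form M) (J : endo_field M) (D : set (R * R))
    (w : R * R -> M) : Prop :=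
  exists C : R, forall p, D p ->
    Num.sqrt (norm_sq_at lam J (w p) (dmap D w p)) <= C.

(** The integral is finite in the uses of this definition. *)
Definition asymptotic_action (R : realType) (m : nat) (M : manifold R m)
    (lam : one_form M) (J : endo_field M) (w : R * R -> M) : R :=
  2^-1 * fine (dpi_sq_integral lam J (@half_cylinder R) w) +
  \int[@lebesgue_measure R]_(t in `[0, 1[)
    pullback lam (@half_cylinder R) w (0, t) (d_t R).

Definition asymptotic_charge (R : realType) (m : nat) (M : manifold R m)
    (lam : one_form M) (w : R * R -> M) : R :=
  \int[@lebesgue_measure R]_(t in `[0, 1[)
    pullback lam (@half_cylinder R) w (0, t) (cyl_j (d_t R)).

(** Convergence in the C^l topology on [A]: in every chart of the target and on
    every compact subset of [A] that the limit maps into that chart, uniform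
    convergence of all partial derivatives of order at most [l]. The maps [u k]
    only need to be C^l near each compact subset of [A] for large [k]. *)
Definition Cl_cvg (R : realType) (m : nat) (M : manifold R m) (l : nat)
    (A : set (R * R)) (u : nat -> R * R -> M) (f : R * R -> M) : Prop :=
  forall (a : index M) (B : set (R * R)),
    compact B -> B `<=` A -> f @` B `<=` dom a ->
    (\forall k \near \oo, u k @` B `<=` dom a) /\
    forall vs : seq (R * R), (size vs <= l)%N ->
      forall e : R, 0 < e ->
      \forall k \near \oo, forall p, B p ->
        `|iterD vs (@coord R m M a \o u k) p -
          iterD vs (@coord R m M a \o f) p| < e.

(* Main.v *)
(* In charts a contact instanton solves a second-order elliptic system whose right
   side is quadratic in dw, so Bernstein's method turns the bound on |dw| into
   uniform bounds on all derivatives of w.  Write A = lam(w_tau), B = lam(w_t) and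
   E = |d^pi w|^2 / 2.  Then dA/dtau + dB/dt = 0 and dB/dtau - dA/dt = E.  The
   circle average of A is thus constant, equal to -Q, and that of B increases, with
   derivative the average of E; being bounded, it converges, with limit T.  The
   averages of E have a bounded derivative, so they tend to zero, and so does E; by
   Landau's interpolation inequality all derivatives of E decay as well.  The
   Laplacians of A and B are -dE/dt and dE/dtau, hence small, and Bernstein's
   estimate on large balls makes the gradients of A and B small.  So A -> -Q and
   B -> T uniformly, and dw approaches X_lam times (-Q dtau + T dt).  Along a
   subsequence with w(s_k, 0) convergent, comparison with the Reeb trajectory
   through the limit point gives pointwise convergence, and Landau's inequality
   upgrades it to all orders. *)

Require Import Defs.
From HB Require Import structures.
From mathcomp Require Import all_boot all_order all_algebra all_fingroup.
From mathcomp Require Import all_classical all_reals all_analysis.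
From mathcomp Require Import ring lra measurable_realfun.

Import Order.TTheory GRing.Theory Num.Theory numFieldNormedType.Exports.
Local Open Scope classical_set_scope.
Local Open Scope ring_scope.

Set Implicit Arguments.
Unset Strict Implicit.
Unset Printing Implicit Defensive.

(** * Directional derivatives and smooth maps *)

Section DirectionalDerivatives.
Context {R : realType}.
Implicit Types V W : normedModType R.

(** Bernstein's method stays within the maximum principle, so the derivative bounds need no function
    spaces and no elliptic regularity theory. Started from w itself, whose Laplacian is quadratic in
    dw, it would call for a smallness condition; the assumed bound on |dw| lets it start one order
    higher. If v stands for all derivatives of w of a fixed order at least one, already known to be
    bounded, then lap v is only linear in dv, while lap dv is quadratic in dv and linear in the
    second derivatives of v. The auxiliary function (K + |v|^2) eta^2 |dv|^2 with a cut-off eta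
    absorbs exactly this growth. The bound on |dw| also provides a radius, uniform up to infinity,
    on which w stays in one chart; without it an estimate in coordinates would say nothing about
    large tau. The limit is not found by a compactness theorem for maps: only points of M are
    extracted, and as dw becomes X_lam times a constant form, an ODE comparison determines
    everything else. So the limit comes with its formula, and its period is inherited from the
    periodicity of w in t. *)

Lemma nbhs_distP V (x : V) (A : set V) :
  nbhs x A <-> exists2 d : R, 0 < d & forall y, `|y - x| < d -> A y.
Proof.
split=> [/nbhs_ballP[d d0 dA]|[d d0 dA]].
  by exists d => // y yd; apply: dA; rewrite -ball_normE /ball_/= distrC.
by apply/nbhs_ballP; exists d => // y; rewrite -ball_normE /ball_/= distrC; exact: dA.
Qed.

Lemma open_distP V (A : set V) x : open A -> A x ->
  exists2 d : R, 0 < d & forall y, `|y - x| < d -> A y.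
Proof. by move=> oA Ax; apply/nbhs_distP; exact: open_nbhs_nbhs. Qed.

Lemma continuous_distP V W (f : V -> W) x : {for x, continuous f} <->
  forall e : R, 0 < e -> exists2 d : R, 0 < d &
    forall y, `|y - x| < d -> `|f y - f x| < e.
Proof.
split=> [/cvgrPdist_lt cf e e0|cf].
  have /nbhs_distP[d d0 H] := cf _ e0.
  by exists d => // y /H; rewrite distrC.
apply/cvgrPdist_lt => e e0; have [d d0 H] := cf _ e0.
by apply/nbhs_distP; exists d => // y /H; rewrite distrC.
Qed.

Lemma dnbhs0_distP (P : R -> Prop) : (\forall h \near 0^', P h) <->
  exists2 d : R, 0 < d & forall h, `|h| < d -> h != 0 -> P h.
Proof.
split=> [/nbhs_distP[d d0 H]|[d d0 H]].
  by exists d => // h hd; apply: H; rewrite subr0.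
by apply/nbhs_distP; exists d => // h; rewrite subr0; exact: H.
Qed.

Lemma is_derive_distP V W (f : V -> W) x v df : is_derive x v f df <->
  forall e : R, 0 < e -> exists2 d : R, 0 < d & forall h : R, `|h| < d -> h != 0 ->
    `|h^-1 *: (f (x + h *: v) - f x) - df| < e.
Proof.
have E : (fun h : R => h^-1 *: ((f \o shift x) (h *: v) - f x)) =
   (fun h => h^-1 *: (f (x + h *: v) - f x)) by apply/funext => h /=; rewrite (addrC x).
split=> [[dfx <-] e e0|H].
  move: dfx; rewrite /derivable E => /cvgrPdist_lt /(_ _ e0) /dnbhs0_distP[d d0 H].
  by exists d => // h hd h0; rewrite distrC /derive E; exact: H.
have C : (fun h : R => h^-1 *: ((f \o shift x) (h *: v) - f x)) @ 0^' --> df.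
  rewrite E; apply/cvgrPdist_lt => e e0; have [d d0 {}H] := H _ e0.
  by apply/dnbhs0_distP; exists d => // h hd h0; rewrite distrC; exact: H.
by apply: DeriveDef; [apply/cvg_ex; exists df|apply: cvg_lim].
Qed.

Lemma is_deriveP V W (f : V -> W) x v df :
  is_derive x v f df <-> derivable f x v /\ 'D_v f x = df.
Proof. by split=> [[]|[]]. Qed.

Lemma line_derive V W (f : V -> W) x v (t : R) df :
  is_derive (x + t *: v) v f df <-> is_derive t 1 (fun s => f (x + s *: v)) df.
Proof.
rewrite !is_derive_distP; split=> H e /H[d d0 {}H]; exists d => // h hd h0.
  by have := H h hd h0; rewrite -addrA -scalerDl [_ *: 1]mulr1.
by have := H h hd h0; rewrite [_ *: 1]mulr1 scalerDl addrA.
Qed.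

Lemma is_derive_affine V W (f : V -> W) (c x v : V) (r : R) df :
  is_derive (c + r *: x) v f df ->
  is_derive x v (fun y => f (c + r *: y)) (r *: df).
Proof.
have [->|r0] := eqVneq r 0.
  move=> _; rewrite scale0r [X in is_derive _ _ X _](_ : _ = cst (f c)).
    exact: is_derive_cst.
  by apply/funext => y; rewrite scale0r addr0.
move=> /is_derive_distP H; apply/is_derive_distP => e e0.
have [d d0 {}H] := H (e / `|r|) (divr_gt0 e0 (etrans (normr_gt0 r) r0)).
exists (d / `|r|); first by rewrite divr_gt0// normr_gt0.
move=> h; rewrite ltr_pdivlMr ?normr_gt0// -normrM => hd h0.
have := H _ hd (mulf_neq0 h0 r0).
rewrite ltr_pdivlMr ?normr_gt0// [ltLHS]mulrC -normrZ scalerBr scalerA invfM mulrCA.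
by rewrite divff// mulr1 (scalerDr r) (scalerA r) addrA (mulrC h).
Qed.

Lemma is_derive_dirZ V W (f : V -> W) x v df (k : R) :
  is_derive x v f df -> is_derive x (k *: v) f (k *: df).
Proof.
have [->|k0] := eqVneq k 0; first by rewrite !scale0r => _; exact: is_derive0.
move=> /is_derive_distP H; apply/is_derive_distP => e e0.
have [d d0 {}H] := H (e / `|k|) (divr_gt0 e0 (etrans (normr_gt0 k) k0)).
exists (d / `|k|); first by rewrite divr_gt0// normr_gt0.
move=> h; rewrite ltr_pdivlMr ?normr_gt0// -normrM => hd h0.
have := H _ hd (mulf_neq0 h0 k0).
rewrite ltr_pdivlMr ?normr_gt0// [ltLHS]mulrC -normrZ (scalerBr k) (scalerA k).
by rewrite invfM mulrCA divff// mulr1 (scalerA h).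
Qed.

Lemma derive_dirZ V W (f : V -> W) x v (k : R) : derivable f x v ->
  'D_(k *: v) f x = k *: 'D_v f x.
Proof. by move=> /derivableP /(is_derive_dirZ k) [_ ->]. Qed.

Lemma derive_dirN V W (f : V -> W) x v : derivable f x v ->
  'D_(- v) f x = - 'D_v f x.
Proof. by move=> fx; rewrite -scaleN1r derive_dirZ// scaleN1r. Qed.

Lemma mvt_line V (f : V -> R) x v (t : R) : 0 <= t ->
  (forall s, 0 <= s <= t -> derivable f (x + s *: v) v) ->
  exists2 s, 0 <= s <= t & f (x + t *: v) - f x = t * 'D_v f (x + s *: v).
Proof.
move=> t0 df.
have D s : 0 <= s <= t ->
    is_derive s 1 (fun s => f (x + s *: v)) ('D_v f (x + s *: v)).
  by move=> /df /derivableP; rewrite line_derive.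
have C : {within `[0, t], continuous (fun s => f (x + s *: v))}.
  by apply: derivable_within_continuous => s; rewrite in_itv/= => /D [].
have [|s] := @MVT_segment R _ (fun s => 'D_v f (x + s *: v)) 0 t t0 _ C.
  by move=> s; rewrite in_itv/= => /andP[/ltW a /ltW b]; apply: D; rewrite a b.
by rewrite in_itv/= scale0r addr0 subr0 => ? ->; exists s => //; rewrite mulrC.
Qed.

Lemma mvt_line1 V (f : V -> R) x v :
  (forall s, 0 <= s <= 1 -> derivable f (x + s *: v) v) ->
  exists2 s, 0 <= s <= 1 & f (x + v) - f x = 'D_v f (x + s *: v).
Proof.
by move=> /(mvt_line ler01)[s s01]; rewrite scale1r mul1r; exists s.
Qed.

Lemma mvt_lineh V (f : V -> R) x v (h : R) :
  (forall s, 0 <= s <= 1 -> derivable f (x + (s * h) *: v) v) ->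
  exists2 s, 0 <= s <= 1 & f (x + h *: v) - f x = h * 'D_v f (x + (s * h) *: v).
Proof.
move=> df; have [|s s01 E] := @mvt_line1 V f x (h *: v).
  move=> s /df; rewrite scalerA => /derivableP/(is_derive_dirZ h)[]//.
by exists s => //; rewrite E scalerA derive_dirZ//; exact: df.
Qed.

(** Split the increment at [x + h *: u]: the first leg is the difference quotient for ['D_u f x],
    the second a mean value of ['D_v f] near [x]. Hence only ['D_v f] has to be continuous. *)
Lemma is_derive_dirD V (f : V -> R) x u v :
  (\forall y \near x, derivable f y v) -> {for x, continuous ('D_v f)} ->
  derivable f x u -> is_derive x (u + v) f ('D_u f x + 'D_v f x).
Proof.
move=> /nbhs_distP[d1 d10 fv] /continuous_distP cv /derivableP/is_derive_distP fu.
apply/is_derive_distP => e e0; have e20 : 0 < e / 2 by rewrite divr_gt0.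
have [d2 d20 {}fu] := fu _ e20; have [d3 d30 {}cv] := cv _ e20.
have uv0 : 0 < 1 + `|u| + `|v| by rewrite -addrA ltr_pwDl// addr_ge0.
pose d := Num.min d1 d3 / (1 + `|u| + `|v|).
exists (Num.min d2 d).
  by rewrite lt_min d20 divr_gt0// lt_min d10.
move=> h; rewrite lt_min => /andP[hd2 hd] h0.
have D s : 0 <= s <= 1 -> `|x + h *: u + (s * h) *: v - x| < Num.min d1 d3.
  move=> /andP[s0 s1]; rewrite addrC addrA addKr.
  rewrite (le_lt_trans (ler_normD _ _))// !normrZ ?normrM (ger0_norm s0).
  move: hd; rewrite /d ltr_pdivlMr// => /(le_lt_trans _); apply.
  rewrite !mulrDr mulr1 lerD//; first by rewrite lerDr.
  by rewrite ler_wpM2r// ler_piMl.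
have [|s s01 E] := @mvt_lineh V f (x + h *: u) v h.
  by move=> s /D; rewrite lt_min => /andP[/fv].
rewrite [e]splitr (scalerDr h) (addrA x) -[_ - f x](subrKA (f (x + h *: u))) (scalerDr h^-1).
rewrite [X in _ - X]addrC opprD addrACA (le_lt_trans (ler_normD _ _))// ltrD//; last exact: (fu h hd2 h0).
rewrite E [_ *: _]mulrA mulVf// mul1r.
by apply: cv; move: (D _ s01); rewrite lt_min => /andP[].
Qed.

End DirectionalDerivatives.

(** * Strict differentiability of C^1 functions of several variables *)

Section C1maps.
Context {R : realType} {m : nat}.
Implicit Types G : 'rV[R]_m -> R.

Definition ev (j : 'I_m) : 'rV[R]_m := delta_mx 0 j.

Lemma rV_sum_ev (k : 'rV[R]_m) : k = \sum_j k 0 j *: ev j.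
Proof.
apply/rowP => i; rewrite summxE (bigD1 i)//= !mxE !eqxx mulr1 big1 ?addr0//.
by move=> j ji; rewrite !mxE eqxx eq_sym (negbTE ji) mulr0.
Qed.

Lemma coord_le_norm (k : 'rV[R]_m) j : `|k 0 j| <= `|k|.
Proof.
rewrite [leRHS]/Num.Def.normr/= mx_normrE.
exact: (le_trans _ (le_bigmax _ _ (0, j))).
Qed.

Lemma rV_norm_le (k : 'rV[R]_m) (e : R) : 0 <= e ->
  (forall j, `|k 0 j| <= e) -> `|k| <= e.
Proof.
move=> e0 H; rewrite [leLHS]/Num.Def.normr/= mx_normrE.
by rewrite bigmax_le// => -[i j] _ /=; rewrite ord1.
Qed.

Lemma rV_norm_lt (k : 'rV[R]_m) (e : R) : 0 < e ->
  (forall j, `|k 0 j| < e) -> `|k| < e.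
Proof.
move=> e0 H; rewrite [ltLHS]/Num.Def.normr/= mx_normrE.
by rewrite bigmax_lt// => -[i j] _ /=; rewrite ord1.
Qed.

Lemma rV_sum_ev_seq (k : 'rV[R]_m) (r : seq 'I_m) l : uniq r ->
  (\sum_(j <- r) k 0 j *: ev j) 0 l = if l \in r then k 0 l else 0.
Proof.
elim: r => [_|i r IH] /=; first by rewrite big_nil mxE.
move=> /andP[ir ur]; rewrite big_cons mxE IH// !mxE eqxx/= in_cons.
have [->|li] := eqVneq l i; first by rewrite (negbTE ir) mulr1 addr0.
by rewrite mulr0 add0r.
Qed.

(* Strict differentiability of C^1 functions, from which the chain rule follows
   without Frechet derivatives. *)
Lemma C1_strict (A : set 'rV[R]_m) G (y : 'rV[R]_m) : open A -> A y -> Ck 1 A G ->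
  forall e : R, 0 < e -> exists2 d : R, 0 < d & forall k, `|k| < d ->
    `|G (y + k) - G y - \sum_j k 0 j * 'D_(ev j) G y| <= e * `|k|.
Proof.
move=> oA Ay [_ GC] e e0.
(* One share of [e] for each of the [m] axes; [m.+1] avoids a division by zero. *)
have e10 : 0 < e / m.+1%:R by rewrite divr_gt0.
have : exists2 d : R, 0 < d & forall z, `|z - y| < d -> A z /\
    forall j, `|'D_(ev j) G z - 'D_(ev j) G y| < e / m.+1%:R.
  have F j : \forall z \near y, `|'D_(ev j) G z - 'D_(ev j) G y| < e / m.+1%:R.
    have [_ [cG _]] := GC (ev j).
    apply/nbhs_distP; exact: ((continuous_distP _ _).1 (cG _ Ay) _ e10).
  have [d1 d10 H1] := open_distP oA Ay.
  have [d2 d20 H2] := (nbhs_distP _ _).1 (filter_forall _ F).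
  exists (Num.min d1 d2); first by rewrite lt_min d10.
  by move=> z; rewrite lt_min => /andP[/H1 ? /H2 ?].
move=> [d d0 dH]; exists d => // k kd.
(* Telescoping along a path that changes one coordinate at a time. In the sup norm every
   intermediate point stays within [|k|] of [y]. *)
have St (r : seq 'I_m) : uniq r ->
    `|G (y + \sum_(j <- r) k 0 j *: ev j) - G y
       - \sum_(j <- r) k 0 j * 'D_(ev j) G y|
     <= (size r)%:R * (e / m.+1%:R * `|k|).
  elim: r => [|i r IH] /=.
    by rewrite !big_nil !addr0 subrr subr0 normr0 mul0r.
  move=> /andP[ir ur]; rewrite !big_cons.
  set S := \sum_(j <- r) _ *: _; rewrite [X in G (_ + X)]addrC addrA.
  have Dz s : 0 <= s <= 1 -> `|y + S + (s * k 0 i) *: ev i - y| < d.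
    move=> /andP[s0 s1]; rewrite addrC addrA addKr (le_lt_trans _ kd)//.
    apply: rV_norm_le => // l; rewrite 2!mxE rV_sum_ev_seq// !mxE eqxx/=.
    have kl := coord_le_norm k l.
    have [->|li] := eqVneq l i; last by rewrite mulr0 addr0; case: ifP; rewrite ?normr0.
    rewrite (negbTE ir) add0r mulr1 normrM (ger0_norm s0).
    by rewrite (le_trans _ (coord_le_norm k i))// ler_piMl.
  have [|s s01 E] := @mvt_lineh R _ G (y + S) (ev i) (k 0 i).
    by move=> s /Dz/dH[Az _]; apply: (GC _).1.
  rewrite -[G _ - G y](subrKA (G (y + S))) E opprD addrACA -mulrBr.
  rewrite (le_trans (ler_normD _ _))// mulrSr mulrDl mul1r [leRHS]addrC lerD//; last exact: IH.

  rewrite normrM mulrC ler_pM// ?coord_le_norm//.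
  by apply: ltW; have [_] := dH _ (Dz _ s01); exact.
have := St (index_enum 'I_m) (index_enum_uniq _).
rewrite -rV_sum_ev => /le_trans; apply.
rewrite mulrA ler_wpM2r// mulrCA ler_piMr//; first exact: ltW.
rewrite ler_pdivrMr ?ltr0n// mul1r ler_nat -[X in (_ <= X.+1)%N]card_ord cardE enumT.
exact: ltnW.
Qed.

End C1maps.

(** * The chain rule *)

Section ChainRule.
Context {R : realType}.
Implicit Types V W : normedModType R.

Lemma is_derive_rVP V (m : nat) (f : V -> 'rV[R]_m) x v df :
  is_derive x v f df <-> forall j, is_derive x v (fun y => f y 0 j) (df 0 j).
Proof.
split=> [[fx <-] j|H].
  have fxj : derivable (fun y => f y 0 j) x v by exact: (derivable_mxP _ _ _).1.
  by apply: DeriveDef => //; rewrite derive_mx// mxE.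
have fx : derivable f x v.
  by apply/derivable_mxP => i j; rewrite ord1; have [] := H j.
apply: DeriveDef => //; rewrite derive_mx//; apply/rowP => j; rewrite mxE.
by have [_ ->] := H j.
Qed.

Lemma derive_coord V (m : nat) (f : V -> 'rV[R]_m) x v j : derivable f x v ->
  'D_v (fun y => f y 0 j) x = 'D_v f x 0 j.
Proof. by move=> /derivableP/is_derive_rVP/(_ j)[]. Qed.

Lemma continuous_rVP V (m : nat) (f : V -> 'rV[R]_m) x :
  {for x, continuous f} <-> forall j, {for x, continuous (fun y => f y 0 j)}.
Proof.
split=> [/continuous_distP H j|H].
  apply/continuous_distP => e /H[d d0 {}H]; exists d => // y /H.
  by apply: le_lt_trans; have := coord_le_norm (f y - f x) j; rewrite !mxE.
apply/continuous_distP => e e0.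
suff /nbhs_distP[] // : nbhs x [set y | `|f y - f x| < e] by move=> d ? ?; exists d.
have F j : \forall y \near x, `|f y 0 j - f x 0 j| < e.
  by have /continuous_distP/(_ e e0) := H j; exact: (nbhs_distP _ _).2.
apply: (@filterS _ (nbhs x) _ _ _ _ (filter_forall _ F)) => y Hy.
by apply: rV_norm_lt => // j; rewrite !mxE.
Qed.

Lemma is_derive_comp_sum V (m : nat) (A : set 'rV[R]_m) (G : 'rV[R]_m -> R)
    (u : V -> 'rV[R]_m) p v du :
  open A -> A (u p) -> Ck 1 A G -> is_derive p v u du ->
  is_derive p v (G \o u) (\sum_j du 0 j * 'D_(ev j) G (u p)).
Proof.
move=> oA Au CG Du; apply/is_derive_distP => e e0.
pose D := \sum_(j < m) `|'D_(ev j) G (u p)|.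
have D0 : 0 <= D by exact: sumr_ge0.
(* The remainder of strict differentiability will cost [e1 * (|du| + 1)], the error of the
   difference quotient [q] of [u] will cost [e1 * D]; together [e / 2]. *)
pose e1 := e / (2 * (`|du| + 1 + D)).
have P0 : 0 < `|du| + 1 + D by rewrite ltr_pwDl// ltr_wpDl.
have e10 : 0 < e1 by rewrite divr_gt0// mulr_gt0.
have [d d0 GC] := C1_strict oA Au CG e10.
have [d1 d10 uq1] := (is_derive_distP _ _ _ _).1 Du _ (ltr01 : (0 < 1 :> R)).
have [d2 d20 uq2] := (is_derive_distP _ _ _ _).1 Du _ e10.
pose d3 := d / (`|du| + 1).
have d30 : 0 < d3 by rewrite divr_gt0// ltr_wpDl.
exists (Num.min d1 (Num.min d2 d3)); first by rewrite !lt_min d10 d20.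
move=> h; rewrite !lt_min => /and3P[hd1 hd2 hd3] h0.
set k := u (p + h *: v) - u p; set q := h^-1 *: k.
have ql : `|q| <= `|du| + 1.
  rewrite -(subrK du q) addrC (le_trans (ler_normD _ _))// lerD2l.
  exact: ltW (uq1 h hd1 h0).
have kE : k = h *: q by rewrite /q scalerA divff// scale1r.
have kd : `|k| < d.
  rewrite kE normrZ; move: hd3; rewrite /d3 ltr_pdivlMr ?ltr_wpDl//.
  by apply: le_lt_trans; rewrite ler_wpM2l.
have := GC k kd; rewrite /k [u p + _]addrC subrK -/k.
set B := \sum_j _ * _ => GB.
have -> : h^-1 *: ((G \o u) (p + h *: v) - (G \o u) p)
     - \sum_j du 0 j * 'D_(ev j) G (u p) =
  h^-1 * (G (u (p + h *: v)) - G (u p) - B)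
    + \sum_j (q - du) 0 j * 'D_(ev j) G (u p).
  rewrite mulrBr /= [_ *: _]/(_ * _) -addrA; congr (_ + _).
  rewrite /B mulr_sumr -!sumrN -big_split/=; apply: eq_bigr => j _.
  by rewrite /q !mxE; ring.
rewrite (le_lt_trans (ler_normD _ _))//.
have a1 : `|h^-1 * (G (u (p + h *: v)) - G (u p) - B)| <= e1 * (`|du| + 1).
  rewrite normrM (le_trans (ler_wpM2l _ GB))// mulrCA (ler_wpM2l (ltW e10))//.
  by rewrite -normrZ -/q.
have a2 : `|\sum_j (q - du) 0 j * 'D_(ev j) G (u p)| <= e1 * D.
  rewrite (le_trans (ler_norm_sum _ _ _))// mulr_sumr ler_sum// => j _.
  rewrite normrM ler_wpM2r// (le_trans (coord_le_norm _ _))// ltW//.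
  exact: uq2.
rewrite (le_lt_trans (lerD a1 a2))// -mulrDr /e1 invfM mulrA divfK ?gt_eqF//.
by rewrite gtr_pMr// invf_lt1// ltr1n.
Qed.

Lemma derive_dir_sum (m : nat) (A : set 'rV[R]_m) (G : 'rV[R]_m -> R) y w :
  open A -> A y -> Ck 1 A G ->
  is_derive y w G (\sum_j w 0 j * 'D_(ev j) G y).
Proof. by move=> oA Ay CG; exact: (@is_derive_comp_sum _ _ A G id). Qed.

Lemma is_derive_compC1 V (m : nat) (A : set 'rV[R]_m) (G : 'rV[R]_m -> R)
    (u : V -> 'rV[R]_m) p v du :
  open A -> A (u p) -> Ck 1 A G -> is_derive p v u du ->
  is_derive p v (G \o u) ('D_du G (u p)).
Proof.
move=> oA Au CG Du; have [_ ->] := derive_dir_sum du oA Au CG.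
exact: (is_derive_comp_sum oA Au CG Du).
Qed.

End ChainRule.

(** * Closure properties of C^k functions and symmetry of second derivatives *)

Section CkTheory.
Context {R : realType}.
Implicit Types V W : normedModType R.

Lemma Ck_cont V W k (A : set V) (f : V -> W) x :
  Ck k A f -> A x -> {for x, continuous f}.
Proof. by case: k => [|k] [cf _]; exact: cf. Qed.

Lemma CkS_is_derive V W k (A : set V) (f : V -> W) x v :
  Ck k.+1 A f -> A x -> is_derive x v f ('D_v f x).
Proof. by move=> [_ /(_ v)[df _]] /df /derivableP. Qed.

Lemma CkS_derive V W k (A : set V) (f : V -> W) v :
  Ck k.+1 A f -> Ck k A ('D_v f).
Proof. by move=> [_ /(_ v)[]]. Qed.

Lemma Ck_sub V W k (A B : set V) (f : V -> W) : B `<=` A -> Ck k A f -> Ck k B f.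
Proof.
move=> BA; elim: k f => [|k IH] f [cf df]; split=> //; try by move=> x /BA/cf.
by move=> v; split; [move=> x /BA; exact: (df v).1|apply: IH; exact: (df v).2].
Qed.

Lemma Ck_pred V W k (A : set V) (f : V -> W) : Ck k.+1 A f -> Ck k A f.
Proof.
elim: k f => [|k IH] f [cf df]; split=> //.
by move=> v; split; [exact: (df v).1|apply: IH; exact: (df v).2].
Qed.

Lemma Ck_le V W k l (A : set V) (f : V -> W) : (k <= l)%N -> Ck l A f -> Ck k A f.
Proof.
move=> /subnK <-; elim: (l - k)%N => //= j IH /Ck_pred; exact: IH.
Qed.

Lemma near_open V (A : set V) x (P : V -> Prop) : open A -> A x ->
  (forall y, A y -> P y) -> \forall y \near x, P y.
Proof. by move=> oA Ax AP; apply: filterS AP _; exact: open_nbhs_nbhs. Qed.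

Lemma continuous_ext_open V W (A : set V) (f g : V -> W) x : open A -> A x ->
  (forall y, A y -> f y = g y) -> {for x, continuous f} -> {for x, continuous g}.
Proof.
move=> oA Ax fg fx; change (g y @[y --> x] --> g x); rewrite -(fg _ Ax).
by apply: cvg_trans fx; apply: near_eq_cvg; apply: near_open fg => //.
Qed.

Lemma Ck_ext V W k (A : set V) (f g : V -> W) : open A ->
  (forall x, A x -> f x = g x) -> Ck k A f -> Ck k A g.
Proof.
move=> oA; elim: k f g => [|k IH] f g fg [cf df]; split=> //.
- by move=> x Ax; exact: continuous_ext_open fg (cf _ Ax).
- by move=> x Ax; exact: continuous_ext_open fg (cf _ Ax).
- move=> v; split.
    move=> x Ax; apply: near_eq_derivable ((df v).1 _ Ax).
    exact: near_open fg.
  apply: IH (df v).2 => x Ax; apply: near_eq_derive; exact: near_open fg.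
Qed.

Lemma CkS_intro V W k (A : set V) (f : V -> W) : open A ->
  (forall x, A x -> {for x, continuous f}) ->
  (forall v, exists2 g, forall x, A x -> is_derive x v f (g x) & Ck k A g) ->
  Ck k.+1 A f.
Proof.
move=> oA cf df; split=> // v; have [g fg Cg] := df v; split.
  by move=> x /fg [].
by apply: Ck_ext Cg => // x /fg [].
Qed.

Lemma Ck_cst V W k (A : set V) (c : W) : Ck k A (fun=> c).
Proof.
elim: k c => [|k IH] c; split=> //; try by move=> x _; exact: cst_continuous.
move=> v; split; first by move=> x _; exact: derivable_cst.
by rewrite (_ : 'D_v _ = fun=> 0)//; apply/funext => x; exact: derive_cst.
Qed.

Lemma Ck_add V W k (A : set V) (f g : V -> W) : open A ->
  Ck k A f -> Ck k A g -> Ck k A (fun x => f x + g x).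
Proof.
move=> oA; elim: k f g => [|k IH] f g Cf Cg.
  by split=> // x Ax; apply: continuousD; [exact: Ck_cont Cf Ax|exact: Ck_cont Cg Ax].
apply: CkS_intro => //.
  by move=> x Ax; apply: continuousD; [exact: Ck_cont Cf Ax|exact: Ck_cont Cg Ax].
move=> v; exists (fun x => 'D_v f x + 'D_v g x).
  by move=> x Ax; apply: is_deriveD; [exact: CkS_is_derive Cf Ax|exact: CkS_is_derive Cg Ax].
by apply: IH; exact: CkS_derive.
Qed.

Lemma Ck_mul V k (A : set V) (f g : V -> R) : open A ->
  Ck k A f -> Ck k A g -> Ck k A (fun x => f x * g x).
Proof.
move=> oA; elim: k f g => [|k IH] f g Cf Cg.
  by split=> // x Ax; apply: continuousM; [exact: Ck_cont Cf Ax|exact: Ck_cont Cg Ax].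
apply: CkS_intro => //.
  by move=> x Ax; apply: continuousM; [exact: Ck_cont Cf Ax|exact: Ck_cont Cg Ax].
move=> v; exists (fun x => f x * 'D_v g x + g x * 'D_v f x).
  by move=> x Ax; apply: is_deriveM; [exact: CkS_is_derive Cf Ax|exact: CkS_is_derive Cg Ax].
apply: Ck_add => //; apply: IH; do ?[exact: Ck_pred|exact: CkS_derive].
Qed.

Lemma Ck_opp V k (A : set V) (f : V -> R) : open A ->
  Ck k A f -> Ck k A (fun x => - f x).
Proof.
move=> oA Cf; rewrite (_ : (fun _ => _) = fun x => -1 * f x).
  by apply: Ck_mul => //; exact: Ck_cst.
by apply/funext => x; rewrite mulN1r.
Qed.

Lemma Ck_sub_fun V k (A : set V) (f g : V -> R) : open A ->
  Ck k A f -> Ck k A g -> Ck k A (fun x => f x - g x).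
Proof. by move=> oA Cf Cg; apply: Ck_add => //; exact: Ck_opp. Qed.

Lemma Ck_sum V k (A : set V) (I : Type) (r : seq I) (P : pred I) (f : I -> V -> R) :
  open A -> (forall i, P i -> Ck k A (f i)) -> Ck k A (fun x => \sum_(i <- r | P i) f i x).
Proof.
move=> oA Cf; elim: r => [|i r IH].
  by rewrite (_ : (fun _ => _) = fun=> 0); [exact: Ck_cst|apply/funext => x; rewrite big_nil].
rewrite (_ : (fun _ => _) = fun x => (if P i then f i x else 0) + \sum_(i <- r | P i) f i x).
  apply: Ck_add => //; case Pi : (P i); [exact: Cf|exact: Ck_cst].
by apply/funext => x; rewrite big_cons; case: ifP => // _; rewrite add0r.
Qed.

Lemma Ck_prod V k (A : set V) (I : Type) (r : seq I) (P : pred I) (f : I -> V -> R) :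
  open A -> (forall i, P i -> Ck k A (f i)) -> Ck k A (fun x => \prod_(i <- r | P i) f i x).
Proof.
move=> oA Cf; elim: r => [|i r IH].
  by rewrite (_ : (fun _ => _) = fun=> 1); [exact: Ck_cst|apply/funext => x; rewrite big_nil].
rewrite (_ : (fun _ => _) = fun x => (if P i then f i x else 1) * \prod_(i <- r | P i) f i x).
  apply: Ck_mul => //; case Pi : (P i); [exact: Cf|exact: Ck_cst].
by apply/funext => x; rewrite big_cons; case: ifP => // _; rewrite mul1r.
Qed.

Lemma Ck_inv V k (A : set V) (f : V -> R) : open A ->
  (forall x, A x -> f x != 0) -> Ck k A f -> Ck k A (fun x => (f x)^-1).
Proof.
move=> oA f0; elim: k => [|k IH] Cf.
  by split=> // x Ax; apply: continuousV (f0 _ Ax) _; exact: Ck_cont Cf Ax.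
have IH' := IH (Ck_pred Cf).
apply: CkS_intro => //.
  by move=> x Ax; apply: continuousV (f0 _ Ax) _; exact: Ck_cont Cf Ax.
move=> v; exists (fun x => - ((f x)^-1 * (f x)^-1 * 'D_v f x)).
  move=> x Ax; have Df := CkS_is_derive v Cf Ax.
  have [fx _] := Df; apply: DeriveDef; first exact: derivableV (f0 _ Ax) fx.
  rewrite deriveV ?f0// /GRing.scale/=.
  by rewrite mulNr -exprVn expr2.
by apply: Ck_opp => //; do ?apply: Ck_mul => //; exact: CkS_derive.
Qed.

Lemma Ck_rVP V (m : nat) k (A : set V) (u : V -> 'rV[R]_m) : open A ->
  Ck k A u <-> forall j, Ck k A (fun x => u x 0 j).
Proof.
move=> oA; split.
  move=> + j; elim: k u => [|k IH] u Cu.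
    by split=> // x Ax; exact: ((continuous_rVP _ _).1 (Ck_cont Cu Ax) j).
  apply: CkS_intro => //.
    by move=> x Ax; exact: ((continuous_rVP _ _).1 (Ck_cont Cu Ax) j).
  move=> v; exists (fun x => 'D_v u x 0 j).
    by move=> x /(CkS_is_derive v Cu)/is_derive_rVP.
  by apply: IH; exact: CkS_derive.
elim: k u => [|k IH] u Cu.
  by split=> // x Ax; apply/continuous_rVP => j; exact: Ck_cont (Cu j) Ax.
apply: CkS_intro => //.
  by move=> x Ax; apply/continuous_rVP => j; exact: Ck_cont (Cu j) Ax.
move=> v; exists (fun x => \row_j 'D_v (fun y => u y 0 j) x).
  by move=> x Ax; apply/is_derive_rVP => j; rewrite mxE; exact: CkS_is_derive (Cu j) Ax.
apply: IH => j; have := CkS_derive v (Cu j); apply: Ck_ext => // x _.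
by rewrite mxE.
Qed.

Lemma Ck_comp V (m : nat) k (A : set V) (B : set 'rV[R]_m) (G : 'rV[R]_m -> R)
    (u : V -> 'rV[R]_m) : open A -> open B -> (forall x, A x -> B (u x)) ->
  Ck k B G -> Ck k A u -> Ck k A (G \o u).
Proof.
move=> oA oB AB; elim: k G => [|k IH] G CG Cu.
  split=> // x Ax; apply: continuous_comp; first exact: Ck_cont Cu Ax.
  by apply: Ck_cont CG _; exact: AB.
apply: CkS_intro => //.
  move=> x Ax; apply: continuous_comp; first exact: Ck_cont Cu Ax.
  by apply: Ck_cont CG _; exact: AB.
move=> v; exists (fun x => \sum_j 'D_v (fun y => u y 0 j) x * ('D_(ev j) G \o u) x).
  move=> x Ax; have Du := CkS_is_derive v Cu Ax.
  have := is_derive_comp_sum oB (AB _ Ax) (Ck_le (ltn0Sn k) CG) Du.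
  rewrite (eq_bigr (fun j => 'D_v (fun y => u y 0 j) x * 'D_(ev j) G (u x)))//.
  by move=> j _; rewrite derive_coord//; case: Du.
apply: Ck_sum => // j _; apply: Ck_mul => //; last first.
  by apply: IH; [exact: CkS_derive|exact: Ck_pred].
apply: Ck_ext (_ : Ck k A (fun x => 'D_v u x 0 j)) => //.
  by move=> x /(CkS_is_derive v Cu)[? _]; rewrite derive_coord.
exact: ((Ck_rVP _ _ oA).1 (CkS_derive v Cu) j).
Qed.

Lemma Ck_coord (m : nat) k (A : set 'rV[R]_m) j : open A ->
  Ck k A (fun x => x 0 j).
Proof.
move=> oA; case: k => [|k].
  by split=> // x _; exact: coord_continuous.
apply: CkS_intro => //; first by move=> x _; exact: coord_continuous.
move=> v; exists (fun=> v 0 j); last exact: Ck_cst.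
by move=> x _; apply: (is_derive_rVP id _ _ _).1; exact: is_derive_id.
Qed.

Lemma derive_add_dir V (A : set V) (f : V -> R) x u v : open A -> A x ->
  Ck 1 A f -> 'D_(u + v) f x = 'D_u f x + 'D_v f x.
Proof.
move=> oA Ax Cf.
have [] := @is_derive_dirD R V f x u v _ _ _ => //.
- by apply: near_open oA Ax _ => y Ay; have [] := CkS_is_derive v Cf Ay.
- exact: Ck_cont (CkS_derive v Cf) Ax.
- by have [] := CkS_is_derive u Cf Ax.
Qed.

(** The mean value theorem, applied in direction [u] to the increment in direction [v] and then in
    direction [v] to ['D_u f], turns the second difference into ['D_v ('D_u f)] at a nearby point.
    Symmetry of the difference in [u] and [v] yields [schwarz]; replacing [u, v] by [v, - v] yields
    the second derivative test [D2_at_max]. *)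
Lemma double_difference V (A : set V) (f : V -> R) x u v : open A -> A x -> Ck 2 A f ->
  forall e : R, 0 < e -> exists2 d : R, 0 < d & forall h, `|h| < d -> h != 0 ->
   `|(h * h)^-1 * (f (x + h *: u + h *: v) - f (x + h *: u) - (f (x + h *: v) - f x))
     - 'D_v ('D_u f) x| < e.
Proof.
move=> oA Ax Cf e e0.
have Cu := CkS_derive u Cf; have Cvu := CkS_derive v Cu.
have [d1 d10 H1] := open_distP oA Ax.
have [d2 d20 H2] := (continuous_distP _ _).1 (Ck_cont Cvu Ax) _ e0.
have uv0 : 0 < 1 + `|u| + `|v| by rewrite -addrA ltr_pwDl// addr_ge0.
exists (Num.min d1 d2 / (1 + `|u| + `|v|)).
  by rewrite divr_gt0// lt_min d10.
move=> h hd h0.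
have D s t : 0 <= s <= 1 -> 0 <= t <= 1 ->
    `|x + (s * h) *: u + (t * h) *: v - x| < Num.min d1 d2.
  move=> /andP[s0 s1] /andP[t0 t1]; rewrite addrC addrA addKr.
  rewrite (le_lt_trans (ler_normD _ _))// !normrZ ?normrM (ger0_norm s0) (ger0_norm t0).
  move: hd; rewrite ltr_pdivlMr// => /(le_lt_trans _); apply.
  rewrite !mulrDr mulr1 lerD//; last by rewrite ler_wpM2r// ler_piMl.
  by rewrite ler_wpDl// ler_wpM2r// ler_piMl.
have DA s t : 0 <= s <= 1 -> 0 <= t <= 1 -> A (x + (s * h) *: u + (t * h) *: v).
  by move=> s01 t01; apply: H1; have := D _ _ s01 t01; rewrite lt_min => /andP[].
have i0 : ((0 : R) <= 0) && ((0 : R) <= 1) by rewrite lexx ler01.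
have i1 : ((0 : R) <= 1) && ((1 : R) <= 1) by rewrite lexx ler01.
have DA0 s : 0 <= s <= 1 -> A (x + (s * h) *: u).
  by move=> s01; have := DA s 0 s01 i0; rewrite mul0r scale0r addr0.
have DA1 s : 0 <= s <= 1 -> A (x + (s * h) *: u + h *: v).
  by move=> s01; have := DA s 1 s01 i1; rewrite mul1r.
pose g y := f (y + h *: v) - f y.
have Dg y : A y -> A (y + h *: v) -> is_derive y u g ('D_u f (y + h *: v) - 'D_u f y).
  move=> Ay Ayh; apply: is_deriveB; last exact: CkS_is_derive Cf Ay.
  have := CkS_is_derive u Cf Ayh; rewrite -[u in X in X -> _]scale1r.
  move=> /is_derive_distP H; apply/is_derive_distP => e' /H[d d0 {}H].
  exists d => // k kd k0; have := H k kd k0.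
  by rewrite scale1r addrAC.
have [|s s01 E] := @mvt_lineh R V g x u h.
  by move=> s s01; have [] := Dg _ (DA0 _ s01) (DA1 _ s01).
have [|t t01 E2] := @mvt_lineh R V ('D_u f) (x + (s * h) *: u) v h.
  by move=> t t01; have [] := CkS_is_derive v Cu (DA _ _ s01 t01).
have -> : f (x + h *: u + h *: v) - f (x + h *: u) - (f (x + h *: v) - f x) =
    g (x + h *: u) - g x by [].
have [_ Eg] := Dg _ (DA0 _ s01) (DA1 _ s01).
rewrite E Eg E2 [h * (h * _)]mulrA mulrA mulVf ?mul1r ?mulf_neq0//.
by apply: H2; have := D _ _ s01 t01; rewrite lt_min => /andP[].
Qed.

Lemma schwarz V (A : set V) (f : V -> R) x u v : open A -> A x -> Ck 2 A f ->
  'D_u ('D_v f) x = 'D_v ('D_u f) x.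
Proof.
move=> oA Ax Cf; apply/eqP/negP => /negP; rewrite -subr_eq0 -normr_gt0.
set a := 'D_u _ x; set b := 'D_v _ x => ab0.
have e0 : 0 < `|a - b| / 2 by rewrite divr_gt0.
have [d1 d10 H1] := double_difference v u oA Ax Cf e0.
have [d2 d20 H2] := double_difference u v oA Ax Cf e0.
pose h := Num.min d1 d2 / 2.
have m0 : 0 < Num.min d1 d2 by rewrite lt_min d10.
have h0 : 0 < h by rewrite divr_gt0.
have : `|h| < Num.min d1 d2 by rewrite gtr0_norm// ltr_pdivrMr// ltr_pMr// ltr1n.
rewrite lt_min => /andP[/H1/(_ (lt0r_neq0 h0)) + /H2/(_ (lt0r_neq0 h0))].
rewrite -[x + h *: v + _]addrA [_ *: v + _]addrC addrA.
set X := f _; set Y := f _; set Z := f _; set W := f x.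
rewrite -/a -/b (_ : X - Y - (Z - W) = X - Z - (Y - W)); last by ring.
set D := _ * _ => Ha Hb.
have : `|a - b| < `|a - b| / 2 + `|a - b| / 2.
  rewrite -[in ltLHS](subrKA D) (le_lt_trans (ler_normD _ _))// ltrD//.
  by rewrite (distrC a); exact: Ha.
by rewrite -splitr ltxx.
Qed.

End CkTheory.

(** * Bernstein's gradient estimate *)

Section SecondDerivatives.
Context {R : realType} {V : normedModType R} {A : set V} (oA : open A).
Implicit Types f g : V -> R.

Lemma D1_mul f g x v : Ck 1 A f -> Ck 1 A g -> A x ->
  'D_v (fun y => f y * g y) x = f x * 'D_v g x + g x * 'D_v f x.
Proof.
move=> Cf Cg Ax; have fx := CkS_is_derive v Cf Ax.
by have [_ ->] := is_deriveM fx (CkS_is_derive v Cg Ax).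
Qed.

Lemma D1_add f g x v : Ck 1 A f -> Ck 1 A g -> A x ->
  'D_v (fun y => f y + g y) x = 'D_v f x + 'D_v g x.
Proof.
move=> Cf Cg Ax; have fx := CkS_is_derive v Cf Ax.
by have [_ ->] := is_deriveD fx (CkS_is_derive v Cg Ax).
Qed.

Lemma D1_sum (I : Type) (r : seq I) (P : pred I) (f : I -> V -> R) x v :
  (forall i, Ck 1 A (f i)) -> A x ->
  'D_v (fun y => \sum_(i <- r | P i) f i y) x = \sum_(i <- r | P i) 'D_v (f i) x.
Proof.
move=> Cf Ax; elim: r => [|i r IH].
  rewrite big_nil (_ : (fun _ => _) = cst 0) ?derive_cst//.
  by apply/funext => y; rewrite big_nil.
rewrite big_cons -IH; case Pi : (P i).
  rewrite -D1_add//; last exact: Ck_sum.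
  by congr ('D_v _ x); apply/funext => y; rewrite big_cons Pi.
by congr ('D_v _ x); apply/funext => y; rewrite big_cons Pi.
Qed.

Lemma D_ext_open (W : normedModType R) (f g : V -> W) x v : A x -> (forall y, A y -> f y = g y) ->
  'D_v f x = 'D_v g x.
Proof. by move=> Ax fg; apply: near_eq_derive; exact: near_open fg. Qed.

Lemma D2_mul f g x u v : Ck 2 A f -> Ck 2 A g -> A x ->
  'D_u ('D_v (fun y => f y * g y)) x = f x * 'D_u ('D_v g) x
     + 'D_u f x * 'D_v g x + 'D_v f x * 'D_u g x + g x * 'D_u ('D_v f) x.
Proof.
move=> Cf Cg Ax; have Cf1 := Ck_pred Cf; have Cg1 := Ck_pred Cg.
rewrite (D_ext_open (g := fun y => f y * 'D_v g y + g y * 'D_v f y))//; last first.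
  by move=> y Ay; exact: D1_mul.
have Dg := CkS_derive v Cg; have Df := CkS_derive v Cf.
rewrite (D1_add u (Ck_mul oA Cf1 Dg) (Ck_mul oA Cg1 Df) Ax).
rewrite (D1_mul u Cf1 Dg Ax) (D1_mul u Cg1 Df Ax).
move: (f x) (g x) ('D_u f x) ('D_v f x) ('D_u g x) ('D_v g x).
move: ('D_u ('D_v f) x) ('D_u ('D_v g) x) => {Cf Cg Cf1 Cg1 Dg Df} *; ring.
Qed.

Lemma D2_add f g x u v : Ck 2 A f -> Ck 2 A g -> A x ->
  'D_u ('D_v (fun y => f y + g y)) x = 'D_u ('D_v f) x + 'D_u ('D_v g) x.
Proof.
move=> Cf Cg Ax; have Cf1 := Ck_pred Cf; have Cg1 := Ck_pred Cg.
rewrite (D_ext_open (g := fun y => 'D_v f y + 'D_v g y))//; last first.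
  by move=> y Ay; exact: D1_add.
exact: (D1_add u (CkS_derive v Cf) (CkS_derive v Cg) Ax).
Qed.

Lemma D2_sum (I : Type) (r : seq I) (P : pred I) (f : I -> V -> R) x u v :
  (forall i, Ck 2 A (f i)) -> A x ->
  'D_u ('D_v (fun y => \sum_(i <- r | P i) f i y)) x =
  \sum_(i <- r | P i) 'D_u ('D_v (f i)) x.
Proof.
move=> Cf Ax.
rewrite (D_ext_open (g := fun y => \sum_(i <- r | P i) 'D_v (f i) y))//; last first.
  by move=> y Ay; apply: D1_sum => // i; exact: Ck_pred.
by rewrite D1_sum// => i; exact: CkS_derive.
Qed.

Lemma D2_at_max f x v : A x -> Ck 2 A f -> (forall y, A y -> f y <= f x) ->
  'D_v ('D_v f) x <= 0.
Proof.
move=> Ax Cf fmax; rewrite leNgt; apply/negP => c0.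
have [d d0 H] := double_difference v (- v) oA Ax Cf c0.
have [d1 d10 H1] := open_distP oA Ax.
pose h := Num.min d (d1 / (1 + `|v|)) / 2.
have v0 : 0 < 1 + `|v| by rewrite ltr_pwDl.
have m0 : 0 < Num.min d (d1 / (1 + `|v|)) by rewrite lt_min d0 divr_gt0.
have h0 : 0 < h by rewrite divr_gt0.
have hm : `|h| < Num.min d (d1 / (1 + `|v|)).
  by rewrite gtr0_norm// ltr_pdivrMr// ltr_pMr// ltr1n.
move: (hm); rewrite lt_min => /andP[/H/(_ (lt0r_neq0 h0)) + hd1].
have hv : `|h *: v| < d1.
  rewrite normrZ; move: hd1; rewrite ltr_pdivlMr//; apply: le_lt_trans.
  by rewrite ler_wpM2l// lerDr.
rewrite scalerN addrK derive_dirN; last by have [] := CkS_is_derive v (CkS_derive v Cf) Ax.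
rewrite opprK => /ltr_normlP[_]; apply/negP; rewrite -leNgt lerDr.
rewrite mulr_ge0//; first by rewrite invr_ge0 mulr_ge0// ltW.
have := fmax (x + h *: v); have := fmax (x - h *: v).
move=> /(_ (H1 _ _)) + /(_ (H1 _ _)).
rewrite [x - _]addrC addrK normrN [x + _]addrC addrK => /(_ hv) + /(_ hv).
by lra.
Qed.

End SecondDerivatives.

(** * The pointwise inequality at a maximum *)

Section Bernstein.
Context {R : realType}.

Lemma amgm (a b t : R) : 0 < t -> 2 * a * b <= a ^+ 2 / t + t * b ^+ 2.
Proof.
move=> t0; rewrite -subr_ge0.
have -> : a ^+ 2 / t + t * b ^+ 2 - 2 * a * b = (a - t * b) ^+ 2 / t.
  by field; rewrite gt_eqF.
by rewrite divr_ge0 ?sqr_ge0 ?ltW.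
Qed.

(** [1024 * m ^+ 3 * C ^+ 2] is four times the coefficient of [H] that the product of the gradients
    of [A] and [P] costs, so a quarter of [A * Z * H] pays for it. The summand 1 keeps [K] at least
    1. *)
Definition bern_K (m C : R) := 1024 * m ^+ 3 * C ^+ 2 + 1.
Definition bern_A (m C : R) := bern_K m C + m * C ^+ 2.
(** The coefficient of [y = Z * P] in the final inequality [3 / 8 * y ^+ 2 <= bern_c * y + bern_A].
    The summands are, in order, the errors from the Laplacians of [A], [Z], [P] and from the
    gradient products of [Z, A] and [Z, P]. *)
Definition bern_c (m C c c5 : R) : R := let Am := bern_A m C in
  let D := m * C ^+ 2 in
  (2 * D + m * D ^+ 2) + Am * c5
  + Am * (C ^+ 2 * m + m ^+ 2 * C ^+ 2 + 4 * m ^+ 3 * Am * C ^+ 2)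
  + 512 * m * c ^+ 2 * C ^+ 2 + 256 * Am * m ^+ 2 * c ^+ 2.

(* Pointwise form of the estimate: A is K + sum v^2, Z = eta^2 the cut-off, P
   and H the squared norms of the first and second derivatives; LX stands for
   the Laplacian of X and GXY for the product of the gradients of X and Y. *)
Lemma bernstein_algebra (m C c c5 A Z P H N1 N2 eta LA LZ LP GZA GAP GZP : R) :
  1 <= m -> 0 <= C -> 0 <= c -> 0 <= c5 ->
  0 <= eta -> eta <= 1 -> Z = eta ^+ 2 ->
  bern_K m C <= A -> A <= bern_A m C -> 0 <= P -> 0 <= H -> 0 <= N1 -> 0 <= N2 ->
  N1 ^+ 2 <= m * P -> N2 ^+ 2 <= m * H ->
  2 * P - 2 * (m * C ^+ 2) * (1 + N1) <= LA ->
  2 * H - 2 * C * N1 * (1 + N1 ^+ 2 + N2) <= LP ->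
  `|LZ| <= c5 ->
  `|GAP| <= 8 * C * N1 ^+ 2 * N2 ->
  `|GZP| <= 8 * c * eta * N1 * N2 ->
  `|GZA| <= 8 * c * C * eta * N1 ->
  Z * P * LA + A * P * LZ + A * Z * LP + 2 * P * GZA + 2 * Z * GAP + 2 * A * GZP <= 0 ->
  Z * P <= 1 + 8 / 3 * (bern_c m C c c5 + bern_A m C).
Proof.
move=> m1 C0 c0 c50 e0 e1 ZE KA AAm P0 H0 N10 N20 NP NH LAge LPge LZle GAPle GZPle GZAle Lle.
have m0 : 0 < m by lra.
set Am := bern_A m C in AAm *; set K := bern_K m C in KA.
pose D := m * C ^+ 2.
have C2 : 0 <= C ^+ 2 by exact: sqr_ge0.
have m2 : 0 < m ^+ 2 by exact: exprn_gt0.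
have m3 : 0 < m ^+ 3 by exact: exprn_gt0.
have D0 : 0 <= D by apply: mulr_ge0; [exact: ltW|].
have K1 : 1 <= K.
  have := mulr_ge0 (ltW m3) C2; rewrite /K /bern_K; lra.
have A0 : 0 < A by lra.
have Am0 : 0 < Am by lra.
have Z0 : 0 <= Z by rewrite ZE sqr_ge0.
have Z1 : Z <= 1 by rewrite ZE expr_le1.
have Nm : N1 ^+ 2 / m <= P by rewrite ler_pdivrMr// mulrC.
have Nm2 : N2 ^+ 2 / m <= H by rewrite ler_pdivrMr// mulrC.
have N4 : N1 ^+ 2 ^+ 2 / m ^+ 2 <= P ^+ 2.
  by rewrite -expr_div_n ler_pXn2r// nnegrE// divr_ge0 ?sqr_ge0// ltW.
set c1 := 2 * D + m * D ^+ 2.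
have hA : P - c1 <= LA.
  have := amgm N1 D m0; rewrite /c1 -/D in LAge *; nra.
set c2 := C ^+ 2 * m + m ^+ 2 * C ^+ 2 + 4 * m ^+ 3 * Am * C ^+ 2.
have hP : H - c2 * P - 1 - P ^+ 2 / (4 * Am) <= LP.
  have t1 := amgm 1 (C * N1) (@ltr01 R).
  have t2 := amgm N2 (C * N1) m0.
  (* This weight makes the cubic term in [N1] cost [P ^+ 2 / (4 * Am)]; after multiplication by
     [A <= Am] that is at most a quarter of [P ^+ 2]. *)
  have q0 : 0 < 4 * m ^+ 2 * Am by have := mulr_gt0 m2 Am0; lra.
  have t3 := amgm (N1 ^+ 2) (C * N1) q0.
  have t4 : C ^+ 2 * N1 ^+ 2 <= C ^+ 2 * (m * P) by rewrite ler_wpM2l ?sqr_ge0.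
  have t5 : (N1 ^+ 2) ^+ 2 / (4 * m ^+ 2 * Am) <= P ^+ 2 / (4 * Am).
    rewrite (_ : (N1 ^+ 2) ^+ 2 / (4 * m ^+ 2 * Am) = (N1 ^+ 2) ^+ 2 / m ^+ 2 / (4 * Am)).
      by rewrite ler_wpM2r// invr_ge0; lra.
    by field; rewrite !gt_eqF.
  have t6 : m * (C * N1) ^+ 2 <= m * (C ^+ 2 * (m * P)).
    by rewrite exprMn (ler_wpM2l (ltW m0)).
  have t7 : 4 * m ^+ 2 * Am * (C * N1) ^+ 2 <= 4 * m ^+ 2 * Am * (C ^+ 2 * (m * P)).
    by rewrite exprMn (ler_wpM2l (ltW q0)).
  have t8 : (C * N1) ^+ 2 <= C ^+ 2 * (m * P) by rewrite exprMn.
  move: t1 t5; rewrite !expr1n divr1 !mul1r => t1 t5.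
  have E : 2 * C * N1 * (1 + N1 ^+ 2 + N2) =
     2 * 1 * (C * N1) + 2 * N1 ^+ 2 * (C * N1) + 2 * N2 * (C * N1) by ring.
  have E2 : c2 * P = C ^+ 2 * (m * P) + m * (C ^+ 2 * (m * P))
      + 4 * m ^+ 2 * Am * (C ^+ 2 * (m * P)) by rewrite /c2; ring.
  lra.
have hAP : - (P ^+ 2 / 4 + K * H / 4) <= 2 * GAP.
  have q0 : 0 < 4 * m ^+ 2 by lra.
  have t1 := amgm (N1 ^+ 2) (8 * C * N2) q0.
  have t2 : (N1 ^+ 2) ^+ 2 / (4 * m ^+ 2) <= P ^+ 2 / 4.
    rewrite (_ : (N1 ^+ 2) ^+ 2 / (4 * m ^+ 2) = (N1 ^+ 2) ^+ 2 / m ^+ 2 / 4).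
      by rewrite ler_wpM2r// invr_ge0.
    by field; rewrite gt_eqF.
  have t3 : 4 * m ^+ 2 * (8 * C * N2) ^+ 2 <= 256 * m ^+ 2 * C ^+ 2 * (m * H).
    rewrite (_ : _ * (8 * C * N2) ^+ 2 = 256 * m ^+ 2 * C ^+ 2 * N2 ^+ 2); last by ring.
    by apply: ler_wpM2l NH; have := mulr_ge0 (ltW m2) C2; clear; lra.
  have t4 : K * H / 4 = 256 * m ^+ 2 * C ^+ 2 * (m * H) + H / 4.
    by rewrite /K /bern_K; field.
  move: H0 t1 t2 t3 t4; have := GAPle; rewrite ler_norml => /andP[]; clear; lra.
have hZP : - (Z * H / 4 + 256 * m ^+ 2 * c ^+ 2 * P) <= 2 * GZP.
  have q0 : 0 < 4 * m by lra.
  have t1 := amgm (eta * N2) (8 * c * N1) q0.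
  have t2 : (eta * N2) ^+ 2 / (4 * m) <= Z * H / 4.
    rewrite (_ : (eta * N2) ^+ 2 / (4 * m) = Z * (N2 ^+ 2 / m) / 4).
      by rewrite ler_wpM2r ?invr_ge0// ler_wpM2l.
    by rewrite ZE; field; rewrite gt_eqF.
  have t3 : 4 * m * (8 * c * N1) ^+ 2 <= 256 * m * c ^+ 2 * (m * P).
    rewrite (_ : _ * (8 * c * N1) ^+ 2 = 256 * m * c ^+ 2 * N1 ^+ 2); last by ring.
    by apply: ler_wpM2l NP; have := mulr_ge0 (ltW m0) (sqr_ge0 c); clear; lra.
  have t4 : 256 * m ^+ 2 * c ^+ 2 * P = 256 * m * c ^+ 2 * (m * P) by ring.
  move: t1 t2 t3 t4; have := GZPle; rewrite ler_norml => /andP[]; clear; lra.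
have hZA : - (Z * P / 8 + 512 * m * c ^+ 2 * C ^+ 2) <= 2 * GZA.
  have q0 : 0 < 8 * m by lra.
  have t1 := amgm (eta * N1) (8 * c * C) q0.
  have t2 : (eta * N1) ^+ 2 / (8 * m) <= Z * P / 8.
    rewrite (_ : (eta * N1) ^+ 2 / (8 * m) = Z * (N1 ^+ 2 / m) / 8).
      by rewrite ler_wpM2r ?invr_ge0// ler_wpM2l.
    by rewrite ZE; field; rewrite gt_eqF.
  have t3 : 8 * m * (8 * c * C) ^+ 2 = 512 * m * c ^+ 2 * C ^+ 2 by ring.
  move: t1 t2 t3; have := GZAle; rewrite ler_norml => /andP[]; clear; lra.
have hLZ : - c5 <= LZ by have := LZle; rewrite ler_norml => /andP[].
pose y := Z * P; have y0 : 0 <= y by exact: mulr_ge0.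
pose c3 := 512 * m * c ^+ 2 * C ^+ 2; pose c4 := 256 * m ^+ 2 * c ^+ 2.
have AZ0 : 0 <= A * Z by rewrite mulr_ge0// ltW.
have c20 : 0 <= c2.
  have := mulr_ge0 (ltW m0) C2; have := mulr_ge0 (ltW m2) C2.
  have := mulr_ge0 (mulr_ge0 (ltW m3) (ltW Am0)) C2; rewrite /c2; clear; lra.
have c40 : 0 <= c4 by have := mulr_ge0 (ltW m2) (sqr_ge0 c); rewrite /c4; clear; lra.
have c30 : 0 <= c3.
  by have := mulr_ge0 (mulr_ge0 (ltW m0) (sqr_ge0 c)) C2; rewrite /c3; clear; lra.
have c10 : 0 <= c1.
  by have := mulr_ge0 (ltW m0) (sqr_ge0 D); move: D0; rewrite /c1; clear; lra.
have s1 : Z * P * (P - c1) <= Z * P * LA by rewrite ler_wpM2l.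
have s2 : A * P * (- c5) <= A * P * LZ by rewrite ler_wpM2l// mulr_ge0// ltW.
have s3 : A * Z * (H - c2 * P - 1 - P ^+ 2 / (4 * Am)) <= A * Z * LP by rewrite ler_wpM2l.
have s4 : P * - (Z * P / 8 + c3) <= P * (2 * GZA) by rewrite ler_wpM2l.
have s5 : Z * - (P ^+ 2 / 4 + K * H / 4) <= Z * (2 * GAP) by rewrite ler_wpM2l.
have s6 : A * - (Z * H / 4 + c4 * P) <= A * (2 * GZP) by rewrite ler_wpM2l// ltW.
have r1 : A * P * c5 <= Am * P * c5 by rewrite ler_wpM2r// ler_wpM2r.
have r2 : A * Z * (c2 * P) <= Am * (c2 * y).
  rewrite (_ : A * Z * (c2 * P) = A * (c2 * y)); last by rewrite /y; ring.
  by rewrite ler_wpM2r// mulr_ge0.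
have r3 : A * Z <= Am * 1 by rewrite ler_pM// ltW.
have r4 : A * Z * (P ^+ 2 / (4 * Am)) <= Z * P ^+ 2 / 4.
  rewrite (_ : A * Z * _ = A / Am * (Z * P ^+ 2 / 4)); last by field; rewrite gt_eqF.
  rewrite ler_piMl ?ler_pdivrMr ?mul1r//.
  by rewrite !mulr_ge0 ?sqr_ge0 ?invr_ge0.
have r5 : Z * (K * H) <= A * Z * H.
  by rewrite mulrCA -mulrA (ler_wpM2r (mulr_ge0 Z0 H0)).
have r6 : A * (c4 * P) <= Am * (c4 * P) by rewrite ler_wpM2r// mulr_ge0.
(* Budget: of [Z * P ^+ 2] the terms in [LP], [GAP] and [GZA] use 1/4, 1/4 and 1/8, which leaves
   3/8. Of [A * Z * H] the terms in [GAP] and [GZP] use a quarter each, and the rest is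
   nonnegative. *)
have F : 3 / 8 * (Z * P ^+ 2) <= c1 * y + Am * P * c5 + Am * (c2 * y) + A * Z
    + c3 * P + Am * (c4 * P).
  rewrite /y in r2 *; have AZH := mulr_ge0 AZ0 H0; move: AZH Lle s1 s2 s3 s4 s5 s6 r1 r2 r4 r5 r6; clear; lra.
have BcE : bern_c m C c c5 = c1 + Am * c5 + Am * c2 + c3 + Am * c4.
  by rewrite /bern_c -/Am -/D -/c1 -/c2 /c3 /c4; ring.
(* One more factor [Z <= 1] makes the left side a multiple of [y ^+ 2], so that the inequality is in
   [y] alone. *)
have G : 3 / 8 * y ^+ 2 <= (bern_c m C c c5) * y + Am.
  have F' := ler_wpM2l Z0 F.
  have Z2 : Z * (c1 * y) <= c1 * y.
    exact: (ler_piMl (mulr_ge0 c10 y0) Z1).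
  have Z3 : Z * (Am * (c2 * y)) <= Am * (c2 * y).
    exact: (ler_piMl (mulr_ge0 (ltW Am0) (mulr_ge0 c20 y0)) Z1).
  have Z4 : Z * (A * Z) <= Am.
    rewrite mulr1 in r3; apply: le_trans r3; exact: ler_piMl AZ0 Z1.
  rewrite BcE.
  rewrite (_ : 3 / 8 * y ^+ 2 = Z * (3 / 8 * (Z * P ^+ 2))); last by rewrite /y; ring.
  apply: (le_trans F').
  have -> : Z * (c1 * y + Am * P * c5 + Am * (c2 * y) + A * Z + c3 * P + Am * (c4 * P))
    = Z * (c1 * y) + Am * c5 * y + Z * (Am * (c2 * y)) + Z * (A * Z) + c3 * y + Am * c4 * y.
    by rewrite /y; clear; clearbody c1 c2 c3 c4 Am; ring.
  by move: Z2 Z3 Z4; clear; clearbody c1 c2 c3 c4 Am y; lra.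
have Bc0 : 0 <= bern_c m C c c5.
  rewrite BcE; have := mulr_ge0 (ltW Am0) c50; have := mulr_ge0 (ltW Am0) c20.
  have := mulr_ge0 (ltW Am0) c40; move: c10 c30; clear; lra.
rewrite -/y; move: (bern_c m C c c5) G Bc0 => B G B0; move: Am0 y0 G B0.
clear; clearbody y Am => Am0 y0 G B0.
(* For [y > 1] the constant [Am] is at most [Am * y], and division by [y] leaves a linear bound. *)
have [y1|y1] := leP y 1; first by lra.
have : y * (3 / 8 * y) <= y * (B + Am).
  have : Am * 1 <= Am * y by rewrite ler_pM2l// ltW.
  lra.
rewrite ler_pM2l; last lra.
lra.
Qed.

End Bernstein.

(** * Coordinates and the Laplacian on the plane *)

Section PlaneCalculus.
Context {R : realType}.

(** Directions are indexed by booleans, [false] for tau and [true] for t, so that multi-indices are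
    lists of booleans and jets of finite families are again indexed by finite types. *)
Definition dd (b : bool) : R * R := if b then d_t R else d_tau R.
Definition cc (b : bool) (y : R * R) : R := if b then y.2 else y.1.
Definition lap (f : R * R -> R) (x : R * R) : R :=
  'D_(dd false) ('D_(dd false) f) x + 'D_(dd true) ('D_(dd true) f) x.

Lemma cc_dd b c : cc b (dd c) = (b == c)%:R.
Proof. by case: b; case: c. Qed.

Lemma pair_normE (y : R * R) : `|y| = Num.max `|y.1| `|y.2|.
Proof. by []. Qed.

Lemma pair_norm_leP (y : R * R) (r : R) :
  reflect (forall b, `|cc b y| <= r) (`|y| <= r).
Proof.
rewrite pair_normE ge_max; apply: (iffP andP) => [[a b] []//|H].
by split; [exact: (H false)|exact: (H true)].
Qed.

Lemma pair_norm_ltP (y : R * R) (r : R) :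
  reflect (forall b, `|cc b y| < r) (`|y| < r).
Proof.
rewrite pair_normE gt_max; apply: (iffP andP) => [[a b] []//|H].
by split; [exact: (H false)|exact: (H true)].
Qed.

Lemma ccD b y z : cc b (y + z) = cc b y + cc b z.
Proof. by case: b. Qed.
Lemma ccB b y z : cc b (y - z) = cc b y - cc b z.
Proof. by case: b. Qed.
Lemma ccZ b k y : cc b (k *: y) = k * cc b y.
Proof. by case: b. Qed.

Lemma is_derive_cc b (x v : R * R) : is_derive x v (cc b) (cc b v).
Proof.
apply/is_derive_distP => e e0; exists 1 => // h _ h0.
rewrite ccD ccZ [cc b x + _]addrC addrK.
by rewrite /GRing.scale/= mulrA mulVf// mul1r subrr normr0.
Qed.

Lemma is_derive_cc_affine b (k c : R) (x v : R * R) :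
  is_derive x v (fun y => k * (cc b y - c)) (k * cc b v).
Proof.
have D := is_deriveZ k (is_deriveB (is_derive_cc b x v) (is_derive_cst c x v)).
by apply: (is_derive_eq D); rewrite subr0.
Qed.

Lemma Ck_cc k (A : set (R * R)) b : open A -> Ck k A (cc b).
Proof.
move=> oA; have C x : {for x, continuous (cc b)}.
  case: b; [exact: cvg_snd|exact: cvg_fst].
case: k => [|k]; first by split=> // x _; exact: C.
apply: CkS_intro => // v; exists (fun=> cc b v); last exact: Ck_cst.
by move=> x _; exact: is_derive_cc.
Qed.

Lemma plane_sum_dd (v : R * R) : v = cc false v *: dd false + cc true v *: dd true.
Proof.
case: v => a b; apply: injective_projections; rewrite /= /GRing.scale/=.
  by rewrite mulr0 mulr1 addr0.
by rewrite mulr0 mulr1 add0r.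
Qed.

Lemma box_compact (x0 : R * R) (r : R) : compact [set y : R * R | `|y - x0| <= r].
Proof.
rewrite (_ : [set _ | _] =
   `[x0.1 - r, x0.1 + r]%classic `*` `[x0.2 - r, x0.2 + r]%classic).
  by apply: compact_setX; exact: segment_compact.
apply/seteqP; split=> y /=.
  by move=> /pair_norm_leP H; have := H false; have := H true;
    rewrite !ccB /= !in_itv/= !ler_distl.
rewrite !in_itv/= -!ler_distl => -[a b]; apply/pair_norm_leP => c.
by rewrite ccB; case: c.
Qed.

Lemma open_dist_lt (V : normedModType R) (x0 : V) (r : R) : open [set y : V | `|y - x0| < r].
Proof.
rewrite openE => y /= yr; apply/nbhs_distP.
exists (r - `|y - x0|); first by rewrite subr_gt0.
move=> z; rewrite ltrBrDr => /(le_lt_trans _); apply.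
by rewrite -[z - x0](subrKA y) ler_normD.
Qed.

End PlaneCalculus.

(** * Laplacians of products and of sums of squares *)

Section GradientLaplacian.
Context {R : realType} {A : set (R * R)} (oA : open A).
Implicit Types f g h : R * R -> R.

Definition grad f g (x : R * R) : R :=
  'D_(dd false) f x * 'D_(dd false) g x + 'D_(dd true) f x * 'D_(dd true) g x.

Lemma lap_mul f g x : Ck 2 A f -> Ck 2 A g -> A x ->
  lap (fun y => f y * g y) x = f x * lap g x + 2 * grad f g x + g x * lap f x.
Proof.
move=> Cf Cg Ax; rewrite /lap.
rewrite (D2_mul oA (dd false) (dd false) Cf Cg Ax) (D2_mul oA (dd true) (dd true) Cf Cg Ax).
rewrite /grad; move: (f x) (g x) ('D_(dd false) f x) ('D_(dd false) g x).
move: ('D_(dd true) f x) ('D_(dd true) g x) ('D_(dd false) _ x) ('D_(dd false) _ x).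
move: ('D_(dd true) _ x) ('D_(dd true) _ x) => {Cf Cg} *; ring.
Qed.

Lemma grad_mul f g h x : Ck 1 A g -> Ck 1 A h -> A x ->
  grad f (fun y => g y * h y) x = g x * grad f h x + h x * grad f g x.
Proof.
move=> Cg Ch Ax; rewrite /grad.
rewrite (D1_mul (dd false) Cg Ch Ax) (D1_mul (dd true) Cg Ch Ax).
move: (h x) (g x) ('D_(dd false) f x) ('D_(dd false) g x) ('D_(dd false) h x).
move: ('D_(dd true) f x) ('D_(dd true) g x) ('D_(dd true) h x) => {Cg Ch} *; ring.
Qed.

Lemma grad_le f g x (a b : R) : (forall c, `|'D_(dd c) f x| <= a) ->
  (forall c, `|'D_(dd c) g x| <= b) -> `|grad f g x| <= 2 * (a * b).
Proof.
move=> ha hb; rewrite (le_trans (ler_normD _ _))// !normrM.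
have := ler_pM (normr_ge0 _) (normr_ge0 _) (ha false) (hb false).
have := ler_pM (normr_ge0 _) (normr_ge0 _) (ha true) (hb true).
move: (`|_| * _) (`|_| * _) => u v; lra.
Qed.

Definition jet1 (I : finType) (v : I -> R * R -> R) (p : I * bool) : R * R -> R :=
  'D_(dd p.2) (v p.1).
Definition SQ (J : finType) (f : J -> R * R -> R) (x : R * R) : R :=
  \sum_j f j x * f j x.
Definition NS (J : finType) (f : J -> R * R -> R) (x : R * R) : R :=
  \sum_j `|f j x|.

Section Families.
Context {J : finType} (f : J -> R * R -> R).

Lemma SQ_ge0 x : 0 <= SQ f x.
Proof. by apply: sumr_ge0 => j _; rewrite -expr2 sqr_ge0. Qed.

Lemma NS_ge0 x : 0 <= NS f x.
Proof. exact: sumr_ge0. Qed.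

Lemma le_NS j x : `|f j x| <= NS f x.
Proof. by rewrite /NS (bigD1 j)//= lerDl sumr_ge0. Qed.

(** Cauchy-Schwarz, by [2 a b <= a^2 + b^2] in each term of the double sum. *)
Lemma NS_SQ (m : R) x : #|J|%:R <= m -> NS f x ^+ 2 <= m * SQ f x.
Proof.
move=> Jm; apply: (@le_trans _ _ (#|J|%:R * SQ f x)); last first.
  by rewrite ler_wpM2r// SQ_ge0.
rewrite expr2 mulr_suml (eq_bigr (fun i => \sum_j `|f i x| * `|f j x|)); last first.
  by move=> i _; rewrite mulr_sumr.
apply: (@le_trans _ _ (\sum_i \sum_j (f i x ^+ 2 / 2 + f j x ^+ 2 / 2))).
  apply: ler_sum => i _; apply: ler_sum => j _.
  rewrite -(real_normK (num_real (f i x))) -(real_normK (num_real (f j x))).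
  by have := sqr_ge0 (`|f i x| - `|f j x|); lra.
rewrite (eq_bigr (fun i => #|J|%:R * (f i x ^+ 2 / 2) + \sum_j f j x ^+ 2 / 2)); last first.
  by move=> i _; rewrite big_split/= sumr_const mulr_natl.
rewrite big_split/= sumr_const -mulr_sumr -[X in _ + X]mulr_natl -mulrDr.
by rewrite -!mulr_suml -splitr /SQ (eq_bigr (fun j => f j x ^+ 2)).
Qed.

Lemma sum_norm_le (a : J -> R) (B : R) x : (forall j, `|a j| <= B) ->
  `|\sum_j a j * f j x| <= B * NS f x.
Proof.
move=> aB; rewrite (le_trans (ler_norm_sum _ _ _))// mulr_sumr ler_sum// => j _.
by rewrite normrM ler_wpM2r.
Qed.

Lemma jet_sum_le b x : \sum_j `|'D_(dd b) (f j) x| <= NS (jet1 f) x.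
Proof.
rewrite /NS -(pair_bigA _ (fun j c => `|jet1 f (j, c) x|))/=.
apply: ler_sum => j _; rewrite (bigD1 b)//= lerDl.
exact: sumr_ge0.
Qed.

Hypothesis Cf : forall j, Ck 2 A (f j).

Lemma Ck_SQ : Ck 2 A (SQ f).
Proof. by apply: Ck_sum => // j _; exact: Ck_mul. Qed.

Lemma D1_SQ v x : A x -> 'D_v (SQ f) x = 2 * \sum_j f j x * 'D_v (f j) x.
Proof.
move=> Ax; rewrite (D1_sum oA) //; last first.
  by move=> j; apply: Ck_mul => //; exact: Ck_pred.
rewrite mulr_sumr; apply: eq_bigr => j _.
rewrite (@D1_mul _ _ A)//; do ?exact: Ck_pred.
by rewrite mulr2n mulrDl !mul1r.
Qed.

Lemma D1_SQ_le b x (B : R) : A x -> (forall j, `|f j x| <= B) ->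
  `|'D_(dd b) (SQ f) x| <= 2 * (B * NS (jet1 f) x).
Proof.
move=> Ax fB; rewrite (D1_SQ _ Ax) normrM (ger0_norm (ler0n _ 2)) ler_wpM2l//.
rewrite (le_trans (ler_norm_sum _ _ _))//.
rewrite (@le_trans _ _ (\sum_j B * `|'D_(dd b) (f j) x|))//.
  by apply: ler_sum => j _; rewrite normrM ler_wpM2r.
(* A negative [B] is possible only for empty [J], where both sides vanish. *)
rewrite -mulr_sumr; have [J0|B0] := boolP (0 <= B).
  by rewrite ler_wpM2l// jet_sum_le.
rewrite big1; last by move=> j _; have := le_trans (normr_ge0 _) (fB j); rewrite (negbTE B0).
rewrite mulr0; case: (pickP (fun j : J => true)) => [j _|J0].
  by have := le_trans (normr_ge0 _) (fB j); rewrite (negbTE B0).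
by rewrite /NS big1 ?mulr0// => -[j c] _; have := J0 j.
Qed.

Lemma lap_SQ x : A x ->
  lap (SQ f) x = 2 * SQ (jet1 f) x + 2 * \sum_j f j x * lap (f j) x.
Proof.
move=> Ax.
have E v : 'D_v ('D_v (SQ f)) x =
    \sum_j (2 * ('D_v (f j) x * 'D_v (f j) x) + 2 * (f j x * 'D_v ('D_v (f j)) x)).
  rewrite (D2_sum oA _ _ v v (fun j => Ck_mul oA (Cf j) (Cf j)) Ax).
  apply: eq_bigr => j _; rewrite (D2_mul oA v v (Cf j) (Cf j) Ax).
  by move: ('D_v ('D_v (f j)) x) ('D_v (f j) x) (f j x) => *; ring.
rewrite /lap !E /SQ -(pair_bigA _ (fun j c => jet1 f (j, c) x * jet1 f (j, c) x))/=.
rewrite !mulr_sumr -!big_split/=; apply: eq_bigr => j _.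
rewrite big_bool /jet1/=.
move: ('D_(dd false) (f j) x) ('D_(dd true) (f j) x) (f j x) => a b c.
move: ('D_(dd false) _ x) ('D_(dd true) _ x) => d e; ring.
Qed.

End Families.
End GradientLaplacian.

(** * A cut-off function on a square *)

Section BumpFunction.
Context {R : realType}.
Variables (x0 : R * R) (r : R).
Hypothesis r0 : 0 < r.

Let q b y := 1 - ((cc b y - cc b x0) / r) * ((cc b y - cc b x0) / r).
(** A polynomial that vanishes on the boundary of the sup-norm ball of radius [r]. The maximum
    principle is applied inside that ball only, so the values beyond it do not matter, and the
    derivatives are explicit. *)
Definition bump y := q false y * q true y.

Let C b k A : open A -> Ck k A (q b).
Proof.
move=> oA; have Cl : Ck k A (fun y => (cc b y - cc b x0) / r).
  apply: Ck_mul => //; last exact: Ck_cst.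
  by apply: Ck_sub_fun => //; [exact: Ck_cc|exact: Ck_cst].
by apply: Ck_sub_fun => //; [exact: Ck_cst|exact: Ck_mul].
Qed.

Lemma Ck_bump k A : open A -> Ck k A bump.
Proof. by move=> oA; apply: Ck_mul => //; exact: C. Qed.

Let Dq b y v : is_derive y v (q b) (- (2 * (cc b y - cc b x0) / r ^+ 2 * cc b v)).
Proof.
have Dl : is_derive y v (fun y => (cc b y - cc b x0) / r) (cc b v / r).
  rewrite (_ : (fun _ => _) = (fun y => r^-1 * (cc b y - cc b x0))); last first.
    by apply/funext => z; rewrite mulrC.
  by rewrite mulrC; exact: is_derive_cc_affine.
have D := is_deriveB (is_derive_cst (1 : R) y v) (is_deriveM Dl Dl).
apply: (is_derive_eq D); rewrite sub0r /GRing.scale/=; congr (- _); field; exact: lt0r_neq0.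
Qed.

Lemma D_bump b y : 'D_(dd b) bump y =
  q (~~ b) y * - (2 * (cc b y - cc b x0) / r ^+ 2).
Proof.
rewrite (@D1_mul _ _ setT)//; do ?exact: C openT.
have [_ ->] := Dq false y (dd b); have [_ ->] := Dq true y (dd b).
by rewrite !cc_dd; case: b => /=; ring.
Qed.

Lemma DD_bump b y : 'D_(dd b) ('D_(dd b) bump) y = q (~~ b) y * - (2 / r ^+ 2).
Proof.
rewrite (_ : 'D_(dd b) bump = fun z => q (~~ b) z * - (2 * (cc b z - cc b x0) / r ^+ 2)); last first.
  by apply/funext => z; exact: D_bump.
have Dl : is_derive y (dd b) (fun z => - (2 * (cc b z - cc b x0) / r ^+ 2)) (- (2 / r ^+ 2)).
  rewrite (_ : (fun _ => _) = (fun z => - (2 / r ^+ 2) * (cc b z - cc b x0))); last first.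
    by apply/funext => z; move: (cc b z) (cc b x0) (r ^+ 2)^-1 => *; ring.
  apply: (is_derive_eq (is_derive_cc_affine _ _ _ _ _)).
  by rewrite cc_dd eqxx mulr1.
have [_ ->] := is_deriveM (Dq (~~ b) y (dd b)) Dl.
rewrite cc_dd; case: b {Dl} => /=; rewrite /GRing.scale/=; ring.
Qed.

Lemma q_bounds b y : `|y - x0| <= r -> 0 <= q b y <= 1.
Proof.
move=> /pair_norm_leP/(_ b); rewrite ccB /q => H.
have : `|(cc b y - cc b x0) / r| <= 1.
  by rewrite normrM normfV (gtr0_norm r0) ler_pdivrMr// mul1r.
move: (_ / r) => t; rewrite ler_norml => /andP[t1 t2].
have : 0 <= t * t by rewrite -expr2 sqr_ge0.
nra.
Qed.

Lemma bump_bounds y : `|y - x0| <= r -> 0 <= bump y <= 1.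
Proof.
move=> yr; have /andP[a0 a1] := q_bounds false yr.
have /andP[b0 b1] := q_bounds true yr.
rewrite /bump mulr_ge0//=; have := ler_pM a0 b0 a1 b1.
by rewrite mulr1.
Qed.

Lemma bump_center : bump x0 = 1.
Proof. by rewrite /bump /q !subrr !mul0r !subr0 mulr1. Qed.

Lemma bump_boundary y : `|y - x0| = r -> bump y = 0.
Proof.
move=> yr; have [b Hb] : exists b, `|cc b (y - x0)| = r.
  move: yr; rewrite pair_normE; case: (leP `|(y - x0).1| `|(y - x0).2|) => _ H.
    by exists true.
  by exists false.
have q0 : q b y = 0.
  rewrite /q -expr2 -(real_normK (num_real _)) normrM normfV (gtr0_norm r0).
  by rewrite -ccB Hb divff ?gt_eqF// expr1n subrr.
by rewrite /bump; case: b q0 {Hb} => ->; rewrite ?mulr0 ?mul0r.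
Qed.

Lemma D_bump_bound b y : `|y - x0| <= r -> `|'D_(dd b) bump y| <= 2 / r.
Proof.
move=> yr; rewrite D_bump normrM normrN.
have /andP[q0 q1] := q_bounds (~~ b) yr; rewrite (ger0_norm q0).
rewrite -[leRHS]mul1r ler_pM//.
have /pair_norm_leP/(_ b) := yr; rewrite ccB => H.
rewrite !normrM normfV (gtr0_norm (exprn_gt0 2 r0)) (gtr0_norm (ltr0Sn _ 1)).
rewrite ler_pdivrMr ?exprn_gt0// -mulrA ler_pM2l//.
by rewrite expr2 mulKf ?gt_eqF.
Qed.

Lemma DD_bump_bound b y : `|y - x0| <= r ->
  `|'D_(dd b) ('D_(dd b) bump) y| <= 2 / r ^+ 2.
Proof.
move=> yr; rewrite DD_bump normrM normrN.
have /andP[q0 q1] := q_bounds (~~ b) yr; rewrite (ger0_norm q0).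
rewrite -[leRHS]mul1r ler_pM// ger0_norm// divr_ge0// exprn_ge0// ltW//.
Qed.

End BumpFunction.

(** * The interior gradient estimate *)

Section BernsteinLemma.
Context {R : realType}.
Context {I : finType} (C r : R) (C0 : 0 <= C) (r0 : 0 < r).

(** There are [4 * #|I|] second derivatives; the extra 1 gives [1 <= m] even for empty [I]. *)
Let m : R := 4 * #|I|%:R + 1.

(** [bern_A] times the bound of [bernstein_algebra] for [Z * P] bounds [Phi], and with it the
    squared gradient at the centre; the outer [1 +] replaces a square root. [2 / r] bounds the
    derivatives of the cut-off, [24 / r ^+ 2] the Laplacian of its square. *)
Definition bernstein_bound : R := 1 + bern_A m C *
  (1 + 8 / 3 * (bern_c m C (2 / r) (24 / r ^+ 2) + bern_A m C)).

Variables (v : I -> R * R -> R) (A : set (R * R)) (x0 : R * R).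
Hypothesis oA : open A.
Hypothesis rA : forall y : R * R, `|y - x0| <= r -> A y.
Hypothesis Cv : forall i, Ck 3 A (v i).
Hypothesis vC : forall (y : R * R) i, `|y - x0| <= r -> `|v i y| <= C.
Let N1 := NS (jet1 v).
Let N2 := NS (jet1 (jet1 v)).
(** The growth that the method tolerates: with [N1] counted as weight one and [N2] as weight two,
    the Laplacian of [v] has weight one and that of its gradient weight two. These are the weights
    [wt] of the bootstrap below. *)
Hypothesis lapv : forall (y : R * R) i, `|y - x0| <= r -> `|lap (v i) y| <= C * (1 + N1 y).
Hypothesis lapg : forall (y : R * R) p, `|y - x0| <= r ->
  `|lap (jet1 v p) y| <= C * (1 + N1 y ^+ 2 + N2 y).

Let K := bern_K m C.
Let P := SQ (jet1 v).
Let Au y := K + SQ v y.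
Let eta := bump x0 r.
Let Z y := eta y * eta y.
(** Bernstein's auxiliary function. The Laplacian of [Au] contains [2 * P], so that of the product
    contains the good term [Z * P ^+ 2], which beats the growth of the Laplacian of [P]. The cut-off
    enters squared so that its gradient is controlled by [eta]. *)
Let Phi y := Au y * (Z y * P y).

Let m1 : 1 <= m. Proof. by rewrite /m lerDr mulr_ge0. Qed.
Let Cv2 i : Ck 2 A (v i). Proof. exact: Ck_pred. Qed.
Let Cg p : Ck 2 A (jet1 v p). Proof. exact: CkS_derive. Qed.
Let CU : Ck 2 A (SQ v). Proof. exact: Ck_SQ. Qed.
Let CP : Ck 2 A P. Proof. exact: Ck_SQ. Qed.
Let CK : Ck 2 A (fun=> K). Proof. exact: Ck_cst. Qed.
Let CAu : Ck 2 A Au. Proof. exact: Ck_add. Qed.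
Let Ce : Ck 2 A eta. Proof. exact: Ck_bump. Qed.
Let CZ : Ck 2 A Z. Proof. exact: Ck_mul. Qed.
Let CZP : Ck 2 A (fun y => Z y * P y). Proof. exact: Ck_mul. Qed.
Let CPhi : Ck 2 A Phi. Proof. exact: Ck_mul. Qed.

Let I_le_m : #|I|%:R <= m.
Proof. by rewrite /m; have := ler0n R #|I|; lra. Qed.

Let N1P y : N1 y ^+ 2 <= m * P y.
Proof.
by apply: NS_SQ; rewrite card_prod card_bool natrM /m; have := ler0n R #|I|; lra.
Qed.

Let N2H y : N2 y ^+ 2 <= m * SQ (jet1 (jet1 v)) y.
Proof.
by apply: NS_SQ; rewrite !card_prod card_bool !natrM /m; have := ler0n R #|I|; lra.
Qed.

Let lap_cst (k : R) y : lap (fun=> k) y = 0.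
Proof.
have E u : 'D_u (fun=> k) = cst 0 :> (R * R -> R) by apply/funext => z; exact: derive_cst.
by rewrite /lap !E !derive_cst addr0.
Qed.

Let lapAu y : A y -> lap Au y = lap (SQ v) y.
Proof.
move=> Ay; rewrite -[RHS]add0r -(lap_cst K y) /lap.
rewrite (D2_add oA (dd false) (dd false) CK CU Ay) (D2_add oA (dd true) (dd true) CK CU Ay).
exact: addrACA.
Qed.

Let lapAu_ge (y : R * R) : `|y - x0| <= r ->
  2 * P y - 2 * (m * C ^+ 2) * (1 + N1 y) <= lap Au y.
Proof.
move=> yr; have Ay := rA yr; rewrite (lapAu Ay) (lap_SQ oA Cv2 Ay).
have : `|\sum_j v j y * lap (v j) y| <= m * C ^+ 2 * (1 + N1 y).
  have N0 : 0 <= 1 + N1 y by rewrite addr_ge0// NS_ge0.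
  rewrite (le_trans (ler_norm_sum _ _ _))//.
  rewrite (@le_trans _ _ (\sum_(j : I) C * (C * (1 + N1 y))))//.
    by apply: ler_sum => j _; rewrite normrM ler_pM//; [exact: vC|exact: lapv].
  rewrite sumr_const -mulr_natl -[leRHS]mulrA.
  rewrite (_ : C * (C * (1 + N1 y)) = C ^+ 2 * (1 + N1 y)); last by rewrite expr2 mulrA.
  by rewrite ler_wpM2r// mulr_ge0// sqr_ge0.
rewrite ler_norml -/P => /andP[].
move: (\sum_j _ * _) (P y) (m * C ^+ 2) (N1 y) => *; lra.
Qed.

Let lapP_ge (y : R * R) : `|y - x0| <= r ->
  2 * SQ (jet1 (jet1 v)) y - 2 * C * N1 y * (1 + N1 y ^+ 2 + N2 y) <= lap P y.
Proof.
move=> yr; have Ay := rA yr; rewrite (lap_SQ oA Cg Ay).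
have : `|\sum_j lap (jet1 v j) y * jet1 v j y| <= C * (1 + N1 y ^+ 2 + N2 y) * N1 y.
  by apply: sum_norm_le => p; exact: lapg.
rewrite (eq_bigr (fun j => jet1 v j y * lap (jet1 v j) y)); last first.
  by move=> j _; rewrite mulrC.
rewrite ler_norml => /andP[].
move: (\sum_j _ * _) (SQ _ y) (N1 y) (N2 y) => *; lra.
Qed.

Let DAu (y : R * R) : `|y - x0| <= r -> forall b, `|'D_(dd b) Au y| <= 2 * (C * N1 y).
Proof.
move=> yr b; have Ay := rA yr.
have -> : 'D_(dd b) Au y = _ := D1_add (dd b) (Ck_pred CK) (Ck_pred CU) Ay.
rewrite derive_cst add0r; apply: (D1_SQ_le oA Cv2 b Ay) => i; exact: vC.
Qed.

Let DP (y : R * R) : `|y - x0| <= r -> forall b, `|'D_(dd b) P y| <= 2 * (N1 y * N2 y).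
Proof. by move=> yr b; apply: (D1_SQ_le oA Cg b (rA yr)) => p; exact: le_NS. Qed.

Let DZ (y : R * R) : `|y - x0| <= r -> forall b, `|'D_(dd b) Z y| <= 2 * (eta y * (2 / r)).
Proof.
move=> yr b; have Ay := rA yr.
have -> : 'D_(dd b) Z y = _ := D1_mul (dd b) (Ck_pred Ce) (Ck_pred Ce) Ay.
have /andP[e0 _] := bump_bounds r0 yr.
have H : `|eta y * 'D_(dd b) eta y| <= eta y * (2 / r).
  by rewrite normrM (ger0_norm e0) ler_wpM2l//; exact: D_bump_bound.
by rewrite (le_trans (ler_normD _ _))// mulr2n mulrDl mul1r lerD.
Qed.

Let lapZ (y : R * R) : `|y - x0| <= r -> `|lap Z y| <= 24 / r ^+ 2.
Proof.
move=> yr; have Ay := rA yr; rewrite (lap_mul oA Ce Ce Ay).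
have G : `|grad eta eta y| <= 2 * (2 / r * (2 / r)).
  by apply: grad_le => b; exact: D_bump_bound.
have L : `|lap eta y| <= 2 / r ^+ 2 + 2 / r ^+ 2.
  by rewrite (le_trans (ler_normD _ _))// lerD//; exact: DD_bump_bound.
have /andP[e0 e1] := bump_bounds r0 yr.
have L' : `|eta y * lap eta y| <= 2 / r ^+ 2 + 2 / r ^+ 2.
  by rewrite normrM (ger0_norm e0) (le_trans _ L)// ler_piMl.
have -> : 24 / r ^+ 2 = (2 / r ^+ 2 + 2 / r ^+ 2) + 2 * (2 * (2 / r * (2 / r)))
    + (2 / r ^+ 2 + 2 / r ^+ 2) by field; exact: lt0r_neq0.
rewrite (le_trans (ler_normD _ _))// lerD// (le_trans (ler_normD _ _))// lerD//.
by rewrite normrM (ger0_norm (ler0n _ 2)) ler_wpM2l.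
Qed.

Let K_ge1 : 1 <= K.
Proof.
rewrite /K /bern_K; have : 0 <= m ^+ 3 * C ^+ 2.
  by rewrite mulr_ge0 ?sqr_ge0// exprn_ge0// (le_trans ler01 m1).
lra.
Qed.

Let Au_le (y : R * R) : `|y - x0| <= r -> Au y <= bern_A m C.
Proof.
move=> yr; rewrite /Au /bern_A lerD2l.
rewrite (@le_trans _ _ (\sum_(j : I) C ^+ 2))//.
  apply: ler_sum => i _.
  by rewrite -expr2 -(real_normK (num_real _)) ler_pXn2r ?nnegrE//; exact: vC.
by rewrite sumr_const -mulr_natl ler_wpM2r// sqr_ge0.
Qed.

Let key (y : R * R) : `|y - x0| < r -> (forall z : R * R, `|z - x0| < r -> Phi z <= Phi y) ->
  Z y * P y <= 1 + 8 / 3 * (bern_c m C (2 / r) (24 / r ^+ 2) + bern_A m C).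
Proof.
move=> yr' Pmax; have yr := ltW yr'; have Ay := rA yr.
have /andP[e0 e1] := bump_bounds r0 yr.
have c0 : 0 <= 2 / r by rewrite divr_ge0// ltW.
have c50 : 0 <= 24 / r ^+ 2 by rewrite divr_ge0// exprn_ge0// ltW.
have ZE : Z y = eta y ^+ 2 by rewrite expr2.
have KA : K <= Au y by rewrite /Au lerDl SQ_ge0.
have GAP : `|grad Au P y| <= 8 * C * N1 y ^+ 2 * N2 y.
  apply: le_trans (grad_le (DAu yr) (DP yr)) _.
  by move: (N1 y) (N2 y) => a b; lra.
have GZP : `|grad Z P y| <= 8 * (2 / r) * eta y * N1 y * N2 y.
  apply: le_trans (grad_le (DZ yr) (DP yr)) _.
  by move: (N1 y) (N2 y) (2 / r) (eta y) => a b c d; lra.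
have GZA : `|grad Z Au y| <= 8 * (2 / r) * C * eta y * N1 y.
  apply: le_trans (grad_le (DZ yr) (DAu yr)) _.
  by move: (N1 y) (2 / r) (eta y) => a b c; lra.
have max b : 'D_(dd b) ('D_(dd b) Phi) y <= 0.
  have C2 : Ck 2 [set z : R * R | `|z - x0| < r] Phi.
    by apply: Ck_sub CPhi => z /= /ltW; exact: rA.
  exact: (D2_at_max (open_dist_lt x0 r) (dd b) yr' C2 Pmax).
have L0 : lap Phi y <= 0 by have := lerD (max false) (max true); rewrite addr0.
apply: (bernstein_algebra m1 C0 c0 c50 e0 e1 ZE KA (Au_le yr) (SQ_ge0 _ _)
  (SQ_ge0 (jet1 (jet1 v)) y) (NS_ge0 _ _) (NS_ge0 _ _) (N1P y) (N2H y)
  (lapAu_ge yr) (lapP_ge yr) (lapZ yr) GAP GZP GZA).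
apply: le_trans L0; rewrite le_eqVlt; apply/orP; left; apply/eqP.
rewrite (lap_mul oA CAu CZP Ay) (lap_mul oA CZ CP Ay).
rewrite (grad_mul Au (Ck_pred CZ) (Ck_pred CP) Ay).
rewrite (_ : grad Au Z y = grad Z Au y); last by rewrite /grad mulrC [X in _ + X]mulrC.
move: (lap Au y) (lap Z y) (lap P y) (grad Z Au y) (grad Au P y) (grad Z P y).
rewrite -[SQ (jet1 v) y]/(P y); move: (Au y) (Z y) (P y) => *; ring.
Qed.

Lemma bernstein_estimate p : `|jet1 v p x0| <= bernstein_bound.
Proof.
pose B := [set y : R * R | `|y - x0| <= r].
have x0B : `|x0 - x0| <= r by rewrite subrr normr0 ltW.
have B0 : B !=set0 by exists x0.
have cPhi : {within B, continuous Phi}.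
  by apply: continuous_in_subspaceT => z; rewrite inE/= => /rA; exact: Ck_cont CPhi.
have [y yB ymax] := compact_EVT_max B0 (@box_compact R x0 r) cPhi.
have {}yB : `|y - x0| <= r by rewrite inE in yB.
have Pmax : Phi x0 <= Phi y by apply: ymax; rewrite inE.
have P0 z : 0 <= P z by exact: SQ_ge0.
have A0 : 0 <= bern_A m C.
  by rewrite (le_trans _ (Au_le x0B))// addr_ge0 ?SQ_ge0// (le_trans ler01 K_ge1).
pose c8 := 1 + 8 / 3 * (bern_c m C (2 / r) (24 / r ^+ 2) + bern_A m C).
have Px0 : P x0 <= Phi x0.
  rewrite /Phi /Z /eta bump_center !mul1r ler_peMl//.
  by rewrite (le_trans K_ge1)// lerDl SQ_ge0.
have {}Px0 : P x0 <= bern_A m C * c8 \/ P x0 <= 0.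
  have [yr|yr] := ltP `|y - x0| r.
    left; rewrite (le_trans Px0)// (le_trans Pmax)//.
    apply: (@le_trans _ _ (bern_A m C * (Z y * P y))).
      by rewrite ler_wpM2r ?Au_le// mulr_ge0// /Z -expr2 sqr_ge0.
    rewrite ler_wpM2l//; apply: key => // z /ltW zr; apply: ymax; rewrite inE//.
  (* A maximum on the boundary, where the cut-off vanishes, makes [Phi] nonpositive at the centre
     too. *)
  right; have /(bump_boundary r0) e0 : `|y - x0| = r by apply/eqP; rewrite eq_le yB yr.
  by rewrite (le_trans Px0)// (le_trans Pmax)// /Phi /Z /eta e0 !mul0r mulr0.
have gP : `|jet1 v p x0| ^+ 2 <= P x0.
  rewrite real_normK ?num_real// /P /SQ (bigD1 p)//= expr2 lerDl sumr_ge0// => q _.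
  by rewrite -expr2 sqr_ge0.
have c80 : 0 <= c8.
  have m0 : 0 <= m by exact: le_trans ler01 m1.
  rewrite /c8 /bern_c; have := ltW r0 => r0'.
  do ?[exact: ler01|exact: ler0n|exact: sqr_ge0|exact: A0|exact: m0|exact: r0'|apply: exprn_ge0
      |apply: divr_ge0|apply: mulr_ge0|apply: addr_ge0].
have : `|jet1 v p x0| ^+ 2 <= bern_A m C * c8.
  by case: Px0 => [|h]; [exact: le_trans|rewrite (le_trans gP)// (le_trans h)// mulr_ge0].
rewrite /bernstein_bound -/c8; move: (bern_A m C * c8) (normr_ge0 (jet1 v p x0)) => X.
move: `|_| => a a0 aX; have : 0 <= (a - 1) ^+ 2 by exact: sqr_ge0.
nra.
Qed.

End BernsteinLemma.

(** * Higher derivatives of solutions of semilinear elliptic systems *)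

Section SmoothFunctions.
Context {R : realType}.
Implicit Types V W : normedModType R.

Lemma smooth_derive V W (A : set V) (f : V -> W) v :
  smooth_on A f -> smooth_on A ('D_v f).
Proof. by move=> Sf k; exact: CkS_derive. Qed.

Lemma smooth_add V (A : set V) (f g : V -> R) : open A ->
  smooth_on A f -> smooth_on A g -> smooth_on A (fun x => f x + g x).
Proof. by move=> oA Sf Sg k; exact: Ck_add. Qed.

Lemma smooth_mul V (A : set V) (f g : V -> R) : open A ->
  smooth_on A f -> smooth_on A g -> smooth_on A (fun x => f x * g x).
Proof. by move=> oA Sf Sg k; exact: Ck_mul. Qed.

Lemma derive_comm3 V (A : set V) (f : V -> R) a v x : open A -> A x ->
  smooth_on A f -> 'D_a ('D_a ('D_v f)) x = 'D_v ('D_a ('D_a f)) x.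
Proof.
move=> oA Ax Sf.
have H1 y : A y -> 'D_a ('D_v f) y = 'D_v ('D_a f) y.
  by move=> Ay; exact: schwarz a v oA Ay (Sf 2%N).
transitivity ('D_a ('D_v ('D_a f)) x); first exact: (D_ext_open oA a Ax H1).
exact: (schwarz a v oA Ax (smooth_derive a Sf 2%N)).
Qed.

Lemma lap_derive (A : set (R * R)) (f : R * R -> R) v x : open A -> A x ->
  smooth_on A f -> lap ('D_v f) x = 'D_v (lap f) x.
Proof.
move=> oA Ax Sf; have S2 w := smooth_derive w (smooth_derive w Sf).
have E : 'D_v (lap f) x = _ := D1_add v (S2 (dd false) 1%N) (S2 (dd true) 1%N) Ax.
have X := derive_comm3 (dd false) v oA Ax Sf.
have Y := derive_comm3 (dd true) v oA Ax Sf.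
apply: (etrans (f_equal2 (fun a b : R => a + b) X Y)); exact: esym E.
Qed.

End SmoothFunctions.

(** * Induction on the order of the derivatives *)

Section Bootstrap.
Context {R : realType} {m : nat} {B K : set 'rV[R]_m} (oB : open B) (cK : compact K)
  (KB : K `<=` B).
Context {Idx : Type} (c : Idx -> R * R) (u : Idx -> R * R -> 'rV[R]_m).
Context {r : R} (r_gt0 : 0 < r).

(** A bound on a family is a bound uniform in the index; the indices will be the centres of all
    balls of radius [r] on which the solution stays in [K]. *)
Definition family := Idx -> R * R -> R.
Implicit Types f g : family.

Definition bball (rho : R) (i : Idx) : set (R * R) := [set y : R * R | `|y - c i| < rho].
Let D := bball r.

Hypothesis u_smooth : forall i, smooth_on (D i) (u i).
Hypothesis u_K : forall i y, D i y -> K (u i y).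

Definition cmp (l : 'I_m) : family := fun i y => u i y 0 l.
Definition der (b : bool) f : family := fun i => 'D_(dd b) (f i).
Definition mder (beta : seq bool) f : family := foldr der f beta.

Let oD i : open (D i). Proof. exact: open_dist_lt. Qed.

Definition Sm f := forall i, smooth_on (D i) (f i).

Let Sm_cmp l : Sm (cmp l).
Proof. by move=> i k; exact: (Ck_rVP _ _ (@oD i)).1 (u_smooth i k) l. Qed.

Let Sm_der b f : Sm f -> Sm (der b f).
Proof. by move=> Sf i; exact: smooth_derive. Qed.

Let Sm_mder beta f : Sm f -> Sm (mder beta f).
Proof. by move=> Sf; elim: beta => //= b beta; exact: Sm_der. Qed.

Let Sm_comp (G : 'rV[R]_m -> R) : smooth_on B G -> Sm (fun i => G \o u i).
Proof.
move=> SG i k; apply: (Ck_comp (@oD i) oB _ (SG k) (u_smooth i k)).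
by move=> y /u_K; exact: KB.
Qed.

Let Sm_add f g : Sm f -> Sm g -> Sm (fun i y => f i y + g i y).
Proof. by move=> Sf Sg i; apply: smooth_add. Qed.

Let Sm_mul f g : Sm f -> Sm g -> Sm (fun i y => f i y * g i y).
Proof. by move=> Sf Sg i; apply: smooth_mul. Qed.

Let eqD f g := forall i y, D i y -> f i y = g i y.

Let eqD_der b f g : eqD f g -> eqD (der b f) (der b g).
Proof. by move=> fg i y Dy; apply: (D_ext_open (@oD i) _ Dy) => z; exact: fg. Qed.

(* Growth classes relative to weights n1 and n2, which in the induction step are
   the norms of the first two unknown orders of derivatives of u. *)
Section Weights.
Variables (rho : R) (rho_r : rho <= r) (n1 n2 : family).
Hypotheses (n1_ge0 : forall i y, 0 <= n1 i y) (n2_ge0 : forall i y, 0 <= n2 i y).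

Definition wt (k : nat) i y : R :=
  match k with 0%N => 1 | 1%N => 1 + n1 i y | _ => 1 + n1 i y ^+ 2 + n2 i y end.

Definition gr (k : nat) f := exists2 C : R, 0 <= C &
  forall i y, bball rho i y -> `|f i y| <= C * wt k i y.

Let bD i y : bball rho i y -> D i y.
Proof. by move=> H; exact: lt_le_trans rho_r. Qed.

Let wt_mul j k i y : (j + k <= 2)%N -> wt j i y * wt k i y <= 2 * wt (j + k) i y.
Proof.
have := n1_ge0 i y; have := n2_ge0 i y; have := sqr_ge0 (1 - n1 i y).
case: j => [|[|[|j]]]; case: k => [|[|[|k]]] //=; rewrite /wt/= expr2;
  move: (n1 i y) (n2 i y) => a b; nra.
Qed.

Let wt_le j k i y : (j <= k)%N -> (k <= 2)%N -> wt j i y <= 2 * wt k i y.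
Proof.
have := n1_ge0 i y; have := n2_ge0 i y; have := sqr_ge0 (1 - n1 i y).
case: j => [|[|[|j]]]; case: k => [|[|[|k]]] //=; rewrite /wt/= expr2;
  move: (n1 i y) (n2 i y) => a b; nra.
Qed.

Let gr_ext k f g : eqD f g -> gr k f -> gr k g.
Proof.
by move=> fg [C C0 H]; exists C => // i y By; rewrite -(fg _ _ (bD By)); exact: H.
Qed.

Let gr_le j k f : (j <= k)%N -> (k <= 2)%N -> gr j f -> gr k f.
Proof.
move=> jk k2 [C C0 H]; exists (C * 2); first by rewrite mulr_ge0.
move=> i y By; rewrite (le_trans (H _ _ By))// -mulrA ler_wpM2l//.
exact: wt_le.
Qed.

Let gr_add k f g : gr k f -> gr k g -> gr k (fun i y => f i y + g i y).
Proof.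
move=> [C C0 H] [C' C0' H']; exists (C + C'); first exact: addr_ge0.
move=> i y By; rewrite (le_trans (ler_normD _ _))// mulrDl.
by apply: lerD; [exact: H|exact: H'].
Qed.

Let gr_mul j k f g : (j + k <= 2)%N -> gr j f -> gr k g ->
  gr (j + k) (fun i y => f i y * g i y).
Proof.
move=> jk [C C0 H] [C' C0' H']; exists (C * C' * 2); first by rewrite !mulr_ge0.
move=> i y By; rewrite normrM.
apply: (le_trans (ler_pM (normr_ge0 _) (normr_ge0 _) (H _ _ By) (H' _ _ By))).
by rewrite mulrACA -[leRHS]mulrA ler_wpM2l ?mulr_ge0// wt_mul.
Qed.

Let gr_sum k (J : finType) (f : J -> family) : (forall j, gr k (f j)) ->
  gr k (fun i y => \sum_j f j i y).
Proof.
move=> /(_ _)/cid2-/all_sig2[C C0 H]; exists (\sum_j C j); first exact: sumr_ge0.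
move=> i y By; rewrite (le_trans (ler_norm_sum _ _ _))// mulr_suml.
by apply: ler_sum => j _; exact: H.
Qed.

(** Derivatives up to order [j] are bounded, those of orders [j + 1] and [j + 2] have weights 1 and
    2. Since the weights are submultiplicative up to a factor, the class is closed under products
    and under composition with smooth functions. *)
Fixpoint GS (j : nat) f : Prop :=
  match j with
  | 0%N => [/\ gr 0 f, forall b, gr 1 (der b f) & forall b b', gr 2 (der b' (der b f))]
  | j'.+1 => gr 0 f /\ forall b, GS j' (der b f)
  end.

Lemma GS_gr0 j f : GS j f -> gr 0 f. Proof. by case: j => [|j] []. Qed.

Let GS_ext j f g : eqD f g -> GS j f -> GS j g.
Proof.
elim: j f g => [|j IH] f g fg /=.
  move=> [f0 f1 f2]; split; first exact: gr_ext f0.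
    by move=> b; apply: gr_ext (f1 b); exact: eqD_der.
  by move=> b b'; apply: gr_ext (f2 b b'); do 2!apply: eqD_der.
move=> [f0 f1]; split; first exact: gr_ext f0.
by move=> b; apply: IH (f1 b); exact: eqD_der.
Qed.

Lemma GS_pred j f : GS j.+1 f -> GS j f.
Proof.
elim: j f => [|j IH] f; last by move=> [f0 f1]; split=> // b; exact: IH.
move=> [f0 f1]; split=> //.
  by move=> b; case: (f1 b) => + _ _; exact: (@gr_le 0 1).
by move=> b b'; have [_ /(_ b') + _] := f1 b; exact: (@gr_le 1 2).
Qed.

Let der_add b f g : Sm f -> Sm g ->
  eqD (fun i y => der b f i y + der b g i y) (der b (fun i y => f i y + g i y)).
Proof. by move=> Sf Sg i y Dy; apply/esym; exact: D1_add (Sf i 1%N) (Sg i 1%N) Dy. Qed.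

Let der_mul b f g : Sm f -> Sm g ->
  eqD (fun i y => f i y * der b g i y + g i y * der b f i y)
      (der b (fun i y => f i y * g i y)).
Proof. by move=> Sf Sg i y Dy; apply/esym; exact: D1_mul (Sf i 1%N) (Sg i 1%N) Dy. Qed.

Lemma GS_add j f g : Sm f -> Sm g -> GS j f -> GS j g -> GS j (fun i y => f i y + g i y).
Proof.
elim: j f g => [|j IH] f g Sf Sg /=; last first.
  move=> [f0 f1] [g0 g1]; split; first exact: gr_add.
  move=> b; apply: GS_ext (der_add b Sf Sg) _.
  exact: IH (Sm_der _ Sf) (Sm_der _ Sg) (f1 b) (g1 b).
move=> [f0 f1 f2] [g0 g1 g2]; split; first exact: gr_add.
  by move=> b; apply: gr_ext (der_add b Sf Sg) _; exact: gr_add.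
move=> b b'; apply: gr_ext (eqD_der b' (der_add b Sf Sg)) _.
apply: gr_ext (der_add b' (Sm_der _ Sf) (Sm_der _ Sg)) _.
exact: gr_add.
Qed.

Lemma GS_mul j f g : Sm f -> Sm g -> GS j f -> GS j g -> GS j (fun i y => f i y * g i y).
Proof.
elim: j f g => [|j IH] f g Sf Sg; last first.
  move=> Gf Gg; have [f0 f1] := Gf; have [g0 g1] := Gg; split.
    exact: (gr_mul (j := 0) (k := 0)).
  move=> b; apply: GS_ext (der_mul b Sf Sg) _.
  apply: GS_add; try by apply: Sm_mul => //; exact: Sm_der.
    exact: IH Sf (Sm_der _ Sg) (GS_pred Gf) (g1 b).
  exact: IH Sg (Sm_der _ Sf) (GS_pred Gg) (f1 b).
move=> [f0 f1 f2] [g0 g1 g2]; split.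
- exact: (gr_mul (j := 0) (k := 0)).
- move=> b; apply: gr_ext (der_mul b Sf Sg) _.
  by apply: gr_add; exact: (gr_mul (j := 0) (k := 1)).
move=> b b'; apply: gr_ext (eqD_der b' (der_mul b Sf Sg)) _.
have Sdf := Sm_der b Sf; have Sdg := Sm_der b Sg.
apply: gr_ext (der_add b' (Sm_mul Sf Sdg) (Sm_mul Sg Sdf)) _.
apply: gr_add.
  apply: gr_ext (der_mul b' Sf Sdg) _.
  by apply: gr_add; [exact: (gr_mul (j := 0) (k := 2))|exact: (gr_mul (j := 1) (k := 1))].
apply: gr_ext (der_mul b' Sg Sdf) _.
by apply: gr_add; [exact: (gr_mul (j := 0) (k := 2))|exact: (gr_mul (j := 1) (k := 1))].
Qed.

Let GS_cst j (k : R) : GS j (fun _ _ => k).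
Proof.
have E b (k' : R) : der b (fun _ _ => k') = (fun _ _ => 0).
  by apply/funext => i; apply/funext => y; exact: derive_cst.
have g j' (k' : R) : (j' <= 2)%N -> gr j' (fun _ _ => k').
  move=> j2; apply: (gr_le (leq0n j')) => //.
  by exists `|k'| => // i y _; rewrite mulr1.
elim: j k => [|j IH] k /=.
  by split; [exact: g|move=> b; rewrite E; exact: g|move=> b b'; rewrite !E; exact: g].
by split; [exact: g|move=> b; rewrite E].
Qed.

Let GS_sum j (I : Type) (s : seq I) (f : I -> family) : (forall i, Sm (f i)) ->
  (forall i, GS j (f i)) ->
  GS j (fun i y => \sum_(x <- s) f x i y) /\ Sm (fun i y => \sum_(x <- s) f x i y).
Proof.
move=> Sf Gf; elim: s => [|x s [IHG IHS]].
  rewrite (_ : (fun _ _ => _) = (fun _ _ => 0)); last first.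
    by apply/funext => i; apply/funext => y; rewrite big_nil.
  by split; [exact: GS_cst|move=> i k; exact: Ck_cst].
rewrite (_ : (fun _ _ => _) = (fun i y => f x i y + \sum_(x <- s) f x i y)); last first.
  by apply/funext => i; apply/funext => y; rewrite big_cons.
by split; [exact: GS_add|exact: Sm_add].
Qed.

Let der_comp b (G : 'rV[R]_m -> R) : smooth_on B G ->
  eqD (fun i y => \sum_l ('D_(ev l) G \o u i) y * der b (cmp l) i y)
      (der b (fun i => G \o u i)).
Proof.
move=> SG i y Dy; have Du := CkS_is_derive (dd b) (u_smooth i 1%N) Dy.
transitivity ('D_(dd b) (G \o u i) y); last by [].
have [_ ->] := is_derive_comp_sum oB (KB (u_K Dy)) (SG 1%N) Du.
apply: eq_bigr => l _; rewrite mulrC; congr (_ * _).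
by have [? _] := Du; rewrite /der /cmp derive_coord.
Qed.

Lemma gr0_comp (G : 'rV[R]_m -> R) : smooth_on B G -> gr 0 (fun i => G \o u i).
Proof.
move=> SG; have cG : {within K, continuous G}.
  by apply: continuous_in_subspaceT => x; rewrite inE => /KB; exact: Ck_cont (SG 0%N).
have [C [_ HC]] := compact_bounded (continuous_compact cG cK).
exists `|C + 1| => // i y By; rewrite mulr1.
have C1 : C < C + 1 by rewrite ltrDl.
apply: (le_trans _ (ler_norm (C + 1))); apply: (HC _ C1).
by exists (u i y) => //; exact: u_K (bD By).
Qed.

Lemma GS_comp j (G : 'rV[R]_m -> R) : smooth_on B G -> (forall l, GS j (cmp l)) ->
  GS j (fun i => G \o u i).
Proof.
have SGu (H : 'rV[R]_m -> R) b l : smooth_on B H ->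
    Sm (fun i y => ('D_(ev l) H \o u i) y * der b (cmp l) i y).
  move=> SH; apply: Sm_mul; last exact: Sm_der.
  exact: (Sm_comp (smooth_derive (ev l) SH)).
elim: j G => [|j IH] G SG Gu.
  have g1 (H : 'rV[R]_m -> R) b : smooth_on B H -> gr 1 (der b (fun i => H \o u i)).
    move=> SH; apply: gr_ext (der_comp b SH) _; apply: gr_sum => l.
    apply: (gr_mul (j := 0) (k := 1)) => //; last by case: (Gu l).
    exact: (gr0_comp (smooth_derive (ev l) SH)).
  split; [exact: gr0_comp|by move=> b; exact: g1|move=> b b'].
  apply: gr_ext (eqD_der b' (der_comp b SG)) _.
  apply: (@gr_ext _ (fun i y => \sum_l der b' (fun i y => ('D_(ev l) G \o u i) y * der b (cmp l) i y) i y)).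
    move=> i y Dy; apply/esym; apply: (D1_sum (@oD i) _ _ _ _ Dy) => l.
    exact: SGu SG i 1%N.
  apply: gr_sum => l; have SGl := smooth_derive (ev l) SG.
  apply: gr_ext (der_mul b' (Sm_comp SGl) (Sm_der b (Sm_cmp l))) _.
  have [_ u1 u2] := Gu l.
  apply: gr_add; first by apply: (gr_mul (j := 0) (k := 2)) => //; exact: (gr0_comp SGl).
  by apply: (gr_mul (j := 1) (k := 1)) => //; exact: (g1 _ _ SGl).
split; first exact: gr0_comp.
move=> b; apply: GS_ext (der_comp b SG) _.
pose F l : family := fun i y => ('D_(ev l) G \o u i) y * der b (cmp l) i y.
have GF l : GS j (F l).
  have SGl := smooth_derive (ev l) SG.
  apply: GS_mul; [exact: (Sm_comp SGl)|exact: Sm_der| |exact: (Gu l).2].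
  exact: (IH _ SGl (fun l' => GS_pred (Gu l'))).
exact: (GS_sum (index_enum _) (fun l => SGu G b l SG) GF).1.
Qed.

Lemma GS_mder j beta f : GS (size beta + j) f -> GS j (mder beta f).
Proof.
elim: beta j => [//|b beta IH] j.
by rewrite -[size _]/(size beta).+1 addSnnS => /IH [_]; exact.
Qed.

End Weights.

(** Polynomials in the first derivatives of [u] with smooth functions of [u] as coefficients. Both
    the right side of the elliptic system and the energy density have this form. *)
Inductive gen : family -> Prop :=
| gen_coef G : smooth_on B G -> gen (fun i => G \o u i)
| gen_der b l : gen (der b (cmp l))
| gen_add f g : gen f -> gen g -> gen (fun i y => f i y + g i y)
| gen_mul f g : gen f -> gen g -> gen (fun i y => f i y * g i y).

Let Sm_gen f : gen f -> Sm f.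
Proof.
elim=> [G SG|b l|{}f g _ Sf _ Sg|{}f g _ Sf _ Sg].
- exact: Sm_comp.
- exact: Sm_der.
- exact: Sm_add.
- exact: Sm_mul.
Qed.

(** One order is lost because [f] contains first derivatives of [u]. *)
Let GS_gen rho n1 n2 j f : rho <= r -> (forall i y, 0 <= n1 i y) ->
  (forall i y, 0 <= n2 i y) -> (forall l, GS rho n1 n2 j.+1 (cmp l)) ->
  gen f -> GS rho n1 n2 j f.
Proof.
move=> rr n10 n20 Gu; elim=> [G SG|b l|{}f g Gf Hf Gg Hg|{}f g Gf Hf Gg Hg].
- by apply: GS_comp => // l; exact: GS_pred.
- exact: (Gu l).2.
- by apply: GS_add => //; exact: Sm_gen.
- by apply: GS_mul => //; exact: Sm_gen.
Qed.

Hypothesis lap_u : forall l, exists2 f, gen f & forall i y, D i y -> lap (cmp l i) y = f i y.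
Hypothesis du_bd : exists C, forall i y b l, D i y -> `|der b (cmp l) i y| <= C.

Definition bdd (rho : R) f := exists C, forall i y, bball rho i y -> `|f i y| <= C.

Let fin_gr rho n1 n2 k (J : finType) (f : J -> family) :
  (forall p, gr rho n1 n2 k (f p)) -> exists2 C : R, 0 <= C &
  forall p i y, bball rho i y -> `|f p i y| <= C * wt n1 n2 k i y.
Proof.
move=> /(_ _)/cid2-/all_sig2[C C0 H]; exists (\sum_j C j); first exact: sumr_ge0.
move=> p i y By; apply: (le_trans (H p i y By)).
have [w0|w0] := boolP (0 <= wt n1 n2 k i y).
  by rewrite ler_wpM2r// (bigD1 p)//= lerDl sumr_ge0.
(* The weights are arbitrary here. A negative one makes every product [C j * wt] both nonpositive
   and nonnegative. *)
have Cw j : C j * wt n1 n2 k i y = 0.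
  apply/eqP; rewrite eq_le (le_trans (normr_ge0 _) (H j i y By)) andbT.
  by rewrite mulr_ge0_le0// ltW// ltNge.
by rewrite mulr_suml big1 ?Cw// => j _; exact: Cw.
Qed.

Let lap_mder beta f g : Sm f -> eqD (fun i => lap (f i)) g ->
  eqD (fun i => lap (mder beta f i)) (mder beta g).
Proof.
move=> Sf fg; elim: beta => [//|b beta IH] i y Dy.
transitivity ('D_(dd b) (lap (mder beta f i)) y).
  by apply: lap_derive (@oD i) Dy _; exact: Sm_mder.
exact: (eqD_der b IH).
Qed.

(** The jets of order [k + 1], bounded by assumption, take the part of [v] in [bernstein_estimate],
    applied on balls of radius [rho / 4] centred in the ball of radius [rho / 2]. The weights [n1]
    and [n2] are the norms of the still uncontrolled jets of orders [k + 2] and [k + 3]. *)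
Let bdd_step k rho : 0 < rho -> rho <= r ->
  (forall beta l, (size beta <= k.+1)%N -> bdd rho (mder beta (cmp l))) ->
  forall beta l, size beta = k.+2 -> bdd (rho / 2) (mder beta (cmp l)).
Proof.
move=> rho0 rho_r bd0.
pose J : finType := (k.+1.-tuple bool * 'I_m)%type.
pose v (i : Idx) (p : J) : R * R -> R := mder (tval p.1) (cmp p.2) i.
pose n1 : family := fun i => NS (jet1 (v i)).
pose n2 : family := fun i => NS (jet1 (jet1 (v i))).
have n10 i y : 0 <= n1 i y by exact: NS_ge0.
have n20 i y : 0 <= n2 i y by exact: NS_ge0.
have gr0 beta l : (size beta <= k.+1)%N -> gr rho n1 n2 0 (mder beta (cmp l)).
  move=> /(bd0 _ l)[C HC]; exists `|C| => // i y By.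
  by rewrite mulr1 (le_trans (HC _ _ By))// ler_norm.
have GSu j beta l : (size beta + j)%N = k.+1 -> GS rho n1 n2 j (mder beta (cmp l)).
  elim: j beta => [|j IH] beta.
    rewrite addn0 => sb; split; first by apply: gr0; rewrite sb.
      move=> b; exists 1 => // i y By; rewrite mul1r.
      have /eqP sb' := sb.
      rewrite (@le_trans _ _ (n1 i y))// ?lerDr//.
      exact: (le_NS (jet1 (v i)) ((Tuple sb', l), b)).
    move=> b b'; exists 1 => // i y By; rewrite mul1r.
    have /eqP sb' := sb.
    rewrite (@le_trans _ _ (n2 i y))// ?lerDr ?addr_ge0 ?sqr_ge0//.
    exact: (le_NS (jet1 (jet1 (v i))) (((Tuple sb', l), b), b')).
  move=> sb; split; first by apply: gr0; rewrite -sb leq_addr.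
  by move=> b; apply: (IH (b :: beta)); rewrite /= addSnnS.
have GU l : GS rho n1 n2 k.+1 (cmp l) by exact: (GSu k.+1 [::]).
have G0 l : exists2 f, GS rho n1 n2 k f & eqD (fun i => lap (cmp l i)) f.
  have [f gf lf] := lap_u l; exists f => //; exact: GS_gen.
(* The Laplacian of a jet is a derivative of [f], which lies in [GS k]; so derivatives of order
   [k + 1] have weight 1 and those of order [k + 2] weight 2, as Bernstein's estimate demands. *)
have L1 (p : J) : gr rho n1 n2 1 (fun i => lap (v i p)).
  have [f Gf lf] := G0 p.2; have := lap_mder (tval p.1) (Sm_cmp p.2) lf.
  have := size_tuple p.1; rewrite /v; case: (tval p.1) => [//|b beta] [sb] E.
  have := GS_mder (j := 0) (beta := beta) (f := f); rewrite addn0 sb => /(_ _ _ _ Gf)[_ H _].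
  by have [C C0 HC] := H b; exists C => // i y By; rewrite E ?HC//; exact: lt_le_trans rho_r.
have L2 (q : J * bool) : gr rho n1 n2 2 (fun i => lap (jet1 (v i) q)).
  have [f Gf lf] := G0 q.1.2.
  have := lap_mder (q.2 :: tval q.1.1) (Sm_cmp q.1.2) lf.
  have := size_tuple q.1.1; rewrite /jet1 /v/=; case: (tval q.1.1) => [//|b beta] [sb] E.
  have := GS_mder (j := 0) (beta := beta) (f := f); rewrite addn0 sb => /(_ _ _ _ Gf)[_ _ H].
  by have [C C0 HC] := H b q.2; exists C => // i y By; rewrite E ?HC//; exact: lt_le_trans rho_r.
have L0 (p : J) : gr rho n1 n2 0 (fun i => v i p).
  by apply: gr0; rewrite size_tuple.
have [C0 C00 H0] := fin_gr L0; have [C1 C10 H1] := fin_gr L1; have [C2 C20 H2] := fin_gr L2.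
pose C := C0 + C1 + C2.
have CC : 0 <= C by rewrite !addr_ge0.
have [C0C C1C C2C] : [/\ C0 <= C, C1 <= C & C2 <= C].
  by rewrite /C; split; lra.
case=> [//|b beta] l [/eqP sb].
exists (@bernstein_bound R J C (rho / 4)) => i y By.
have r4 : 0 < rho / 4 by rewrite divr_gt0.
have yB (z : R * R) : `|z - y| <= rho / 4 -> bball rho i z.
  move=> zy; rewrite /bball/= -(subrKA y) (le_lt_trans (ler_normD _ _))//.
  have := By; rewrite /bball/=; move: zy; move: `|z - y| `|y - c i| => a1 a2; lra.
have yD (z : R * R) : `|z - y| <= rho / 4 -> D i z.
  by move=> /yB zB; exact: lt_le_trans rho_r.
apply: (bernstein_estimate CC r4 (@oD i) yD (v := v i) _ _ _ _ ((Tuple sb, l), b)).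
- by move=> p; exact: (Sm_mder _ (Sm_cmp _)).
- move=> z p /yB zB; rewrite (le_trans (H0 p i z zB))//= mulr1//.
- move=> z p /yB zB; rewrite (le_trans (H1 p i z zB))// ler_wpM2r//=.
  by rewrite addr_ge0.
- move=> z p /yB zB; rewrite (le_trans (H2 p i z zB))// ler_wpM2r//=.
  by rewrite !addr_ge0// sqr_ge0.
Qed.

Let bdd_all k : exists rho, [/\ 0 < rho, rho <= r &
  forall beta l, (size beta <= k.+1)%N -> bdd rho (mder beta (cmp l))].
Proof.
elim: k => [|k [rho [rho0 rho_r H]]].
  exists r; split=> // -[|b [|//]] l _ /=.
    have SG : smooth_on B (fun x : 'rV[R]_m => x 0 l) by move=> k; exact: Ck_coord.
    have [C C0 HC] := gr0_comp (lexx r) (fun _ _ => 0) (fun _ _ => 0) SG.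
    by exists C => i y By; have := HC i y By; rewrite mulr1.
  by have [C HC] := du_bd; exists C => i y By; exact: HC.
exists (rho / 2); split; first by rewrite divr_gt0.
  by move: rho0 rho_r; lra.
move=> beta l; rewrite leq_eqVlt => /orP[/eqP sb|sb]; first exact: bdd_step sb.
have [C HC] := H beta l sb; exists C => i y By; apply: HC; apply: (lt_trans By).
by rewrite ltr_pdivrMr// ltr_pMr// ltr1n.
Qed.

Lemma gen_bounds f : gen f -> forall beta, exists C, forall i, `|mder beta f i (c i)| <= C.
Proof.
(* With zero weights each class [gr k] with [k <= 2] just means boundedness, and the closure lemmas
   for [GS] carry the bounds over from [u] to [f]. *)
move=> gf beta; pose n0 : family := fun _ _ => 0.
have [rho [rho0 rho_r H]] := bdd_all (size beta + 3).
have n00 i y : 0 <= n0 i y by [].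
have gr0 k b l : (k <= 2)%N -> (size b <= size beta + 3)%N -> gr rho n0 n0 k (mder b (cmp l)).
  move=> k2 /leqW/(H _ l)[C HC]; exists `|C| => // i y By.
  rewrite (le_trans (HC _ _ By))// (le_trans (ler_norm _))//.
  by case: k k2 => [|[|[|k]]] //= _; rewrite /n0 ?expr0n ?addr0 mulr1.
have GSu j b l : (size b + j <= size beta + 1)%N -> GS rho n0 n0 j (mder b (cmp l)).
  elim: j b => [|j IH] b sb.
    have sb' : (size b <= size beta + 1)%N by rewrite addn0 in sb.
    have s3 k : (k <= 2)%N -> (size b + k <= size beta + 3)%N.
      by move=> k2; rewrite (leq_trans (leq_add sb' k2))// -addnA.
    split; first by apply: gr0 => //; rewrite -[size b]addn0 s3.
      by move=> b1; apply: (gr0 1 (b1 :: b)) => //=; rewrite -addn1 s3.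
    by move=> b1 b2; apply: (gr0 2 (b2 :: b1 :: b)) => //=; rewrite -addn2 s3.
  split; first by apply: gr0 => //; rewrite (leq_trans (leq_addr j.+1 _))// (leq_trans sb)// leq_add2l.
  by move=> b1; apply: (IH (b1 :: b)); rewrite /= addSnnS.
have GU l : GS rho n0 n0 (size beta).+1 (cmp l) by apply: (GSu _ [::]); rewrite addn1.
have Gf := GS_gen rho_r n00 n00 GU gf.
have := GS_mder (j := 0) (beta := beta) (f := f); rewrite addn0 => /(_ _ _ _ Gf).
move=> /GS_gr0 [C C0 HC]; exists C => i.
by have := HC i (c i); rewrite mulr1; apply; rewrite /bball/= subrr normr0.
Qed.

End Bootstrap.

(** * Differential forms and contact algebra in charts *)

Section SmoothDeterminant.
Context {R : realType} {V : normedModType R} {A : set V} (oA : open A).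

Lemma Ck_det k (p : nat) (H : V -> 'M[R]_p) :
  (forall i j, Ck k A (fun x => H x i j)) -> Ck k A (fun x => \det (H x)).
Proof.
move=> CH; apply: Ck_sum => // s _; apply: Ck_mul => //; first exact: Ck_cst.
exact: Ck_prod.
Qed.

(** Cramer's rule: cofactors divided by the determinant. *)
Lemma Ck_invmx k (p : nat) (H : V -> 'M[R]_p) : (forall i j, Ck k A (fun x => H x i j)) ->
  (forall x, A x -> H x \in unitmx) -> forall i j, Ck k A (fun x => invmx (H x) i j).
Proof.
move=> CH uH i j.
apply: (@Ck_ext _ _ _ _ _ (fun x => (\det (H x))^-1 * ((-1) ^+ (j + i) *
    \det (row' j (col' i (H x)))))) => //.
  by move=> x Ax; rewrite /invmx (uH x Ax) !mxE.
apply: Ck_mul => //.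
  apply: Ck_inv => //; last exact: Ck_det.
  by move=> x /uH; rewrite unitmxE unitfE.
apply: Ck_mul => //; first exact: Ck_cst.
apply: Ck_det => k1 k2.
by rewrite (_ : (fun _ => _) = (fun x => H x (lift j k1) (lift i k2)))//; apply/funext => x; rewrite !mxE.
Qed.

End SmoothDeterminant.

(** * One-sided derivatives *)

Section DeriveIn.
Context {R : realType} {V W : normedModType R}.

(** The difference quotient restricted to [D] only meets values shared with the extension [g], and a
    proper filter has at most one limit. So derivatives up to the boundary may be computed from any
    local extension. *)
Lemma derive_in_ext (D U : set V) (v : V) (f g : V -> W) (p : V) :
  ProperFilter (within [set h : R | D (p + h *: v)] (0 : R)^') ->
  open U -> U p -> D p -> (forall q, D q -> U q -> f q = g q) -> derivable g p v ->
  derive_in D v f p = 'D_v g p.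
Proof.
move=> PF oU Up Dp fg dg; apply: cvg_lim => //.
have cg : (h^-1 *: (g (p + h *: v) - g p)) @[h --> within [set h : R | D (p + h *: v)] (0 : R)^']
    --> 'D_v g p.
  have /is_derive_distP H : is_derive p v g ('D_v g p) by exact/derivableP.
  apply: (@cvg_trans _ ((h^-1 *: (g (p + h *: v) - g p)) @[h --> (0 : R)^'])).
    by apply: cvg_app; exact: cvg_within.
  apply/cvgrPdist_lt => e e0; have [d d0 {}H] := H _ e0.
  by apply/dnbhs0_distP; exists d => // h hd h0; rewrite distrC; exact: H.
apply: cvg_trans cg; apply: near_eq_cvg; rewrite near_withinE.
have [d d0 dU] := open_distP oU Up.
apply/dnbhs0_distP; exists (d / (1 + `|v|)); first by rewrite divr_gt0// ltr_pwDl.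
move=> h; rewrite ltr_pdivlMr ?ltr_pwDl// => hd h0 Dh.
rewrite !fg//; apply: dU; rewrite addrC addKr normrZ (le_lt_trans _ hd)//.
by rewrite ler_wpM2l// lerDr.
Qed.

Lemma derive_in_open (D : set V) (v : V) (f : V -> W) (p : V) : open D -> D p ->
  derive_in D v f p = 'D_v f p.
Proof.
move=> oD Dp; rewrite /derive_in /derive.
have -> : within [set h : R | D (p + h *: v)] (0 : R)^' = (0 : R)^'.
  apply/seteqP; split=> P; last exact: cvg_within.
  rewrite /within/= => H; have [d d0 dD] := open_distP oD Dp.
  have N : \forall h \near (0 : R)^', D (p + h *: v).
    apply/dnbhs0_distP; exists (d / (1 + `|v|)); first by rewrite divr_gt0// ltr_pwDl.
    move=> h; rewrite ltr_pdivlMr ?ltr_pwDl// => hd h0.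
    apply: dD; rewrite addrC addKr normrZ (le_lt_trans _ hd)//.
    by rewrite ler_wpM2l// lerDr.
  by apply: filterS2 N H => h Dh; exact.
rewrite [X in lim (X @ _) = _](_ : _ = (fun h => h^-1 *: ((f \o shift p) (h *: v) - f p)))//.
by apply/funext => h /=; rewrite (addrC p).
Qed.

End DeriveIn.

(** * Exterior derivatives and changes of charts *)

Section Forms.
Context {R : realType} {m : nat} {M : manifold R m}.
Implicit Types (lam : one_form M) (J : endo_field M) (a b : Defs.index M).

Lemma cdom_open a : open (cdom a). Proof. exact: coord_open. Qed.

Lemma lam_sum lam a x v : lam a x v = \sum_j v 0 j * lam a x (ev j).
Proof. by rewrite {1}[v]rV_sum_ev linear_sum; apply: eq_bigr => j _; rewrite linearZ. Qed.

Lemma endo_sum J a x v : J a x v = \sum_j v 0 j *: J a x (ev j).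
Proof. by rewrite {1}[v]rV_sum_ev linear_sum; apply: eq_bigr => j _; rewrite linearZ. Qed.

Lemma dformE lam a x u v : cdom a x -> dform lam a x u v =
  'D_u (fun y => lam a y v) x - 'D_v (fun y => lam a y u) x.
Proof. by move=> Ax; rewrite /dform /ext_d !derive_in_open//; exact: cdom_open. Qed.

Lemma lam_C1 lam a v : Ck 1 (cdom a) (fun x => lam a x v).
Proof. exact: form_smooth. Qed.

Lemma dlam_dir lam a x u v : cdom a x ->
  'D_u (fun y => lam a y v) x = \sum_i u 0 i * 'D_(ev i) (fun y => lam a y v) x.
Proof. by move=> Ax; have [_ ->] := derive_dir_sum u (@cdom_open a) Ax (lam_C1 lam a v). Qed.

Lemma dlam_val lam a x u v : cdom a x ->
  'D_u (fun y => lam a y v) x = \sum_j v 0 j * 'D_u (fun y => lam a y (ev j)) x.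
Proof.
move=> Ax; rewrite (_ : (fun y => _) = (fun y => \sum_j v 0 j * lam a y (ev j))); last first.
  by apply/funext => y; exact: lam_sum.
rewrite (D1_sum (@cdom_open a) _ _ _ _ Ax); last first.
  by move=> j; apply: Ck_mul (@cdom_open a) _ _; [exact: Ck_cst|exact: lam_C1].
apply: eq_bigr => j _.
rewrite (D1_mul u (Ck_cst _ _ _) (lam_C1 lam a (ev j)) Ax).
by rewrite derive_cst mulr0 addr0.
Qed.

Lemma dform_sum lam a x u v : cdom a x -> dform lam a x u v =
  \sum_i \sum_j u 0 i * v 0 j * dform lam a x (ev i) (ev j).
Proof.
move=> Ax; rewrite dformE// dlam_dir// [X in _ - X]dlam_dir//.
under eq_bigr => i _ do rewrite dlam_val// mulr_sumr.
under [X in _ - X]eq_bigr => i _ do rewrite dlam_val// mulr_sumr.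
rewrite [X in _ - X]exchange_big/= -sumrB; apply: eq_bigr => i _.
rewrite -sumrB; apply: eq_bigr => j _; rewrite dformE//.
by move: ('D_(ev i) _ x) ('D_(ev j) _ x) => s t; ring.
Qed.

Lemma dform_antisym lam a x u v : cdom a x -> dform lam a x u v = - dform lam a x v u.
Proof. by move=> Ax; rewrite !dformE// opprB. Qed.

Lemma dformDl lam a x u u' v k : cdom a x ->
  dform lam a x (k *: u + u') v = k * dform lam a x u v + dform lam a x u' v.
Proof.
move=> Ax; rewrite !(dform_sum lam _ _ Ax) mulr_sumr -big_split/=.
apply: eq_bigr => i _; rewrite mulr_sumr -big_split/=.
by apply: eq_bigr => j _; rewrite !mxE; ring.
Qed.

Lemma dformDr lam a x u v v' k : cdom a x ->
  dform lam a x u (k *: v + v') = k * dform lam a x u v + dform lam a x u v'.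
Proof.
move=> Ax; rewrite dform_antisym// dformDl// opprD -mulrN -!dform_antisym//.
Qed.

Lemma smooth_dform lam a i j : smooth_on (cdom a) (fun x => dform lam a x (ev i) (ev j)).
Proof.
move=> k; apply: (@Ck_ext _ _ _ _ _ (fun x => 'D_(ev i) (fun y => lam a y (ev j)) x
    - 'D_(ev j) (fun y => lam a y (ev i)) x)); first exact: cdom_open.
  by move=> x Ax; rewrite dformE.
by apply: Ck_sub_fun (@cdom_open a) _ _; apply: CkS_derive; exact: form_smooth.
Qed.

(* Naturality of the exterior derivative; the second derivatives of F cancel by
   symmetry. *)
Lemma pullback_dform lam a (V : normedModType R) (A : set V) (F : V -> 'rV[R]_m) x u v :
  open A -> A x -> (forall y, A y -> cdom a (F y)) -> Ck 2 A F ->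
  'D_u (fun z => lam a (F z) ('D_v F z)) x - 'D_v (fun z => lam a (F z) ('D_u F z)) x =
  dform lam a (F x) ('D_u F x) ('D_v F x).
Proof.
move=> oA Ax AF CF.
have CF1 := Ck_pred CF.
have CFj j : Ck 2 A (fun z => F z 0 j) by exact: ((Ck_rVP _ _ oA).1 CF j).
pose g w j z := 'D_w (fun z => F z 0 j) z * (fun y => lam a y (ev j)) (F z).
have Cl j : Ck 1 A ((fun y => lam a y (ev j)) \o F).
  exact: (Ck_comp oA (@cdom_open a) AF (lam_C1 lam a (ev j)) CF1).
have Cg w j : Ck 1 A (g w j) by apply: Ck_mul oA _ _; [exact: CkS_derive|exact: Cl].
have E w y : A y -> lam a (F y) ('D_w F y) = \sum_j g w j y.
  move=> Ay; rewrite lam_sum; apply: eq_bigr => j _.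
  by rewrite /g derive_coord//; have [] := CkS_is_derive w CF1 Ay.
rewrite (D_ext_open oA u Ax (E v)) (D_ext_open oA v Ax (E u)).
rewrite (D1_sum oA _ _ _ (Cg v) Ax) (D1_sum oA _ _ _ (Cg u) Ax).
have DF w j : 'D_w F x 0 j = 'D_w (fun z => F z 0 j) x.
  by rewrite derive_coord//; have [] := CkS_is_derive w CF1 Ax.
have Dl w j : 'D_w ((fun y => lam a y (ev j)) \o F) x =
    'D_('D_w F x) (fun y => lam a y (ev j)) (F x).
  have Dw := CkS_is_derive w CF1 Ax.
  by have [_ ->] := is_derive_compC1 (@cdom_open a) (AF _ Ax) (lam_C1 lam a (ev j)) Dw.
have Dg w w' j : 'D_w (g w' j) x = 'D_w' F x 0 j * 'D_('D_w F x) (fun y => lam a y (ev j)) (F x)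
     + lam a (F x) (ev j) * 'D_w ('D_w' (fun z => F z 0 j)) x.
  have -> : 'D_w (g w' j) x = _ := D1_mul w (CkS_derive w' (CFj j)) (Cl j) Ax.
  by rewrite Dl DF.
pose L w j := 'D_('D_w F x) (fun y => lam a y (ev j)) (F x).
pose Q w w' := \sum_j lam a (F x) (ev j) * 'D_w ('D_w' (fun z => F z 0 j)) x.
have S w w' : \sum_j 'D_w (g w' j) x = \sum_j 'D_w' F x 0 j * L w j + Q w w'.
  by rewrite /Q -big_split; apply: eq_bigr => j _; exact: Dg.
have QC : Q u v = Q v u.
  apply: eq_bigr => j _.
  exact: (congr1 (fun t : R => lam a (F x) (ev j) * t) (schwarz u v oA Ax (CFj j))).
have E1 : 'D_('D_u F x) (fun y => lam a y ('D_v F x)) (F x) = _ :=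
  dlam_val lam ('D_u F x) ('D_v F x) (AF _ Ax).
have E2 : 'D_('D_v F x) (fun y => lam a y ('D_u F x)) (F x) = _ :=
  dlam_val lam ('D_v F x) ('D_u F x) (AF _ Ax).
have E3 := etrans (dformE lam ('D_u F x) ('D_v F x) (AF _ Ax))
  (f_equal2 (fun p q : R => p - q) E1 E2).
have T (X Y s t q q' : R) : X = s + q -> Y = t + q' -> q = q' -> X - Y = s - t.
  by move=> -> -> ->; rewrite opprD addrACA subrr addr0.
exact: (etrans (T _ _ _ _ _ _ (S u v) (S v u) QC) (esym E3)).
Qed.

Lemma overlap_open a b : open (overlap a b).
Proof.
rewrite openE => y [p [pa pb] <-]; rewrite /interior.
have ca : cdom a (Defs.coord a p) by exists p.
have : nbhs (Defs.coord a p) ([set x | Defs.dom b (Defs.param a x)] `&` cdom a).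
  apply: filterI; last by apply: open_nbhs_nbhs; split; [exact: cdom_open|].
  have := @param_continuous R m M a _ ca; apply.
  by rewrite coordK//; apply: open_nbhs_nbhs; split; [exact: dom_open|].
apply: filterS => x [/= bx [q qa qx]]; exists q => //; split=> //.
by move: bx; rewrite -qx coordK.
Qed.

Lemma overlap_cdom a b x : overlap a b x -> cdom a x.
Proof. by move=> [p [pa _] <-]; exists p. Qed.

Lemma overlap_transition a b x : overlap a b x -> overlap b a (transition a b x).
Proof. by move=> [p [pa pb] <-]; exists p => //; rewrite /transition/= coordK. Qed.

Lemma transitionK a b x : overlap a b x -> transition b a (transition a b x) = x.
Proof. by move=> [p [pa pb] <-]; rewrite /transition/= !coordK. Qed.

Lemma smooth_transition a b : smooth_on (overlap a b) (@transition R m M a b).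
Proof. exact: transition_smooth. Qed.

Definition dtrans a b x v := 'D_v (@transition R m M a b) x.

Lemma is_derive_trans (V : normedModType R) a b (u : V -> 'rV[R]_m) p v du :
  overlap a b (u p) -> is_derive p v u du ->
  is_derive p v (@transition R m M a b \o u) (dtrans a b (u p) du).
Proof.
move=> ov Du; apply/is_derive_rVP => j.
have Cj := (Ck_rVP _ _ (@overlap_open a b)).1 (@smooth_transition a b 1%N) j.
have := is_derive_compC1 (@overlap_open a b) ov Cj Du.
rewrite /dtrans derive_coord//.
by have [] := CkS_is_derive du (@smooth_transition a b 1%N) ov.
Qed.

Lemma dtransD a b x k u v : overlap a b x ->
  dtrans a b x (k *: u + v) = k *: dtrans a b x u + dtrans a b x v.
Proof.
move=> ov; have Ct w := CkS_is_derive w (@smooth_transition a b 1%N) ov.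
apply/rowP => j; rewrite !mxE /dtrans.
have Cj := (Ck_rVP _ _ (@overlap_open a b)).1 (@smooth_transition a b 1%N) j.
have E w : ('D_w (transition a b) x) 0 j = 'D_w (fun y => transition a b y 0 j) x.
  by rewrite derive_coord//; have [] := Ct w.
rewrite (E (k *: u + v)) (E u) (E v).
rewrite (derive_add_dir _ _ (@overlap_open a b) ov Cj) derive_dirZ//.
by have [] := CkS_is_derive u Cj ov.
Qed.

Lemma dtransK a b x v : overlap a b x ->
  dtrans b a (transition a b x) (dtrans a b x v) = v.
Proof.
move=> ov; have Dt := CkS_is_derive v (@smooth_transition a b 1%N) ov.
have [_ <-] := is_derive_trans (overlap_transition ov) Dt.
rewrite -[RHS](@derive_id _ _ x v).
by apply: (D_ext_open (@overlap_open a b) v ov) => y; exact: transitionK.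
Qed.

Lemma lam_trans lam a b x v : overlap a b x ->
  lam b (transition a b x) (dtrans a b x v) = lam a x v.
Proof. by move=> ov; rewrite [RHS](form_transition lam v ov). Qed.

Lemma endo_trans J a b x v : overlap a b x ->
  J b (transition a b x) (dtrans a b x v) = dtrans a b x (J a x v).
Proof. by move=> ov; rewrite [RHS](endo_transition J v ov). Qed.

Lemma dform_trans lam a b x u v : overlap a b x ->
  dform lam b (transition a b x) (dtrans a b x u) (dtrans a b x v) = dform lam a x u v.
Proof.
move=> ov; have oA := @overlap_open a b.
have AF y : overlap a b y -> cdom b (transition a b y).
  by move=> /overlap_transition/overlap_cdom.
rewrite -(pullback_dform lam u v oA ov AF (@smooth_transition a b 2%N)).
rewrite (dformE lam _ _ (overlap_cdom ov)).
have E w y : overlap a b y -> lam b (transition a b y) ('D_w (transition a b) y) = lam a y w.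
  exact: lam_trans.
by rewrite (D_ext_open oA u ov (E v)) (D_ext_open oA v ov (E u)).
Qed.

End Forms.

(** * The Reeb field and the triad metric *)

Section ContactAlgebra.
Context {R : realType} {n : nat} {M : manifold R n.*2.+1} {lam : one_form M}
  {J : endo_field M} (tr : contact_triad lam J).
Implicit Types a b : Defs.index M.
Local Notation m := n.*2.+1.

(** The triad metric with the projections to [xi] left out; [dform] and [J] both annihilate the Reeb
    field, see [triad_metricE]. In this form its matrix [hmx] is visibly smooth, before anything is
    known about the smoothness of [reeb]. *)
Definition hform a x (u v : 'rV[R]_m) : R := dform lam a x u (J a x v) + lam a x u * lam a x v.

Lemma dform0l a x v : cdom a x -> dform lam a x 0 v = 0.
Proof. by move=> Ax; have := dformDl lam 0 0 v (-1) Ax; rewrite scaler0 addr0 mulN1r addNr. Qed.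

Lemma dform0r a x v : cdom a x -> dform lam a x v 0 = 0.
Proof. by move=> Ax; rewrite dform_antisym// dform0l// oppr0. Qed.

Lemma dformBl a x u k v w : cdom a x ->
  dform lam a x (u - k *: v) w = dform lam a x u w - k * dform lam a x v w.
Proof. by move=> Ax; rewrite addrC -scaleNr dformDl// mulNr addrC. Qed.

Lemma J_reeb a x : cdom a x -> J a x (reeb lam a x) = 0.
Proof. by move=> /(tr.2 _ _)[]. Qed.

Lemma J_pos a x v : cdom a x -> lam a x v = 0 -> v != 0 -> 0 < dform lam a x v (J a x v).
Proof. by move=> /(tr.2 _ _)[_ _ _ [_ + _]]; exact. Qed.

(* A skew matrix of odd size is singular, and d lam is nondegenerate on ker lam,
   so the kernel of d lam is a line transverse to ker lam. *)
Lemma reeb_exists a x : cdom a x ->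
  exists X, lam a x X = 1 /\ forall u, dform lam a x X u = 0.
Proof.
move=> Ax; pose O : 'M[R]_m := \matrix_(i, j) dform lam a x (ev i) (ev j).
have OT : O^T = - O.
  by apply/matrixP => i j; rewrite !mxE dform_antisym.
have : \det O == 0.
  have := det_tr O; rewrite OT -scaleN1r detZ exprS -[_ ^+ n.*2]signr_odd odd_double expr0 mulr1.
  rewrite mulN1r => /eqP; rewrite eq_sym -subr_eq0 opprK -mulr2n mulrn_eq0.
  by rewrite orFb.
move=> /det0P[v v0 vO].
have vk u : dform lam a x v u = 0.
  rewrite dform_sum// exchange_big/= big1// => j _.
  have : (v *m O) 0 j = 0 by rewrite vO mxE.
  rewrite mxE => H; transitivity (u 0 j * \sum_i v 0 i * O i j); last by rewrite H mulr0.
  by rewrite mulr_sumr; apply: eq_bigr => i _; rewrite mxE; ring.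
have lv : lam a x v != 0.
  by apply/eqP => lv; have := J_pos Ax lv v0; rewrite vk ltxx.
exists ((lam a x v)^-1 *: v); split; first by rewrite linearZ/= mulVf.
by move=> u; rewrite -[_ *: v]addr0 dformDl// vk mulr0 dform0l// addr0.
Qed.

Lemma reebP a x : cdom a x ->
  lam a x (reeb lam a x) = 1 /\ forall u, dform lam a x (reeb lam a x) u = 0.
Proof. by move=> /reeb_exists[X HX]; exact: (@xgetPex _ 0 [set X | lam a x X = 1 /\ _] (ex_intro _ X HX)). Qed.

Lemma reeb_unique a x Y : cdom a x -> lam a x Y = 1 ->
  (forall u, dform lam a x Y u = 0) -> Y = reeb lam a x.
Proof.
move=> Ax lY dY; have [lX dX] := reebP Ax.
apply/eqP; rewrite -subr_eq0; apply/negP => /negP Z0.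
have lZ : lam a x (Y - reeb lam a x) = 0 by rewrite linearB/= lY lX subrr.
have := J_pos Ax lZ Z0; rewrite -[reeb lam a x in X in dform _ _ _ X]scale1r dformBl//.
by rewrite dY dX mulr0 subrr ltxx.
Qed.

Lemma dform_proj a x u v : cdom a x ->
  dform lam a x (xi_proj lam a x u) v = dform lam a x u v.
Proof. by move=> Ax; rewrite /xi_proj dformBl// (reebP Ax).2 mulr0 subr0. Qed.

Lemma J_proj a x v : cdom a x -> J a x (xi_proj lam a x v) = J a x v.
Proof. by move=> Ax; rewrite /xi_proj linearB linearZ/= J_reeb// scaler0 subr0. Qed.

Lemma lam_proj a x v : cdom a x -> lam a x (xi_proj lam a x v) = 0.
Proof. by move=> Ax; rewrite /xi_proj linearB linearZ/= (reebP Ax).1 mulr1 subrr. Qed.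

Lemma triad_metricE a x u v : cdom a x -> triad_metric lam J a x u v = hform a x u v.
Proof. by move=> Ax; rewrite /triad_metric /hform dform_proj// J_proj. Qed.

Lemma dform_J_ge0 a x v : cdom a x -> 0 <= dform lam a x v (J a x v).
Proof.
move=> Ax; rewrite -dform_proj// -(J_proj v Ax).
have [->|v0] := eqVneq (xi_proj lam a x v) 0; first by rewrite dform0l.
by apply: ltW; apply: J_pos => //; exact: lam_proj.
Qed.

Lemma hform_gt0 a x v : cdom a x -> v != 0 -> 0 < hform a x v v.
Proof.
move=> Ax v0; have H := dform_J_ge0 v Ax; rewrite /hform -expr2.
have [l0|l0] := eqVneq (lam a x v) 0.
  by rewrite l0 expr0n addr0; exact: J_pos.
by rewrite ltr_wpDl// exprn_even_gt0.
Qed.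

Lemma hform_ge0 a x v : cdom a x -> 0 <= hform a x v v.
Proof. by move=> Ax; rewrite /hform addr_ge0 ?dform_J_ge0// -expr2 sqr_ge0. Qed.

Lemma reeb_trans a b x : overlap a b x ->
  dtrans a b x (reeb lam a x) = reeb lam b (transition a b x).
Proof.
move=> ov; have Ax := overlap_cdom ov; have [lX dX] := reebP Ax.
have ov' := overlap_transition ov.
apply: reeb_unique; first exact: overlap_cdom ov'.
  by rewrite lam_trans.
move=> u; have := dtransK u ov'; rewrite transitionK// => <-.
by rewrite dform_trans.
Qed.

Lemma dtransZ a b x k u : overlap a b x -> dtrans a b x (k *: u) = k *: dtrans a b x u.
Proof.
move=> ov; have := dtransD k u 0 ov; rewrite addr0 => ->.
by rewrite /dtrans derive0 addr0.
Qed.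

Lemma dtransB a b x u v : overlap a b x ->
  dtrans a b x (u - v) = dtrans a b x u - dtrans a b x v.
Proof. by move=> ov; rewrite addrC -scaleN1r dtransD// scaleN1r addrC. Qed.

Lemma dtrans_inj a b x u : overlap a b x -> dtrans a b x u = 0 -> u = 0.
Proof.
by move=> ov u0; rewrite -(dtransK u ov) u0 /dtrans derive0.
Qed.

Lemma proj_trans a b x v : overlap a b x ->
  xi_proj lam b (transition a b x) (dtrans a b x v) = dtrans a b x (xi_proj lam a x v).
Proof. by move=> ov; rewrite /xi_proj lam_trans// -reeb_trans// dtransB// dtransZ. Qed.

Lemma hform_trans a b x u v : overlap a b x ->
  hform b (transition a b x) (dtrans a b x u) (dtrans a b x v) = hform a x u v.
Proof. by move=> ov; rewrite /hform endo_trans// dform_trans// !lam_trans. Qed.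

Lemma smooth_endo a i j : smooth_on (cdom a) (fun x => J a x (ev i) 0 j).
Proof. by move=> k; exact: ((Ck_rVP _ _ (@cdom_open _ _ _ a)).1 (endo_smooth J a (ev i) k) j). Qed.

Lemma dformJ_sum a x u v : cdom a x -> dform lam a x u (J a x v) =
  \sum_i \sum_j u 0 i * v 0 j * \sum_l J a x (ev j) 0 l * dform lam a x (ev i) (ev l).
Proof.
move=> Ax; rewrite dform_sum//; apply: eq_bigr => i _.
under [RHS]eq_bigr => j _ do rewrite mulr_sumr.
rewrite exchange_big/=; apply: eq_bigr => l _.
rewrite endo_sum summxE mulr_sumr mulr_suml; apply: eq_bigr => j _.
by rewrite mxE; ring.
Qed.

Definition hmx a x : 'M[R]_m := \matrix_(i, j)
  (\sum_l J a x (ev j) 0 l * dform lam a x (ev i) (ev l) + lam a x (ev i) * lam a x (ev j)).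

Lemma hform_sum a x u v : cdom a x -> hform a x u v = \sum_i \sum_j u 0 i * v 0 j * hmx a x i j.
Proof.
move=> Ax; rewrite /hform dformJ_sum// (lam_sum lam a x u) (lam_sum lam a x v) mulr_suml.
rewrite -big_split/=; apply: eq_bigr => i _; rewrite mulr_sumr -big_split/=.
by apply: eq_bigr => j _; rewrite mxE; ring.
Qed.

Lemma smooth_hmx a i j : smooth_on (cdom a) (fun x => hmx a x i j).
Proof.
move=> k; have oA := @cdom_open _ _ _ a.
apply: (@Ck_ext _ _ _ _ _ (fun x => \sum_l J a x (ev j) 0 l * dform lam a x (ev i) (ev l)
  + lam a x (ev i) * lam a x (ev j))) => //; first by move=> x _; rewrite mxE.
apply: Ck_add => //; last by apply: Ck_mul => //; exact: form_smooth.
by apply: Ck_sum => // l _; apply: Ck_mul => //; [exact: smooth_endo|exact: smooth_dform].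
Qed.

Lemma hmx_unit a x : cdom a x -> hmx a x \in unitmx.
Proof.
move=> Ax; rewrite unitmxE unitfE; apply/negP => /det0P[v v0 vH].
have := hform_gt0 Ax v0; rewrite hform_sum// exchange_big/= big1 ?ltxx// => j _.
have : (v *m hmx a x) 0 j = 0 by rewrite vH mxE.
rewrite mxE => H; transitivity (v 0 j * \sum_i v 0 i * hmx a x i j); last by rewrite H mulr0.
by rewrite mulr_sumr; apply: eq_bigr => i _; ring.
Qed.

(** The Reeb field is the metric dual of [lam]: it solves the linear system with matrix [hmx] and
    right side [lam]. Cramer's rule then gives smoothness, although [reeb] is defined by choice. *)
Lemma smooth_reeb a : smooth_on (cdom a) (reeb lam a).
Proof.
have oA := @cdom_open _ _ _ a; move=> k; apply/Ck_rVP => // j.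
apply: (@Ck_ext _ _ _ _ _ (fun x => \sum_i invmx (hmx a x) j i * lam a x (ev i))) => //.
  move=> x Ax; have [lX dX] := reebP Ax.
  have E : hmx a x *m (reeb lam a x)^T = \col_i lam a x (ev i).
    apply/colP => i; rewrite !mxE.
    have -> : lam a x (ev i) = hform a x (ev i) (reeb lam a x).
      by rewrite /hform J_reeb// dform0r// add0r lX mulr1.
    rewrite hform_sum// [RHS](bigD1 i)//= [X in _ = _ + X]big1 ?addr0; last first.
      move=> l li; rewrite big1// => l' _.
      by rewrite mxE eqxx/= (negbTE li) !mul0r.
    by apply: eq_bigr => l _; rewrite /ev [X in _ = X * _ * _]mxE !eqxx mul1r [X in _ * X = _]mxE mulrC.
  have := congr1 (mulmx (invmx (hmx a x))) E; rewrite mulKmx; last exact: hmx_unit.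
  move=> /matrixP/(_ j 0); rewrite mxE => ->; rewrite mxE.
  by apply: eq_bigr => i _; rewrite mxE.
apply: Ck_sum => // i _; apply: Ck_mul => //; last exact: form_smooth.
apply: Ck_invmx => //; last by move=> x; exact: hmx_unit.
by move=> i1 j1; exact: smooth_hmx.
Qed.

(** By homogeneity it suffices to minimise over [K] times the unit sphere, a compact set on which
    the form is continuous and positive. *)
Lemma hform_coercive a (K : set 'rV[R]_m) : compact K -> K `<=` cdom a ->
  exists2 c : R, 0 < c & forall x v, K x -> c * `|v| ^+ 2 <= hform a x v v.
Proof.
move=> cK KA; pose S := [set v : 'rV[R]_m | `|v| = 1].
have cS : compact S.
  apply: bounded_closed_compact.
    exists 1; split; first exact: num_real.
    by move=> e e1 v /= ->; exact: ltW.
  have -> : S = (fun v : 'rV[R]_m => `|v|) @^-1` [set 1] by [].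
  by apply: closed_comp; [move=> v _; exact: norm_continuous|exact: closed_eq].
have [K0|/set0P[x0 Kx0]] := eqVneq K set0.
  by exists 1 => // x v; rewrite K0.
have S0 : S (const_mx 1).
  rewrite /S/=; apply/eqP; rewrite eq_le; apply/andP; split.
    by apply: rV_norm_le => // j; rewrite mxE normr1.
  by have := coord_le_norm (const_mx 1 : 'rV[R]_m) 0; rewrite mxE normr1.
pose f (p : 'rV[R]_m * 'rV[R]_m) := \sum_i \sum_j p.2 0 i * p.2 0 j * hmx a p.1 i j.
have KS0 : (K `*` S) !=set0 by exists (x0, const_mx 1).
have cf : {within K `*` S, continuous f}.
  pose A := [set p : 'rV[R]_m * 'rV[R]_m | cdom a p.1].
  have oA : open A.
    have := @cdom_open _ _ _ a; apply: open_comp => p _; exact: cvg_fst.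
  have CA (g : 'rV[R]_m * 'rV[R]_m -> R) :
    (forall p, A p -> {for p, continuous g}) -> Ck 0 A g by [].
  suff H : Ck 0 A f.
    apply: continuous_in_subspaceT => -[x v]; rewrite inE => -[/= Kx _].
    exact: Ck_cont H (KA _ Kx : A (x, v)).
  apply: Ck_sum => // i _; apply: Ck_sum => // j _.
  apply: Ck_mul => //; first apply: Ck_mul => //; apply: CA => p Ap.
  - by apply: (@continuous_comp _ _ _ snd (fun x : 'rV[R]_m => x 0 i));
      [exact: cvg_snd|exact: coord_continuous].
  - by apply: (@continuous_comp _ _ _ snd (fun x : 'rV[R]_m => x 0 j));
      [exact: cvg_snd|exact: coord_continuous].
  - apply: (@continuous_comp _ _ _ fst (fun x => hmx a x i j)); first exact: cvg_fst.
    exact: (Ck_cont (@smooth_hmx a i j 0%N) (Ap : cdom a p.1)).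
have [[x1 v1]] := compact_EVT_min KS0 (compact_setX cK cS) cf.
rewrite inE => -[/= Kx1 Sv1] fmin.
exists (f (x1, v1)).
  rewrite /f/= -hform_sum; last exact: KA.
  apply: hform_gt0; first exact: KA.
  by rewrite -normr_eq0 Sv1 oner_eq0.
move=> x v Kx; have [->|v0] := eqVneq v 0.
  by rewrite normr0 expr0n mulr0; apply: hform_ge0; exact: KA.
have vp : 0 < `|v| by rewrite normr_gt0.
have Sv : S (`|v|^-1 *: v).
  by rewrite /S/= normrZ normfV normr_id mulVf// gt_eqF.
have /fmin : (x, `|v|^-1 *: v) \in K `*` S by rewrite inE.
set X := f (x1, v1) => H; rewrite -ler_pdivlMr ?exprn_gt0//.
apply: (le_trans H); rewrite le_eqVlt; apply/orP; left; apply/eqP.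
rewrite /f/= (hform_sum _ _ (KA _ Kx)) mulr_suml; apply: eq_bigr => i _.
rewrite mulr_suml; apply: eq_bigr => j _; rewrite !mxE.
by field; rewrite gt_eqF.
Qed.

Lemma dformNr a x u v : cdom a x -> dform lam a x u (- v) = - dform lam a x u v.
Proof.
by move=> Ax; rewrite -scaleN1r -[-1 *: v]addr0 dformDr// dform0r// addr0 mulN1r.
Qed.

Lemma triad_metric_proj a x u : cdom a x ->
  triad_metric lam J a x (xi_proj lam a x u) (xi_proj lam a x u) = dform lam a x u (J a x u).
Proof.
move=> Ax; rewrite triad_metricE// /hform !lam_proj// mulr0 addr0.
by rewrite J_proj// dform_proj.
Qed.

Lemma dformJ_trans a b x u : overlap a b x ->
  dform lam b (transition a b x) (dtrans a b x u) (J b (transition a b x) (dtrans a b x u)) =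
  dform lam a x u (J a x u).
Proof. by move=> ov; rewrite endo_trans// dform_trans. Qed.

End ContactAlgebra.

(** * Contact instantons in charts *)

Section LocalSmoothness.
Context {R : realType}.
Implicit Types V W : normedModType R.

Lemma Ck_local V W k (A : set V) (f : V -> W) :
  (forall x, A x -> exists U, [/\ open U, U x & Ck k U f]) -> Ck k A f.
Proof.
elim: k f => [|k IH] f H.
  by split=> // x /H[U [_ Ux [cf _]]]; exact: cf.
split; first by move=> x /H[U [_ Ux [cf _]]]; exact: cf.
move=> v; split; first by move=> x /H[U [_ Ux [_ /(_ v)[df _]]]]; exact: df.
by apply: IH => x /H[U [oU Ux Cf]]; exists U; split=> //; exact: CkS_derive.
Qed.

Lemma open_preimage_in (T T' : topologicalType) (U : set T) (F : T -> T') (O : set T') :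
  open U -> open O -> (forall x, U x -> {for x, continuous F}) ->
  open (U `&` F @^-1` O).
Proof.
move=> oU oO cF; rewrite openE => x [Ux Ox]; apply: filterI.
  exact: open_nbhs_nbhs.
by apply: cF => //; exact: open_nbhs_nbhs.
Qed.

End LocalSmoothness.

Section Admissible.
Context {R : realType}.

(** Properness makes the limit in [derive_in] unique. On the half-cylinder it holds because, at a
    boundary point, every direction or its opposite stays inside. *)
Definition admissible (D : set (R * R)) := forall p v : R * R, D p ->
  ProperFilter (within [set h : R | D (p + h *: v)] (0 : R)^').

Lemma admissible_half : admissible (@half_cylinder R).
Proof.
move=> p v p0; apply: Build_ProperFilter_ex => P.
rewrite /within/= => /dnbhs0_distP[d d0 H].
have d2 : 0 < d / 2 by rewrite divr_gt0.
have dlt : d / 2 < d by rewrite ltr_pdivrMr// ltr_pMr// ltr1n.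
have [v0|v0] := leP 0 v.1.
  exists (d / 2); apply: H; rewrite ?gt_eqF ?(gtr0_norm d2)//.
  by rewrite /half_cylinder/= addr_ge0// mulr_ge0// ltW.
exists (- (d / 2)); apply: H; rewrite ?normrN ?oppr_eq0 ?gt_eqF ?(gtr0_norm d2)//.
by rewrite /half_cylinder/= addr_ge0// [_ *: _]mulNr -mulrN mulr_ge0// ?oppr_ge0 ltW.
Qed.

Lemma admissible_full : admissible (@full_cylinder R).
Proof.
move=> p v _; rewrite /full_cylinder (_ : [set h : R | _] = setT); last by apply/seteqP; split.
rewrite (_ : within setT _ = (0 : R)^'); last first.
  by apply/seteqP; split=> P; rewrite /within/=; [apply: filterS => h; exact|exact: filterS].
exact: Proper_dnbhs_numFieldType.
Qed.

Lemma cyl_j_tau : cyl_j (dd false) = dd true :> R * R.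
Proof. by rewrite /cyl_j /= oppr0. Qed.
Lemma cyl_j_t : cyl_j (dd true) = - dd false :> R * R.
Proof. by rewrite /cyl_j /=; congr pair; rewrite oppr0. Qed.

End Admissible.

(** * Local extensions of cylinder maps *)

Section Representations.
Context {R : realType} {n : nat} {M : manifold R n.*2.+1} {lam : one_form M}
  {J : endo_field M} (tr : contact_triad lam J).
Local Notation m := n.*2.+1.
Implicit Types a b : Defs.index M.

(** [F] extends [w], read in the chart [a], to the open set [U] even at boundary points. The
    definitions use the preferred chart at [w q] and one-sided derivatives; the lemmas below express
    them by ordinary derivatives of [F] in an arbitrary chart. *)
Definition lrep (D : set (R * R)) (w : R * R -> M) a (U : set (R * R))
    (F : R * R -> 'rV[R]_m) :=
  [/\ open U, smooth_on U F, forall q, U q -> cdom a (F q) &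
      forall q, D q -> U q -> Defs.dom a (w q) /\ Defs.coord a (w q) = F q].

Lemma lrep_at D w a p : smooth_cylinder_map D w -> D p -> Defs.dom a (w p) ->
  exists U F, lrep D w a U F /\ U p.
Proof.
move=> [_ sw] Dp ap; have [U [F [oU Up SF wF]]] := sw p a Dp ap.
exists (U `&` F @^-1` cdom a), F; split; last first.
  by split=> //=; have [_ <-] := wF p Dp Up; exists (w p).
split=> //; last by move=> q Dq [Uq _]; exact: wF.
- apply: open_preimage_in => //; first exact: cdom_open.
  by move=> x; exact: Ck_cont (SF 0%N).
- by move=> k; apply: Ck_sub (SF k); exact: subIsetl.
- by move=> q [].
Qed.

Section Rep.
Context {D : set (R * R)} (aD : admissible D) {w : R * R -> M}.
Context {a : Defs.index M} {U : set (R * R)} {F : R * R -> 'rV[R]_m} (rep : lrep D w a U F).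
Context {q : R * R} (Dq : D q) (Uq : U q).
Let b := chart_at (w q).

Lemma rep_overlap : overlap a b (F q).
Proof.
have [_ _ _ /(_ q Dq Uq)[aw <-]] := rep.
by exists (w q) => //; split=> //; exact: chart_at_dom.
Qed.

Lemma rep_coord : Defs.coord b (w q) = transition a b (F q).
Proof. by have [_ _ _ /(_ q Dq Uq)[aw <-]] := rep; rewrite /transition/= coordK. Qed.

Lemma rep_cdom : cdom b (Defs.coord b (w q)).
Proof. by exists (w q) => //; exact: chart_at_dom. Qed.

Lemma rep_derive v : is_derive q v F ('D_v F q).
Proof. by have [_ SF _ _] := rep; exact: CkS_is_derive (SF 1%N) Uq. Qed.

Lemma dmap_rep v : dmap D w q v = dtrans a b (F q) ('D_v F q).
Proof.
have [oU SF FU wF] := rep.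
have [dg <-] := is_derive_trans rep_overlap (rep_derive v).
pose U' := U `&` F @^-1` overlap a b.
have oU' : open U'.
  apply: open_preimage_in => //; first exact: overlap_open.
  by move=> x; exact: Ck_cont (SF 0%N).
have U'q : U' q by split=> //; exact: rep_overlap.
have fg q' : D q' -> U' q' -> (Defs.coord b \o w) q' = (@transition R m M a b \o F) q'.
  by move=> Dq' [Uq' ov']; have [aw E] := wF q' Dq' Uq'; rewrite /= -E /transition/= coordK.
exact: (derive_in_ext (@aD q v Dq) oU' U'q Dq fg dg).
Qed.

Lemma pullback_rep v : pullback lam D w q v = lam a (F q) ('D_v F q).
Proof. by rewrite /pullback dmap_rep rep_coord lam_trans//; exact: rep_overlap. Qed.

Lemma norm_dmap_rep : norm_sq_at lam J (w q) (dmap D w q) =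
  hform (J := J) (lam := lam) a (F q) ('D_(dd false) F q) ('D_(dd false) F q) +
  hform (J := J) (lam := lam) a (F q) ('D_(dd true) F q) ('D_(dd true) F q).
Proof.
have ov := rep_overlap; have cb := rep_cdom; rewrite /norm_sq_at.
have E v : triad_metric lam J b (Defs.coord b (w q)) (dmap D w q v) (dmap D w q v) =
    hform (J := J) (lam := lam) a (F q) ('D_v F q) ('D_v F q).
  by rewrite (triad_metricE tr _ _ cb) dmap_rep rep_coord (hform_trans _ _ ov).
exact: (f_equal2 (fun s t : R => s + t) (E (dd false)) (E (dd true))).
Qed.

Lemma norm_dpi_rep : norm_sq_at lam J (w q) (dpi lam D w q) =
  dform lam a (F q) ('D_(dd false) F q) (J a (F q) ('D_(dd false) F q)) +
  dform lam a (F q) ('D_(dd true) F q) (J a (F q) ('D_(dd true) F q)).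
Proof.
have ov := rep_overlap; have cb := rep_cdom; rewrite /norm_sq_at /dpi.
have E v : triad_metric lam J b (Defs.coord b (w q))
    (xi_proj lam b (Defs.coord b (w q)) (dmap D w q v))
    (xi_proj lam b (Defs.coord b (w q)) (dmap D w q v)) =
    dform lam a (F q) ('D_v F q) (J a (F q) ('D_v F q)).
  by rewrite (triad_metric_proj tr _ cb) dmap_rep rep_coord (dformJ_trans _ ov).
exact: (f_equal2 (fun s t : R => s + t) (E (dd false)) (E (dd true))).
Qed.

Lemma delbar_rep v : delbar_pi lam J D w q v = 0 <->
  'D_v F q - lam a (F q) ('D_v F q) *: reeb lam a (F q) + J a (F q) ('D_(cyl_j v) F q) = 0.
Proof.
have ov := rep_overlap; have cb := rep_cdom.
have E : delbar_pi lam J D w q v = 2^-1 *: dtrans a b (F q)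
   ('D_v F q - lam a (F q) ('D_v F q) *: reeb lam a (F q) + J a (F q) ('D_(cyl_j v) F q)).
  rewrite /delbar_pi /dpi -/b (J_proj tr _ cb) !dmap_rep rep_coord (proj_trans tr _ ov).
  rewrite (endo_trans J _ ov); congr (_ *: _).
  have := dtransD 1 (xi_proj lam a (F q) ('D_v F q)) (J a (F q) ('D_(cyl_j v) F q)) ov.
  by rewrite !scale1r => ->.
rewrite E; split=> [/eqP|->].
  rewrite scaler_eq0 invr_eq0 pnatr_eq0/= => /eqP; exact: dtrans_inj.
by rewrite /dtrans derive0 scaler0.
Qed.

End Rep.
End Representations.

(** * The instanton equations in a chart *)

Section Instanton.
Context {R : realType} {n : nat} {M : manifold R n.*2.+1} {lam : one_form M}
  {J : endo_field M} (tr : contact_triad lam J).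
Local Notation m := n.*2.+1.
Implicit Types a b : Defs.index M.
Local Notation D := (@half_cylinder R).
Context {w : R * R -> M} (inst : contact_instanton lam J D w).

(** Boundary points are left out, so that [loc a] itself is smooth on this set and no extension has
    to be chosen. *)
Definition inner a : set (R * R) := [set q | 0 < q.1 /\ Defs.dom a (w q)].
Definition loc a (q : R * R) : 'rV[R]_m := Defs.coord a (w q).

Let pos : set (R * R) := [set q | 0 < q.1].
Let pos_open : open pos.
Proof.
have -> : pos = fst @^-1` [set x : R | 0 < x] by [].
by apply: open_comp; [move=> p _; exact: cvg_fst|exact: open_gt].
Qed.

Let inner_nbhd a p : inner a p -> exists U, [/\ open U, U p, U `<=` inner a & smooth_on U (loc a)].
Proof.
move=> [p0 ap]; have [sw _ _] := inst.
have [U [F [[oU SF _ wF] Up]]] := lrep_at sw (ltW p0 : D p) ap.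
exists (U `&` pos); split=> //.
- exact: openI.
- by move=> q [Uq q0]; split=> //; exact: (wF q (ltW q0) Uq).1.
- move=> k; apply: (@Ck_ext _ _ _ _ _ F); first exact: openI.
    by move=> q [Uq q0]; rewrite /loc (wF q (ltW q0) Uq).2.
  by apply: Ck_sub (SF k); exact: subIsetl.
Qed.

Lemma inner_open a : open (inner a).
Proof.
rewrite openE => p /inner_nbhd[U [oU Up UI _]].
by apply: filterS UI _; exact: open_nbhs_nbhs.
Qed.

Lemma smooth_loc a : smooth_on (inner a) (loc a).
Proof.
by move=> k; apply: Ck_local => p /inner_nbhd[U [oU Up _ SU]]; exists U.
Qed.

Lemma inner_rep a : lrep D w a (inner a) (loc a).
Proof.
split; [exact: inner_open|exact: smooth_loc| |by move=> q _ []].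
by move=> q [_ aq]; exists (w q).
Qed.

Let innerD a q : inner a q -> D q. Proof. by move=> [/ltW]. Qed.

Definition fa a (q : R * R) : R := lam a (loc a q) ('D_(dd false) (loc a) q).
Definition fb a (q : R * R) : R := lam a (loc a q) ('D_(dd true) (loc a) q).
Definition fe a (q : R * R) : R := dform lam a (loc a q) ('D_(dd false) (loc a) q)
  (J a (loc a q) ('D_(dd false) (loc a) q)).

Let Du a q v : inner a q -> is_derive q v (loc a) ('D_v (loc a) q).
Proof. by move=> Iq; exact: CkS_is_derive (smooth_loc a 1%N) Iq. Qed.

Let Xr a q : 'rV[R]_m := reeb lam a (loc a q).

(** The Cauchy-Riemann equation leaves the Reeb components [fa] and [fb] free; those are governed by
    [eq_closed] and [eq_area]. *)
Lemma eq_tau a q : inner a q ->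
  'D_(dd false) (loc a) q = fa a q *: Xr a q - J a (loc a q) ('D_(dd true) (loc a) q).
Proof.
move=> Iq; have [_ /(_ q (dd false) (innerD Iq)) + _] := inst.
move=> /(delbar_rep tr admissible_half (inner_rep a) (innerD Iq) Iq); rewrite cyl_j_tau.
by rewrite addrAC => /eqP; rewrite subr_eq0 => /eqP <-; rewrite addrK.
Qed.

Lemma eq_t a q : inner a q ->
  'D_(dd true) (loc a) q = fb a q *: Xr a q + J a (loc a q) ('D_(dd false) (loc a) q).
Proof.
move=> Iq; have [_ /(_ q (dd true) (innerD Iq)) + _] := inst.
move=> /(delbar_rep tr admissible_half (inner_rep a) (innerD Iq) Iq); rewrite cyl_j_t.
rewrite derive_dirN ?linearN/=; last by have [] := Du (dd false) Iq.
by move=> /eqP; rewrite subr_eq0 subr_eq addrC => /eqP.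
Qed.

Lemma smooth_lam_loc a v : smooth_on (inner a) (fun q => lam a (loc a q) ('D_v (loc a) q)).
Proof.
move=> k; have oI := @inner_open a.
apply: (@Ck_ext _ _ _ _ _ (fun q => \sum_j 'D_v (fun z => loc a z 0 j) q *
   ((fun x => lam a x (ev j)) \o loc a) q)) => //.
  move=> q Iq; rewrite lam_sum; apply: eq_bigr => j _; rewrite derive_coord//.
  by have [] := Du v Iq.
apply: Ck_sum => // j _; apply: Ck_mul => //.
  by apply: CkS_derive; exact: ((Ck_rVP _ _ oI).1 (smooth_loc a k.+1) j).
apply: (Ck_comp oI (@cdom_open _ _ _ a) _ (form_smooth lam a (ev j) k) (smooth_loc a k)).
by have [] := inner_rep a.
Qed.

Lemma eq_closed a q : inner a q -> 'D_(dd false) (fa a) q + 'D_(dd true) (fb a) q = 0.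
Proof.
move=> Iq; have [_ _ /(_ q (dd false) (dd true) (innerD Iq))] := inst.
have oI := @inner_open a.
have adm := @admissible_half R.
have E (v z : R * R) : derive_in D v (fun q' => pullback lam D w q' z) q =
    'D_v (fun q' => lam a (loc a q') ('D_z (loc a) q')) q.
  apply: (derive_in_ext (adm q v (innerD Iq)) oI Iq (innerD Iq)).
    by move=> q' Dq' Iq'; rewrite (pullback_rep adm (inner_rep a) Dq' Iq').
  by have [] := CkS_is_derive v (smooth_lam_loc a z 1%N) Iq.
rewrite /ext_d cyl_j_tau cyl_j_t (E (dd false) (- dd false)) (E (dd true) (dd true)).
have X : 'D_(dd false) (fun q' => lam a (loc a q') ('D_(- dd false) (loc a) q')) q =
    - 'D_(dd false) (fa a) q.
  have Ca := CkS_is_derive (dd false) (smooth_lam_loc a (dd false) 1%N) Iq.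
  have [_ <-] := is_deriveN Ca.
  apply: (D_ext_open oI (dd false) Iq) => q' Iq'.
  by rewrite derive_dirN ?linearN//; have [] := Du (dd false) Iq'.
have T (s t z : R) : s - t = 0 -> s = - z -> z + t = 0.
  by move=> /[swap] ->; rewrite -opprD => /eqP; rewrite oppr_eq0 => /eqP.
by move=> H; exact: (T _ _ _ H X).
Qed.

Lemma dform_tau_t a q : inner a q ->
  dform lam a (loc a q) ('D_(dd false) (loc a) q) ('D_(dd true) (loc a) q) = fe a q.
Proof.
move=> Iq; have [_ _ /(_ q Iq) cu _] := inner_rep a.
rewrite (eq_t Iq) (dformDr _ _ _ _ _ cu) /fe (dform_antisym _ _ (Xr a q) cu).
by rewrite (reebP tr cu).2 oppr0 mulr0 add0r.
Qed.

(** The exterior derivative commutes with pullback, and by the Cauchy-Riemann equation the pullback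
    of [d lam] has the energy density as its coefficient. *)
Lemma eq_area a q : inner a q -> 'D_(dd false) (fb a) q - 'D_(dd true) (fa a) q = fe a q.
Proof.
move=> Iq; have oI := @inner_open a; have [_ _ cu _] := inner_rep a.
have E := pullback_dform lam (dd false) (dd true) oI Iq cu (smooth_loc a 2%N).
exact: (etrans E (dform_tau_t Iq)).
Qed.

(** By the Cauchy-Riemann equation the tau and the t direction contribute equally, whence the factor
    2. *)
Lemma norm_dpi_inner a q : inner a q ->
  norm_sq_at lam J (w q) (dpi lam D w q) = 2 * fe a q.
Proof.
move=> Iq; have [_ _ /(_ q Iq) cu _] := inner_rep a.
apply: (etrans (norm_dpi_rep tr admissible_half (inner_rep a) (innerD Iq) Iq)).
have E : J a (loc a q) ('D_(dd true) (loc a) q) = fa a q *: Xr a q - 'D_(dd false) (loc a) q.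
  by rewrite {1}(eq_tau Iq) opprB addrC subrK.
have E2 : dform lam a (loc a q) ('D_(dd true) (loc a) q)
    (J a (loc a q) ('D_(dd true) (loc a) q)) = fe a q.
  rewrite E (dformDr _ _ _ _ _ cu) (dform_antisym _ _ (Xr a q) cu).
  rewrite (reebP tr cu).2 oppr0 mulr0 add0r (dformNr _ _ cu) -(dform_antisym _ _ _ cu).
  exact: dform_tau_t.
rewrite mulr2n mulrDl mul1r.
exact: (f_equal2 (fun s t : R => s + t) (erefl (fe a q)) E2).
Qed.

End Instanton.

(** * Uniform derivative bounds *)

Section SegmentInduction.
Context {R : realType}.

(** The continuity method: the supremum of the good initial segments is good by the closedness
    assumption, and openness lets one pass beyond it unless it is 1. *)
Lemma segment_induction (P : R -> Prop) : P 0 ->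
  (forall s, 0 <= s <= 1 -> P s -> exists2 d : R, 0 < d & forall t, `|t - s| < d -> P t) ->
  (forall s, 0 < s <= 1 -> (forall t, 0 <= t < s -> P t) -> P s) ->
  forall s, 0 <= s <= 1 -> P s.
Proof.
move=> P0 Po Pc.
pose T := [set s : R | 0 <= s <= 1 /\ forall t, 0 <= t <= s -> P t].
have T0 : T 0.
  by rewrite /T/= lexx ler01; split=> // t /andP[a b]; have -> : t = 0 by apply/le_anti; rewrite a b.
have ubT : ubound T 1 by move=> s [/andP[]].
have hs : has_sup T by split; [exists 0|exists 1].
set sg := sup T.
have sg0 : 0 <= sg by apply: sup_upper_bound => //.
have sg1 : sg <= 1 by apply: ge_sup => //; exists 0.
have below t : 0 <= t < sg -> P t.
  move=> /andP[t0 ts]; have d0 : 0 < sg - t by rewrite subr_gt0.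
  have [s [_ Ts]] := sup_adherent d0 hs.
  rewrite subKr => tls; apply: Ts; rewrite t0 ltW//.
have Psg : P sg.
  move: sg0; rewrite le_eqVlt => /orP[/eqP <-//|sgp].
  by apply: Pc => //; rewrite sgp.
have [d d0 Hd] := Po sg (introT andP (conj sg0 sg1)) Psg.
have le1 : sg = 1.
  apply/eqP; rewrite eq_le sg1 leNgt; apply/negP => sl1.
  pose s := Num.min 1 (sg + d / 2).
  have d2 : 0 < d / 2 by rewrite divr_gt0.
  have : T s.
    split; first by rewrite le_min ler01 ge_min lexx addr_ge0// ltW.
    move=> t /andP[t0]; rewrite le_min => /andP[_ ts].
    have [tl|tg] := ltP t sg; first by apply: below; rewrite t0.
    apply: Hd; rewrite ger0_norm ?subr_ge0//.
    by move: d0 ts; lra.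
  move=> /(sup_upper_bound hs); rewrite -/sg leNgt => /negP; apply.
  by rewrite lt_min sl1 ltrDl.
move=> s /andP[s0]; rewrite le_eqVlt => /orP[/eqP ->|s1]; first by rewrite -le1.
by apply: below; rewrite s0 le1.
Qed.

End SegmentInduction.

Section IteratedDerivatives.
Context {R : realType}.
Implicit Types f g : R * R -> R.

Definition itD (beta : seq bool) f : R * R -> R := foldr (fun b g => 'D_(dd b) g) f beta.

Lemma itD_ext (A : set (R * R)) beta f g x : open A -> (forall y, A y -> f y = g y) ->
  A x -> itD beta f x = itD beta g x.
Proof.
move=> oA; elim: beta f g x => [|b beta IH] f g x fg Ax /=; first exact: fg.
by apply: (D_ext_open oA (dd b) Ax) => y Ay; exact: IH.
Qed.

Lemma smooth_itD (A : set (R * R)) beta f : smooth_on A f -> smooth_on A (itD beta f).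
Proof. by elim: beta => //= b beta IH /IH; exact: smooth_derive. Qed.

Lemma mder_itD (Idx : Type) beta (f : Idx -> R * R -> R) i : mder beta f i = itD beta (f i).
Proof. by elim: beta => //= b beta IH; rewrite /der IH. Qed.

Lemma D1_sub (V : normedModType R) (A : set V) (f g : V -> R) x v :
  Ck 1 A f -> Ck 1 A g -> A x ->
  'D_v (fun y => f y - g y) x = 'D_v f x - 'D_v g x.
Proof.
move=> Cf Cg Ax; have fx := CkS_is_derive v Cf Ax.
by have [_ ->] := is_deriveB fx (CkS_is_derive v Cg Ax).
Qed.

End IteratedDerivatives.

Section GenClosure.
Context {R : realType} {m : nat} {B : set 'rV[R]_m} {Idx : Type}
  (u : Idx -> R * R -> 'rV[R]_m).

Lemma gen_cst (k : R) : gen (B := B) u (fun _ _ => k).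
Proof. by apply: (@gen_coef _ _ _ _ _ (fun=> k)) => j; exact: Ck_cst. Qed.

Lemma gen_sum (I : Type) (s : seq I) (f : I -> family) :
  (forall i, gen (B := B) u (f i)) -> gen (B := B) u (fun i y => \sum_(x <- s) f x i y).
Proof.
move=> Gf; elim: s => [|x s IH].
  rewrite (_ : (fun _ _ => _) = (fun _ _ => 0)); first exact: gen_cst.
  by apply/funext => i; apply/funext => y; rewrite big_nil.
rewrite (_ : (fun _ _ => _) = (fun i y => f x i y + \sum_(x <- s) f x i y)); last first.
  by apply/funext => i; apply/funext => y; rewrite big_cons.
exact: gen_add.
Qed.

Definition gder b (G : 'rV[R]_m -> R) : family :=
  fun i y => \sum_p ('D_(ev p) G \o u i) y * der b (cmp u p) i y.

Lemma gen_gder b G : smooth_on B G -> gen (B := B) u (gder b G).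
Proof.
move=> SG; apply: gen_sum => p; apply: gen_mul; last exact: gen_der.
exact: (gen_coef u (smooth_derive (ev p) SG)).
Qed.

End GenClosure.

(** * The elliptic system and bounds in one chart *)

Section LocalBounds.
Context {R : realType} {n : nat} {M : manifold R n.*2.+1} {lam : one_form M}
  {J : endo_field M} (tr : contact_triad lam J).
Local Notation m := n.*2.+1.
Implicit Types a : Defs.index M.
Local Notation D := (@half_cylinder R).
Context {w : R * R -> M} (inst : contact_instanton lam J D w)
  (wb : bounded_differential lam J D w).

Let oI a := @inner_open _ _ _ lam J w inst a.
Let repI a := @inner_rep _ _ _ lam J w inst a.
Let sI a := @smooth_loc _ _ _ lam J w inst a.

Section Chart.
Context {a : Defs.index M}.
Local Notation u := (@loc R n M w a).
Local Notation I := (@inner R n M w a).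
Local Notation fa := (@fa R n M lam w a).
Local Notation fb := (@fb R n M lam w a).
Local Notation fe := (@fe R n M lam J w a).

Let Xl l (x : 'rV[R]_m) : R := reeb lam a x 0 l.
Let Jkl k l (x : 'rV[R]_m) : R := J a x (ev k) 0 l.
Let lj j (x : 'rV[R]_m) : R := lam a x (ev j).
Let U l q : R := u q 0 l.

Let SX l : smooth_on (cdom a) (Xl l).
Proof. by move=> k; exact: ((Ck_rVP _ _ (@cdom_open _ _ _ a)).1 (smooth_reeb tr a k) l). Qed.
Let SJ k l : smooth_on (cdom a) (Jkl k l). Proof. exact: smooth_endo. Qed.
Let Sl j : smooth_on (cdom a) (lj j). Proof. exact: form_smooth. Qed.
Let SU l : smooth_on I (U l).
Proof. by move=> k; exact: ((Ck_rVP _ _ (@oI a)).1 (@sI a k) l). Qed.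
Let cu q : I q -> cdom a (u q). Proof. by have [_ _ H _] := @repI a; exact: H. Qed.
Let Scomp (G : 'rV[R]_m -> R) : smooth_on (cdom a) G -> smooth_on I (G \o u).
Proof. by move=> SG k; exact: (Ck_comp (@oI a) (@cdom_open _ _ _ a) cu (SG k) (@sI a k)). Qed.

Let DU v q l : I q -> 'D_v u q 0 l = 'D_v (U l) q.
Proof. by move=> Iq; rewrite derive_coord//; have [] := CkS_is_derive v (@sI a 1%N) Iq. Qed.

Let J_row v q l : J a (u q) v 0 l = \sum_k v 0 k * Jkl k l (u q).
Proof. by rewrite endo_sum summxE; apply: eq_bigr => k _; rewrite mxE. Qed.

Let Ftau l q := fa q * (Xl l \o u) q - \sum_k 'D_(dd true) (U k) q * (Jkl k l \o u) q.
Let Ft l q := fb q * (Xl l \o u) q + \sum_k 'D_(dd false) (U k) q * (Jkl k l \o u) q.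

Let Utau l q : I q -> 'D_(dd false) (U l) q = Ftau l q.
Proof.
move=> Iq; rewrite -DU// (eq_tau tr inst Iq) !mxE J_row /Ftau.
by congr (_ - _); apply: eq_bigr => k _; rewrite DU.
Qed.

Let Ut l q : I q -> 'D_(dd true) (U l) q = Ft l q.
Proof.
move=> Iq; rewrite -DU// (eq_t tr inst Iq) !mxE J_row /Ft.
by congr (_ + _); apply: eq_bigr => k _; rewrite DU.
Qed.

Let dcomp b (G : 'rV[R]_m -> R) q : smooth_on (cdom a) G -> I q ->
  'D_(dd b) (G \o u) q = \sum_p ('D_(ev p) G \o u) q * 'D_(dd b) (U p) q.
Proof.
move=> SG Iq; have Du := CkS_is_derive (dd b) (@sI a 1%N) Iq.
have [_ ->] := is_derive_comp_sum (@cdom_open _ _ _ a) (cu Iq) (SG 1%N) Du.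
by apply: eq_bigr => p _; rewrite mulrC DU.
Qed.

Let fs b q := \sum_j (lj j \o u) q * 'D_(dd b) (U j) q.

Let fsE b q : I q -> lam a (u q) ('D_(dd b) u q) = fs b q.
Proof.
move=> Iq; rewrite lam_sum; apply: eq_bigr => j _.
by rewrite mulrC; apply: (f_equal (fun t : R => _ * t)); exact: DU.
Qed.

(** Written with [-1 *] in place of a difference so as to match the constructors of [gen]. *)
Let gq l q := fs false q * (\sum_p ('D_(ev p) (Xl l) \o u) q * 'D_(dd false) (U p) q)
  + fs true q * (\sum_p ('D_(ev p) (Xl l) \o u) q * 'D_(dd true) (U p) q)
  + \sum_k ('D_(dd false) (U k) q * (\sum_p ('D_(ev p) (Jkl k l) \o u) q * 'D_(dd true) (U p) q)
     + -1 * 'D_(dd true) (U k) q * (\sum_p ('D_(ev p) (Jkl k l) \o u) q * 'D_(dd false) (U p) q)).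

(** Differentiate [eq_tau] in tau and [eq_t] in t and add. The mixed second derivatives under [J]
    cancel by symmetry, the derivatives of [fa] and [fb] cancel by [eq_closed], and only products of
    first derivatives remain. *)
Lemma lap_loc l q : I q -> lap (U l) q = gq l q.
Proof.
move=> Iq; have Sa : smooth_on I fa := smooth_lam_loc inst a (dd false).
have Sb : smooth_on I fb := smooth_lam_loc inst a (dd true).
have SdU v k : smooth_on I ('D_v (U k)) by exact: smooth_derive.
have SXu := Scomp (SX l); have SJu k := Scomp (SJ k l).
have Csum b : Ck 1 I (fun q => \sum_k 'D_(dd b) (U k) q * (Jkl k l \o u) q).
  by apply: Ck_sum (@oI a) _ => k _; apply: Ck_mul (@oI a) _ _; [exact: SdU|exact: SJu].
have Dsum b c : 'D_(dd c) (fun q => \sum_k 'D_(dd b) (U k) q * (Jkl k l \o u) q) q =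
    \sum_k 'D_(dd b) (U k) q * 'D_(dd c) (Jkl k l \o u) q
    + \sum_k (Jkl k l \o u) q * 'D_(dd c) ('D_(dd b) (U k)) q.
  rewrite (D1_sum (@oI a) _ _ _ (fun k => Ck_mul (@oI a) (SdU _ k 1%N) (SJu k 1%N)) Iq).
  by rewrite -big_split; apply: eq_bigr => k _; exact: D1_mul (SdU _ k 1%N) (SJu k 1%N) Iq.
have E1 : 'D_(dd false) ('D_(dd false) (U l)) q =
    fa q * 'D_(dd false) (Xl l \o u) q + (Xl l \o u) q * 'D_(dd false) fa q
    - (\sum_k 'D_(dd true) (U k) q * 'D_(dd false) (Jkl k l \o u) q
       + \sum_k (Jkl k l \o u) q * 'D_(dd false) ('D_(dd true) (U k)) q).
  apply: (etrans (D_ext_open (@oI a) (dd false) Iq (@Utau l))).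
  apply: (etrans (D1_sub _ (Ck_mul (@oI a) (Sa 1%N) (SXu 1%N)) (Csum true) Iq)).
  exact: (f_equal2 (fun s t : R => s - t) (D1_mul _ (Sa 1%N) (SXu 1%N) Iq) (Dsum _ _)).
have E2 : 'D_(dd true) ('D_(dd true) (U l)) q =
    fb q * 'D_(dd true) (Xl l \o u) q + (Xl l \o u) q * 'D_(dd true) fb q
    + (\sum_k 'D_(dd false) (U k) q * 'D_(dd true) (Jkl k l \o u) q
       + \sum_k (Jkl k l \o u) q * 'D_(dd true) ('D_(dd false) (U k)) q).
  apply: (etrans (D_ext_open (@oI a) (dd true) Iq (@Ut l))).
  apply: (etrans (D1_add _ (Ck_mul (@oI a) (Sb 1%N) (SXu 1%N)) (Csum false) Iq)).
  exact: (f_equal2 (fun s t : R => s + t) (D1_mul _ (Sb 1%N) (SXu 1%N) Iq) (Dsum _ _)).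
have Sch : \sum_k (Jkl k l \o u) q * 'D_(dd true) ('D_(dd false) (U k)) q =
    \sum_k (Jkl k l \o u) q * 'D_(dd false) ('D_(dd true) (U k)) q.
  apply: eq_bigr => k _; apply: (f_equal (fun t : R => (Jkl k l \o u) q * t)).
  exact: schwarz (dd true) (dd false) (@oI a) Iq (SU k 2%N).
have cl := eq_closed inst Iq.
have G : gq l q = fa q * 'D_(dd false) (Xl l \o u) q + fb q * 'D_(dd true) (Xl l \o u) q
    + (\sum_k 'D_(dd false) (U k) q * 'D_(dd true) (Jkl k l \o u) q
       - \sum_k 'D_(dd true) (U k) q * 'D_(dd false) (Jkl k l \o u) q).
  have X1 b : fs b q * (\sum_p ('D_(ev p) (Xl l) \o u) q * 'D_(dd b) (U p) q) =
      lam a (u q) ('D_(dd b) u q) * 'D_(dd b) (Xl l \o u) q.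
    exact: (f_equal2 (fun s t : R => s * t) (esym (fsE b Iq)) (esym (dcomp b (SX l) Iq))).
  apply: (f_equal2 (fun s t : R => s + t)
    (f_equal2 (fun s t : R => s + t) (X1 false) (X1 true))).
  rewrite -sumrB; apply: eq_bigr => k _.
  have Tk (a1 b1 s t s' t' : R) : s = s' -> t = t' -> a1 * s + -1 * b1 * t = a1 * s' - b1 * t'.
    by move=> -> ->; rewrite mulN1r mulNr.
  exact: (Tk _ _ _ _ _ _ (esym (dcomp true (SJ k l) Iq)) (esym (dcomp false (SJ k l) Iq))).
have T (x1 x2 a1 a2 b1 b2 X Ta Tb s1 s2 t1 t2 g : R) :
    x1 = a1 * a2 + X * Ta - (s1 + t1) -> x2 = b1 * b2 + X * Tb + (s2 + t2) -> t2 = t1 ->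
    Ta + Tb = 0 -> g = a1 * a2 + b1 * b2 + (s2 - s1) -> x1 + x2 = g.
  move=> -> -> -> H ->; transitivity (a1 * a2 + b1 * b2 + (s2 - s1) + X * (Ta + Tb)).
    by ring.
  by rewrite H mulr0 addr0.
exact: (T _ _ _ _ _ _ _ _ _ _ _ _ _ _ E1 E2 Sch cl G).
Qed.

(** [bounded_differential] measures in the triad metric; coercivity over [K] turns it into a bound
    in coordinates. *)
Lemma du_bound (K : set 'rV[R]_m) : compact K -> K `<=` cdom a ->
  exists2 L : R, 0 <= L & forall q, I q -> K (u q) -> forall b, `|'D_(dd b) u q| <= L.
Proof.
move=> cK KA; have [c c0 Hc] := hform_coercive tr cK KA; have [C HC] := wb.
exists (1 + C ^+ 2 / c); first by rewrite addr_ge0// divr_ge0 ?sqr_ge0// ltW.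
move=> q Iq Kq b; have Dq : D q by case: Iq => /ltW.
have := HC q Dq; rewrite (norm_dmap_rep tr admissible_half (@repI a) Dq Iq).
set h0 := hform _ _ _ _; set h1 := hform _ _ _ _ => Hs.
have h00 : 0 <= h0 by exact: (hform_ge0 tr _ (cu Iq)).
have h10 : 0 <= h1 by exact: (hform_ge0 tr _ (cu Iq)).
have hC : h0 + h1 <= C ^+ 2.
  rewrite -(sqr_sqrtr (addr_ge0 h00 h10)) ler_pXn2r// nnegrE ?sqrtr_ge0//.
  exact: le_trans (sqrtr_ge0 _) Hs.
have T (s t : R) : 0 <= s -> 0 <= t -> s <= s + t /\ t <= s + t by lra.
have [h0s h1s] := T _ _ h00 h10.
have : c * `|'D_(dd b) u q| ^+ 2 <= C ^+ 2.
  apply: (le_trans (Hc _ _ Kq)); apply: le_trans hC.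
  by case: b; [exact: h1s|exact: h0s].
rewrite mulrC -ler_pdivlMr// => H.
rewrite (@le_trans _ _ (1 + `|'D_(dd b) u q| ^+ 2))//; last by rewrite lerD2l.
move: `|_| => t; have := sqr_ge0 (t - 1); have := sqr_ge0 t; nra.
Qed.

Section Family.
Context {K : set 'rV[R]_m} {r : R} (cK : compact K) (KA : K `<=` cdom a) (r0 : 0 < r).

(** All centres whose [r]-ball is mapped into the compact part [K] of the chart; the bootstrap is
    uniform over them, however large tau is. *)
Let Idx := {x : R * R | forall y : R * R, `|y - x| < r -> I y /\ K (u y)}.
Let c (i : Idx) : R * R := sval i.
Let uf (i : Idx) : R * R -> 'rV[R]_m := u.

Let family_bounds (f : Idx -> R * R -> R) : gen (B := cdom a) uf f ->
  forall beta, exists C, forall i, `|mder beta f i (c i)| <= C.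
Proof.
have inI i y : bball c r i y -> I y /\ K (u y) by exact: (svalP i).
apply: (gen_bounds (@cdom_open _ _ _ a) cK KA r0).
- by move=> i k; apply: Ck_sub (@sI a k) => y /inI [].
- by move=> i y /inI [].
- move=> l; exists (fun i => gq l); last by move=> i y /inI[Iy _]; exact: lap_loc.
  have Gd b p : gen (B := cdom a) uf (fun i q => 'D_(dd b) (U p) q) by exact: (gen_der uf b p).
  have Gs b : gen (B := cdom a) uf (fun i q => fs b q).
    by apply: gen_sum => j; apply: gen_mul; [exact: gen_coef|exact: Gd].
  have Gg b (G : 'rV[R]_m -> R) : smooth_on (cdom a) G ->
      gen (B := cdom a) uf (fun i q => \sum_p ('D_(ev p) G \o u) q * 'D_(dd b) (U p) q).
    exact: gen_gder.
  apply: gen_add; first by apply: gen_add; apply: gen_mul => //; exact: Gg.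
  apply: gen_sum => k; apply: gen_add; first by apply: gen_mul => //; exact: Gg.
  by apply: gen_mul; [apply: gen_mul => //; exact: gen_cst|exact: Gg].
have [L L0 HL] := du_bound cK KA.
exists L => i y b l /inI[Iy Ky]; rewrite (le_trans _ (HL y Iy Ky b))//.
by rewrite /der /cmp -[X in `|X|]DU// coord_le_norm.
Qed.

Lemma loc_bounds l beta : exists C : R, forall x : R * R,
  (forall y : R * R, `|y - x| < r -> I y /\ K (u y)) -> `|itD beta (U l) x| <= C.
Proof.
have [|C HC] := @family_bounds (fun _ => U l) _ beta.
  by apply: (gen_coef uf (G := fun x : 'rV[R]_m => x 0 l)) => k; apply: Ck_coord; exact: (@cdom_open _ _ _ a).
by exists C => x Hx; have := HC (exist _ x Hx); rewrite mder_itD.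
Qed.

Lemma energy_bounds beta : exists C : R, forall x : R * R,
  (forall y : R * R, `|y - x| < r -> I y /\ K (u y)) -> `|itD beta fe x| <= C.
Proof.
pose g q := \sum_i \sum_j 'D_(dd false) (U i) q * 'D_(dd false) (U j) q *
  \sum_l (Jkl j l \o u) q * ((fun x => dform lam a x (ev i) (ev l)) \o u) q.
have Gg : gen (B := cdom a) uf (fun _ => g).
  apply: gen_sum => i; apply: gen_sum => j; apply: gen_mul.
    by apply: gen_mul; [exact: (gen_der uf false i)|exact: (gen_der uf false j)].
  apply: gen_sum => l; apply: gen_mul; first exact: gen_coef.
  exact: (gen_coef uf (smooth_dform lam a i l)).
have [C HC] := family_bounds Gg beta.
exists C => x Hx; have := HC (exist _ x Hx); rewrite mder_itD.
have Ix : I x by apply: (Hx x _).1; rewrite subrr normr0.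
rewrite (_ : itD beta g _ = itD beta fe x)//; apply/esym.
apply: (itD_ext beta (@oI a) _ Ix) => y Iy; rewrite /fe dformJ_sum; last exact: cu.
apply: eq_bigr => i _; apply: eq_bigr => j _.
have T (p p' s t z : R) : p = s -> p' = t -> p * p' * z = s * t * z by move=> -> ->.
exact: (T _ _ _ _ _ (DU _ _ Iy) (DU _ _ Iy)).
Qed.

End Family.
End Chart.
End LocalBounds.

Section PlaneCalculus.
Context {R : realType}.

Lemma derive_plane (A : set (R * R)) (f : R * R -> R) x v : open A -> A x -> Ck 1 A f ->
  'D_v f x = cc false v * 'D_(dd false) f x + cc true v * 'D_(dd true) f x.
Proof.
move=> oA Ax Cf.
have D u : derivable f x u by have [] := CkS_is_derive u Cf Ax.
have E : 'D_(cc false v *: dd false + cc true v *: dd true) f x =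
    'D_(cc false v *: dd false) f x + 'D_(cc true v *: dd true) f x.
  exact: derive_add_dir oA Ax Cf.
rewrite -plane_sum_dd in E; apply: (etrans E).
exact: (f_equal2 (fun s t : R => s + t) (derive_dirZ _ (D _)) (derive_dirZ _ (D _))).
Qed.

Lemma derive_plane_le (A : set (R * R)) (f : R * R -> R) x v (L : R) :
  open A -> A x -> Ck 1 A f -> (forall b, `|'D_(dd b) f x| <= L) ->
  `|'D_v f x| <= 2 * (`|v| * L).
Proof.
move=> oA Ax Cf HL.
have T (a b s t n : R) : `|a| <= n -> `|b| <= n -> `|s| <= L -> `|t| <= L ->
    `|a * s + b * t| <= 2 * (n * L).
  move=> an bn sL tL; rewrite (le_trans (ler_normD _ _))// !normrM.
  rewrite mulr2n mulrDl mul1r.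
  by apply: lerD; apply: ler_pM.
have /pair_norm_leP H := lexx `|v|.
have E := derive_plane v oA Ax Cf.
have := T _ _ _ _ _ (H false) (H true) (HL false) (HL true).
by move=> /(le_trans _); apply; rewrite le_eqVlt E eqxx.
Qed.

Lemma path_bound m (A : set (R * R)) (f : R * R -> 'rV[R]_m) x v (L s : R) :
  open A -> Ck 1 A f -> 0 <= L -> 0 <= s ->
  (forall t, 0 <= t <= s -> A (x + t *: v) /\ forall b, `|'D_(dd b) f (x + t *: v)| <= L) ->
  `|f (x + s *: v) - f x| <= s * (2 * (`|v| * L)).
Proof.
move=> oA Cf L0 s0 H; have nn : 0 <= s * (2 * (`|v| * L)) by rewrite !mulr_ge0.
apply: rV_norm_le => // j.
have Cj : Ck 1 A (fun y => f y 0 j) by exact: ((Ck_rVP _ _ oA).1 Cf j).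
have Dj y u : A y -> is_derive y u (fun y => f y 0 j) ('D_u (fun y => f y 0 j) y).
  by move=> Ay; exact: CkS_is_derive Cj Ay.
have [t ts|t ts E] := mvt_line (f := fun y => f y 0 j) (x := x) (v := v) s0.
  by have [] := Dj (x + t *: v) v (H t ts).1.
rewrite !mxE; apply: (@le_trans _ _ `|s * 'D_v (fun y => f y 0 j) (x + t *: v)|).
  by rewrite le_eqVlt -E eqxx.
rewrite normrM (ger0_norm s0) ler_wpM2l//.
have [At HL] := H t ts; apply: (derive_plane_le v oA At Cj) => b.
apply: le_trans (HL b).
have <- : ('D_(dd b) f (x + t *: v)) 0 j = 'D_(dd b) (fun y => f y 0 j) (x + t *: v).
  by rewrite derive_coord//; have [] := CkS_is_derive (dd b) Cf At.
exact: coord_le_norm.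
Qed.

End PlaneCalculus.

Section CompactBound.
Context {R : realType}.

(** The covering property of compact sets, used with the filter at plus infinity, replaces the
    maximum over a finite subcover. *)
Lemma compact_bound (T : topologicalType) (K : set T) (P : T -> R -> Prop) : compact K ->
  (forall p C C', C <= C' -> P p C -> P p C') ->
  (forall p, K p -> exists C, \forall q \near p, P q C) -> exists C, forall p, K p -> P p C.
Proof.
move=> cK Pm PC; have /(_ R (pinfty_nbhs R) (fun C p => P p C) _) H :=
  (compact_near_coveringP K).1 cK.
have [|C [Cr HC]] := H; last first.
  by exists (C + 1) => p; apply: HC; rewrite ltrDl.
move=> p Kp; have [C HC] := PC p Kp.
exists ([set q | P q C], [set C' | C <= C']) => [|[q C'] [/= Pq CC']]; last exact: Pm Pq.
by split=> //=; apply: nbhs_pinfty_ge; exact: num_real.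
Qed.

Lemma rV_ball_compact m (x0 : 'rV[R]_m) (r : R) : compact [set x | `|x - x0| <= r].
Proof.
have [r0|r0] := ltP r 0.
  rewrite (_ : [set _ | _] = set0); first exact: compact0.
  by apply/seteqP; split=> // x /= /(le_trans (normr_ge0 _)); rewrite leNgt r0.
rewrite (_ : [set x | `|x - x0| <= r] = [set x : 'rV[R]_m | forall j, `[x0 0 j - r, x0 0 j + r]%classic (x 0 j)]).
  exact: (rV_compact (fun j => @segment_compact _ _ _)).
apply/seteqP; split=> x /= H.
  by move=> j; have := coord_le_norm (x - x0) j; rewrite !mxE in_itv/= -ler_distl => /le_trans; apply.
by apply: rV_norm_le => // j; have := H j; rewrite !mxE in_itv/= -ler_distl.
Qed.

End CompactBound.

(** * Bounds independent of the chart and of tau *)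

Section UniformBounds.
Context {R : realType} {n : nat} {M : manifold R n.*2.+1} {lam : one_form M}
  {J : endo_field M} (tr : contact_triad lam J) (compactM : compact [set: M]).
Local Notation m := n.*2.+1.
Implicit Types a : Defs.index M.
Local Notation D := (@half_cylinder R).
Context {w : R * R -> M} (inst : contact_instanton lam J D w)
  (wb : bounded_differential lam J D w).

Local Notation inner := (@inner R n M w).
Local Notation loc := (@loc R n M w).
Local Notation fe := (@fe R n M lam J w).

Lemma inst_continuous q : 0 < q.1 -> {for q, continuous w}.
Proof.
move=> q0; have [sw _ _] := inst; have Dq : D q by exact: ltW.
have [U [F [[oU SF FU wF] Uq]]] := lrep_at sw Dq (chart_at_dom (w q)).
have [aq E] := wF q Dq Uq; set a := chart_at _ in FU wF aq E.
have cq : {for q, continuous (Defs.param a \o F)}.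
  apply: continuous_comp; first exact: Ck_cont (SF 0%N) Uq.
  by apply: param_continuous; exact: FU.
rewrite /prop_for/continuous_at -[w q](coordK aq) E.
have -> : Defs.param a (F q) = (Defs.param a \o F) q by [].
apply: cvg_trans cq; apply: near_eq_cvg.
have oP : nbhs q [set y : R * R | 0 < y.1].
  apply/nbhs_distP; exists q.1 => // y /pair_norm_ltP/(_ false).
  rewrite ccB /= distrC => /(le_lt_trans (ler_norm _)); rewrite ltrBlDr ltrDl; exact.
apply: filterS (filterI (open_nbhs_nbhs (conj oU Uq)) oP) => y [Uy /= y0].
by have [ay <-] := wF y (ltW y0) Uy; rewrite coordK.
Qed.

Lemma chart_ball a (x0 : 'rV[R]_m) : cdom a x0 -> exists2 rho : R, 0 < rho &
  [set x | `|x - x0| <= 2 * rho] `<=` cdom a.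
Proof.
move=> Ax; have [d d0 H] := open_distP (@cdom_open _ _ _ a) Ax.
exists (d / 4); first by rewrite divr_gt0.
by move=> x /= xd; apply: H; apply: (le_lt_trans xd); move: d0; lra.
Qed.

(** While the image of the segment from [x] to [y] stays in the compact ball of radius [2 * rho],
    its speed is controlled by [L]; in the [r]-ball it therefore moves by less than [rho] and cannot
    reach the boundary. The radius [r] does not depend on [x]. *)
Lemma staying a (x0 : 'rV[R]_m) (rho : R) : 0 < rho ->
  [set x | `|x - x0| <= 2 * rho] `<=` cdom a ->
  exists r : R, [/\ 0 < r, r <= 1 & forall x : R * R, r <= x.1 -> Defs.dom a (w x) ->
    `|loc a x - x0| < rho -> forall y : R * R, `|y - x| < r ->
    inner a y /\ [set z | `|z - x0| <= 2 * rho] (loc a y)].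
Proof.
move=> rho0 KA; set K := [set z | _] in KA *.
have cK : compact K by exact: rV_ball_compact.
have [L L0 HL] := du_bound tr inst wb cK KA.
have L1 : 0 < 2 * L + 1 by move: L0; lra.
(* The displacement is at most [2 * (r * L)]; the summand 1 makes it strictly smaller than [rho] and
   the denominator nonzero. The bound by 1 keeps the ball in positive tau as soon as [1 <= x.1]. *)
exists (Num.min 1 (rho / (2 * L + 1))); split.
- by rewrite lt_min ltr01 divr_gt0.
- by rewrite ge_min lexx.
set r := Num.min _ _ => x rx ax xr y yx.
have r0 : 0 < r by rewrite lt_min ltr01 divr_gt0.
have rL : 2 * (r * L) < rho.
  have rr : r <= rho / (2 * L + 1) by rewrite ge_min lexx orbT.
  have : r * (2 * L + 1) <= rho by rewrite -ler_pdivlMr.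
  by move: r0; move: (r) => s; nra.
pose v := y - x.
pose P s := inner a (x + s *: v) /\ `|loc a (x + s *: v) - x0| < 2 * rho.
have oI := @inner_open _ _ _ lam J w inst a.
have xs0 s : 0 <= s <= 1 -> 0 < (x + s *: v).1.
  move=> /andP[s0 s1]; have /pair_norm_ltP/(_ false) := yx; rewrite -/v => /= v1.
  have := v1; rewrite ltr_norml => /andP[v2 _].
  rewrite /= /GRing.scale/=; move: s0 s1 v2 rx; move: v.1 => t; nra.
suff: P 1.
  by rewrite /P scale1r [x + v]addrC subrK => -[Iy /ltW].
have P0 : P 0.
  rewrite /P scale0r addr0; split; last by move: rho0 xr; lra.
  by split=> //; exact: lt_le_trans rx.
apply: (@segment_induction _ P P0); last by rewrite ler01 lexx.
- move=> s s01 [Is Ps].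
  have oP : open (inner a `&` (loc a) @^-1` [set z | `|z - x0| < 2 * rho]).
    apply: open_preimage_in => //; first exact: open_dist_lt.
    by move=> z; exact: Ck_cont (smooth_loc inst a 0%N).
  have [d d0 Hd] := open_distP oP (conj Is Ps).
  exists (d / (1 + `|v|)); first by rewrite divr_gt0// ltr_pwDl.
  move=> t ts; apply: Hd; rewrite opprD addrACA subrr add0r -scalerBl normrZ.
  have v1 : 0 < 1 + `|v| by rewrite ltr_pwDl.
  move: ts; rewrite ltr_pdivlMr// => ts; apply: le_lt_trans ts.
  by rewrite ler_wpM2l// lerDr.
- move=> s /andP[s0 s1] Pt.
  have s01 : 0 <= s <= 1 by rewrite ltW.
  (* At the limit parameter [w] might leave the chart. But the image of [K] is compact, hence closed
     in the Hausdorff space [M], so the limit point still lies in it. *)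
  have cl : closed (Defs.param a @` K).
    apply: compact_closed; first exact: manifold_hausdorff.
    apply: continuous_compact => //; apply: continuous_in_subspaceT => z.
    by rewrite inE => Kz; apply: param_continuous; exact: KA.
  have cwl : {for s, continuous (fun t : R => w (x + t *: v))}.
    apply: continuous_comp; last by apply: inst_continuous; exact: xs0.
    by apply: continuousD; [exact: cvg_cst|apply: continuousZr_tmp; exact: cvg_id].
  have [z Kz wz] : (Defs.param a @` K) (w (x + s *: v)).
    apply: cl => B /cwl /nbhs_distP[d d0 Hd].
    pose t := Num.max 0 (s - d / 2).
    have tl : 0 <= t < s.
      by rewrite le_max lexx/= gt_max s0 ltrBlDr ltrDl divr_gt0.
    exists (w (x + t *: v)); split.
      have [It /ltW Kt] := Pt t tl.
      by exists (loc a (x + t *: v)) => //; rewrite /loc coordK//; case: It.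
    apply: Hd; rewrite distrC ger0_norm ?subr_ge0; last by case/andP: tl => _ /ltW.
    have : s - d / 2 <= t by rewrite le_max lexx orbT.
    by move: d0; lra.
  have Ks : inner a (x + s *: v) /\ K (loc a (x + s *: v)).
    have [p ap pz] := KA z Kz.
    have ws : w (x + s *: v) = p by rewrite -wz -pz coordK.
    split; first by split; [exact: xs0|rewrite ws].
    by rewrite /loc ws pz.
  split; first exact: Ks.1.
  have H t : 0 <= t <= s -> inner a (x + t *: v) /\
      forall b, `|'D_(dd b) (loc a) (x + t *: v)| <= L.
    move=> /andP[t0]; rewrite le_eqVlt => /orP[/eqP ->|ts].
      by split; [exact: Ks.1|move=> b; exact: (HL _ Ks.1 Ks.2)].
    have [It Kt] := Pt t (introT andP (conj t0 ts)).
    by split=> // b; apply: (HL _ It); exact: ltW.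
  have PB := path_bound oI (smooth_loc inst a 1%N) L0 (ltW s0) H.
  have T (p q c : 'rV[R]_m) : p - c = (p - q) + (q - c) by rewrite addrA subrK.
  rewrite (T _ (loc a x)) (le_lt_trans (ler_normD _ _))//.
  have : s * (2 * (`|v| * L)) <= 2 * (r * L).
    rewrite -[leRHS]mul1r; apply: ler_pM => //; first by exact: ltW.
      by rewrite !mulr_ge0.
    by rewrite ler_wpM2l// ler_wpM2r// ltW.
  by move: PB xr rL; move: `|_ - loc a x| `|_ - x0| (s * _) => p1 p2 p3; lra.
Qed.

(** [V] is a neighbourhood in [M] and not in the cylinder: whenever [w x] lies in [V], a whole ball
    of fixed radius around [x] stays in the chart, so the constants do not depend on [x]. *)
Lemma loc_unif a (p : M) : Defs.dom a p -> exists V : set M, [/\ nbhs p V,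
   forall x, 1 <= x.1 -> V (w x) -> inner a x &
   forall beta, exists C : R, forall x, 1 <= x.1 -> V (w x) ->
     (forall l, `|itD beta (fun y => loc a y 0 l) x| <= C) /\ `|itD beta (fe a) x| <= C].
Proof.
move=> ap; set x0 := Defs.coord a p; have cx0 : cdom a x0 by exists p.
have [rho rho0 KA] := chart_ball cx0.
have [r [r0 r1 Hr]] := staying rho0 KA.
exists [set q | Defs.dom a q /\ `|Defs.coord a q - x0| < rho]; split.
- apply: filterI; first by apply: open_nbhs_nbhs; split=> //; exact: dom_open.
  have cp := Defs.coord_continuous ap.
  by apply: (cp [set z | `|z - x0| < rho]); apply: open_nbhs_nbhs; split; [exact: open_dist_lt|rewrite /= subrr normr0].
- by move=> x x1 [ax _]; split=> //; exact: lt_le_trans x1.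
move=> beta; have cK := @rV_ball_compact _ _ x0 (2 * rho).
have B l := loc_bounds tr inst wb cK KA r0 l beta.
have [C HC] := choice B.
have [E HE] := energy_bounds tr inst wb cK KA r0 beta.
exists (\sum_l `|C l| + `|E|) => x x1 [ax xr].
have S := Hr x (le_trans r1 x1) ax xr; split.
  move=> l; rewrite (le_trans (HC l x S))// (le_trans (ler_norm _))//.
  by rewrite (bigD1 l)//= -addrA lerDl addr_ge0// sumr_ge0.
by rewrite (le_trans (HE x S))// (le_trans (ler_norm _))// lerDr sumr_ge0.
Qed.

(** On the overlap of two charts the functions [fe] agree, being half of the same squared norm; so
    the local bounds combine over the compact [M]. *)
Lemma energy_unif beta : exists C : R, forall x a, 1 <= x.1 -> inner a x ->
  `|itD beta (fe a) x| <= C.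
Proof.
pose P (p : M) (C : R) := forall x a, 1 <= x.1 -> inner a x -> w x = p ->
   `|itD beta (fe a) x| <= C.
have [||C HC] := @compact_bound _ _ _ P compactM.
- by move=> p C C' CC' HP x a x1 Ix wx; exact: le_trans (HP x a x1 Ix wx) CC'.
- move=> p _; have [V [pV VI /(_ beta)[C HC]]] := loc_unif (chart_at_dom p).
  exists C; apply: filterS pV => q Vq x a x1 Ix wx; rewrite -wx in Vq.
  have [_] := HC x x1 Vq; have Ix' := VI x x1 Vq; apply: le_trans.
  rewrite le_eqVlt; apply/orP; left; apply/eqP; apply: (f_equal (fun t : R => `|t|)).
  apply: (@itD_ext _ (inner a `&` inner (chart_at p))); last by [].
    by apply: openI; exact: (inner_open inst).
  move=> y [Iy Iy'].
  have : 2 * fe a y = 2 * fe (chart_at p) y.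
    exact: (etrans (esym (norm_dpi_inner tr inst Iy)) (norm_dpi_inner tr inst Iy')).
  by apply: mulfI; rewrite pnatr_eq0.
by exists C => x a x1 Ix; exact: (HC (w x) I x a x1 Ix).
Qed.

End UniformBounds.

(** * Circle averages *)

Section UnitIntegral.
Context {R : realType}.
Local Notation mu := (@lebesgue_measure R).
Implicit Types f g : R -> R.

Definition I01 f : R := \int[mu]_(t in `[0, 1[) f t.

Lemma I01_integrable f : continuous f -> mu.-integrable `[0%R, 1%R[ (EFin \o f).
Proof.
move=> cf; have /integrableS : mu.-integrable `[0%R, 1%R] (EFin \o f).
  apply: continuous_compact_integrable; first exact: segment_compact.
  exact: continuous_subspaceT.
by apply => //; apply: subset_itvl; rewrite bnd_simp.
Qed.

Lemma I01_le f g : continuous f -> continuous g ->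
  (forall t, 0 <= t <= 1 -> f t <= g t) -> I01 f <= I01 g.
Proof.
move=> cf cg fg; apply: le_Rintegral => //; try exact: I01_integrable.
by move=> t /=; rewrite in_itv/= => /andP[t0 /ltW t1]; apply: fg; rewrite t0.
Qed.

Lemma I01B f g : continuous f -> continuous g ->
  I01 (fun t => f t - g t) = I01 f - I01 g.
Proof. by move=> cf cg; apply: RintegralB => //; exact: I01_integrable. Qed.

Lemma I01Z (k : R) f : continuous f -> I01 (fun t => k * f t) = k * I01 f.
Proof. by move=> cf; apply: RintegralZl => //; exact: I01_integrable. Qed.

Lemma I01_cst (c : R) : I01 (fun=> c) = c.
Proof.
rewrite /I01 Rintegral_cst//= lebesgue_measure_itv/= lte_fin ltr01.
by rewrite -EFinB subr0 mulr1.
Qed.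

Lemma eq_I01 f g : (forall t, 0 <= t < 1 -> f t = g t) -> I01 f = I01 g.
Proof.
move=> fg; apply: eq_Rintegral => t; rewrite inE/= in_itv/=; exact: fg.
Qed.

Lemma I01_norm_le f (c : R) : continuous f -> (forall t, 0 <= t <= 1 -> `|f t| <= c) ->
  `|I01 f| <= c.
Proof.
move=> cf fc; have cc (k : R) : continuous (fun _ : R => k) by move=> x; exact: cvg_cst.
rewrite ler_norml; apply/andP; split.
  rewrite -(I01_cst (- c)); apply: I01_le => // t /fc; by rewrite ler_norml => /andP[].
by rewrite -[leRHS](I01_cst c); apply: I01_le => // t /fc; rewrite ler_norml => /andP[].
Qed.

Lemma I01_FTC (F f : R -> R) : (forall t : R, is_derive t (1 : R) F (f t)) -> continuous f ->
  I01 f = F 1 - F 0.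
Proof.
move=> DF cf; rewrite /I01 Rintegral_itv_bndo_bndc; last exact: I01_integrable.
have cF : continuous F.
  by move=> t; apply: differentiable_continuous; apply/derivable1_diffP; have [] := DF t.
rewrite /Rintegral (@continuous_FTC2 _ f F 0 1) ?ltr01//.
- exact: continuous_subspaceT.
- split; first by move=> t _; have [] := DF t.
    by apply: cvg_at_right_filter; exact: cF.
  by apply: cvg_at_left_filter; exact: cF.
- by move=> t _; rewrite derive1E; have [_] := DF t.
Qed.

End UnitIntegral.

(** * Integrals over circles *)

Section Slices.
Context {R : realType}.
Implicit Types f g : R * R -> R.

Lemma slice_near f (tau : R) (e : R) : (forall t, {for (tau, t), continuous f}) -> 0 < e ->
  exists2 d : R, 0 < d & forall s, `|s - tau| < d -> forall t, 0 <= t <= 1 ->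
    `|f (s, t) - f (tau, t)| < e.
Proof.
move=> cf e0; have cI : compact `[0%R, 1%R : R]%classic by exact: segment_compact.
have /(_ R (nbhs tau) (fun s t => `|f (s, t) - f (tau, t)| < e) _) H :=
  (compact_near_coveringP _).1 cI.
have [t /= _|d d0 Hd] := (nbhs_distP _ _).1 (H _); last first.
  by exists d => // s sd t t01; apply: (Hd s sd); rewrite /= in_itv.
have e2 : 0 < e / 2 by rewrite divr_gt0.
have [d d0 Hd] := (continuous_distP _ _).1 (cf t) _ e2.
exists ([set t' : R | `|t' - t| < d], [set s : R | `|s - tau| < d]).
  by split; apply/nbhs_distP; exists d.
move=> [t' s] [/= t'd sd].
have H1 : `|f (s, t') - f (tau, t)| < e / 2.
  by apply: Hd; apply/pair_norm_ltP => -[].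
have H2 : `|f (tau, t') - f (tau, t)| < e / 2.
  by apply: Hd; apply/pair_norm_ltP => -[] //=; rewrite subrr normr0.
have -> : f (s, t') - f (tau, t') = (f (s, t') - f (tau, t)) - (f (tau, t') - f (tau, t)).
  by rewrite opprB addrA subrK.
rewrite (le_lt_trans (ler_normB _ _))//; move: H1 H2; lra.
Qed.

Lemma slice_continuous f (tau : R) : (forall t, {for (tau, t), continuous f}) ->
  continuous (fun t => f (tau, t)).
Proof.
move=> cf t; apply/continuous_distP => e e0.
have [d d0 Hd] := (continuous_distP _ _).1 (cf t) _ e0.
exists d => // y yd; apply: Hd; apply/pair_norm_ltP => -[] //=.
by rewrite subrr normr0.
Qed.

Lemma I01_slice_continuous f : continuous f -> continuous (fun tau => I01 (fun t => f (tau, t))).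
Proof.
move=> cf tau; apply/continuous_distP => e e0.
have e2 : 0 < e / 2 by rewrite divr_gt0.
have [d d0 Hd] := slice_near (fun t => cf (tau, t)) e2.
exists d => // s sd.
have cs s' : continuous (fun t => f (s', t)) by apply: slice_continuous => t; exact: cf.
rewrite -I01B//; apply: (@le_lt_trans _ _ (e / 2)); last by move: e0; lra.
apply: I01_norm_le => [t|t t01]; last by apply/ltW/Hd.
by apply: continuousB; exact: cs.
Qed.

(** By the mean value theorem the difference quotients are values of the tau-derivative nearby, and
    [slice_near] makes them uniformly close over the compact circle. *)
Lemma I01_slice_derive f (tau : R) : continuous f ->
  (forall q : R * R, 0 < q.1 -> derivable f q (dd false)) ->
  (forall t, {for (tau, t), continuous ('D_(dd false) f)}) -> 0 < tau ->
  is_derive tau 1 (fun s => I01 (fun t => f (s, t))) (I01 (fun t => 'D_(dd false) f (tau, t))).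
Proof.
move=> cf Df cD tau0; apply/is_derive_distP => e e0.
have e2 : 0 < e / 2 by rewrite divr_gt0.
have [d d0 Hd] := slice_near cD e2.
exists (Num.min d tau); first by rewrite lt_min d0.
move=> h; rewrite lt_min => /andP[hd ht] h0.
have cs s' : continuous (fun t => f (s', t)) by apply: slice_continuous => t; exact: cf.
have cDs : continuous (fun t => 'D_(dd false) f (tau, t)) by exact: (slice_continuous cD).
have cB s' : continuous (fun t => f (s', t) - f (tau, t)).
  by move=> t; apply: continuousB; exact: cs.
rewrite [h^-1 *: _](_ : _ = I01 (fun t => h^-1 * (f (tau + h *: 1, t) - f (tau, t)))).
  rewrite -I01B//; last by move=> t; apply: cvgM; [exact: cvg_cst|exact: cB].
  have {}e2 : e / 2 < e by move: e0; lra.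
  apply: le_lt_trans e2; apply: I01_norm_le => [t|t t01].
    by apply: cvgB; [apply: cvgM; [exact: cvg_cst|exact: cB]|exact: cDs].
  have pt (k : R) : (tau, t) + k *: dd false = (tau + k, t) :> R * R.
    by apply: injective_projections; rewrite /= /GRing.scale/= ?mulr1 ?mulr0 ?addr0.
  have sh (s : R) : 0 <= s <= 1 -> `|s * h| <= `|h|.
    move=> /andP[s0 s1]; rewrite normrM (ger0_norm s0) -[leRHS]mul1r ler_wpM2r//.
  have [s s01|s s01 E] := mvt_lineh (f := f) (x := (tau, t)) (v := dd false) (h := h).
    apply: Df; rewrite pt/=.
    have := le_lt_trans (sh s s01) ht; rewrite ltr_norml => /andP[+ _]; lra.
  rewrite !pt in E; rewrite [_ + h *: _](_ : _ = tau + h); last by rewrite /GRing.scale/= mulr1.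
  rewrite E mulrA mulVf// mul1r; apply: ltW; apply: Hd => //.
  by rewrite addrAC subrr add0r; exact: le_lt_trans (sh s s01) hd.
by rewrite I01Z// I01B.
Qed.

End Slices.

Section Strip.
Context {R : realType}.
Local Notation mu := (@lebesgue_measure R).

(** The preimage of an open ray is open, hence a countable union of squares with rational centres
    and radii [1 / (k + 1)]; squares are measurable rectangles of the product. *)
Lemma plane_continuous_measurable (f : R * R -> R) : continuous f ->
  measurable_fun setT (f : (measurableTypeR R) * (measurableTypeR R) -> R).
Proof.
move=> cf; apply: (measurability (@RGenOInfty.G R)); first exact: RGenOInfty.measurableE.
move=> _ [_ [x ->] <-]; rewrite setTI.
pose S (i : rat * rat * nat) : set (R * R) :=
  [set y : R * R | `|y - (ratr i.1.1, ratr i.1.2)| < i.2.+1%:R^-1].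
pose F i := if pselect (S i `<=` f @^-1` `]x, +oo[) then S i else set0.
rewrite (_ : f @^-1` _ = \bigcup_i F i); last first.
  apply/seteqP; split=> [z fz|z [i _]]; last by rewrite /F; case: pselect => // H /H.
  have oO : open (f @^-1` `]x, +oo[%classic).
    by apply: open_comp; [move=> y _; exact: cf|exact: interval_open].
  have [d d0 Hd] := open_distP oO fz.
  have d2 : 0 < d / 2 by rewrite divr_gt0.
  have [k Hk] : exists k : nat, k.+1%:R^-1 < d / 2.
    by have [k] := ltr_add_invr d2; rewrite add0r; exists k.
  set e : R := k.+1%:R^-1 in Hk.
  have e0 : 0 < e by rewrite invr_gt0.
  have lt1 (y : R) : y - e < y + e by lra.
  have [p] := rat_in_itvoo (lt1 z.1); have [q] := rat_in_itvoo (lt1 z.2).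
  rewrite !in_itv/= -!ltr_distl => zq zp.
  have Sz : S (p, q, k) z.
    by apply/pair_norm_ltP => -[]; rewrite ccB/= distrC.
  exists (p, q, k) => //; rewrite /F; case: pselect => // -[]; move=> y Sy.
  apply: Hd; rewrite (_ : y - z = (y - (ratr p, ratr q)) + ((ratr p, ratr q) - z)); last by rewrite addrA subrK.
  rewrite (le_lt_trans (ler_normD _ _))//.
  have := Sz; rewrite /S/= distrC -/e; have := Sy; rewrite /S/= -/e.
  move: Hk; move: `|y - _| `|_ - z| => a b; lra.
apply: countable_bigcupT_measurable; first exact: countableP.
move=> i; rewrite /F; case: pselect => [H|H]; last exact: measurable0.
suff SE : S i = `](ratr i.1.1 - i.2.+1%:R^-1), (ratr i.1.1 + i.2.+1%:R^-1)[%classic `*`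
   `](ratr i.1.2 - i.2.+1%:R^-1), (ratr i.1.2 + i.2.+1%:R^-1)[%classic.
  by rewrite /= SE; apply: measurableX; exact: measurable_itv.
apply/seteqP; split=> y /=.
  by move=> /pair_norm_ltP N; have := N false; have := N true; rewrite !ccB /= !in_itv/= !ltr_distl.
by rewrite !in_itv/= -!ltr_distl => -[a b]; apply/pair_norm_ltP => -[]; rewrite ccB.
Qed.

Lemma tonelli_strip (g : R * R -> R) : continuous g -> (forall p, 0 <= g p) ->
  (\int[mu \x mu]_(p in (@half_cylinder R) `&` (setT `*` `[0%R, 1%R[)) (g p)%:E =
   \int[mu]_(x in `[0%R, +oo[) (I01 (fun t => g (x, t)))%:E)%E.
Proof.
move=> cg g0; set D := _ `&` _.
have DE : D = `[0%R, +oo[%classic `*` `[0%R, 1%R[%classic.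
  by apply/seteqP; split=> -[x t]; rewrite /D /half_cylinder/= !in_itv/= andbT => -[]// ? [].
have mD : measurable (D : set ((measurableTypeR R) * (measurableTypeR R))).
  by rewrite DE; apply: measurableX; exact: measurable_itv.
have mg := plane_continuous_measurable cg.
rewrite integral_mkcond fubini_tonelli1; last 2 first.
- have mE : measurable_fun setT (fun p : (measurableTypeR R) * (measurableTypeR R) => (g p)%:E).
    exact/measurable_EFinP.
  exact: ((measurable_restrictT _ mD).1 (measurable_funTS mE)).
- by move=> p; rewrite /patch; case: ifP => // _; rewrite lee_fin.
rewrite [RHS]integral_mkcond; apply: eq_integral => x _.
rewrite /fubini_F /patch.
have [x0|x0] := boolP (x \in `[0%R, +oo[%classic).
  rewrite /I01 /Rintegral fineK; last first.
    by apply: integrable_fin_num => //; apply: I01_integrable; apply: slice_continuous => t; exact: cg.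
  rewrite [RHS]integral_mkcond; apply: eq_integral => t _; rewrite /patch DE.
  by rewrite in_setX x0.
rewrite integral0_eq// => t _; rewrite DE in_setX (negbTE x0)//.
Qed.

End Strip.

(** * Functions smooth up to the boundary of the half-cylinder *)

Section HalfPlane.
Context {R : realType}.
Implicit Types G : R * R -> R.
Local Notation D := (@half_cylinder R).

Definition posp : set (R * R) := [set q : R * R | 0 < q.1].

Lemma posp_open : open posp.
Proof.
have -> : posp = fst @^-1` [set x : R | 0 < x] by [].
by apply: open_comp; [move=> p _; exact: cvg_fst|exact: open_gt].
Qed.

Definition half_smooth G := forall q, D q -> exists U g,
  [/\ open U, U q, smooth_on U g & forall q', D q' -> U q' -> G q' = g q'].

(** Values at negative tau are junk. Composition with this retraction gives functions continuous on
    the whole plane, unchanged for nonnegative tau, to which the integration lemmas apply. *)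
Definition clamp (q : R * R) : R * R := (Num.max 0 q.1, q.2).

Lemma clamp_id q : D q -> clamp q = q.
Proof. by case: q => x t x0; rewrite /clamp/= max_r. Qed.

Lemma clampD q : D (clamp q).
Proof. by rewrite /half_cylinder/= le_max lexx. Qed.

Lemma clamp_continuous : continuous clamp.
Proof.
move=> q; apply/continuous_distP => e e0; exists e => // y /pair_norm_ltP H.
apply/pair_norm_ltP => -[]; rewrite ccB; first by have := H true; rewrite ccB.
have := H false; rewrite ccB /clamp/= !ltr_distl.
by case: (leP 0 y.1) => ?; case: (leP 0 q.1) => ? ?; lra.
Qed.

Lemma half_smooth_pos G : half_smooth G -> smooth_on posp G.
Proof.
move=> hG k; apply: Ck_local => q q0; have [U [g [oU Uq Sg Gg]]] := hG q (ltW q0).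
exists (U `&` posp); split; [by apply: openI => //; exact: posp_open|by []|].
apply: (@Ck_ext _ _ _ _ _ g); first by apply: openI => //; exact: posp_open.
  by move=> q' [Uq' /ltW q'0]; rewrite Gg.
by apply: Ck_sub (Sg k); exact: subIsetl.
Qed.

Lemma half_smooth_clamp G : half_smooth G -> continuous (G \o clamp).
Proof.
move=> hG q; have [U [g [oU Uq Sg Gg]]] := hG _ (clampD q).
have cg : {for q, continuous (g \o clamp)}.
  by apply: continuous_comp; [exact: clamp_continuous|exact: Ck_cont (Sg 0%N) Uq].
rewrite /continuous_at /= Gg//; last exact: clampD.
apply: cvg_trans cg; apply: near_eq_cvg.
have H : \forall y \near q, U (clamp y) := clamp_continuous (open_nbhs_nbhs (conj oU Uq)).
by apply: (@filterS _ (nbhs q) _ _ _ _ H) => y Uy /=; rewrite Gg//; exact: clampD.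
Qed.

Definition sliceI G (tau : R) : R := I01 (fun t => (G \o clamp) (tau, t)).

Lemma sliceI_continuous G : half_smooth G -> continuous (sliceI G).
Proof. by move=> /half_smooth_clamp; exact: I01_slice_continuous. Qed.

Lemma sliceIE G (tau : R) : 0 <= tau -> sliceI G tau = I01 (fun t => G (tau, t)).
Proof. by move=> t0; apply: eq_I01 => t _ /=; rewrite clamp_id. Qed.

Lemma sliceI_derive G (tau : R) : half_smooth G -> 0 < tau ->
  is_derive tau (1 : R) (sliceI G) (I01 (fun t => 'D_(dd false) G (tau, t))).
Proof.
move=> hG t0; have SG := half_smooth_pos hG.
have Gc q : posp q -> (G \o clamp) q = G q by move=> /ltW q0 /=; rewrite clamp_id.
have C1 : Ck 1 posp (G \o clamp).
  apply: (@Ck_ext _ _ _ _ _ G); [exact: posp_open|by move=> q /Gc|exact: SG].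
have [_ /(_ (dd false))[D1 [c1 _]]] := C1.
have H := I01_slice_derive (half_smooth_clamp hG) D1 (fun t => c1 (tau, t) t0) t0.
apply: (is_derive_eq H); apply: eq_I01 => t _.
exact: (D_ext_open posp_open (dd false) (t0 : posp (tau, t)) Gc).
Qed.

Lemma pos_slice_continuous G (tau : R) : Ck 0 posp G -> 0 < tau -> continuous (fun t => G (tau, t)).
Proof. by move=> C t0; apply: slice_continuous => t; exact: Ck_cont C _. Qed.

Lemma pt_line (tau t k : R) : (tau, t) + k *: dd true = (tau, t + k) :> R * R.
Proof. by apply: injective_projections; rewrite /= /GRing.scale/= ?mulr1 ?mulr0 ?addr0. Qed.

Lemma is_derive_slice G (tau t dg : R) : is_derive (tau, t) (dd true) G dg ->
  is_derive t (1 : R) (fun s => G (tau, s)) dg.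
Proof.
move=> H; have := (line_derive G (tau, 0) (dd true) t dg).1.
rewrite pt_line add0r => /(_ H).
rewrite (_ : (fun s => _) = (fun s => G (tau, s)))//.
by apply/funext => s; rewrite pt_line add0r.
Qed.

Lemma sliceI_dt G (tau : R) : Ck 1 posp G -> 0 < tau -> (forall t, G (tau, t + 1) = G (tau, t)) ->
  I01 (fun t => 'D_(dd true) G (tau, t)) = 0.
Proof.
move=> C t0 per; have Dt t : is_derive t (1 : R) (fun s => G (tau, s)) ('D_(dd true) G (tau, t)).
  by apply: is_derive_slice; exact: CkS_is_derive C _.
rewrite (I01_FTC Dt); first by rewrite -[X in G (_, X) - _]add0r per subrr.
exact: (pos_slice_continuous (CkS_derive (dd true) C) t0).
Qed.

End HalfPlane.

Section Monotone.
Context {R : realType}.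

Lemma nondecreasing_pos (f g : R -> R) : continuous f ->
  (forall x : R, 0 < x -> is_derive x (1 : R) f (g x)) -> (forall x, 0 < x -> 0 <= g x) ->
  forall x y, 0 <= x -> x <= y -> f x <= f y.
Proof.
move=> cf Df g0 x y x0; rewrite le_eqVlt => /orP[/eqP ->//|xy].
have [||c] := @MVT R f g x y xy.
- by move=> z; rewrite in_itv/= => /andP[xz _]; apply: Df; exact: le_lt_trans xz.
- exact: continuous_subspaceT.
rewrite in_itv/= => /andP[xc _] E; rewrite -subr_ge0 E mulr_ge0//.
  by apply: g0; exact: le_lt_trans xc.
by rewrite subr_ge0 ltW.
Qed.

Lemma constant_pos (f : R -> R) : continuous f ->
  (forall x : R, 0 < x -> is_derive x (1 : R) f 0) -> forall x, 0 <= x -> f x = f 0.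
Proof.
move=> cf Df x x0; apply/eqP; rewrite eq_le; apply/andP; split; last first.
  exact: (nondecreasing_pos cf Df).
have cfN : continuous (fun x => - f x) by move=> z; apply: cvgN; exact: cf.
rewrite -lerN2; apply: (nondecreasing_pos cfN (g := fun=> 0)) => //.
by move=> z z0; rewrite -[X in is_derive _ _ _ X]oppr0; apply: is_deriveN; exact: Df.
Qed.

End Monotone.

Lemma norm_le_sqrt (R : realType) (x y d1 d2 C : R) : 0 <= d1 -> 0 <= d2 ->
  Num.sqrt (d1 + x * x + (d2 + y * y)) <= C -> `|x| <= `|C| /\ `|y| <= `|C|.
Proof.
move=> d10 d20 sC.
have s0 : 0 <= d1 + x * x + (d2 + y * y) by rewrite !addr_ge0// -expr2 sqr_ge0.
have C0 : 0 <= C := le_trans (sqrtr_ge0 _) sC.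
have : d1 + x * x + (d2 + y * y) <= C ^+ 2.
  by rewrite -(sqr_sqrtr s0) ler_pXn2r// nnegrE ?sqrtr_ge0.
have := sqr_ge0 x; have := sqr_ge0 y => y0 x0 sC2.
split; rewrite -ler_sqr ?nnegrE// !real_normK ?num_real//; move: sC2 y0 x0;
  rewrite !expr2; lra.
Qed.

(** * The functions A, B and E on the half-cylinder *)

Section CylinderFunctions.
Context {R : realType} {n : nat} {M : manifold R n.*2.+1} {lam : one_form M}
  {J : endo_field M} (tr : contact_triad lam J).
Local Notation m := n.*2.+1.
Implicit Types a : Defs.index M.
Local Notation D := (@half_cylinder R).
Context {w : R * R -> M} (inst : contact_instanton lam J D w)
  (wb : bounded_differential lam J D w).
Local Notation inner := (@inner R n M w).
Local Notation loc := (@loc R n M w).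
Local Notation fa := (@fa R n M lam w).
Local Notation fb := (@fb R n M lam w).
Local Notation fe := (@fe R n M lam J w).

Definition pA (q : R * R) : R := pullback lam D w q (dd false).
Definition pB (q : R * R) : R := pullback lam D w q (dd true).
(** With the factor one half this is the coefficient of the pullback of [d lam], see [pE_inner]. *)
Definition pE (q : R * R) : R := 2^-1 * norm_sq_at lam J (w q) (dpi lam D w q).

Lemma smooth_lam_rep a U F v : lrep D w a U F ->
  smooth_on U (fun q => lam a (F q) ('D_v F q)).
Proof.
move=> [oU SF FU _] k.
apply: (@Ck_ext _ _ _ _ _ (fun q => \sum_j 'D_v (fun z => F z 0 j) q *
   ((fun x => lam a x (ev j)) \o F) q)) => //.
  move=> q Uq; rewrite lam_sum; apply: eq_bigr => j _; rewrite derive_coord//.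
  by have [] := CkS_is_derive v (SF 1%N) Uq.
apply: Ck_sum => // j _; apply: Ck_mul => //.
  by apply: CkS_derive; exact: ((Ck_rVP _ _ oU).1 (SF k.+1) j).
by apply: (Ck_comp oU (@cdom_open _ _ _ a) _ (form_smooth lam a (ev j) k) (SF k)).
Qed.

Lemma smooth_dformJ_rep a U F v : lrep D w a U F ->
  smooth_on U (fun q => dform lam a (F q) ('D_v F q) (J a (F q) ('D_v F q))).
Proof.
move=> [oU SF FU _] k.
apply: (@Ck_ext _ _ _ _ _ (fun q => \sum_i \sum_j 'D_v (fun z => F z 0 i) q *
   'D_v (fun z => F z 0 j) q * \sum_l ((fun x => J a x (ev j) 0 l) \o F) q *
   ((fun x => dform lam a x (ev i) (ev l)) \o F) q)) => //.
  move=> q Uq; rewrite dformJ_sum; last exact: FU.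
  have DF j : 'D_v F q 0 j = 'D_v (fun z => F z 0 j) q.
    by rewrite derive_coord//; have [] := CkS_is_derive v (SF 1%N) Uq.
  apply: eq_bigr => i _; apply: eq_bigr => j _.
  have T (p p' s t z : R) : p = s -> p' = t -> p * p' * z = s * t * z by move=> -> ->.
  exact: (T _ _ _ _ _ (esym (DF i)) (esym (DF j))).
have SD j : Ck k U ('D_v (fun z => F z 0 j)).
  by apply: CkS_derive; exact: ((Ck_rVP _ _ oU).1 (SF k.+1) j).
apply: Ck_sum => // i _; apply: Ck_sum => // j _; apply: Ck_mul => //.
  by apply: Ck_mul => //; exact: SD.
apply: Ck_sum => // l _; apply: Ck_mul => //.
  exact: (Ck_comp oU (@cdom_open _ _ _ a) FU (@smooth_endo _ _ _ J a j l k) (SF k)).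
exact: (Ck_comp oU (@cdom_open _ _ _ a) FU (smooth_dform lam a i l k) (SF k)).
Qed.

Let sw : smooth_cylinder_map D w. Proof. by have [] := inst. Qed.

Lemma pull_half_smooth v : half_smooth (fun q => pullback lam D w q v).
Proof.
move=> q Dq; have [U [F [rep Uq]]] := lrep_at sw Dq (chart_at_dom (w q)).
set a := chart_at _ in rep; have [oU _ _ _] := rep.
exists U, (fun q => lam a (F q) ('D_v F q)); split=> //; first exact: smooth_lam_rep rep.
by move=> q' Dq' Uq'; exact: (pullback_rep admissible_half rep Dq' Uq').
Qed.

Lemma pA_half_smooth : half_smooth pA. Proof. exact: pull_half_smooth. Qed.
Lemma pB_half_smooth : half_smooth pB. Proof. exact: pull_half_smooth. Qed.

Lemma pE_half_smooth : half_smooth pE.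
Proof.
move=> q Dq; have [U [F [rep Uq]]] := lrep_at sw Dq (chart_at_dom (w q)).
set a := chart_at _ in rep; have [oU _ _ _] := rep.
have H v := smooth_dformJ_rep v rep.
exists U, (fun q => 2^-1 * (dform lam a (F q) ('D_(dd false) F q) (J a (F q) ('D_(dd false) F q))
  + dform lam a (F q) ('D_(dd true) F q) (J a (F q) ('D_(dd true) F q)))); split=> //.
  move=> k; apply: Ck_mul => //; first exact: Ck_cst.
  by apply: Ck_add => //; [exact: H|exact: H].
move=> q' Dq' Uq'; apply: (f_equal (fun s : R => 2^-1 * s)).
exact: (norm_dpi_rep tr admissible_half rep Dq' Uq').
Qed.

Lemma pA_inner a q : inner a q -> pA q = fa a q.
Proof. by move=> Iq; exact: (pullback_rep admissible_half (inner_rep inst a) (ltW Iq.1 : D q) Iq). Qed.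

Lemma pB_inner a q : inner a q -> pB q = fb a q.
Proof. by move=> Iq; exact: (pullback_rep admissible_half (inner_rep inst a) (ltW Iq.1 : D q) Iq). Qed.

Lemma pE_inner a q : inner a q -> pE q = fe a q.
Proof.
move=> Iq; apply: (etrans (f_equal (fun s : R => 2^-1 * s) (norm_dpi_inner tr inst Iq))).
by rewrite mulrA mulVf ?mul1r// pnatr_eq0.
Qed.

Lemma inner_chart q : 0 < q.1 -> inner (chart_at (w q)) q.
Proof. by move=> q0; split=> //; exact: chart_at_dom. Qed.

Lemma dmap_periodic q v : D q -> dmap D w (q + d_t R) v = dmap D w q v.
Proof.
move=> Dq; have [per _] := sw; rewrite /dmap per//; set b := chart_at _.
have DT (z : R * R) : D (z + d_t R) = D z by rewrite /half_cylinder/= addr0.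
have swap (h : R) : q + d_t R + h *: v = (q + h *: v) + d_t R by rewrite addrAC.
rewrite /derive_in /=.
rewrite (_ : [set h : R | D (q + d_t R + h *: v)] = [set h : R | D (q + h *: v)]); last first.
  by apply/seteqP; split=> h /=; rewrite swap DT.
congr lim; rewrite per//.
set Fl := within _ _.
have near_eq : \forall h \near Fl, Defs.coord b (w (q + d_t R + h *: v)) = Defs.coord b (w (q + h *: v)).
  rewrite /Fl near_withinE; apply: filterE => h Dh.
  by rewrite swap per.
by apply/seteqP; split=> P /=; apply: filterS2 near_eq => h /= ->.
Qed.

Lemma pullback_periodic q v : D q -> pullback lam D w (q + d_t R) v = pullback lam D w q v.
Proof. by move=> Dq; have [per _] := sw; rewrite /pullback dmap_periodic// per. Qed.

Lemma pE_periodic q : D q -> pE (q + d_t R) = pE q.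
Proof.
move=> Dq; have [/(_ q Dq) Ew _] := sw.
have Ed : dpi lam D w (q + d_t R) = dpi lam D w q.
  apply/funext => v; exact: (f_equal2 (fun (p : M) z =>
    let a := chart_at p in xi_proj lam a (Defs.coord a p) z) Ew (dmap_periodic v Dq)).
exact: (f_equal2 (fun (p : M) L => 2^-1 * norm_sq_at lam J p L) Ew Ed).
Qed.

Let SA : smooth_on posp pA. Proof. exact: half_smooth_pos pA_half_smooth. Qed.
Let SB : smooth_on posp pB. Proof. exact: half_smooth_pos pB_half_smooth. Qed.

Let D_inner a (f g : R * R -> R) q v : inner a q -> (forall y, inner a y -> f y = g y) ->
  'D_v f q = 'D_v g q.
Proof. move=> Iq fg; exact: (D_ext_open (@inner_open _ _ _ _ _ _ inst a) v Iq fg). Qed.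

Lemma pAB_closed q : 0 < q.1 -> 'D_(dd false) pA q + 'D_(dd true) pB q = 0.
Proof.
move=> q0; have Iq := inner_chart q0.
have E1 := D_inner (dd false) Iq (@pA_inner (chart_at (w q))).
have E2 := D_inner (dd true) Iq (@pB_inner (chart_at (w q))).
exact: (etrans (f_equal2 (fun s t : R => s + t) E1 E2) (eq_closed inst Iq)).
Qed.

Lemma pAB_area q : 0 < q.1 -> 'D_(dd false) pB q - 'D_(dd true) pA q = pE q.
Proof.
move=> q0; have Iq := inner_chart q0.
have E1 := D_inner (dd false) Iq (@pB_inner (chart_at (w q))).
have E2 := D_inner (dd true) Iq (@pA_inner (chart_at (w q))).
apply: (etrans (f_equal2 (fun s t : R => s - t) E1 E2)).
exact: (etrans (eq_area tr inst Iq) (esym (pE_inner Iq))).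
Qed.

Lemma pE_ge0 q : D q -> 0 <= pE q.
Proof.
move=> Dq; have cb : cdom (chart_at (w q)) (Defs.coord (chart_at (w q)) (w q)).
  by exists (w q) => //; exact: chart_at_dom.
rewrite /pE mulr_ge0 ?invr_ge0// /norm_sq_at.
by rewrite addr_ge0// (triad_metric_proj tr _ cb); exact: (dform_J_ge0 tr).
Qed.

Lemma pAB_bounded : exists2 C : R, 0 <= C & forall q, D q -> `|pA q| <= C /\ `|pB q| <= C.
Proof.
have [C HC] := wb; exists `|C| => // q Dq.
have cb : cdom (chart_at (w q)) (Defs.coord (chart_at (w q)) (w q)).
  by exists (w q) => //; exact: chart_at_dom.
have [U [F [rep Uq]]] := lrep_at sw Dq (chart_at_dom (w q)).
have := HC q Dq; rewrite (norm_dmap_rep tr admissible_half rep Dq Uq).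
set a := chart_at _ in rep *; have [_ _ /(_ q Uq) cF _] := rep.
have PA : pA q = lam a (F q) ('D_(dd false) F q) := pullback_rep admissible_half rep Dq Uq _.
have PB : pB q = lam a (F q) ('D_(dd true) F q) := pullback_rep admissible_half rep Dq Uq _.
have H v : 0 <= dform lam a (F q) ('D_v F q) (J a (F q) ('D_v F q)) := dform_J_ge0 tr _ cF.
rewrite PA PB; exact: (norm_le_sqrt (H (dd false)) (H (dd true))).
Qed.

Local Notation mu := (@lebesgue_measure R).

(** The sign comes from [j] mapping the t direction to minus the tau direction. The average is
    constant because its derivative integrates a t-derivative over a full period. *)
Lemma sliceI_pA (tau : R) : 0 <= tau -> sliceI pA tau = - asymptotic_charge lam w.
Proof.
move=> t0; have pt (t : R) : (0, t + 1) = (0, t) + d_t R :> R * R.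
  by apply: injective_projections; rewrite /= ?addr0.
have -> : asymptotic_charge lam w = I01 (fun t => -1 * (pA \o clamp) (0, t)).
  apply: eq_I01 => t _; rewrite /= clamp_id; last by rewrite /half_cylinder/=.
  have D0 : D (0, t) by rewrite /half_cylinder/=.
  have [U [F [rep Uq]]] := lrep_at sw D0 (chart_at_dom (w (0, t))).
  rewrite /pA (pullback_rep admissible_half rep D0 Uq) (pullback_rep admissible_half rep D0 Uq).
  rewrite cyl_j_t derive_dirN; last by have [] := rep_derive rep Uq (dd false).
  by rewrite linearN mulN1r.
rewrite I01Z; last by apply: slice_continuous => t; exact: (half_smooth_clamp pA_half_smooth).
rewrite mulN1r opprK.
apply: (constant_pos (sliceI_continuous pA_half_smooth)) => // x x0.
apply: (is_derive_eq (sliceI_derive pA_half_smooth x0)).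
rewrite -[RHS](I01_cst 0).
transitivity (I01 (fun t => -1 * 'D_(dd true) pB (x, t))).
  apply: eq_I01 => t _; have := pAB_closed (x0 : 0 < (x, t).1).
  by move=> /eqP; rewrite addr_eq0 mulN1r => /eqP.
rewrite I01Z; last by exact: (pos_slice_continuous (CkS_derive (dd true) (SB 1%N)) x0).
rewrite (sliceI_dt (SB 1%N) x0) ?mulr0 ?I01_cst// => t.
have Dxt : D (x, t) := ltW x0.
have E : (x, t + 1) = (x, t) + d_t R :> R * R.
  by apply: injective_projections; rewrite /= ?addr0.
by rewrite E; exact: pullback_periodic.
Qed.

Lemma sliceI_pB_derive (tau : R) : 0 < tau -> is_derive tau (1 : R) (sliceI pB) (sliceI pE tau).
Proof.
move=> x0; apply: (is_derive_eq (sliceI_derive pB_half_smooth x0)).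
rewrite sliceIE ?ltW//.
transitivity (I01 (fun t => pE (tau, t) - -1 * 'D_(dd true) pA (tau, t))).
  apply: eq_I01 => t _; rewrite -(pAB_area (x0 : 0 < (tau, t).1)) mulN1r opprK subrK//.
have cA : continuous (fun t => 'D_(dd true) pA (tau, t)).
  exact: (pos_slice_continuous (CkS_derive (dd true) (SA 1%N)) x0).
rewrite I01B; last 2 first.
- by exact: (pos_slice_continuous (half_smooth_pos pE_half_smooth 0%N) x0).
- by move=> t; apply: cvgM; [exact: cvg_cst|exact: cA].
rewrite (I01Z (-1))// (sliceI_dt (SA 1%N) x0) ?mulr0 ?subr0// => t.
have Dxt : D (tau, t) := ltW x0.
have E : (tau, t + 1) = (tau, t) + d_t R :> R * R.
  by apply: injective_projections; rewrite /= ?addr0.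
by rewrite E; exact: pullback_periodic.
Qed.

Lemma sliceI_pE_ge0 tau : 0 <= sliceI pE tau.
Proof.
rewrite -(I01_cst 0); apply: I01_le => [t||t _]; first exact: cvg_cst.
  by apply: slice_continuous => t; exact: (half_smooth_clamp pE_half_smooth).
by apply: pE_ge0; exact: clampD.
Qed.

(** The total energy is the increment of [sliceI pB] from 0 to infinity, and the second summand of
    the action is its value at 0. *)
Lemma sliceI_pB_cvg : sliceI pB tau @[tau --> +oo] --> asymptotic_action lam J w.
Proof.
have cB := sliceI_continuous pB_half_smooth.
(* [clamp] makes [sliceI pB] constant at negative times, so it is monotone on the whole line. *)
have mono : {homo sliceI pB : x y / x <= y}.
  move=> x y xy; have C (z : R) : sliceI pB z = sliceI pB (Num.max 0 z).
    by apply: eq_I01 => t _; rewrite /= /clamp/= maxA maxxx.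
  rewrite (C x) (C y); apply: (nondecreasing_pos cB sliceI_pB_derive).
  - by move=> z _; exact: sliceI_pE_ge0.
  - by rewrite le_max lexx.
  - by rewrite ge_max !le_max lexx xy orbT.
have ub : has_ubound (range (sliceI pB)).
  have [C C0 HC] := pAB_bounded; exists C => _ [x _ <-].
  apply: (le_trans (ler_norm _)); apply: I01_norm_le.
    by apply: slice_continuous => t; exact: (half_smooth_clamp pB_half_smooth).
  by move=> t _; exact: (HC _ (clampD _)).2.
have lim := nondecreasing_cvgr mono ub.
suff -> : asymptotic_action lam J w = sup (range (sliceI pB)) by [].
set l := sup _ in lim *.
(* Tonelli's theorem, then the fundamental theorem on the half-line with primitive
   [2 * sliceI pB]. *)
have I2 : dpi_sq_integral lam J D w = (2 * l - 2 * sliceI pB 0)%:E.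
  transitivity (\int[mu \x mu]_(p in D `&` (setT `*` `[0%R, 1%R[))
      (2 * (pE \o clamp) p)%:E)%E.
    apply: eq_integral => p; rewrite inE => -[Dp _] /=; rewrite clamp_id//.
    by rewrite /pE mulrA mulfV ?mul1r// pnatr_eq0.
  rewrite (@tonelli_strip _ (fun p => 2 * (pE \o clamp) p)); last 2 first.
  - by move=> p; apply: cvgM; [exact: cvg_cst|exact: (half_smooth_clamp pE_half_smooth)].
  - by move=> p; rewrite mulr_ge0//; apply: pE_ge0; exact: clampD.
  have cE := sliceI_continuous pE_half_smooth.
  transitivity (\int[mu]_(x in `[0%R, +oo[) (2 * sliceI pE x)%:E)%E.
    apply: eq_integral => x _; rewrite I01Z//.
    by apply: slice_continuous => t; exact: (half_smooth_clamp pE_half_smooth).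
  rewrite (@ge0_continuous_FTC2y _ (fun x => 2 * sliceI pE x) (fun x => 2 * sliceI pB x) 0 (2 * l)).
  - by rewrite EFinB.
  - by move=> x _; rewrite mulr_ge0// sliceI_pE_ge0.
  - by apply: continuous_subspaceT => x; apply: cvgM; [exact: cvg_cst|exact: cE].
  - by apply: cvgM; [exact: cvg_cst|exact: lim].
  - by move=> x x0; apply: derivableM => //; have [] := sliceI_pB_derive x0.
  - by apply: cvg_at_right_filter; apply: cvgM; [exact: cvg_cst|exact: cB].
  - move=> x; rewrite in_itv/= andbT => x0; rewrite derive1E.
    have [_ ->] := is_deriveZ 2 (sliceI_pB_derive x0); by [].
rewrite /asymptotic_action I2 /=.
have -> : \int[mu]_(t in `[0, 1[) pullback lam D w (0, t) (d_t R) = sliceI pB 0.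
  by rewrite sliceIE.
by rewrite -mulrBr mulrA mulVf ?pnatr_eq0// mul1r subrK.
Qed.

End CylinderFunctions.

(** * Decay at infinity *)

Section Landau.
Context {R : realType}.

(** A mean value of the derivative over a step of length [h] is at most [e / h], and it differs from
    the value at [x] by at most [L * h]. *)
Lemma landau_line (V : normedModType R) (f : V -> R) x v (h e L : R) : 0 < h ->
  (forall s, 0 <= s <= 1 -> derivable f (x + (s * h) *: v) v) ->
  (forall s, 0 <= s <= 1 -> `|'D_v f (x + (s * h) *: v) - 'D_v f x| <= L * h) ->
  `|f (x + h *: v) - f x| <= e -> `|'D_v f x| <= e / h + L * h.
Proof.
move=> h0 df Lf fe; have [s s01 E] := mvt_lineh df.
have T (p q : R) : `|q - p| <= L * h -> `|h * q| <= e -> `|p| <= e / h + L * h.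
  move=> pq; rewrite normrM (gtr0_norm h0) => qe.
  have {}qe : `|q| <= e / h by rewrite ler_pdivlMr// mulrC.
  rewrite (_ : p = q - (q - p)); last by rewrite opprB addrC subrK.
  by rewrite (le_trans (ler_normB _ _))// lerD.
by apply: (T _ _ (Lf s s01)); rewrite -E.
Qed.

(* The interval length h balances the two terms of the Landau inequality. *)
Lemma landau_small (eta L hmax : R) : 0 < eta -> 0 <= L -> 0 < hmax -> exists h e : R,
  [/\ 0 < h, h <= hmax, 0 < e & forall (V : normedModType R) (f : V -> R) x v,
  (forall s, 0 <= s <= 1 -> derivable f (x + (s * h) *: v) v) ->
  (forall s, 0 <= s <= 1 -> `|'D_v f (x + (s * h) *: v) - 'D_v f x| <= L * h) ->
  `|f (x + h *: v) - f x| <= e -> `|'D_v f x| <= eta].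
Proof.
move=> eta0 L0 hmax0; have L1 : 0 < L + 1 by rewrite ltr_pwDr.
have k0 : 0 < eta / 2 / (L + 1) by rewrite !divr_gt0.
pose h := Num.min hmax (eta / 2 / (L + 1)).
have h0 : 0 < h by rewrite lt_min hmax0.
exists h, (eta / 2 * h); split=> //; first by rewrite ge_min lexx.
  by rewrite mulr_gt0// divr_gt0.
move=> V f x v df Lf fe; apply: (le_trans (landau_line h0 df Lf fe)).
rewrite mulfK ?gt_eqF//.
have : h <= eta / 2 / (L + 1) by rewrite ge_min lexx orbT.
rewrite ler_pdivlMr// mulrDr mulr1 mulrC; move: h0 eta0; move: (L * h) => p; lra.
Qed.

End Landau.

(** * Periodic functions with small mean *)

Section PeriodicSup.
Context {R : realType}.

Lemma is_derive_shift (h : R -> R) (s t d : R) : is_derive (s + t) (1 : R) h d ->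
  is_derive t (1 : R) (fun t => h (s + t)) d.
Proof.
move=> H; have := (line_derive h s (1 : R) t d).1; rewrite [t *: 1]mulr1 => /(_ H).
rewrite (_ : (fun _ => _) = (fun t => h (s + t)))//.
by apply/funext => k; rewrite [k *: 1]mulr1.
Qed.

Context {h dh : R -> R} (Dh : forall t, is_derive t (1 : R) h (dh t))
  (cdh : continuous dh) (per : forall t, h (t + 1) = h t).

Let ch : continuous h.
Proof.
by move=> t; apply: differentiable_continuous; apply/derivable1_diffP; have [] := Dh t.
Qed.

Let csh (g : R -> R) s : continuous g -> continuous (fun t => g (s + t)).
Proof.
move=> cg t; apply: (@continuous_comp _ _ _ (fun t => s + t) g); last exact: cg.
by apply: cvgD; [exact: cvg_cst|exact: cvg_id].
Qed.

Let h_plane (q : R * R) : is_derive q (dd false) (fun q : R * R => h (q.1 + q.2)) (dh (q.1 + q.2)).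
Proof.
apply/is_derive_distP => e e0; have [d d0 Hd] := (is_derive_distP _ _ _ _).1 (Dh (q.1 + q.2)) e e0.
exists d => // k kd k0; have := Hd k kd k0.
by rewrite /= /GRing.scale/= !mulr1 mulr0 addr0 (addrAC q.1 k).
Qed.

(** The derivative in [s] is the integral of [dh] over a full period, which is zero. *)
Lemma I01_shift (s : R) : 0 <= s -> I01 (fun t => h (s + t)) = I01 h.
Proof.
move=> s0; pose f (q : R * R) := h (q.1 + q.2).
have cpl (g : R -> R) : continuous g -> continuous (fun q : R * R => g (q.1 + q.2)).
  move=> cg q; apply: (@continuous_comp _ _ _ (fun q : R * R => q.1 + q.2) g); last exact: cg.
  by apply: cvgD; [exact: cvg_fst|exact: cvg_snd].
have Df : 'D_(dd false) f = (fun q : R * R => dh (q.1 + q.2)).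
  by apply/funext => q; have [_] := h_plane q.
have -> : I01 h = (fun s => I01 (fun t => f (s, t))) 0.
  by apply: eq_I01 => t _; rewrite /f/= add0r.
apply: (constant_pos (f := fun s => I01 (fun t => f (s, t)))) => //.
  by apply: I01_slice_continuous; exact: cpl.
move=> x x0.
have H : is_derive x (1 : R) (fun s => I01 (fun t => f (s, t)))
    (I01 (fun t => 'D_(dd false) f (x, t))).
  apply: I01_slice_derive => //; first exact: cpl.
  - by move=> q _; have [] := h_plane q.
  - by move=> t; rewrite Df; exact: (cpl _ cdh).
apply: (is_derive_eq H).
transitivity (I01 (fun t => dh (x + t))).
  by apply: eq_I01 => t _; have [_] := h_plane (x, t).
have Dsh t : is_derive t (1 : R) (fun t => h (x + t)) (dh (x + t)) by exact: is_derive_shift.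
rewrite (I01_FTC Dsh); first by rewrite addr0 per subrr.
exact: csh.
Qed.

(** Integrate the derivative of [t * h (s + t) ^+ 2] over [[0, 1]]: the boundary term is [h s ^+ 2]
    by periodicity, and the integrand is at most [(C + 2 * L) * h (s + t)]. So a nonnegative
    function with bounded derivative is small once its mean is small. *)
Lemma periodic_sup (C L s : R) : (forall t, 0 <= h t <= C) -> (forall t, `|dh t| <= L) -> 0 <= s ->
  h s * h s <= (C + 2 * L) * I01 h.
Proof.
move=> hC hL s0; rewrite -(I01_shift s0).
pose psi t := t * (h (s + t) * h (s + t)).
pose dpsi t := h (s + t) * h (s + t) + t * (2 * h (s + t) * dh (s + t)).
have Dpsi t : is_derive t (1 : R) psi (dpsi t).
  have D1 : is_derive t (1 : R) (fun t => h (s + t)) (dh (s + t)) by exact: is_derive_shift.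
  have D2 := is_deriveM D1 D1; have D3 := is_deriveM (is_derive_id t (1 : R)) D2.
  apply: (is_derive_eq D3); rewrite /dpsi /GRing.scale/=.
  by rewrite mulr1 addrC; congr (_ + _ * _); ring.
have csh' := @csh h s ch; have csd := @csh dh s cdh.
have cM (f g : R -> R) : continuous f -> continuous g -> continuous (fun t => f t * g t).
  by move=> cf cg t; apply: cvgM; [exact: cf|exact: cg].
have cdpsi : continuous dpsi.
  move=> t; apply: cvgD; first exact: (cM _ _ csh' csh').
  apply: (cM id (fun t => 2 * h (s + t) * dh (s + t))); first by move=> z; exact: cvg_id.
  have c2 : continuous (fun _ : R => 2 : R) by move=> z; exact: cvg_cst.
  exact: (cM _ _ (cM _ _ c2 csh') csd).
have -> : h s * h s = I01 dpsi.
  by rewrite (I01_FTC Dpsi)// /psi mul0r subr0 mul1r per.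
rewrite -I01Z//; apply: I01_le => //.
  by apply: cM => //; move=> z; exact: cvg_cst.
move=> t /andP[t0 t1]; rewrite /dpsi.
have /andP[h0 h1] := hC (s + t); have := hL (s + t).
rewrite ler_norml => /andP[_ d1].
move: h0 h1 d1; move: (h (s + t)) (dh (s + t)) => p q p0 pC qL.
have L0 : 0 <= L by exact: le_trans (normr_ge0 _) (hL 0).
have pp : p * p <= C * p by rewrite ler_wpM2r.
have H : t * (2 * p * q) <= 2 * L * p.
  have [q0|q0] := leP 0 q.
    apply: (@le_trans _ _ (1 * (2 * p * q))).
      by rewrite ler_wpM2r// !mulr_ge0.
    rewrite mul1r mulrAC ler_wpM2r//. by rewrite ler_wpM2l.
  apply: (@le_trans _ _ 0); last by rewrite !mulr_ge0.
  by rewrite mulr_ge0_le0// mulr_ge0_le0// ?mulr_ge0// ltW.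
by rewrite [leRHS]mulrDl lerD.
Qed.

Lemma periodic_int (g : R -> R) : (forall t, g (t + 1) = g t) ->
  forall t : R, exists2 s : R, 0 <= s <= 1 & g t = g s.
Proof.
move=> pg t.
have N (k : nat) x : g (x + k%:R) = g x.
  by elim: k => [|k IH]; rewrite ?addr0// -natr1 addrA pg.
have Z (k : int) x : g (x + k%:~R) = g x.
  by case: k => k; [exact: N|rewrite NegzE mulrNz -[RHS](N k.+1 x) -[in RHS](N k.+1) ?subrK]; rewrite -[LHS](N k.+1) subrK N.
exists (t - (Num.floor t)%:~R).
  have /andP[a b] := floor_itv t; move: b; rewrite intrD; lra.
by rewrite -[in LHS](subrK (Num.floor t)%:~R t) Z.
Qed.

End PeriodicSup.

(** * Decay of derivatives, and rescaling to the unit ball *)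

Section Decay.
Context {R : realType}.
Implicit Types f g : R * R -> R.

(** Uniform in t. The thresholds are at least 1 because the derivative bounds of the instanton hold
    only for [1 <= x.1]. *)
Definition decays f := forall e : R, 0 < e ->
  exists2 N : R, 1 <= N & forall x : R * R, N <= x.1 -> `|f x| <= e.

Lemma decays_ext f g : (forall x : R * R, 1 <= x.1 -> f x = g x) -> decays f -> decays g.
Proof.
move=> fg df e /df[N N1 H]; exists N => // x Nx.
by rewrite -fg ?H//; exact: le_trans Nx.
Qed.

Lemma decaysN f : decays f -> decays (fun x => - f x).
Proof. by move=> df e /df[N N1 H]; exists N => // x Nx; rewrite normrN H. Qed.

Lemma decays_der f b (L : R) : smooth_on posp f -> decays f ->
  (forall x : R * R, 1 <= x.1 -> `|'D_(dd b) ('D_(dd b) f) x| <= L) -> decays ('D_(dd b) f).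
Proof.
move=> Sf df HL eta eta0.
have L0 : 0 <= L by apply: le_trans (normr_ge0 _) (HL (1, 0) _).
have [h [e [h0 h1 e0 H]]] := landau_small eta0 L0 ltr01.
have e2 : 0 < e / 2 by rewrite divr_gt0.
have [N N1 HN] := df _ e2; exists N => // x Nx.
have mv (k : R) : 0 <= k -> N <= (x + k *: dd b).1.
  by move=> k0; rewrite (le_trans Nx)//= lerDl mulr_ge0//; case: b {HL}.
have pos (y : R * R) : N <= y.1 -> posp y.
  by move=> Ny; apply: lt_le_trans Ny; apply: lt_le_trans N1.
have Df g : smooth_on posp g -> forall y, posp y -> derivable g y (dd b).
  by move=> Sg y py; have [] := CkS_is_derive (dd b) (Sg 1%N) py.
have sh s : 0 <= s <= 1 -> 0 <= s * h by move=> /andP[s0 _]; rewrite mulr_ge0// ltW.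
apply: H.
- by move=> s s01; apply: (Df _ Sf); apply/pos/mv/sh.
- move=> s s01; have Sg := smooth_derive (dd b) Sf.
  have [t /andP[t0 ts]|t /andP[t0 ts] ->] := mvt_line (f := 'D_(dd b) f) (x := x) (v := dd b) (sh s s01).
    by apply: (Df _ Sg); apply/pos/mv.
  have /andP[s0 s1] := s01; rewrite normrM (ger0_norm (sh s s01)) mulrC.
  apply: ler_pM => //; first exact: sh.
    by apply: HL; apply: le_trans (mv t t0).
  by rewrite -[leRHS]mul1r ler_wpM2r// ltW.
- rewrite (le_trans (ler_normB _ _))// (@le_trans _ _ (e / 2 + e / 2))//.
    by rewrite lerD// HN// mv// ltW.
  by rewrite -splitr.
Qed.

Section Scaling.
Context {B : set (R * R)} (oB : open B) (x0 : R * R) (rho : R).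
Let A : set (R * R) := (fun y => x0 + rho *: y) @^-1` B.
Local Notation S g := (fun y : R * R => g (x0 + rho *: y)).

Let caff : continuous (fun y : R * R => x0 + rho *: y).
Proof. by move=> y; apply: continuousD; [exact: cvg_cst|first [apply: continuousZl_tmp|apply: continuousZr_tmp]; exact: cvg_id]. Qed.

Lemma scale_open : open A.
Proof. by apply: open_comp => // y _; exact: caff. Qed.

Lemma derive_scale g v y : Ck 1 B g -> A y -> 'D_v (S g) y = rho * 'D_v g (x0 + rho *: y).
Proof. by move=> Cg Ay; have [_] := is_derive_affine (CkS_is_derive v Cg Ay). Qed.

Lemma Ck_scale k g : Ck k B g -> Ck k A (S g).
Proof.
elim: k g => [|k IH] g Cg.
  split=> // y Ay; exact: (continuous_comp (@caff y) (Ck_cont Cg Ay)).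
have C1 : Ck 1 B g by apply: Ck_le Cg.
split.
  by move=> y Ay; exact: (continuous_comp (@caff y) (Ck_cont Cg Ay)).
move=> v; split.
  by move=> y Ay; have [] := is_derive_affine (CkS_is_derive v C1 Ay).
apply: (@Ck_ext _ _ _ _ _ (fun y => rho * 'D_v g (x0 + rho *: y))); first exact: scale_open.
  by move=> y Ay; rewrite derive_scale.
apply: Ck_mul; [exact: scale_open|exact: Ck_cst|exact: (IH ('D_v g) (CkS_derive v Cg))].
Qed.

Lemma derive_scale_mul (k : R) g v y : Ck 1 B g -> A y ->
  'D_v (fun y => k * g (x0 + rho *: y)) y = k * rho * 'D_v g (x0 + rho *: y).
Proof.
move=> Cg Ay; have [_ ->] := is_deriveZ k (is_derive_affine (CkS_is_derive v Cg Ay)).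
by rewrite /GRing.scale/= mulrA.
Qed.

Lemma derive2_scale g u v y : Ck 2 B g -> A y ->
  'D_u ('D_v (S g)) y = rho ^+ 2 * 'D_u ('D_v g) (x0 + rho *: y).
Proof.
move=> Cg Ay; have C1 : Ck 1 B g by apply: Ck_le Cg.
transitivity ('D_u (fun y => rho * ('D_v g) (x0 + rho *: y)) y).
  by apply: (D_ext_open scale_open u Ay) => z Az; exact: derive_scale.
by rewrite (derive_scale_mul _ _ (CkS_derive v Cg) Ay) expr2.
Qed.

Lemma lap_scale g y : Ck 2 B g -> A y -> lap (S g) y = rho ^+ 2 * lap g (x0 + rho *: y).
Proof.
move=> Cg Ay; rewrite [RHS]mulrDr.
exact: (f_equal2 (fun s t : R => s + t) (derive2_scale _ _ Cg Ay) (derive2_scale _ _ Cg Ay)).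
Qed.

End Scaling.

(** A quantitative Liouville theorem. Rescaled from a ball of radius [rho] to the unit ball, [f]
    keeps its bound and satisfies the hypotheses of Bernstein's estimate with a constant free of
    [rho]; undoing the scaling divides the gradient bound by [rho]. *)
Lemma harmonic_decay f (C : R) : smooth_on posp f ->
  (forall x, posp x -> `|f x| <= C) -> decays (lap f) ->
  (forall b, decays ('D_(dd b) (lap f))) -> forall b, decays ('D_(dd b) f).
Proof.
move=> Sf fC dl ddl b e e0.
pose C1 := 1 + `|C|; have C11 : 1 <= C1 by rewrite lerDl.
have C10 : 0 <= C1 by exact: le_trans C11.
pose bb := bernstein_bound (I := unit) C1 1.
(* Chosen so that the rescaled bound [(1 + |bb|) / rho] equals [e]. *)
pose rho := (1 + `|bb|) / e.
have rho0 : 0 < rho by rewrite divr_gt0// ltr_pwDl.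
(* Rescaling multiplies the Laplacian by [rho ^+ 2] and its first derivatives by [rho ^+ 3]; these
   thresholds make both at most 1, which is at most [C1]. *)
have e2 : 0 < rho ^- 2 by rewrite invr_gt0 exprn_gt0.
have e3 : 0 < rho ^- 3 by rewrite invr_gt0 exprn_gt0.
have [N1 N11 H1] := dl _ e2; have [N2 N21 H2] := ddl false _ e3; have [N3 N31 H3] := ddl true _ e3.
pose N := N1 + N2 + N3.
have [NN1 NN2 NN3] : [/\ N1 <= N, N2 <= N & N3 <= N] by rewrite /N; split; lra.
exists (N + rho); first by move: rho0 NN1; lra.
move=> x Nx; pose A : set (R * R) := (fun y => x + rho *: y) @^-1` posp.
have oA : open A by exact: scale_open posp_open x rho.
have inN (y : R * R) : `|y - 0| <= 1 -> N <= (x + rho *: y).1.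
  rewrite subr0 => /pair_norm_leP/(_ false) /=; rewrite ler_norml => /andP[y1 _].
  by move: rho0 Nx y1; rewrite /GRing.scale/=; move: y.1 => t; nra.
have inA (y : R * R) : `|y - 0| <= 1 -> A y.
  by move=> /inN; apply: lt_le_trans; apply: lt_le_trans NN1; exact: lt_le_trans N11.
pose v (_ : unit) (y : R * R) := f (x + rho *: y).
have CV k i : Ck k A (v i) by apply: Ck_scale; [exact: posp_open|exact: Sf].
have Sl : smooth_on posp (lap f).
  by apply: smooth_add; [exact: posp_open|do 2 apply: smooth_derive..].
have lapv i y : A y -> lap (v i) y = rho ^+ 2 * lap f (x + rho *: y).
  by move=> Ay; apply: (lap_scale posp_open) => //; exact: Sf.
have est := @bernstein_estimate R unit C1 1 C10 ltr01 v A 0 oA inA (CV 3%N) _ _ _ (tt, b).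
have : `|jet1 v (tt, b) 0| <= bb.
  apply: est => [y i y1|y i y1|y [i c] y1].
  - by rewrite (le_trans (fC _ (inA _ y1)))// (le_trans (ler_norm _))// lerDr.
  - rewrite (lapv _ _ (inA _ y1)) normrM (ger0_norm (exprn_ge0 _ (ltW rho0))).
    apply: (@le_trans _ _ 1).
      rewrite mulrC -ler_pdivlMr ?exprn_gt0// mul1r.
      by apply: H1; apply: le_trans (inN _ y1).
    rewrite -[leLHS]mulr1; apply: ler_pM => //; by rewrite lerDl NS_ge0.
  - have E : lap (jet1 v (i, c)) y = rho ^+ 3 * 'D_(dd c) (lap f) (x + rho *: y).
      have Sv : smooth_on A (v i) by move=> k; exact: CV.
      apply: (etrans (lap_derive (dd c) oA (inA _ y1) Sv)).
      apply: (etrans (D_ext_open oA (dd c) (inA _ y1) (lapv i))).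
      apply: (etrans (@derive_scale_mul posp x rho (rho ^+ 2) _ (dd c) _ (Sl 1%N) (inA _ y1))).
      by rewrite -exprSr.
    rewrite E normrM (ger0_norm (exprn_ge0 _ (ltW rho0))).
    apply: (@le_trans _ _ 1).
      rewrite mulrC -ler_pdivlMr ?exprn_gt0// mul1r.
      by case: c {E}; [apply: H3|apply: H2]; apply: le_trans (inN _ y1).
    rewrite -[leLHS]mulr1; apply: ler_pM => //; rewrite -addrA lerDl.
    by rewrite addr_ge0 ?sqr_ge0// NS_ge0.
have A0 : A 0 by apply: inA; rewrite subrr normr0.
have -> : jet1 v (tt, b) 0 = rho * 'D_(dd b) f x.
  have := @derive_scale posp x rho _ (dd b) _ (Sf 1%N) A0; rewrite scaler0 addr0; exact.
rewrite normrM (gtr0_norm rho0) => H.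
have H' : rho * `|'D_(dd b) f x| <= 1 + `|bb|.
  by apply: (le_trans H); apply: (le_trans (ler_norm _)); rewrite lerDr.
move: H'; rewrite /rho mulrAC ler_pdivrMr// mulrC.
by rewrite [leRHS]mulrC ler_pM2r// ltr_pwDl.
Qed.

End Decay.

Lemma dist_half (R : realType) (p q r d : R) : `|r - p| <= d / 2 -> `|r - q| <= d / 2 -> `|q - p| <= d.
Proof. by rewrite !ler_norml => /andP[a b] /andP[c e]; apply/andP; split; lra. Qed.

(** * Limits of A, B and E *)

Section Asymptotics.
Context {R : realType} {n : nat} {M : manifold R n.*2.+1} {lam : one_form M}
  {J : endo_field M} (tr : contact_triad lam J) (compactM : compact [set: M]).
Local Notation m := n.*2.+1.
Implicit Types a : Defs.index M.
Local Notation D := (@half_cylinder R).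
Context {w : R * R -> M} (inst : contact_instanton lam J D w)
  (wb : bounded_differential lam J D w).
Local Notation inner := (@inner R n M w).
Local Notation pA := (@pA R n M lam w).
Local Notation pB := (@pB R n M lam w).
Local Notation pE := (@pE R n M lam J w).
Local Notation Q := (asymptotic_charge lam w).
Local Notation T := (asymptotic_action lam J w).

Let hA : half_smooth pA := pA_half_smooth inst.
Let hB : half_smooth pB := pB_half_smooth inst.
Let hE : half_smooth pE := pE_half_smooth tr inst.
Let SA : smooth_on posp pA := half_smooth_pos hA.
Let SB : smooth_on posp pB := half_smooth_pos hB.
Let SE : smooth_on posp pE := half_smooth_pos hE.

Let ptdt (x t : R) : (x, t + 1) = (x, t) + d_t R :> R * R.
Proof. by apply: injective_projections; rewrite /= ?addr0. Qed.

Lemma pE_derivs_bounded beta : exists C : R, forall x : R * R, 1 <= x.1 ->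
  `|itD beta pE x| <= C.
Proof.
have [C HC] := energy_unif tr compactM inst wb beta; exists C => x x1.
have Ix := @inner_chart _ _ _ w x (lt_le_trans ltr01 x1).
apply: le_trans (HC x _ x1 Ix); rewrite le_eqVlt; apply/orP; left; apply/eqP.
apply: (f_equal (fun t : R => `|t|)).
apply: (itD_ext beta (@inner_open _ _ _ _ _ _ inst _) _ Ix) => y Iy.
exact: (pE_inner tr inst Iy).
Qed.

(** Landau's inequality for [sliceI pB]: it converges, so its increments are small, and its
    derivative [sliceI pE] is Lipschitz. *)
Lemma sliceI_pE_decays (e : R) : 0 < e -> exists2 N : R, 1 <= N &
  forall tau, N <= tau -> sliceI pE tau <= e.
Proof.
move=> e0; have [L HL] := pE_derivs_bounded [:: false].
have L0 : 0 <= L by apply: le_trans (normr_ge0 _) (HL (1, 0) _).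
have [h [d [h0 h1 d0 H]]] := landau_small e0 L0 ltr01.
have cvB := sliceI_pB_cvg tr inst wb.
have d2 : 0 < d / 2 by rewrite divr_gt0.
move/cvgrPdist_le : cvB => /(_ _ d2) [N0 [_ HN]].
pose N := Num.max 1 (N0 + 1).
exists N => [|tau Nt]; first by rewrite le_max lexx.
have t1 : 1 <= tau by apply: le_trans Nt; rewrite le_max lexx.
have tN : N0 < tau by apply: lt_le_trans Nt; rewrite lt_max ltrDl ltr01 orbT.
have tp (k : R) : 0 <= k -> 0 < tau + k by move=> k0; move: t1; lra.
have Dp (x : R) : 0 < x -> 'D_1 (sliceI pB) x = sliceI pE x.
  by move=> x0; have [_] := sliceI_pB_derive tr inst x0.
have sh (s : R) : 0 <= s <= 1 -> 0 <= s * h by move=> /andP[s0 _]; rewrite mulr_ge0// ltW.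
have ep (s : R) : tau + (s * h) *: (1 : R) = tau + s * h by rewrite [_ *: _]mulr1.
rewrite -[leLHS]ger0_norm; last exact: (sliceI_pE_ge0 tr inst).
rewrite -Dp; last by rewrite -[tau]addr0 tp.
apply: H.
- by move=> s s01; have [] := sliceI_pB_derive tr inst (tp _ (sh s s01)); rewrite -ep.
- move=> s s01; rewrite ep !Dp; [|by rewrite -[tau]addr0 tp|by apply/tp/sh].
  have cs x : continuous (fun t => (pE \o clamp) (x, t)).
    by apply: slice_continuous => t; exact: (half_smooth_clamp hE).
  rewrite -I01B//; apply: I01_norm_le => [t|t _].
    by apply: cvgB; exact: cs.
  rewrite /= !clamp_id; [|by apply: ltW; rewrite -[tau]addr0 tp|by apply/ltW/tp/sh].
  have pt (k : R) : (tau, t) + k *: dd false = (tau + k, t) :> R * R.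
    by apply: injective_projections; rewrite /= /GRing.scale/= ?mulr1 ?mulr0 ?addr0.
  have [c /andP[c0 c1]|c /andP[c0 c1]] := mvt_line (f := pE) (x := (tau, t)) (v := dd false) (sh s s01).
    have [] // := CkS_is_derive (dd false) (SE 1%N) (_ : posp ((tau, t) + c *: dd false)).
    by rewrite pt; exact: tp.
  rewrite !pt => ->; rewrite normrM (ger0_norm (sh s s01)) mulrC.
  have /andP[s0 s1] := s01.
  apply: ler_pM => //; first exact: sh.
    by apply: (HL (tau + c, t)); rewrite /=; move: t1 c0; lra.
  by rewrite -[leRHS]mul1r ler_wpM2r// ltW.
- have H1 := HN tau tN; have H2 : `|T - sliceI pB (tau + h)| <= d / 2 by apply: HN; move: tN h0; lra.
  rewrite [h *: _]mulr1.
  exact: dist_half H1 H2.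
Qed.

Lemma pE_decays : decays pE.
Proof.
move=> e e0; have [C HC] := pE_derivs_bounded [::]; have [L HL] := pE_derivs_bounded [:: true].
have L0 : 0 <= L by apply: le_trans (normr_ge0 _) (HL (1, 0) _).
have C0 : 0 <= C by apply: le_trans (normr_ge0 _) (HC (1, 0) _).
have CL : 0 < C + 2 * L + 1 by move: C0 L0; lra.
have ee : 0 < e * e / (C + 2 * L + 1) by rewrite divr_gt0// mulr_gt0.
have [N N1 HN] := sliceI_pE_decays ee; exists N => // -[tau t] /= Nt.
have t1 : 1 <= tau by exact: le_trans Nt.
have tp : 0 < tau by exact: lt_le_trans t1.
have Dt : D (tau, t) by exact: ltW.
have per u : pE (tau, u + 1) = pE (tau, u) by rewrite ptdt (pE_periodic inst).
have [s s01 ->] := periodic_int per t.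
have Dh u : is_derive u (1 : R) (fun u => pE (tau, u)) ('D_(dd true) pE (tau, u)).
  by apply: is_derive_slice; exact: CkS_is_derive (SE 1%N) _.
have cdh := pos_slice_continuous (CkS_derive (dd true) (SE 1%N)) tp.
have E0 u : 0 <= pE (tau, u) by apply: (pE_ge0 tr); exact: ltW.
have /andP[s0 _] := s01.
have := periodic_sup (C := C) (L := L) Dh cdh per _ _ s0.
rewrite -sliceIE ?(ltW tp)// => /(_ _ _)/le_trans H.
have : pE (tau, s) * pE (tau, s) <= e * e.
  apply: H => [u|u|]; first by rewrite E0/=; apply: le_trans (ler_norm _) (HC (tau, u) t1).
    exact: (HL (tau, u) t1).
  have := HN tau Nt; rewrite ler_pdivlMr// => H.
  apply: le_trans H; rewrite mulrC ler_wpM2l//; first exact: (sliceI_pE_ge0 tr inst).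
  by rewrite lerDl.
rewrite -!expr2 ler_sqr ?nnegrE ?E0// ?(ltW e0)// => H'.
by rewrite ger0_norm.
Qed.

Lemma pE_derivs_decay beta : decays (itD beta pE).
Proof.
elim: beta => [|b beta IH]; first exact: pE_decays.
have [L HL] := pE_derivs_bounded [:: b, b & beta].
exact: (decays_der (smooth_itD beta SE) IH HL).
Qed.

Let posE (f g : R * R -> R) b : (forall y, posp y -> f y = g y) ->
  forall q, posp q -> 'D_(dd b) f q = 'D_(dd b) g q.
Proof. by move=> fg q q0; exact: (D_ext_open posp_open (dd b) q0 fg). Qed.

Let dA y : posp y -> 'D_(dd false) pA y = - 'D_(dd true) pB y.
Proof. by move=> y0; apply/eqP; rewrite -addr_eq0; apply/eqP; exact: (pAB_closed inst y0). Qed.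

Let dB y : posp y -> 'D_(dd false) pB y = pE y + 'D_(dd true) pA y.
Proof. by move=> y0; apply/eqP; rewrite -subr_eq; apply/eqP; exact: (pAB_area tr inst y0). Qed.

Lemma lap_pA q : posp q -> lap pA q = - 'D_(dd true) pE q.
Proof.
move=> q0.
have SBt := smooth_derive (dd true) SB; have SAt := smooth_derive (dd true) SA.
have E1 : 'D_(dd false) ('D_(dd false) pA) q = - 'D_(dd false) ('D_(dd true) pB) q.
  apply: (etrans (posE false dA q0)).
  by have [_] := is_deriveN (CkS_is_derive (dd false) (SBt 1%N) q0).
have E2 : 'D_(dd false) ('D_(dd true) pB) q = 'D_(dd true) pE q + 'D_(dd true) ('D_(dd true) pA) q.
  apply: (etrans (schwarz (dd false) (dd true) posp_open q0 (SB 2%N))).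
  apply: (etrans (posE true dB q0)).
  exact: (D1_add (dd true) (SE 1%N) (SAt 1%N) q0).
have S (x y z u v : R) : x = - y -> y = z + u -> x + u = - z by move=> -> ->; ring.
exact: (S _ _ _ _ 0 E1 E2).
Qed.

Lemma lap_pB q : posp q -> lap pB q = 'D_(dd false) pE q.
Proof.
move=> q0.
have SBt := smooth_derive (dd true) SB; have SAt := smooth_derive (dd true) SA.
have E1 : 'D_(dd false) ('D_(dd false) pB) q = 'D_(dd false) pE q + 'D_(dd false) ('D_(dd true) pA) q.
  apply: (etrans (posE false dB q0)).
  exact: (D1_add (dd false) (SE 1%N) (SAt 1%N) q0).
have E2 : 'D_(dd false) ('D_(dd true) pA) q = - 'D_(dd true) ('D_(dd true) pB) q.
  apply: (etrans (schwarz (dd false) (dd true) posp_open q0 (SA 2%N))).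
  apply: (etrans (posE true dA q0)).
  by have [_] := is_deriveN (CkS_is_derive (dd true) (SBt 1%N) q0).
have S (x y z u : R) : x = z + y -> y = - u -> x + u = z by move=> -> ->; ring.
exact: (S _ _ _ _ E1 E2).
Qed.

Let p1 (x : R * R) : 1 <= x.1 -> posp x. Proof. exact: lt_le_trans. Qed.

Lemma pA_grad_decays b : decays ('D_(dd b) pA).
Proof.
have [C C0 HC] := pAB_bounded tr inst wb.
apply: (harmonic_decay SA (C := C)).
- by move=> x /ltW Dx; have [] := HC x Dx.
- apply: decays_ext (decaysN (pE_derivs_decay [:: true])) => x /p1 x1.
  by rewrite lap_pA.
- move=> c; apply: decays_ext (decaysN (pE_derivs_decay [:: c; true])) => x /p1 x1.
  apply/esym; apply: (etrans (posE c lap_pA x1)).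
  have St := smooth_derive (dd true) SE.
  by have [_] := is_deriveN (CkS_is_derive (dd c) (St 1%N) x1).
Qed.

Lemma pB_grad_decays b : decays ('D_(dd b) pB).
Proof.
have [C C0 HC] := pAB_bounded tr inst wb.
apply: (harmonic_decay SB (C := C)).
- by move=> x /ltW Dx; have [] := HC x Dx.
- apply: decays_ext (pE_derivs_decay [:: false]) => x /p1 x1.
  by rewrite lap_pB.
- move=> c; apply: decays_ext (pE_derivs_decay [:: c; false]) => x /p1 x1.
  exact: (esym (posE c lap_pB x1)).
Qed.

(** Two points of the circle are at distance at most 1, so the deviation from the mean is at most
    the maximum of the t-derivative. *)
Lemma slice_osc (G : R * R -> R) (e : R) : half_smooth G ->
  (forall q, D q -> G (q + d_t R) = G q) -> decays ('D_(dd true) G) -> 0 < e ->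
  exists2 N : R, 1 <= N & forall x : R * R, N <= x.1 -> `|G x - sliceI G x.1| <= e.
Proof.
move=> hG per dG e0; have [N N1 HN] := dG e e0; exists N => // -[tau t] /= Nt.
have tp : 0 < tau by apply: lt_le_trans Nt; exact: lt_le_trans N1.
have Dt u : D (tau, u) by exact: ltW.
have peru u : G (tau, u + 1) = G (tau, u) by rewrite ptdt per.
have [s s01 ->] := periodic_int peru t.
have SG := half_smooth_pos hG.
have cG := pos_slice_continuous (SG 0%N) tp.
rewrite sliceIE; last exact: ltW.
rewrite -[X in `|X - _|](I01_cst (G (tau, s))) -I01B//; last by move=> z; exact: cvg_cst.
apply: I01_norm_le => [z|u u01]; first by apply: cvgB; [exact: cvg_cst|exact: cG].
have pt (k : R) : (tau, u) + k *: dd true = (tau, u + k) :> R * R by exact: pt_line.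
have [c c01|c c01 E] := mvt_lineh (f := G) (x := (tau, u)) (v := dd true) (h := s - u).
  have [] // := CkS_is_derive (dd true) (SG 1%N) (_ : posp ((tau, u) + (c * (s - u)) *: dd true)).
  by rewrite pt.
move: E; rewrite !pt [u + _]addrC subrK => ->; rewrite normrM -[leRHS]mul1r.
apply: ler_pM => //; last exact: HN.
by move: s01 u01 => /andP[s0 s1] /andP[u0 u1]; rewrite ler_norml; apply/andP; split; lra.
Qed.

Lemma pA_decays : decays (fun x => pA x - (- Q)).
Proof.
move=> e e0; have [N N1 HN] := slice_osc hA (fun q => @pullback_periodic _ _ _ _ _ _ inst q _) (pA_grad_decays true) e0.
exists N => // x Nx; rewrite -(sliceI_pA inst (_ : 0 <= x.1)); first exact: HN.
by apply: le_trans Nx; exact: le_trans N1.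
Qed.

Lemma pB_decays : decays (fun x => pB x - T).
Proof.
move=> e e0; have e2 : 0 < e / 2 by rewrite divr_gt0.
have [N N1 HN] := slice_osc hB (fun q => @pullback_periodic _ _ _ _ _ _ inst q _) (pB_grad_decays true) e2.
have := sliceI_pB_cvg tr inst wb; move/cvgrPdist_le => /(_ _ e2) [N0 [_ HN0]].
exists (Num.max N (N0 + 1)) => [|x]; first by rewrite le_max N1.
rewrite ge_max => /andP[/HN H Nx].
have {}Nx : N0 < x.1 by apply: lt_le_trans Nx; rewrite ltrDl.
have H0 := HN0 x.1 Nx; rewrite /= distrC in H0; rewrite distrC in H.
exact: dist_half H0 H.
Qed.

End Asymptotics.

(** * The Reeb flow *)

Section CompactLipschitz.
Context {R : realType}.

Lemma compact_norm_bound (V W : normedModType R) (K : set V) (G : V -> W) : compact K ->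
  (forall x, K x -> {for x, continuous G}) -> exists2 C : R, 0 <= C & forall x, K x -> `|G x| <= C.
Proof.
move=> cK cG; have [||C HC] := @compact_bound R V K (fun p C => `|G p| <= C) cK.
- by move=> p C C' CC' /le_trans; apply.
- move=> p Kp; exists (`|G p| + 1); have [d d0 Hd] := (continuous_distP _ _).1 (cG p Kp) 1 ltr01.
  apply/nbhs_distP; exists d => // y /Hd /ltW H; rewrite -lerBlDl.
  exact: le_trans (lerB_dist _ _) H.
by exists `|C| => // x Kx; apply: le_trans (HC x Kx) (ler_norm _).
Qed.

Lemma ball_lipschitz m (B : set 'rV[R]_m) (x0 : 'rV[R]_m) (r : R) (G : 'rV[R]_m -> R) :
  open B -> [set x | `|x - x0| <= r] `<=` B -> Ck 1 B G -> exists2 L : R, 0 <= L &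
  forall y z, `|y - x0| <= r -> `|z - x0| <= r -> `|G y - G z| <= L * `|y - z|.
Proof.
move=> oB KB CG; set K := [set x | _] in KB.
have cK : compact K by exact: rV_ball_compact.
have H j : exists C : R, forall x, K x -> `|'D_(ev j) G x| <= C.
  have [x /KB Bx|C _ HC] := @compact_norm_bound _ _ K ('D_(ev j) G) cK; last by exists C.
  exact: Ck_cont (CkS_derive (ev j) CG) Bx.
have [C HC] := choice H.
exists (\sum_j `|C j|) => [|y z Ky Kz]; first exact: sumr_ge0.
have seg s : 0 <= s <= 1 -> K (z + s *: (y - z)).
  move=> /andP[s0 s1]; rewrite /K/=.
  have -> : z + s *: (y - z) - x0 = (1 - s) *: (z - x0) + s *: (y - x0).
    by apply/rowP => j; rewrite !mxE; ring.
  rewrite (le_trans (ler_normD _ _))// !normrZ (ger0_norm s0) ger0_norm ?subr_ge0//.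
  have T (p q : R) : p <= r -> q <= r -> (1 - s) * p + s * q <= r.
    move=> pr qr; rewrite [leRHS](_ : _ = (1 - s) * r + s * r); last by ring.
    by apply: lerD; rewrite ler_wpM2l// subr_ge0.
  exact: T.
have [s s01|s s01] := mvt_line1 (f := G) (x := z) (v := y - z).
  by have [] := CkS_is_derive (y - z) CG (KB _ (seg s s01)).
rewrite [z + _]addrC subrK => ->.
have [_ ->] := derive_dir_sum (y - z) oB (KB _ (seg s s01)) CG.
rewrite (le_trans (ler_norm_sum _ _ _))// mulr_suml; apply: ler_sum => j _.
rewrite normrM mulrC; apply: ler_pM => //; last exact: coord_le_norm.
by rewrite (le_trans (HC j _ (seg s s01)))// ler_norm.
Qed.

End CompactLipschitz.

(** * Primitives and geometric convergence *)

Section Primitive.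
Context {R : realType}.
Implicit Types g h : R -> R.
Local Notation mu := (@lebesgue_measure R).

(** The base point -1 puts 0 in the interior of the range of integration, so that the fundamental
    theorem gives two-sided derivatives for small times of either sign. *)
Definition prim g (t : R) : R :=
  \int[mu]_(s in `[(-1)%R, t]) g s - \int[mu]_(s in `[(-1)%R, 0]) g s.

Lemma prim0 g : prim g 0 = 0. Proof. exact: subrr. Qed.

Lemma is_derive_prim g (t : R) : continuous g -> -1 < t -> is_derive t (1 : R) (prim g) (g t).
Proof.
move=> cg t1; have tt1 : t < t + 1 by rewrite ltrDl.
have ig : mu.-integrable `[(-1)%R, (t + 1)%R] (EFin \o g).
  apply: continuous_compact_integrable; first exact: segment_compact.
  exact: continuous_subspaceT.
have [dF FE] := continuous_FTC1_closed tt1 ig t1 (cg t).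
have D : is_derive t (1 : R) (fun y => \int[mu]_(s in `[(-1)%R, y]) g s) (g t).
  by apply/is_deriveP; split; [exact: dF|rewrite -FE derive1E].
have D2 := is_deriveB D (is_derive_cst (\int[mu]_(s in `[(-1)%R, 0]) g s) t (1 : R)).
by apply: (is_derive_eq D2); rewrite subr0.
Qed.

Lemma prim_dist g h (t c : R) : continuous g -> continuous h -> `|t| < 1 ->
  (forall s, `|s| <= `|t| -> `|g s - h s| <= c) -> `|prim g t - prim h t| <= `|t| * c.
Proof.
move=> cg ch t1 H; pose k s := prim g s - prim h s.
have inb (s : R) : 0 <= s <= 1 -> `|s * t| <= `|t|.
  by move=> /andP[s0 s1]; rewrite normrM (ger0_norm s0) -[leRHS]mul1r ler_wpM2r.
have Dk (s : R) : `|s| <= `|t| -> is_derive s (1 : R) k (g s - h s).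
  move=> st; have s1 : -1 < s by have := le_lt_trans st t1; rewrite ltr_norml => /andP[].
  exact: is_deriveB (is_derive_prim cg s1) (is_derive_prim ch s1).
have ep (s : R) : 0 + s *: (1 : R) = s by rewrite add0r [_ *: _]mulr1.
have [s s01|s s01] := mvt_lineh (f := k) (x := 0) (v := 1 : R) (h := t).
  by rewrite ep; have [] := Dk _ (inb s s01).
rewrite !ep {2}/k !prim0 !subr0 -/(k t) => ->; rewrite normrM ler_wpM2l//.
by have [_ ->] := Dk _ (inb s s01); exact: H (inb s s01).
Qed.

(** The intervals of radius [2 * c * 2^-1 ^+ k] around [a k] are nested; the limit is the supremum
    of their left ends. *)
Lemma geometric_limit (a : nat -> R) (c : R) : 0 <= c ->
  (forall k, `|a k.+1 - a k| <= c * 2^-1 ^+ k) ->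
  exists l : R, forall k, `|l - a k| <= 2 * c * 2^-1 ^+ k.
Proof.
move=> c0 H; pose b k := a k - 2 * c * 2^-1 ^+ k; pose d k := a k + 2 * c * 2^-1 ^+ k.
have hh k : 2 * c * 2^-1 ^+ k = 2 * c * 2^-1 ^+ k.+1 + c * 2^-1 ^+ k.
  by rewrite exprSr mulrA -(mulrA 2) mulrAC; have := splitr (2 * (c * 2^-1 ^+ k)); lra.
have bS k : b k <= b k.+1.
  by have := H k; have := hh k; rewrite /b ler_norml => -> /andP[]; lra.
have dS k : d k.+1 <= d k.
  by have := H k; have := hh k; rewrite /d ler_norml => -> /andP[]; lra.
have pk k : 0 <= 2 * c * 2^-1 ^+ k by rewrite !mulr_ge0// exprn_ge0// invr_ge0.
have bm : {homo b : i j / (i <= j)%N >-> i <= j} by exact/nondecreasing_seqP.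
have dm : {homo d : i j / (i <= j)%N >-> j <= i} by exact/nonincreasing_seqP.
have bd i j : b i <= d j.
  apply: (le_trans (bm _ _ (leq_maxl i j))); apply: (le_trans _ (dm _ _ (leq_maxr i j))).
  by rewrite /b /d; have := pk (maxn i j); lra.
have hs : has_sup (range b) by split; [exists (b 0%N), 0%N|exists (d 0%N) => _ [i _ <-]].
exists (sup (range b)) => k; rewrite ler_distl; apply/andP; split.
  by apply: (sup_upper_bound hs); exists k.
by apply: ge_sup => [|_ [i _ <-]]; [case: hs|exact: bd].
Qed.

End Primitive.

(** * Picard iteration *)

Section Picard.
Context {R : realType} {m : nat} {f : 'rV[R]_m -> 'rV[R]_m} {C L delta : R}.
Hypotheses (C0 : 0 <= C) (L0 : 0 <= L) (d0 : 0 < delta) (d1 : delta < 1)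
  (dL : delta * L <= 2^-1) (fC : forall x, `|f x| <= C)
  (fL : forall x y, `|f x - f y| <= L * `|x - y|).
Variable x0 : 'rV[R]_m.

Let fcont : continuous f.
Proof.
move=> x; apply/continuous_distP => e e0; have L1 : 0 < L + 1 by rewrite ltr_pwDr.
exists (e / (L + 1)); first by rewrite divr_gt0.
move=> y; rewrite ltr_pdivlMr// => yx; apply: (le_lt_trans (fL y x)).
apply: le_lt_trans yx; rewrite mulrC ler_wpM2l// lerDl//.
Qed.

(** Time frozen outside [[- delta, delta]]: the iterates are then continuous on the whole line and
    the contraction estimate holds at all times. *)
Let cl (t : R) : R := Num.max (- delta) (Num.min t delta).

Let cl_le t : `|cl t| <= delta.
Proof.
rewrite ler_norml /cl le_max lexx/= ge_max ge_min lexx orbT andbT.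
by move: d0; lra.
Qed.

Let cl_lt1 t : `|cl t| < 1. Proof. exact: le_lt_trans (cl_le t) d1. Qed.

Let cl_id t : `|t| < delta -> cl t = t.
Proof.
by rewrite ltr_norml => /andP[a b]; rewrite /cl min_l ?max_r// ltW.
Qed.

Let cl_cont : continuous cl.
Proof.
move=> t; apply/continuous_distP => e e0; exists e => // y.
rewrite !ltr_distl /cl /Num.max /Num.min; move: d0; do 4 case: ifP; lra.
Qed.

Let step (x : R -> 'rV[R]_m) (t : R) : 'rV[R]_m :=
  x0 + \row_j prim (fun s => f (x s) 0 j) (cl t).

Let fx_cont (x : R -> 'rV[R]_m) j : continuous x -> continuous (fun s => f (x s) 0 j).
Proof.
move=> cx s; have cfx : {for s, continuous (f \o x)} by apply: continuous_comp; [exact: cx|exact: fcont].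
exact: ((continuous_rVP _ _).1 cfx j).
Qed.

Let prim_cl_cont (g : R -> R) : continuous g -> continuous (fun t => prim g (cl t)).
Proof.
move=> cg t; apply: continuous_comp; first exact: cl_cont.
apply: differentiable_continuous; apply/derivable1_diffP.
have c1 : -1 < cl t by have := cl_lt1 t; rewrite ltr_norml => /andP[].
by have [] := is_derive_prim cg c1.
Qed.

Let step_cont (x : R -> 'rV[R]_m) : continuous x -> continuous (step x).
Proof.
move=> cx t; apply/continuous_rVP => j.
rewrite (_ : (fun y => _) = (fun y => x0 0 j + prim (fun s => f (x s) 0 j) (cl y))).
  by apply: cvgD; [exact: cvg_cst|apply: prim_cl_cont; exact: fx_cont].
by apply/funext => y; rewrite !mxE.
Qed.

Let step_dist (x y : R -> 'rV[R]_m) (c : R) t : continuous x -> continuous y -> 0 <= c ->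
  (forall s, `|x s - y s| <= c) -> `|step x t - step y t| <= 2^-1 * c.
Proof.
move=> cx cy c0 xy; rewrite /step opprD addrACA subrr add0r.
apply: rV_norm_le => [|j]; first by rewrite mulr_ge0// invr_ge0.
rewrite !mxE; apply: (@le_trans _ _ (`|cl t| * (L * c))).
  apply: prim_dist; [exact: fx_cont|exact: fx_cont|exact: cl_lt1|].
  move=> s _; have := coord_le_norm (f (x s) - f (y s)) j; rewrite !mxE => /le_trans; apply.
  by apply: (le_trans (fL _ _)); rewrite ler_wpM2l.
by rewrite mulrA ler_wpM2r//; apply: le_trans dL; rewrite ler_wpM2r.
Qed.

Let pic (k : nat) : R -> 'rV[R]_m := iter k step (fun=> x0).

Let pic_cont k : continuous (pic k).
Proof. by elim: k => [|k IH]; [move=> t; exact: cvg_cst|exact: step_cont]. Qed.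

Let pic_step k t : `|pic k.+1 t - pic k t| <= C * 2^-1 ^+ k.
Proof.
elim: k t => [|k IH] t.
  rewrite expr0 mulr1 /pic/= /step addrAC subrr add0r.
  apply: rV_norm_le => // j; rewrite mxE.
  have c0 (k : R) : continuous (fun _ : R => k) by move=> z; exact: cvg_cst.
  have p0 : prim (fun=> 0) (cl t) = 0 :> R by rewrite /prim !Rintegral_cst// !mul0r subrr.
  rewrite -[prim _ _]subr0 -p0; apply: (@le_trans _ _ (`|cl t| * C)).
    apply: prim_dist; [exact: c0|exact: c0|exact: cl_lt1|].
    by move=> s _; rewrite subr0; exact: le_trans (coord_le_norm _ _) (fC _).
  by rewrite -[leRHS]mul1r ler_wpM2r// ltW// cl_lt1.
have Ck0 : 0 <= C * 2^-1 ^+ k by rewrite mulr_ge0// exprn_ge0// invr_ge0.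
by rewrite exprS mulrCA; exact: (step_dist t (@pic_cont k.+1) (@pic_cont k) Ck0 IH).
Qed.

Lemma picard_exists : exists x : R -> 'rV[R]_m, x 0 = x0 /\
  forall t, `|t| < delta -> is_derive t (1 : R) x (f (x t)).
Proof.
have H t j : exists l : R, forall k, `|l - pic k t 0 j| <= 2 * C * 2^-1 ^+ k.
  apply: geometric_limit => // k; apply: le_trans (pic_step k t).
  by have := coord_le_norm (pic k.+1 t - pic k t) j; rewrite !mxE.
have H2 t := choice (H t).
pose l t := projT1 (H2 t); have Hl t := projT2 (H2 t).
pose x t := \row_j l t j.
have e_ge0 k : 0 <= 2 * C * 2^-1 ^+ k by rewrite !mulr_ge0// exprn_ge0// invr_ge0.
have xp t k : `|x t - pic k t| <= 2 * C * 2^-1 ^+ k.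
  by apply: rV_norm_le => // j; rewrite !mxE; exact: Hl.
have small (e : R) : 0 < e -> exists k : nat, 2 * C * 2^-1 ^+ k < e.
  move=> e0; have C1 : 0 < 2 * C + 1 by rewrite ltr_wpDl// mulr_ge0.
  have h1 : `|2^-1 : R| < 1 by rewrite ger0_norm ?invr_ge0// invf_lt1// ltr1n.
  move/cvgrPdist_lt: (cvg_expr h1) => /(_ _ (divr_gt0 e0 C1)) [N _ /(_ N)/=].
  rewrite leqnn => /(_ isT); rewrite sub0r normrN ger0_norm; last by rewrite exprn_ge0// invr_ge0.
  rewrite ltr_pdivlMr// => HN; exists N; apply: le_lt_trans HN.
  by rewrite mulrC ler_wpM2l ?lerDl// exprn_ge0// invr_ge0.
have cx : continuous x.
  move=> t; apply/continuous_distP => e e0; have e3 : 0 < e / 3 by rewrite divr_gt0.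
  have [k Hk] := small _ e3.
  have [d dp Hd] := (continuous_distP _ _).1 (@pic_cont k t) _ e3.
  exists d => // y /Hd yd; have A1 := xp y k; have A2 := xp t k.
  rewrite (_ : x y - x t = (x y - pic k y) + (pic k y - pic k t) - (x t - pic k t)); last first.
    by rewrite addrA subrK opprB addrA subrK.
  rewrite (le_lt_trans (ler_normB _ _))//.
  have := ler_normD (x y - pic k y) (pic k y - pic k t).
  by move: A1 A2 yd Hk; move: `|x y - pic k y + _| `|x y - _| `|x t - _| `|pic k y - _| => *; lra.
have fix_x t : x t = step x t.
  apply/eqP; rewrite -subr_eq0 -normr_le0; apply/ler_addgt0Pl => e e0; rewrite addr0.
  have e2 : 0 < e / 2 by rewrite divr_gt0.
  have [k Hk] := small _ e2.
  rewrite -(subrKA (pic k.+1 t)) (le_trans (ler_normD _ _))//.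
  have A1 := xp t k.+1.
  have A2 : `|step (pic k) t - step x t| <= 2^-1 * (2 * C * 2^-1 ^+ k).
    by apply: step_dist => // s; rewrite distrC.
  have hS : 2 * C * 2^-1 ^+ k.+1 = 2^-1 * (2 * C * 2^-1 ^+ k) by rewrite exprS mulrCA.
  move: A1 A2 Hk; rewrite hS -[pic k.+1 t]/(step (pic k) t).
  move: (2 * C * _) `|x t - _| `|_ - step x t| => p q r; lra.
exists x; split.
  rewrite fix_x /step cl_id ?normr0//; apply/rowP => j.
  by rewrite !mxE prim0 addr0.
move=> t td; have t1 : -1 < t by have := lt_trans td d1; rewrite ltr_norml => /andP[].
apply/is_derive_rVP => j.
have D := is_derive_prim (@fx_cont x j cx) t1.
have D2 := is_deriveD (is_derive_cst (x0 0 j) t (1 : R)) D; rewrite add0r in D2.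
apply/is_derive_distP => e e0; have [d dp Hd] := (is_derive_distP _ _ _ _).1 D2 e e0.
exists (Num.min d (delta - `|t|)); first by rewrite lt_min dp subr_gt0.
move=> h; rewrite lt_min => /andP[hd ht] h0.
have xE s : `|s| < delta -> x s 0 j = x0 0 j + prim (fun s => f (x s) 0 j) s.
  by move=> sd; rewrite [in LHS]fix_x /step cl_id// !mxE.
have th : `|t + h *: (1 : R)| < delta.
  rewrite [h *: _]mulr1 (le_lt_trans (ler_normD _ _))//; move: ht; lra.
by rewrite !xE//; exact: Hd.
Qed.

End Picard.

Section BoxProjection.
Context {R : realType} {m : nat} (x0 : 'rV[R]_m) (r : R).

(** A nonexpansive retraction onto the sup-norm ball. A vector field composed with it becomes
    globally bounded and Lipschitz, and is unchanged for trajectories that stay in the ball. *)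
Definition box_proj (y : 'rV[R]_m) : 'rV[R]_m :=
  \row_j Num.max (x0 0 j - r) (Num.min (y 0 j) (x0 0 j + r)).

Lemma box_proj_in y : 0 <= r -> `|box_proj y - x0| <= r.
Proof.
move=> r0; apply: rV_norm_le => // j; rewrite !mxE ler_distl le_max lexx/= ge_max ge_min lexx orbT andbT.
by move: r0; lra.
Qed.

Lemma box_proj_id y : `|y - x0| <= r -> box_proj y = y.
Proof.
move=> yr; apply/rowP => j; rewrite !mxE.
have := coord_le_norm (y - x0) j; rewrite !mxE => /le_trans/(_ yr).
by rewrite ler_distl => /andP[a b]; rewrite min_l ?max_r.
Qed.

Lemma box_proj_dist y z : 0 <= r -> `|box_proj y - box_proj z| <= `|y - z|.
Proof.
move=> r0; apply: rV_norm_le => // j; have := coord_le_norm (y - z) j; rewrite !mxE.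
move=> H; apply: le_trans H; move: (x0 0 j) (y 0 j) (z 0 j) => a b c.
have := ler_norm (b - c); have := ler_norm (c - b); rewrite (distrC c b) ler_norml.
move: `|b - c| r0 => d; rewrite /Num.max /Num.min; do 4 case: ifP; lra.
Qed.

End BoxProjection.

(** * Global Reeb trajectories *)

Section ReebFlow.
Context {R : realType} {n : nat} {M : manifold R n.*2.+1} {lam : one_form M}
  {J : endo_field M} (tr : contact_triad lam J) (compactM : compact [set: M]).
Local Notation m := n.*2.+1.
Implicit Types a b : Defs.index M.

(** [reeb_trajectory] localised at one time, so that pieces can be glued; [traj_param] shows that
    checking one chart suffices. *)
Definition traj_at (c : R -> M) (t : R) := {for t, continuous c} /\
  forall a, Defs.dom a (c t) ->
    is_derive t (1 : R) (@Defs.coord R m M a \o c) (reeb lam a (Defs.coord a (c t))).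

Lemma traj_param a (x : R -> 'rV[R]_m) (t : R) : cdom a (x t) ->
  is_derive t (1 : R) x (reeb lam a (x t)) -> traj_at (@Defs.param R m M a \o x) t.
Proof.
move=> Ax Dx.
have cx : {for t, continuous x}.
  by apply: differentiable_continuous; apply/derivable1_diffP; have [] := Dx.
split; first by apply: continuous_comp => //; exact: param_continuous.
move=> b bp; have ov : overlap a b (x t).
  by have [p ap px] := Ax; exists p => //; split=> //; move: bp; rewrite /= -px coordK.
have D := is_derive_trans ov Dx; apply: (is_derive_eq D).
exact: (reeb_trans tr ov).
Qed.

Lemma traj_shift (c : R -> M) (b t : R) : traj_at c (b + t) -> traj_at (fun s => c (b + s)) t.
Proof.
move=> [cc Dc]; split.
  apply: (@continuous_comp _ _ _ (fun s => b + s) c) => //.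
  by apply: cvgD; [exact: cvg_cst|exact: cvg_id].
move=> a ac; have := (line_derive (@Defs.coord R m M a \o c) b (1 : R) t _).1.
rewrite [t *: 1]mulr1 => /(_ _ (Dc a ac)).
rewrite (_ : (fun _ => _) = @Defs.coord R m M a \o (fun s => c (b + s)))//.
by apply/funext => k; rewrite /= [k *: 1]mulr1.
Qed.

(** The existence time is written as [C^-1] because enlarging [C] weakens the claim, which is the
    monotonicity that [compact_bound] asks for. *)
Lemma local_flow (p : M) : exists C : R, \forall q \near p, 0 < C /\
  exists c : R -> M, c 0 = q /\ forall t, `|t| < C^-1 -> traj_at c t.
Proof.
set a := chart_at p; set x0 := Defs.coord a p.
have ap : Defs.dom a p by exact: chart_at_dom.
have Ax0 : cdom a x0 by exists p.
have [rho rho0 KA] := chart_ball Ax0; set K := [set x | _] in KA.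
have oA := @cdom_open _ _ _ a.
have cK : compact K by exact: rV_ball_compact.
have SX := smooth_reeb tr a.
have Lj j : exists L : R, 0 <= L /\ forall y z, K y -> K z ->
    `|reeb lam a y 0 j - reeb lam a z 0 j| <= L * `|y - z|.
  have [|L L0 HL] := ball_lipschitz oA KA (G := fun y => reeb lam a y 0 j).
    exact: ((Ck_rVP _ _ oA).1 (SX 1%N) j).
  by exists L; split=> // y z Ky Kz; exact: HL.
have [Lf HLf] := choice Lj.
pose L := \sum_j Lf j; have L0 : 0 <= L by apply: sumr_ge0 => j _; case: (HLf j).
have [x /KA Ax|C C0 HC] := @compact_norm_bound R _ _ K (reeb lam a) cK.
  exact: Ck_cont (SX 0%N) Ax.
(* [N^-1] is less than 1, contracts since [N^-1 * L <= 1/2], and satisfies [N^-1 * C <= rho], so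
   that trajectories starting within [rho] of [x0] stay in [K]. *)
pose N := 2 + 2 * L + C / rho.
have Cr : 0 <= C / rho by rewrite divr_ge0// ltW.
have N2 : 2 <= N by rewrite /N -addrA lerDl addr_ge0// mulr_ge0.
have N0 : 0 < N by exact: lt_le_trans N2.
have r2 : 0 <= 2 * rho by rewrite mulr_ge0// ltW.
pose f y := reeb lam a (box_proj x0 (2 * rho) y).
have fK y : K (box_proj x0 (2 * rho) y) by exact: box_proj_in.
have fC y : `|f y| <= C by apply: HC; exact: fK.
have fL y z : `|f y - f z| <= L * `|y - z|.
  apply: rV_norm_le => [|j]; first by rewrite mulr_ge0.
  rewrite !mxE; have [Lj0 H] := HLf j; apply: (le_trans (H _ _ (fK y) (fK z))).
  apply: ler_pM => //; last exact: box_proj_dist.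
  by rewrite /L (bigD1 j)//= lerDl sumr_ge0// => i _; case: (HLf i).
have Ni0 : 0 < N^-1 by rewrite invr_gt0.
have Ni1 : N^-1 < 1 by rewrite invf_lt1//; apply: lt_le_trans N2; rewrite ltr1n.
have NL : N^-1 * L <= 2^-1.
  rewrite mulrC ler_pdivrMr// mulrC ler_pdivlMr// mulrC.
  by move: Cr L0; rewrite /N; lra.
have NC : N^-1 * C <= rho.
  rewrite mulrC ler_pdivrMr// mulrC -ler_pdivrMr//.
  by move: L0; rewrite /N; lra.
exists N.
have near_a : \forall q \near p, Defs.dom a q /\ `|Defs.coord a q - x0| < rho.
  apply: filterI; first by apply: open_nbhs_nbhs; split=> //; exact: dom_open.
  have cp := Defs.coord_continuous ap.
  by apply: (cp [set z | `|z - x0| < rho]); apply: open_nbhs_nbhs; split; [exact: open_dist_lt|rewrite /= subrr normr0].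
apply: (@filterS _ (nbhs p) _ _ _ _ near_a) => q [aq qr]; split=> //.
set y0 := Defs.coord a q in qr.
have [x [x00 Dx]] := picard_exists C0 L0 Ni0 Ni1 NL fC fL y0.
exists (@Defs.param R m M a \o x); split; first by rewrite /= x00 coordK.
move=> t tN.
have xb : `|x t - y0| <= rho.
  apply: rV_norm_le => [|j]; first exact: ltW.
  have inb (s : R) : 0 <= s <= 1 -> `|s * t| <= `|t|.
    by move=> /andP[s0 s1]; rewrite normrM (ger0_norm s0) -[leRHS]mul1r ler_wpM2r.
  have ep (s : R) : 0 + s *: (1 : R) = s by rewrite add0r [_ *: _]mulr1.
  have Dj (s : R) : 0 <= s <= 1 -> is_derive (s * t) (1 : R) (fun u => x u 0 j) (f (x (s * t)) 0 j).
    move=> s01; have st := le_lt_trans (inb s s01) tN.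
    exact: ((is_derive_rVP _ _ _ _).1 (Dx _ st) j).
  have [s s01|s s01] := mvt_lineh (f := fun u => x u 0 j) (x := 0) (v := 1 : R) (h := t).
    by rewrite ep; have [] := Dj s s01.
  rewrite !ep x00 !mxE => ->; rewrite normrM; apply: le_trans NC.
  apply: ler_pM => //; first exact: ltW.
  have [_ ->] := Dj s s01; exact: le_trans (coord_le_norm _ _) (fC _).
have Kx : K (x t).
  rewrite /K/= -(subrKA y0) (le_trans (ler_normD _ _))// mulr2n mulrDl mul1r.
  by rewrite lerD// ltW.
apply: traj_param; first exact: KA.
by have := Dx t tN; rewrite /f box_proj_id.
Qed.

Lemma uniform_flow : exists2 eta : R, 0 < eta & forall q : M, exists c : R -> M,
  c 0 = q /\ forall t, `|t| <= eta -> traj_at c t.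
Proof.
pose P (q : M) (C : R) := 0 < C /\
  exists c : R -> M, c 0 = q /\ forall t, `|t| < C^-1 -> traj_at c t.
have [||C HC] := @compact_bound R M setT P compactM.
- move=> q C C' CC' [C0 [c [c0 Hc]]]; have C'0 : 0 < C' by exact: lt_le_trans CC'.
  split=> //; exists c; split=> // t tC; apply: Hc; apply: lt_le_trans tC _.
  by rewrite lef_pV2.
- by move=> p _; exact: local_flow.
have [[q _]|E] := pselect (exists q : M, True); last first.
  by exists 1 => // q; case: E; exists q.
have [C0 _] := HC q I.
exists (C^-1 / 2) => [|q']; first by rewrite divr_gt0// invr_gt0.
have [_ [c [c0 Hc]]] := HC q' I; exists c; split=> // t tC; apply: Hc.
by apply: (le_lt_trans tC); rewrite ltr_pdivrMr// ltr_pMr ?ltr1n// invr_gt0.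
Qed.

Lemma traj_glue (c c1 c2 : R -> M) (s d : R) : 0 < d ->
  (forall t, s - d < t -> t < s -> c t = c1 t) -> (forall t, s <= t -> t < s + d -> c t = c2 t) ->
  traj_at c1 s -> traj_at c2 s -> c1 s = c2 s -> traj_at c s.
Proof.
move=> d0 H1 H2 [cc1 D1] [cc2 D2] E; have sd : s < s + d by rewrite ltrDl.
have c2E : c s = c2 s by apply: H2.
have c1E : c s = c1 s by rewrite E.
split.
  move=> U nU; rewrite c1E in nU; have /nbhs_distP[d1 d10 B1] := cc1 U nU.
  rewrite -c1E c2E in nU; have /nbhs_distP[d2 d20 B2] := cc2 U nU.
  apply/nbhs_distP; exists (Num.min d (Num.min d1 d2)); first by rewrite !lt_min d0 d10.
  move=> t; rewrite !lt_min => /and3P[td td1 td2].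
  move: td; rewrite ltr_distl => /andP[ta tb].
  have [ts|ts] := ltP t s; first by rewrite /= H1//; exact: B1.
  by rewrite /= H2//; exact: B2.
move=> a ac; apply/is_derive_distP => e e0.
have ac1 : Defs.dom a (c1 s) by rewrite -c1E.
have ac2 : Defs.dom a (c2 s) by rewrite -c2E.
have [d1 d10 B1] := (is_derive_distP _ _ _ _).1 (D1 a ac1) e e0.
have [d2 d20 B2] := (is_derive_distP _ _ _ _).1 (D2 a ac2) e e0.
exists (Num.min d (Num.min d1 d2)); first by rewrite !lt_min d0 d10.
move=> h; rewrite !lt_min => /and3P[hd hd1 hd2] h0.
have hE : s + h *: (1 : R) = s + h by rewrite [_ *: _]mulr1.
move: (hd); rewrite ltr_norml => /andP[ha hb].
have [hs|hs] := ltP h 0.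
  have h1 : s - d < s + h by rewrite ltrD2l.
  have h2 : s + h < s by rewrite gtrDl.
  by have := B1 h hd1 h0; rewrite /= hE -(H1 _ h1 h2) -c1E.
have h1 : s <= s + h by rewrite lerDl.
have h2 : s + h < s + d by rewrite ltrD2l.
by have := B2 h hd2 h0; rewrite /= hE -(H2 _ h1 h2) -c2E.
Qed.

Lemma reeb_flow (p : M) : exists gamma : R -> M, gamma 0 = p /\ reeb_trajectory lam gamma.
Proof.
have [eta eta0 H] := uniform_flow; have [e He] := choice H.
have e0 q : e q 0 = q by have [] := He q.
have et q t : `|t| <= eta -> traj_at (e q) t by have [_] := He q; exact.
pose P (j : nat) : M := iter j (fun q => e q eta) p.
pose N (j : nat) : M := iter j (fun q => e q (- eta)) p.
(* The piece on [[k eta, (k + 1) eta]] is anchored at its left end for [k >= 0] and, for [Negz j],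
   at its right end [- j eta]: both half-lines are built outwards from [p]. *)
pose c (k : int) (t : R) : M := match k with
  | Posz j => e (P j) (- (j%:R * eta) + t) | Negz j => e (N j) (j%:R * eta + t) end.
have ct k t : k%:~R * eta <= t <= (k + 1)%:~R * eta -> traj_at (c k) t.
  rewrite intrD mulrDl mul1r; case: k => j.
    rewrite -[j%:~R]/(j%:R) => /andP[a b]; apply: traj_shift; apply: et.
    by rewrite ler_norml; move: a b eta0; lra.
  rewrite NegzE mulrNz -[j.+1%:~R]/(j.+1%:R) -natr1 => /andP[a b]; apply: traj_shift; apply: et.
  by rewrite ler_norml; move: a b eta0; lra.
have joint k : c k ((k + 1)%:~R * eta) = c (k + 1) ((k + 1)%:~R * eta).
  case: k => j.
    have -> : Posz j + 1 = Posz j.+1 by rewrite -PoszD addn1.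
    rewrite /c -[j.+1%:~R]/(j.+1%:R) addNr e0 -natr1.
    by rewrite (_ : - _ + _ = eta)//; ring.
  case: j => [|j].
    by rewrite (_ : Negz 0 + 1 = Posz 0)// /c -[0%:~R]/(0 : R) !mul0r oppr0 addr0 !e0.
  have -> : Negz j.+1 + 1 = Negz j by rewrite !NegzE -[in Posz j.+2]addn1 PoszD opprD subrK.
  rewrite /c NegzE mulrNz -[j.+1%:~R]/(j.+1%:R) mulNr subrr e0 -natr1.
  by rewrite (_ : _ + - _ = - eta)//; ring.
pose gamma t := c (Num.floor (t / eta)) t.
have gE k t : k%:~R * eta <= t -> t < (k + 1)%:~R * eta -> gamma t = c k t.
  move=> kt tk; rewrite /gamma (_ : Num.floor (t / eta) = k)//.
  by apply: floor_def; rewrite ler_pdivlMr// kt ltr_pdivrMr.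
have T t : traj_at gamma t.
  pose k := Num.floor (t / eta).
  have /andP[kt tk] : k%:~R * eta <= t < (k + 1)%:~R * eta.
    have := floor_itv (t / eta); rewrite ler_pdivlMr// ltr_pdivrMr//.
  have kk : traj_at (c k) t by apply: ct; rewrite kt ltW.
  have [tE|tn] := eqVneq t (k%:~R * eta).
    have kE : k = (k - 1) + 1 by rewrite subrK.
    have tkd : t + eta = (k + 1)%:~R * eta by rewrite intrD mulrDl mul1r -tE.
    have tkd' : t - eta = (k - 1)%:~R * eta by rewrite intrB mulrBl mul1r -tE.
    have k1 : traj_at (c (k - 1)) t.
      by apply: ct; rewrite subrK -tE lexx andbT -tkd' gerBl ltW.
    apply: (traj_glue (c1 := c (k - 1)) (c2 := c k) eta0) => //.
    - by move=> u u1 u2; apply: gE; [rewrite -tkd' ltW|rewrite subrK -tE].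
    - by move=> u u1 u2; apply: gE; [rewrite -tE|rewrite -tkd].
    - by rewrite tE; have := joint (k - 1); rewrite subrK.
  have lt1 : k%:~R * eta < t by rewrite lt_neqAle eq_sym tn.
  pose d := Num.min (t - k%:~R * eta) ((k + 1)%:~R * eta - t).
  have d0 : 0 < d by rewrite lt_min !subr_gt0 lt1.
  have da : d <= t - k%:~R * eta by rewrite ge_min lexx.
  have db : d <= (k + 1)%:~R * eta - t by rewrite ge_min lexx orbT.
  apply: (traj_glue (c1 := c k) (c2 := c k) d0) => // u u1 u2; apply: gE.
  - by move: da u1; lra.
  - by apply: lt_trans u2 _.
  - by apply: le_trans u1; exact: ltW.
  - by move: db u2; lra.
exists gamma; split; last first.
  by split=> [t|t a at_]; [have [] := T t|have [_] := T t; exact].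
have -> : gamma 0 = c 0 0.
  by apply: gE; [rewrite mul0r|rewrite add0r mul1r].
by rewrite -[c 0 0]/(e p (- (0%:R * eta) + 0)) mul0r oppr0 addr0 e0.
Qed.

End ReebFlow.

(** * Reeb trajectories as massless instantons *)

Section LinearReebMap.
Context {R : realType} {n : nat} {M : manifold R n.*2.+1} {lam : one_form M}
  {J : endo_field M} (tr : contact_triad lam J).
Local Notation m := n.*2.+1.
Implicit Types a : Defs.index M.
Context {gamma : R -> M} (rg : reeb_trajectory lam gamma) (alpha beta : R).

Definition ell (z : R * R) : R := alpha * z.1 + beta * z.2.
Definition reeb_map (z : R * R) : M := gamma (ell z).
Local Notation f := reeb_map.
Local Notation F a := (@Defs.coord R m M a \o f).
Local Notation O a := [set z : R * R | Defs.dom a (f z)].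
Local Notation D := (@full_cylinder R).

Let ell_add z h v : ell (z + h *: v) = ell z + h *: (ell v *: (1 : R)).
Proof.
by case: z v => [z1 z2] [v1 v2]; rewrite /ell/= /GRing.scale/= mulr1; ring.
Qed.

Lemma ell_continuous : continuous ell.
Proof.
move=> z; apply: cvgD; apply: cvgM; (try exact: cvg_cst); [exact: cvg_fst|exact: cvg_snd].
Qed.

Lemma reeb_map_continuous : continuous f.
Proof. by move=> z; apply: continuous_comp; [exact: ell_continuous|case: rg => c _; exact: c]. Qed.

Lemma reeb_map_open a : open (O a).
Proof.
have -> : O a = f @^-1` Defs.dom a by [].
by apply: open_comp; [move=> z _; exact: reeb_map_continuous|exact: dom_open].
Qed.

Lemma is_derive_reeb_map a z v : O a z -> is_derive z v (F a) (ell v *: reeb lam a (F a z)).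
Proof.
move=> Oz; have [_ /(_ _ a Oz) Dg] := rg.
have D2 := is_derive_dirZ (ell v) Dg.
apply/is_derive_distP => e e0; have [d d0 Hd] := (is_derive_distP _ _ _ _).1 D2 e e0.
exists d => // h hd h0; have := Hd h hd h0; rewrite -ell_add; exact.
Qed.

(** Its derivative is a constant times the smooth Reeb field along the map itself, so C^k implies
    C^(k+1). *)
Lemma reeb_map_smooth a : smooth_on (O a) (F a).
Proof.
have oO := @reeb_map_open a; have FO z : O a z -> cdom a (F a z) by move=> Oz; exists (f z).
have cF z : O a z -> {for z, continuous (F a)}.
  move=> Oz; apply: continuous_comp; first exact: reeb_map_continuous.
  exact: Defs.coord_continuous.
elim=> [|k IH]; first by split.
apply: CkS_intro => // v; exists (fun z => ell v *: reeb lam a (F a z)).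
  by move=> z; exact: is_derive_reeb_map.
apply/(Ck_rVP _ _ oO) => j.
apply: (@Ck_ext _ _ _ _ _ (fun z => ell v * ((fun x => reeb lam a x 0 j) \o F a) z)) => //.
  by move=> z _; rewrite mxE.
apply: Ck_mul => //; first exact: Ck_cst.
apply: (Ck_comp oO (@cdom_open _ _ _ a) FO _ IH).
exact: ((Ck_rVP _ _ (@cdom_open _ _ _ a)).1 (smooth_reeb tr a k) j).
Qed.

Lemma reeb_map_rep a : lrep D f a (O a) (F a).
Proof.
split; [exact: reeb_map_open|exact: reeb_map_smooth| |by []].
by move=> z Oz; exists (f z).
Qed.

Let Dz z : D z. Proof. by []. Qed.
Let Oz z : O (chart_at (f z)) z. Proof. exact: chart_at_dom. Qed.
Let DF z v : 'D_v (F (chart_at (f z))) z = ell v *: reeb lam (chart_at (f z)) (F (chart_at (f z)) z).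
Proof. by have [_] := is_derive_reeb_map v (Oz z). Qed.

Let cF z : cdom (chart_at (f z)) (F (chart_at (f z)) z).
Proof. by exists (f z) => //; exact: chart_at_dom. Qed.

Lemma pullback_reeb_map z v : pullback lam D f z v = ell v.
Proof.
apply: (etrans (pullback_rep admissible_full (reeb_map_rep (chart_at (f z))) (Dz z) (Oz z) v)).
rewrite DF linearZ/= (reebP tr (cF z)).1; exact: mulr1.
Qed.

Lemma reeb_map_delbar z v : delbar_pi lam J D f z v = 0.
Proof.
apply/(delbar_rep tr admissible_full (reeb_map_rep (chart_at (f z))) (Dz z) (Oz z)).
have E (x X : 'rV[R]_m) a (l k : R) : lam a x X = 1 -> J a x X = 0 ->
    l *: X - lam a x (l *: X) *: X + J a x (k *: X) = 0.
  move=> lX JX; have -> : J a x (k *: X) = 0 by rewrite linearZ/= JX scaler0.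
  have -> : lam a x (l *: X) = l by rewrite linearZ/= lX [LHS]mulr1.
  by rewrite addr0 subrr.
rewrite !DF; exact: (E _ _ _ _ _ (reebP tr (cF z)).1 (J_reeb tr (cF z))).
Qed.

Lemma reeb_map_closed z u v : ext_d D (fun q y => pullback lam D f q (cyl_j y)) z u v = 0.
Proof.
have E (y k : R * R) : derive_in D k (fun q => pullback lam D f q (cyl_j y)) z = 0.
  rewrite /derive_in (_ : (fun h => _) = (fun _ : R => 0 : R)).
    have PF := admissible_full k (Dz z).
    by apply: (@cvg_lim _ (@Rhausdorff R)); exact: cvg_cst.
  by apply/funext => h; rewrite !pullback_reeb_map subrr scaler0.
by rewrite /ext_d !E subr0.
Qed.

Lemma reeb_map_norm_dpi z : norm_sq_at lam J (f z) (dpi lam D f z) = 0.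
Proof.
apply: (etrans (norm_dpi_rep tr admissible_full (reeb_map_rep (chart_at (f z))) (Dz z) (Oz z))).
have H v : dform lam (chart_at (f z)) (F (chart_at (f z)) z) ('D_v (F (chart_at (f z))) z)
    (J (chart_at (f z)) (F (chart_at (f z)) z) ('D_v (F (chart_at (f z))) z)) = 0.
  by rewrite DF linearZ/= (J_reeb tr (cF z)) scaler0 (dform0r _ (cF z)).
exact: (etrans (f_equal2 (fun s t : R => s + t) (H (dd false)) (H (dd true))) (addr0 0)).
Qed.

Lemma reeb_map_massless : (forall x, gamma (x + beta) = gamma x) -> massless_instanton lam J f.
Proof.
move=> per; split; last first.
  rewrite /pi_energy /dpi_sq_integral integral0_eq ?mule0// => z _.
  by rewrite reeb_map_norm_dpi.
split.
- split=> [z _|z a _ az]; last first.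
    exists (O a), (F a); split=> //; [exact: reeb_map_open|exact: reeb_map_smooth].
  by rewrite /f (_ : ell (z + d_t R) = ell z + beta)// /ell/=; ring.
- by move=> z v _; exact: reeb_map_delbar.
- by move=> z u v _; exact: reeb_map_closed.
Qed.

End LinearReebMap.

(** * Subsequential limits *)

Section Translation.
Context {R : realType}.

Lemma derive_translate (V W : normedModType R) (f : V -> W) (c v : V) :
  'D_v (fun y => f (c + y)) = (fun y => 'D_v f (c + y)).
Proof.
apply/funext => z; rewrite /derive.
rewrite (_ : (fun h : R => _) =
  (fun h : R => h^-1 *: ((f \o shift (c + z)) (h *: v) - f (c + z))))//.
by apply/funext => h /=; rewrite addrCA.
Qed.

Lemma Ck_translate (V W : normedModType R) k (A : set V) (f : V -> W) (c : V) :
  Ck k A f -> Ck k ((fun y => c + y) @^-1` A) (fun y => f (c + y)).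
Proof.
have cc (y : V) : {for y, continuous (fun y : V => c + y)}.
  by apply: cvgD; [exact: cvg_cst|exact: cvg_id].
have ct g : (forall x, A x -> {for x, continuous g}) ->
    forall x, A (c + x) -> {for x, continuous (fun y => g (c + y) : W)}.
  by move=> cg x Ax; exact: (continuous_comp (cc x) (cg _ Ax)).
elim: k f => [|k IH] f Cf; first by split=> //; apply: ct => x; exact: Ck_cont Cf.
split; first by apply: ct => x; exact: Ck_cont Cf.
move=> v; split; last by rewrite derive_translate; exact: (IH ('D_v f) (CkS_derive v Cf)).
move=> x Ax; have [_ /(_ v)[/(_ _ Ax) df _]] := Cf.
move: df; rewrite /derivable.
rewrite [X in _ -> cvg (X @ _)](_ : _ =
  (fun h : R => h^-1 *: ((f \o shift (c + x)) (h *: v) - f (c + x))))//.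
by apply/funext => h /=; rewrite addrCA.
Qed.

End Translation.

Section IteratedDirectionalDerivatives.
Context {R : realType}.
Implicit Types f g : R * R -> R.

Lemma iterD_ext (V W : normedModType R) (A : set V) vs (f g : V -> W) x : open A ->
  (forall y, A y -> f y = g y) -> A x -> Defs.iterD vs f x = Defs.iterD vs g x.
Proof.
move=> oA fg; elim: vs x => [|v vs IH] x Ax /=; first exact: fg.
by apply: (D_ext_open oA v Ax) => y Ay; exact: IH.
Qed.

Lemma smooth_iterD (V W : normedModType R) (A : set V) vs (f : V -> W) : smooth_on A f ->
  smooth_on A (Defs.iterD vs f).
Proof. by elim: vs => //= v vs IH /IH; exact: smooth_derive. Qed.

Lemma smooth_sub (V : normedModType R) (A : set V) (f g : V -> R) : open A ->
  smooth_on A f -> smooth_on A g -> smooth_on A (fun x => f x - g x).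
Proof. by move=> oA Sf Sg k; exact: Ck_sub_fun. Qed.

Lemma iterD_sub (V : normedModType R) (A : set V) vs (f g : V -> R) x : open A ->
  smooth_on A f -> smooth_on A g -> A x ->
  Defs.iterD vs (fun y => f y - g y) x = Defs.iterD vs f x - Defs.iterD vs g x.
Proof.
move=> oA Sf Sg; elim: vs x => [//|v vs IH] x Ax /=.
apply: (etrans (D_ext_open oA v Ax IH)).
exact: (D1_sub v (smooth_iterD vs Sf 1%N) (smooth_iterD vs Sg 1%N) Ax).
Qed.

Lemma iterD_lin (V : normedModType R) (A : set V) vs (k l : R) (f g : V -> R) x : open A ->
  smooth_on A f -> smooth_on A g -> A x ->
  Defs.iterD vs (fun y => k * f y + l * g y) x = k * Defs.iterD vs f x + l * Defs.iterD vs g x.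
Proof.
move=> oA Sf Sg; elim: vs x => [//|v vs IH] x Ax /=.
apply: (etrans (D_ext_open oA v Ax IH)).
have Df := is_deriveZ k (CkS_is_derive v (smooth_iterD vs Sf 1%N) Ax).
have Dg := is_deriveZ l (CkS_is_derive v (smooth_iterD vs Sg 1%N) Ax).
by have [_ E] := is_deriveD Df Dg; exact: E.
Qed.

Lemma iterD_coord (V : normedModType R) m (A : set V) vs (F : V -> 'rV[R]_m) x j : open A ->
  smooth_on A F -> A x -> Defs.iterD vs F x 0 j = Defs.iterD vs (fun y => F y 0 j) x.
Proof.
move=> oA SF; elim: vs x => [//|v vs IH] x Ax /=.
have D := CkS_is_derive v (smooth_iterD vs SF 1%N) Ax.
have [df _] := D; rewrite -derive_coord//.
exact: (D_ext_open oA v Ax IH).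
Qed.

Lemma iterD_rcons (V W : normedModType R) vs v (f : V -> W) :
  Defs.iterD (rcons vs v) f = Defs.iterD vs ('D_v f).
Proof. by elim: vs => //= u vs ->. Qed.

Lemma itD_rcons beta b f : itD (rcons beta b) f = itD beta ('D_(dd b) f).
Proof. by rewrite /itD foldr_rcons. Qed.

(* Iterated derivatives in arbitrary directions are combinations of those in the
   coordinate directions. *)
Lemma iterD_family_bound (Idx : Type) (A : Idx -> set (R * R)) (x : Idx -> R * R) vs
  (f : Idx -> R * R -> R) : (forall i, open (A i)) -> (forall i, A i (x i)) ->
  (forall i, smooth_on (A i) (f i)) ->
  (forall beta, exists C : R, forall i, `|itD beta (f i) (x i)| <= C) ->
  exists C : R, forall i, `|Defs.iterD vs (f i) (x i)| <= C.
Proof.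
move=> oA Ax; elim/last_ind: vs f => [|vs v IH] f Sf Hf; first exact: (Hf [::]).
have Sd b i : smooth_on (A i) ('D_(dd b) (f i)) by exact: smooth_derive.
have Hd b : exists C : R, forall i, `|Defs.iterD vs ('D_(dd b) (f i)) (x i)| <= C.
  apply: IH => [|beta]; first exact: Sd.
  by have [C HC] := Hf (rcons beta b); exists C => i; rewrite -itD_rcons.
have [C0 H0] := Hd false; have [C1 H1] := Hd true.
exists (`|cc false v| * C0 + `|cc true v| * C1) => i; rewrite iterD_rcons.
have E : Defs.iterD vs ('D_v (f i)) (x i) =
    cc false v * Defs.iterD vs ('D_(dd false) (f i)) (x i) + cc true v * Defs.iterD vs ('D_(dd true) (f i)) (x i).
  apply: (etrans (iterD_ext vs (oA i) _ (Ax i))); last exact: (iterD_lin vs _ _ (oA i) (Sd false i) (Sd true i) (Ax i)).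
  by move=> y Ay; exact: derive_plane (oA i) Ay (Sf i 1%N).
have S (s t a b c d z : R) : z = a * s + b * t -> `|s| <= c -> `|t| <= d -> `|z| <= `|a| * c + `|b| * d.
  move=> -> sc td; rewrite (le_trans (ler_normD _ _))// !normrM.
  by apply: lerD; rewrite ler_wpM2l.
exact: (S _ _ _ _ _ _ _ E (H0 i) (H1 i)).
Qed.

(** One derivative by Landau's inequality, at the price of half the radius. [P e' i] records
    smallness of the original functions and stays the same under iteration, and [B] the range of
    indices with bounded second derivatives. *)
Lemma small_derivative (Idx : Type) (B : Idx -> Prop) (P : R -> Idx -> Prop) (z0 v : R * R) (r L : R)
  (f : Idx -> R * R -> R) : 0 < r -> 0 <= L ->
  (forall i, B i -> smooth_on [set z : R * R | `|z - z0| < r] (f i)) ->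
  (forall i, B i -> forall z : R * R, `|z - z0| < r -> `|'D_v ('D_v (f i)) z| <= L) ->
  (forall e : R, 0 < e -> exists2 e' : R, 0 < e' & forall i, P e' i ->
     B i /\ forall z : R * R, `|z - z0| < r -> `|f i z| <= e) ->
  forall e : R, 0 < e -> exists2 e' : R, 0 < e' & forall i, P e' i ->
    forall z : R * R, `|z - z0| < r / 2 -> `|'D_v (f i) z| <= e.
Proof.
move=> r0 L0 Sf HL Hf e e0.
have v1 : 0 < 1 + `|v| by rewrite ltr_pwDl.
have hm : 0 < r / 2 / (1 + `|v|) by rewrite !divr_gt0.
have [h [d [h0 hh d0 H]]] := landau_small e0 L0 hm.
have d2 : 0 < d / 2 by rewrite divr_gt0.
have [d' d'0 Hd'] := Hf _ d2; exists d' => // i /(Hd' i)[Bi fd] z zr.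
have hv : h * `|v| <= r / 2.
  move: hh; rewrite ler_pdivlMr// => /(le_trans _); apply.
  by rewrite ler_wpM2l ?lerDr// ltW.
have inb s : 0 <= s <= h -> `|z + s *: v - z0| < r.
  move=> /andP[s0 sh]; rewrite addrAC (le_lt_trans (ler_normD _ _))// normrZ ger0_norm//.
  have : s * `|v| <= h * `|v| by rewrite ler_wpM2r.
  by move: zr hv; lra.
have oB : open [set y : R * R | `|y - z0| < r] by exact: open_dist_lt.
have sh s : 0 <= s <= 1 -> 0 <= s * h <= h.
  move=> /andP[s0 s1]; rewrite mulr_ge0//= ?(ltW h0)// -[leRHS]mul1r ler_wpM2r// ltW//.
have Sd := smooth_derive v (Sf i Bi).
apply: H.
- by move=> s s01; have [] := CkS_is_derive v (Sf i Bi 1%N) (inb _ (sh s s01)).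
- move=> s s01; have /andP[sh0 sh1] := sh s s01.
  have [t /andP[t0 ts]|t /andP[t0 ts] ->] := mvt_line (f := 'D_v (f i)) (x := z) (v := v) sh0.
    have th : 0 <= t <= h by rewrite t0 (le_trans ts).
    by have [] := CkS_is_derive v (Sd 1%N) (inb _ th).
  rewrite normrM (ger0_norm sh0) mulrC; apply: ler_pM => //.
  by apply: HL => //; apply: inb; rewrite t0 (le_trans ts).
- rewrite (le_trans (ler_normB _ _))// [leRHS]splitr lerD// fd//.
    by apply: inb; rewrite lexx ltW.
  by apply: lt_trans zr _; rewrite ltr_pdivrMr// ltr_pMr// ltr1n.
Qed.

End IteratedDirectionalDerivatives.

(** * Uniform convergence near a point of convergence *)

Section Convergence.
Context {R : realType} {n : nat} {M : manifold R n.*2.+1} {lam : one_form M}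
  {J : endo_field M} (tr : contact_triad lam J) (compactM : compact [set: M]).
Local Notation m := n.*2.+1.
Implicit Types a : Defs.index M.
Local Notation D := (@half_cylinder R).
Context {w : R * R -> M} (inst : contact_instanton lam J D w)
  (wb : bounded_differential lam J D w).
Local Notation inner := (@inner R n M w).
Local Notation loc := (@loc R n M w).
Local Notation Q := (asymptotic_charge lam w).
Local Notation T := (asymptotic_action lam J w).
Local Notation ell := (@ell R (- Q) T).
Local Notation X a := (reeb lam a).

Let oI a := @inner_open _ _ _ lam J w inst a.
Let sI a := @smooth_loc _ _ _ lam J w inst a.
Let cI a q : inner a q -> cdom a (loc a q). Proof. by move=> [_ aq]; exists (w q). Qed.

Lemma xi_part_bound a (K : set 'rV[R]_m) : compact K -> K `<=` cdom a ->
  exists2 c : R, 0 < c & forall q, inner a q -> K (loc a q) -> forall b,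
  c * `|'D_(dd b) (loc a) q - lam a (loc a q) ('D_(dd b) (loc a) q) *: X a (loc a q)| ^+ 2 <=
  pE (lam := lam) (J := J) (w := w) q.
Proof.
move=> cK KA; have [c c0 Hc] := hform_coercive tr cK KA; exists c => // q Iq Kq b.
have Aq := cI Iq.
have Dq : D q by case: Iq => /ltW.
rewrite (pE_inner tr inst Iq).
apply: (le_trans (Hc _ _ Kq)).
have E v : hform (J := J) (lam := lam) a (loc a q) (v - lam a (loc a q) v *: X a (loc a q))
    (v - lam a (loc a q) v *: X a (loc a q)) = dform lam a (loc a q) v (J a (loc a q) v).
  rewrite -[v - _]/(xi_proj lam a (loc a q) v) /hform (dform_proj tr _ _ Aq) (J_proj tr _ Aq).
  by rewrite (lam_proj tr _ Aq) mulr0 addr0.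
rewrite E; case: b; last by rewrite lexx.
have S (x y : R) : x + y = 2 * x -> y <= x.
  by rewrite mulr2n mulrDl mul1r => /addrI ->.
apply: S; rewrite -(norm_dpi_inner tr inst Iq).
exact: esym (norm_dpi_rep tr admissible_half (inner_rep inst a) Dq Iq).
Qed.

(** The part of [du] in [xi] is controlled by [pE] through coercivity; its Reeb component is [pA] or
    [pB], which tend to the values of [ell] on the coordinate directions. *)
Lemma du_decay a (K : set 'rV[R]_m) (e : R) : compact K -> K `<=` cdom a -> 0 < e ->
  exists2 N : R, 1 <= N & forall x, N <= x.1 -> inner a x -> K (loc a x) -> forall b j,
  `|'D_(dd b) (fun y => loc a y 0 j) x - ell (dd b) * X a (loc a x) 0 j| <= e.
Proof.
move=> cK KA e0; have [c c0 Hc] := xi_part_bound cK KA.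
have [x /KA Ax|C C0 HC] := @compact_norm_bound R _ _ K (X a) cK.
  exact: Ck_cont (smooth_reeb tr a 0%N) Ax.
have C1 : 0 < C + 1 by rewrite ltr_pwDr.
have e2 : 0 < e / 2 by rewrite divr_gt0.
have ec : 0 < c * (e / 2) ^+ 2 by rewrite mulr_gt0// exprn_gt0.
have eC : 0 < e / 2 / (C + 1) by rewrite divr_gt0.
have [NE NE1 HE] := pE_decays tr compactM inst wb ec.
have [NA NA1 HA] := pA_decays tr compactM inst wb eC.
have [NB NB1 HB] := pB_decays tr compactM inst wb eC.
exists (NE + NA + NB); first by move: NE1 NA1 NB1; lra.
move=> x Nx Ix Kx b j.
have [xE xA xB] : [/\ NE <= x.1, NA <= x.1 & NB <= x.1].
  by move: NE1 NA1 NB1 Nx; split; lra.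
have H1 := Hc x Ix Kx b; have := HE x xE; have x10 : 0 < x.1 by case: Ix.
rewrite ger0_norm; last by apply: (pE_ge0 tr); exact: ltW.
move=> /(le_trans H1); rewrite ler_pM2l// ler_sqr ?nnegrE//; last exact: ltW.
move=> H2.
have H3 : `|lam a (loc a x) ('D_(dd b) (loc a) x) - ell (dd b)| <= e / 2 / (C + 1).
  have ef : ell (dd false) = - Q by rewrite /ell/= mulr1 mulr0 addr0.
  have et : ell (dd true) = T by rewrite /ell/= mulr1 mulr0 add0r.
  case: (b); rewrite ?ef ?et.
    by have := HB x xB; rewrite (pB_inner inst Ix).
  by have := HA x xA; rewrite (pA_inner inst Ix).
have DE : 'D_(dd b) (fun y => loc a y 0 j) x = 'D_(dd b) (loc a) x 0 j.
  by rewrite derive_coord//; have [] := CkS_is_derive (dd b) (@sI a 1%N) Ix.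
have H4 := le_trans (coord_le_norm _ j) H2.
have XC : `|X a (loc a x) 0 j| <= C := le_trans (coord_le_norm _ j) (HC _ Kx).
have S (d l k y z : R) : `|d - l * y| <= e / 2 -> `|l - k| <= e / 2 / (C + 1) -> `|y| <= C ->
    z = d -> `|z - k * y| <= e.
  move=> dl lk yC ->; rewrite (_ : d - k * y = (d - l * y) + (l - k) * y); last by ring.
  rewrite (le_trans (ler_normD _ _))// [leRHS]splitr lerD// normrM.
  apply: (@le_trans _ _ (e / 2 / (C + 1) * (C + 1))); last by rewrite divfK// gt_eqF.
  by apply: ler_pM => //; apply: (le_trans yC); rewrite lerDl.
by apply: (S _ _ _ _ _ _ H3 XC DE); move: H4; rewrite !mxE.
Qed.

Lemma reeb_lipschitz a (x0 : 'rV[R]_m) (r : R) : [set x | `|x - x0| <= r] `<=` cdom a ->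
  exists2 L : R, 0 <= L & forall j y z, `|y - x0| <= r -> `|z - x0| <= r ->
    `|X a y 0 j - X a z 0 j| <= L * `|y - z|.
Proof.
move=> KA; have oA := @cdom_open _ _ _ a.
have Lj j : exists L : R, 0 <= L /\ forall y z, `|y - x0| <= r -> `|z - x0| <= r ->
    `|X a y 0 j - X a z 0 j| <= L * `|y - z|.
  have [|L L0 HL] := ball_lipschitz oA KA (G := fun y => X a y 0 j).
    exact: ((Ck_rVP _ _ oA).1 (smooth_reeb tr a 1%N) j).
  by exists L; split=> // y z Ky Kz; exact: HL.
have [Lf HLf] := choice Lj.
exists (\sum_j Lf j); first by apply: sumr_ge0 => j _; case: (HLf j).
move=> j y z Ky Kz; have [L0 H] := HLf j; apply: (le_trans (H _ _ Ky Kz)).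
by rewrite ler_wpM2r// (bigD1 j)//= lerDl sumr_ge0// => i _; case: (HLf i).
Qed.

Lemma is_derive_translate (V W : normedModType R) (f : V -> W) (c x v : V) df :
  is_derive (c + x) v f df -> is_derive x v (fun y => f (c + y)) df.
Proof.
move=> /is_derive_distP H; apply/is_derive_distP => e /H[d d0 Hd]; exists d => // h hd h0.
by rewrite addrA; exact: Hd.
Qed.

Context {gamma : R -> M} (rg : reeb_trajectory lam gamma).
Context {s : nat -> R} (s_infty : s @ \oo --> +oo).
Local Notation f := (@reeb_map R n M gamma (- Q) T).
Local Notation F a := (@Defs.coord R m M a \o f).
Let c k : R * R := (s k, 0).
Let W k z : M := w (c k + z).

Definition converges_at (z : R * R) := (fun k => w ((s k, 0) + z)) @ \oo --> f z.

Let s_large (N : R) : \forall k \near \oo, N <= s k.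
Proof. by move/cvgryPge : s_infty => /(_ N). Qed.

Lemma chart_converges a z : Defs.dom a (f z) ->
  (forall e : R, 0 < e -> \forall k \near \oo, inner a (c k + z) /\ `|loc a (c k + z) - F a z| <= e) ->
  converges_at z.
Proof.
move=> az H U nU; have cz : cdom a (F a z) by exists (f z).
have := param_continuous cz; rewrite /prop_for/continuous_at /= coordK// => /(_ U nU).
move=> /nbhs_distP[d d0 Hd]; have d2 : 0 < d / 2 by rewrite divr_gt0.
apply: (@filterS _ \oo _ _ _ _ (H _ d2)) => k [Ik lk] /=.
rewrite -(coordK Ik.2); apply: Hd; apply: le_lt_trans lk _.
by rewrite ltr_pdivrMr// ltr_pMr// ltr1n.
Qed.

(** A short-time Gronwall argument: on segments so short that length times Lipschitz constant is at
    most 1/2, the largest distance [S] to the Reeb map is at most a small quantity plus [S / 2]. The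
    radius depends on [z0] only and not on the point [z] where convergence is known. *)
Lemma spread a z0 : Defs.dom a (f z0) -> exists2 r : R, 0 < r &
  forall z, `|z - z0| < r -> converges_at z -> forall e : R, 0 < e ->
  \forall k \near \oo, forall z', `|z' - z0| < r ->
    inner a (c k + z') /\ `|loc a (c k + z') - F a z'| <= e.
Proof.
move=> az0; set x0 := Defs.coord a (f z0); have cx0 : cdom a x0 by exists (f z0).
have [rho rho0 KA] := chart_ball cx0; have cK := @rV_ball_compact _ _ x0 (2 * rho).
have [rs [rs0 rs1 Hst]] := staying tr inst wb rho0 KA.
have [L L0 HL] := reeb_lipschitz KA.
have oO := @reeb_map_open _ _ _ _ _ rg (- Q) T a.
have SF := reeb_map_smooth tr rg (- Q) T a.
have rho2 : 0 < rho / 2 by rewrite divr_gt0.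
have [rf rf0 Hf] : exists2 rf : R, 0 < rf & forall z, `|z - z0| < rf ->
    Defs.dom a (f z) /\ `|F a z - x0| < rho / 2.
  have [d1 d10 H1] := open_distP oO az0.
  have [d2 d20 H2] := (continuous_distP _ _).1 (Ck_cont (SF 0%N) az0) _ rho2.
  exists (Num.min d1 d2) => [|z]; first by rewrite lt_min d10.
  by rewrite lt_min => /andP[/H1 ? /H2 ?].
pose Lam := `|Q| + `|T|; have Lam0 : 0 <= Lam by rewrite addr_ge0.
have LL1 : 0 < 4 * (Lam * L + 1) by rewrite mulr_gt0// ltr_wpDl// mulr_ge0.
(* The three bounds keep the Reeb map within [rho / 2] of [x0], keep [w] in the chart by [staying],
   and make [Lam * (2 * r) * L] at most 1/2. *)
pose r := Num.min rf (Num.min (rs / 2) (4 * (Lam * L + 1))^-1).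
have r0 : 0 < r by rewrite !lt_min rf0 divr_gt0// invr_gt0.
have r_rf : r <= rf by rewrite ge_min lexx.
have r_rs : 2 * r <= rs.
  by rewrite mulrC -ler_pdivlMr// ge_min ge_min lexx orbT.
have r_L : Lam * (2 * r) * L <= 2^-1.
  have : r <= (4 * (Lam * L + 1))^-1 by rewrite ge_min ge_min lexx !orbT.
  rewrite -[leRHS]mul1r ler_pdivlMr// => H.
  rewrite (_ : Lam * (2 * r) * L = 2 * (r * (Lam * L))); last by ring.
  have G (p q : R) : 0 < p -> p * (4 * (q + 1)) <= 1 -> 2 * (p * q) <= 2^-1.
    by move=> p0; rewrite (_ : p * (4 * (q + 1)) = 4 * (p * q) + 4 * p); [lra|ring].
  exact: G H.
exists r => // z zr cz e e0.
(* The initial distance costs [e / 8] and the two directions in [du_decay] as much each; absorbing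
   [S / 2] doubles the sum to [6 / 8 * e]. *)
have e8 : 0 < e / 8 by rewrite divr_gt0.
have [N N1 HN] := du_decay cK KA e8.
have em : 0 < Num.min (rho / 2) (e / 8) by rewrite lt_min rho2.
have [az Fz] := Hf z (lt_le_trans zr r_rf).
have nb : nbhs (f z) [set q | Defs.dom a q /\
    `|Defs.coord a q - F a z| < Num.min (rho / 2) (e / 8)].
  apply: filterI; first by apply: open_nbhs_nbhs; split=> //; exact: dom_open.
  have cp := Defs.coord_continuous az.
  by apply: (cp [set y | `|y - F a z| < _]); apply: open_nbhs_nbhs; split; [exact: open_dist_lt|rewrite /= subrr normr0].
have near_z : \forall k \near \oo, Defs.dom a (w (c k + z)) /\
    `|Defs.coord a (w (c k + z)) - F a z| < Num.min (rho / 2) (e / 8) := cz _ nb.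
have near_s := s_large (N + 1 + `|z|).
apply: (@filterS _ \oo _ _ _ _ (filterI near_z near_s)) => k [[akz ukz] sk] z' zr'.
have ckz y : `|y - z| < 1 -> N <= (c k + y).1.
  move=> /pair_norm_ltP/(_ false); rewrite ccB /= => yz.
  have /pair_norm_leP/(_ false)/= := lexx `|z|; move: yz sk.
  by rewrite ltr_norml ler_norml => /andP[y1 _] sk /andP[z1 _]; lra.
move: ukz; rewrite lt_min => /andP[ukz1 ukz2].
have zz1 : `|z - z| < 1 by rewrite subrr normr0.
have H y : `|y - (c k + z)| < rs -> inner a y /\ `|loc a y - x0| <= 2 * rho.
  apply: Hst => //; first by apply: le_trans (ckz z zz1); apply: le_trans N1.
  rewrite -(subrKA (F a z)) (le_lt_trans (ler_normD _ _))//.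
  by rewrite [ltRHS]splitr ltrD.
pose v := z' - z.
have vr : `|v| < 2 * r.
  rewrite /v -(subrKA z0) (le_lt_trans (ler_normD _ _))// mulr2n mulrDl mul1r ltrD//.
  by rewrite distrC.
have vrs := lt_le_trans vr r_rs.
have v1 : `|v| <= 1 by apply: (le_trans (ltW vrs)).
have sv (t : R) : 0 <= t <= 1 -> `|t *: v| <= `|v|.
  by move=> /andP[t0 t1]; rewrite normrZ (ger0_norm t0) -[leRHS]mul1r ler_wpM2r.
have ptI (t : R) : 0 <= t <= 1 -> inner a (c k + (z + t *: v)) /\ `|loc a (c k + (z + t *: v)) - x0| <= 2 * rho.
  move=> t01; apply: H; rewrite opprD addrACA subrr add0r addrAC subrr add0r.
  exact: le_lt_trans (sv t t01) vrs.
have ptF (t : R) : 0 <= t <= 1 -> Defs.dom a (f (z + t *: v)) /\ `|F a (z + t *: v) - x0| < rho / 2.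
  move=> /andP[t0 t1]; apply: Hf; apply: lt_le_trans r_rf.
  have -> : z + t *: v - z0 = (1 - t) *: (z - z0) + t *: (z' - z0).
    rewrite /v scalerBl scale1r !scalerBr.
    by apply: injective_projections; rewrite /= /GRing.scale/=; ring.
  rewrite (le_lt_trans (ler_normD _ _))// !normrZ (ger0_norm t0) ger0_norm ?subr_ge0//.
  have S (p q : R) : p < r -> q < r -> 0 <= p -> 0 <= q -> (1 - t) * p + t * q < r.
    move=> pr qr p0 q0; have [tE|tn] := eqVneq t 0; first by rewrite tE; lra.
    have tp : 0 < t by rewrite lt_neqAle eq_sym tn.
    have H1 : (1 - t) * p <= (1 - t) * r by rewrite ler_wpM2l ?subr_ge0// ltW.
    have H2 : t * q < t * r by rewrite ltr_pM2l.
    by move: H1 H2; rewrite mulrBl mul1r mulrBl mul1r; lra.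
  exact: S.
pose g (y : R * R) : 'rV[R]_m := loc a (c k + y) - F a y.
have cg t : 0 <= t <= 1 -> {for t, continuous (fun t : R => `|g (z + t *: v)|)}.
  move=> t01; have [It _] := ptI t t01; have [Ft _] := ptF t t01.
  have cg0 : {for z + t *: v, continuous g}.
    apply: continuousB; last exact: Ck_cont (SF 0%N) Ft.
    apply: (@continuous_comp _ _ _ (fun y => c k + y) (loc a)); last exact: Ck_cont (@sI a 0%N) It.
    by apply: cvgD; [exact: cvg_cst|exact: cvg_id].
  have cl : {for t, continuous (fun t : R => z + t *: v)}.
    by apply: continuousD; [exact: cvg_cst|apply: continuousZr_tmp; exact: cvg_id].
  have c2 := continuous_comp cl cg0.
  by apply: continuous_comp c2 _; exact: norm_continuous.
have [t0 t0I tmax] : exists2 t0 : R, 0 <= t0 <= 1 & forall t, 0 <= t <= 1 ->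
    `|g (z + t *: v)| <= `|g (z + t0 *: v)|.
  have [|t0 + tm] := @EVT_max R (fun t => `|g (z + t *: v)|) 0 1 ler01.
    by apply: continuous_in_subspaceT => t; rewrite inE/= in_itv/=; exact: cg.
  by rewrite in_itv/= => t0I; exists t0 => // t t01; apply: tm; rewrite in_itv/=.
set S := `|g (z + t0 *: v)| in tmax.
have S0 : 0 <= S := normr_ge0 _.
(* The mean value theorem up to the parameter of largest distance: the error of [du] gives
   [2 * (e / 8)], and the variation of the Reeb field between the two maps gives at most [S / 2]. *)
have step : `|g (z + t0 *: v) - g z| <= 2 * (e / 8) + S / 2.
  have nn : 0 <= 2 * (e / 8) + S / 2 by rewrite addr_ge0// ?mulr_ge0// ?divr_ge0// ltW.
  apply: rV_norm_le => // j.
  have /andP[t00 t01] := t0I.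
  pose gj (y : R * R) : R := loc a (c k + y) 0 j - F a y 0 j.
  have Dg (t : R) : 0 <= t <= t0 -> is_derive (z + t *: v) v gj
     ('D_v (fun y => loc a y 0 j) (c k + (z + t *: v)) - ell v * X a (F a (z + t *: v)) 0 j).
    move=> /andP[ta tb]; have tI : 0 <= t <= 1 by rewrite ta (le_trans tb).
    have [It _] := ptI t tI; have [Ft _] := ptF t tI.
    apply: is_deriveB.
      apply: (is_derive_translate (f := fun y => loc a y 0 j)).
      exact: CkS_is_derive ((Ck_rVP _ _ (@oI a)).1 (@sI a 1%N) j) It.
    have DF := (is_derive_rVP _ _ _ _).1 (is_derive_reeb_map rg v Ft) j.
    by apply: (is_derive_eq DF); rewrite mxE.
  have [t tI|t tI E] := mvt_line (f := gj) (x := z) (v := v) t00.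
    by have [] := Dg t tI.
  have -> : (g (z + t0 *: v) - g z) 0 j = gj (z + t0 *: v) - gj z by rewrite !mxE.
  rewrite E normrM (ger0_norm t00) -[leRHS]mul1r; apply: ler_pM => //.
  have [_ ->] := Dg t tI.
  have /andP[ta tb] := tI; have tI' : 0 <= t <= 1 by rewrite ta (le_trans tb).
  have [It Kt] := ptI t tI'; have [Ft Ft2] := ptF t tI'.
  have Nt : N <= (c k + (z + t *: v)).1.
    apply: ckz; rewrite addrAC subrr add0r; apply: (le_lt_trans (sv t tI')).
    exact: lt_le_trans vrs rs1.
  have Kt2 : `|F a (z + t *: v) - x0| <= 2 * rho by move: Ft2 rho0; move: `|_ - x0| => q; lra.
  have HX := HL j _ _ Kt Kt2.
  have Dt b := HN _ Nt It Kt b j.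
  have CU : Ck 1 (inner a) (fun y => loc a y 0 j) := (Ck_rVP _ _ (@oI a)).1 (@sI a 1%N) j.
  have E2 := derive_plane v (@oI a) It CU.
  have gS : `|loc a (c k + (z + t *: v)) - F a (z + t *: v)| <= S := tmax t tI'.
  have ellE : ell v = cc false v * ell (dd false) + cc true v * ell (dd true).
    by rewrite /ell /= !mulr1 !mulr0 addr0 add0r !(mulrC v.1) !(mulrC v.2).
  have ellv : `|ell v| * L <= 2^-1.
    apply: le_trans r_L; rewrite ler_wpM2r//.
    have /pair_norm_leP Hv := ltW vr; have Hv1 := Hv false; have Hv2 := Hv true.
    rewrite /ell (le_trans (ler_normD _ _))// !normrM normrN /Lam mulrDl.
    by apply: lerD; rewrite ler_wpM2l.
  have /pair_norm_leP V1 := v1.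
  have G (d v1' v2' d1 d2 l1 l2 l xu xf gg : R) : d = v1' * d1 + v2' * d2 -> l = v1' * l1 + v2' * l2 ->
      `|v1'| <= 1 -> `|v2'| <= 1 -> `|d1 - l1 * xu| <= e / 8 -> `|d2 - l2 * xu| <= e / 8 ->
      `|xu - xf| <= L * gg -> gg <= S -> `|l| * L <= 2^-1 -> `|d - l * xf| <= 2 * (e / 8) + S / 2.
    move=> dE lE a1 a2 b1 b2 xx gS' lL.
    have -> : d - l * xf = v1' * (d1 - l1 * xu) + v2' * (d2 - l2 * xu) + l * (xu - xf).
      by rewrite dE lE; ring.
    rewrite (le_trans (ler_normD _ _))//; apply: lerD.
      rewrite (le_trans (ler_normD _ _))// mulr2n mulrDl mul1r !normrM.
      by apply: lerD; rewrite -[leRHS]mul1r; apply: ler_pM.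
    rewrite normrM; apply: (@le_trans _ _ (`|l| * (L * S))).
      by rewrite ler_wpM2l// (le_trans xx)// ler_wpM2l.
    by rewrite mulrA mulrC ler_wpM2l.
  exact: (G _ _ _ _ _ _ _ _ _ _ _ E2 ellE (V1 false) (V1 true) (Dt false) (Dt true) HX gS ellv).
have Sle : S <= e.
  have gz : `|g z| < e / 8 by exact: ukz2.
  have : S <= `|g z| + `|g (z + t0 *: v) - g z|.
    by rewrite /S -{1}[g (z + t0 *: v)](subrK (g z)) addrC ler_normD.
  move: gz step; move: `|g z| `|_ - g z| S0 e0 => p q; lra.
have i01 : 0 <= (1 : R) <= 1 by rewrite ler01 lexx.
have zE : z + 1 *: v = z' by rewrite scale1r /v addrC subrK.
have [I1 _] := ptI 1 i01; have G1 := tmax 1 i01; rewrite zE in I1 G1.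
by split=> //; exact: le_trans G1 Sle.
Qed.

End Convergence.

(** * Convergence of all derivatives *)

Section SmoothConvergence.
Context {R : realType} {n : nat} {M : manifold R n.*2.+1} {lam : one_form M}
  {J : endo_field M} (tr : contact_triad lam J) (compactM : compact [set: M]).
Local Notation m := n.*2.+1.
Implicit Types a : Defs.index M.
Local Notation D := (@half_cylinder R).
Context {w : R * R -> M} (inst : contact_instanton lam J D w)
  (wb : bounded_differential lam J D w).
Local Notation inner := (@inner R n M w).
Local Notation loc := (@loc R n M w).
Local Notation Q := (asymptotic_charge lam w).
Local Notation T := (asymptotic_action lam J w).
Context {gamma : R -> M} (rg : reeb_trajectory lam gamma).
Context {s : nat -> R} (s_infty : s @ \oo --> +oo).
Local Notation f := (@reeb_map R n M gamma (- Q) T).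
Local Notation F a := (@Defs.coord R m M a \o f).
Local Notation c := (fun k => (s k, 0) : R * R).
Local Notation conv := (@converges_at R n M lam J w gamma s).

Let oI a := @inner_open _ _ _ lam J w inst a.
Let sI a := @smooth_loc _ _ _ lam J w inst a.

Let s_large (N : R) : \forall k \near \oo, N <= s k.
Proof. by move/cvgryPge : s_infty => /(_ N). Qed.

(** The continuity method along the segment from 0 to [z]. Closedness holds because the radius in
    [spread] is tied to the limit point, so an earlier point of convergence lies within it. *)
Lemma converges_everywhere : conv 0 -> forall z, conv z.
Proof.
move=> conv0 z; rewrite -[z]scale1r.
have spreads z0 : exists2 r : R, 0 < r &
    forall y, `|y - z0| < r -> conv y -> forall y', `|y' - z0| < r -> conv y'.
  have az0 : Defs.dom (chart_at (f z0)) (f z0) by exact: chart_at_dom.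
  have [r1 r10 H1] := spread tr compactM inst wb rg s_infty az0.
  have [r2 r20 H2] := open_distP (@reeb_map_open _ _ _ _ _ rg (- Q) T (chart_at (f z0))) az0.
  exists (Num.min r1 r2) => [|y + cy y']; first by rewrite lt_min r10.
  rewrite !lt_min => /andP[yr1 _] /andP[y'r1 /H2 ay'].
  apply: (chart_converges ay') => e e0.
  apply: (@filterS _ \oo _ _ _ _ (H1 y yr1 cy e e0)) => k; exact.
have dz (t t' : R) : `|t *: z - t' *: z| <= `|t - t'| * (1 + `|z|).
  by rewrite -scalerBl normrZ ler_wpM2l// lerDr.
have z1 : 0 < 1 + `|z| by rewrite ltr_pwDl.
apply: (@segment_induction _ (fun t => conv (t *: z))); first by rewrite scale0r.
- move=> t _ ct; have [r r0 Hr] := spreads (t *: z).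
  exists (r / (1 + `|z|)) => [|t']; first by rewrite divr_gt0.
  rewrite ltr_pdivlMr// => tt'; apply: (Hr _ _ ct); first by rewrite subrr normr0.
  exact: le_lt_trans (dz _ _) tt'.
- move=> t /andP[t0 t1] ct; have [r r0 Hr] := spreads (t *: z).
  have d0 : 0 < r / (1 + `|z|) by rewrite divr_gt0.
  pose t' := Num.max 0 (t - r / (1 + `|z|) / 2).
  have t'0 : 0 <= t' by rewrite le_max lexx.
  have t't : t' < t by rewrite gt_max t0 ltrBlDr ltrDl divr_gt0.
  have tt' : `|t' - t| < r / (1 + `|z|).
    rewrite distrC gtr0_norm ?subr_gt0//.
    have : t - r / (1 + `|z|) / 2 <= t' by rewrite le_max lexx orbT.
    by move: d0; move: (r / _) => q; lra.
  have ct' : conv (t' *: z) by apply: ct; rewrite t'0.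
  apply: (Hr _ _ ct'); last by rewrite subrr normr0.
  by apply: le_lt_trans (dz _ _) _; rewrite -ltr_pdivlMr.
- by rewrite ler01 lexx.
Qed.

Lemma itD_translate beta (g : R * R -> R) (b : R * R) :
  itD beta (fun y => g (b + y)) = (fun y => itD beta g (b + y)).
Proof. by elim: beta => //= b' beta ->; exact: derive_translate. Qed.

Hypothesis conv_all : forall z, conv z.

Section Local.
Context {a : Defs.index M} {z0 : R * R} (az0 : Defs.dom a (f z0)).

(** For [r <= 1] the bound [2 + |z0|] guarantees [1 <= x.1] at all translated points of the ball,
    where the uniform derivative bounds are available. *)
Let P (r e : R) (k : nat) := 2 + `|z0| <= s k /\ forall z, `|z - z0| < r ->
  inner a ((s k, 0) + z) /\ `|loc a ((s k, 0) + z) - F a z| <= e.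
Let g j k (y : R * R) : R := loc a ((s k, 0) + y) 0 j - F a y 0 j.

Lemma local_setup : exists r delta : R, [/\ 0 < r, 0 < delta,
  forall z, `|z - z0| < r -> Defs.dom a (f z),
  forall e : R, 0 < e -> \forall k \near \oo, P r e k &
  forall vs j, exists2 L : R, 0 <= L & forall k, P r delta k -> forall z, `|z - z0| < r ->
    `|Defs.iterD vs (g j k) z| <= L].
Proof.
set x0 := Defs.coord a (f z0); have cx0 : cdom a x0 by exists (f z0).
have [r1 r10 H1] := spread tr compactM inst wb rg s_infty az0.
have oO := @reeb_map_open _ _ _ _ _ rg (- Q) T a.
have SF := reeb_map_smooth tr rg (- Q) T a.
have [r2 r20 H2] := open_distP oO az0.
have [V [nV VI VB]] := loc_unif tr inst wb az0.
(* The factor 2 leaves room for two distances of at most [delta]: from [loc a] to the Reeb map and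
   from there to [x0]. *)
have [delta delta0 Hd] : exists2 d : R, 0 < d & forall x, `|x - x0| < 2 * d -> V (Defs.param a x).
  have := param_continuous cx0; rewrite /prop_for/continuous_at /= coordK// => /(_ V nV).
  move=> /nbhs_distP[d d0 Hd]; exists (d / 2); first by rewrite divr_gt0.
  by move=> x; rewrite mulrC divfK ?pnatr_eq0//; exact: Hd.
have [r3 r30 H3] := (continuous_distP _ _).1 (Ck_cont (SF 0%N) az0) _ delta0.
pose r := Num.min r1 (Num.min (r2 / 2) (Num.min r3 1)).
have r0 : 0 < r by rewrite !lt_min r10 divr_gt0// r30 ltr01.
have rr1 : r <= r1 by rewrite ge_min lexx.
have rr2 : r <= r2 / 2 by rewrite !ge_min lexx !orbT.
have rr3 : r <= r3 by rewrite !ge_min lexx !orbT.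
have rr4 : r <= 1 by rewrite !ge_min lexx !orbT.
have rlt2 (x : R) : x <= r -> x < r2 by move: rr2 r20; lra.
have z0r : `|z0 - z0| < r1 by rewrite subrr normr0.
have domO (z : R * R) : `|z - z0| < r -> Defs.dom a (f z) by move=> /ltW/rlt2; exact: H2.
exists r, delta; split=> //.
  move=> e e0; have Hs := H1 z0 z0r (@conv_all z0) e e0.
  apply: (@filterS _ \oo _ _ _ _ (filterI (s_large (2 + `|z0|)) Hs)) => k [sk Hk]; split=> // z zr.
  by apply: Hk; exact: lt_le_trans rr1.
move=> vs j.
have oB : open [set z : R * R | `|z - z0| < r] by exact: open_dist_lt.
pose Idx := {kz : nat * (R * R) | P r delta kz.1 /\ `|kz.2 - z0| < r}.
have Su k : P r delta k -> smooth_on [set z : R * R | `|z - z0| < r] (fun y => loc a ((s k, 0) + y) 0 j).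
  move=> [_ Hk] l; apply: (@Ck_sub _ _ _ _ _ _ _ _ (Ck_translate (s k, 0) ((Ck_rVP _ _ (@oI a)).1 (@sI a l) j))).
  by move=> z /Hk[].
have SFj : smooth_on [set z : R * R | `|z - z0| < r] (fun y => F a y 0 j).
  move=> l; apply: (@Ck_sub _ _ _ _ _ _ _ _ ((Ck_rVP _ _ oO).1 (SF l) j)) => z; exact: domO.
have [|||beta|C HC] := @iterD_family_bound R Idx (fun=> [set z : R * R | `|z - z0| < r])
    (fun i => (sval i).2) vs (fun i y => loc a ((s (sval i).1, 0) + y) 0 j).
- by move=> i.
- by move=> [[k z] [Pk zr]].
- by move=> [[k z] [Pk zr]]; exact: Su Pk.
- have [C HC] := VB beta; exists C => -[[k z] [/= [sk Hk] zr]].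
  rewrite (itD_translate beta (fun y => loc a y 0 j) (s k, 0)); have [Ik Lk] := Hk z zr.
  apply: (HC _ _ _).1 => //.
    move: zr => /pair_norm_ltP/(_ false); rewrite ccB /= ltr_norml => /andP[zr _].
    have /pair_norm_leP/(_ false)/= := lexx `|z0|; rewrite ler_norml => /andP[zz _].
    by move: sk zr zz rr4; lra.
  rewrite -(coordK Ik.2); apply: Hd.
  have Fz : `|F a z - x0| < delta by apply: H3; exact: lt_le_trans rr3.
  rewrite -(subrKA (F a z)) (le_lt_trans (ler_normD _ _))// mulr2n mulrDl mul1r.
  exact: ler_ltD.
have KO : [set z : R * R | `|z - z0| <= r] `<=` [set z | Defs.dom a (f z)].
  by move=> z /rlt2; exact: H2.
have SFO : smooth_on [set z | Defs.dom a (f z)] (fun y => F a y 0 j).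
  by move=> l; exact: ((Ck_rVP _ _ oO).1 (SF l) j).
have [z /KO Oz|C2 C20 HC2] := @compact_norm_bound R _ _ [set z : R * R | `|z - z0| <= r]
    (Defs.iterD vs (fun y => F a y 0 j)) (@box_compact R z0 r).
  exact: Ck_cont (smooth_iterD vs SFO 0%N) Oz.
exists (`|C| + C2) => [|k Pk z zr]; first by rewrite addr_ge0.
have E : Defs.iterD vs (g j k) z = Defs.iterD vs (fun y => loc a ((s k, 0) + y) 0 j) z -
    Defs.iterD vs (fun y => F a y 0 j) z := iterD_sub vs oB (Su k Pk) SFj zr.
rewrite E (le_trans (ler_normB _ _))//; apply: lerD; last by apply: HC2; exact: ltW.
have Hi : P r delta (k, z).1 /\ `|(k, z).2 - z0| < r by [].
exact: le_trans (HC (exist _ (k, z) Hi)) (ler_norm C).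
Qed.

(** Induction on [vs]: each further direction [v] uses a bound on the derivative along [v, v & vs]
    and halves the ball. *)
Lemma local_smooth_convergence vs j : exists2 r : R, 0 < r & forall e : R, 0 < e ->
  \forall k \near \oo, forall z, `|z - z0| < r -> `|Defs.iterD vs (g j k) z| <= e.
Proof.
have [r [delta [r0 delta0 rO rP rB]]] := local_setup.
have oO := @reeb_map_open _ _ _ _ _ rg (- Q) T a.
have SF := reeb_map_smooth tr rg (- Q) T a.
have Pmono e e' k : e <= e' -> P r e k -> P r e' k.
  by move=> ee [sk H]; split=> // z /H[Iz Lz]; split=> //; exact: le_trans ee.
have Sg k : P r delta k -> smooth_on [set z : R * R | `|z - z0| < r] (g j k).
  move=> [_ Hk]; apply: smooth_sub; first exact: open_dist_lt.
    move=> l; apply: (@Ck_sub _ _ _ _ _ _ _ _ (Ck_translate (s k, 0) ((Ck_rVP _ _ (@oI a)).1 (@sI a l) j))).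
    by move=> z /Hk[].
  move=> l; apply: (@Ck_sub _ _ _ _ _ _ _ _ ((Ck_rVP _ _ oO).1 (SF l) j)) => z; exact: rO.
suff [r' [r'0 _ H]] : exists r' : R, [/\ 0 < r', r' <= r & forall e : R, 0 < e ->
    exists2 e' : R, 0 < e' & forall k, P r e' k ->
      P r delta k /\ forall z, `|z - z0| < r' -> `|Defs.iterD vs (g j k) z| <= e].
  exists r' => // e /H[e' e'0 H']; apply: (@filterS _ \oo _ _ _ _ (rP _ e'0)) => k /H'; by case.
elim: vs => [|v vs [r1 [r10 r1r IH]]].
  exists r; split=> // e e0; exists (Num.min e delta) => [|k Pk]; first by rewrite lt_min e0.
  split; first by apply: Pmono Pk; rewrite ge_min lexx orbT.
  move=> z zr /=; have [_ /(_ z zr)[_ L]] := Pk.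
  have := coord_le_norm (loc a ((s k, 0) + z) - F a z) j; rewrite !mxE => /le_trans; apply.
  by apply: (le_trans L); rewrite ge_min lexx.
have [L L0 HL] := rB [:: v, v & vs] j.
exists (r1 / 2); split; first by rewrite divr_gt0.
  by move: r10 r1r; lra.
move=> e e0.
have [|||e' e'0 He'] := @small_derivative R nat (P r delta) (P r) z0 v r1 L
    (fun k => Defs.iterD vs (g j k)) r10 L0 _ _ _ e e0.
- move=> k Pk; apply: smooth_iterD => l; apply: Ck_sub (Sg k Pk l) => z /= zr.
  exact: lt_le_trans r1r.
- by move=> k Pk z zr; apply: (HL k Pk); exact: lt_le_trans r1r.
- exact: IH.
exists (Num.min e' delta) => [|k Pk]; first by rewrite lt_min e'0.
have P1 : P r e' k by apply: Pmono Pk; rewrite ge_min lexx.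
split; first by apply: Pmono Pk; rewrite ge_min lexx orbT.
exact: He' P1.
Qed.

End Local.

Lemma smooth_convergence (l : nat) (A : set (R * R)) :
  Cl_cvg l A (fun k p => w ((s k, 0) + p)) f.
Proof.
move=> a B cB _ fB; have dB z : B z -> Defs.dom a (f z) by move=> Bz; apply: fB; exists z.
have oO := @reeb_map_open _ _ _ _ _ rg (- Q) T a.
have SF := reeb_map_smooth tr rg (- Q) T a.
have in_chart : \forall k \near \oo, forall z, B z -> inner a ((s k, 0) + z).
  have /(_ nat \oo (fun k z => inner a ((s k, 0) + z)) _) H := (compact_near_coveringP B).1 cB.
  apply: H => z Bz; have [r [delta [r0 delta0 rO rP _]]] := local_setup (dB z Bz).
  exists ([set y | `|y - z| < r], [set k | forall y : R * R, `|y - z| < r -> inner a ((s k, 0) + y)]).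
    split=> /=; first by apply/nbhs_distP; exists r.
    apply: (@filterS _ \oo _ _ _ _ (rP _ delta0)) => k [_ Hk] y /Hk[]//.
  by move=> [y k] [/= yr]; exact.
split.
  by apply: (@filterS _ \oo _ _ _ _ in_chart) => k Hk _ [z Bz <-]; exact: (Hk z Bz).2.
move=> vs _ e e0; have e2 : 0 < e / 2 by rewrite divr_gt0.
have small j : \forall k \near \oo, forall z, B z ->
    `|Defs.iterD vs (fun y => loc a ((s k, 0) + y) 0 j - F a y 0 j) z| <= e / 2.
  have /(_ nat \oo (fun k z => `|Defs.iterD vs (fun y => loc a ((s k, 0) + y) 0 j - F a y 0 j) z| <= e / 2) _) H :=
    (compact_near_coveringP B).1 cB.
  apply: H => z Bz; have [r r0 H] := local_smooth_convergence (dB z Bz) vs j.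
  exists ([set y | `|y - z| < r], [set k | forall y : R * R, `|y - z| < r ->
      `|Defs.iterD vs (fun y => loc a ((s k, 0) + y) 0 j - F a y 0 j) y| <= e / 2]).
    by split=> /=; [apply/nbhs_distP; exists r|exact: H].
  by move=> [y k] [/= yr]; exact.
have all_small : \forall k \near \oo, forall j z, B z ->
    `|Defs.iterD vs (fun y => loc a ((s k, 0) + y) 0 j - F a y 0 j) z| <= e / 2.
  exact: filter_forall small.
apply: (@filterS _ \oo _ _ _ _ (filterI in_chart all_small)) => k [Ik Sk] z Bz.
have [Iz Oz] := (Ik z Bz, dB z Bz).
pose U : set (R * R) := ((fun y => (s k, 0) + y) @^-1` inner a) `&` [set y | Defs.dom a (f y)].
have oU : open U.
  apply: openI => //; apply: open_comp => [y _|]; last exact: oI.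
  by apply: cvgD; [exact: cvg_cst|exact: cvg_id].
have Uz : U z by [].
have Su : smooth_on U (fun y => loc a ((s k, 0) + y)).
  by move=> q; apply: Ck_sub (Ck_translate (s k, 0) (@sI a q)) => y [].
have SFU : smooth_on U (F a) by move=> q; apply: Ck_sub (SF q) => y [].
apply: le_lt_trans (_ : e / 2 < e); last by rewrite ltr_pdivrMr// ltr_pMr// ltr1n.
apply: rV_norm_le => [|j]; first exact: ltW.
have E1 := iterD_coord vs j oU Su Uz; have E2 := iterD_coord vs j oU SFU Uz.
have S1 : smooth_on U (fun y => loc a ((s k, 0) + y) 0 j).
  by move=> q; exact: ((Ck_rVP _ _ oU).1 (Su q) j).
have S2 : smooth_on U (fun y => F a y 0 j).
  by move=> q; exact: ((Ck_rVP _ _ oU).1 (SFU q) j).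
have := Sk j z Bz; rewrite (iterD_sub vs oU S1 S2 Uz) -E1 -E2 !mxE; exact.
Qed.

(** A unit step in t does not change [w] but advances the argument of [gamma] by [T]; the limits at
    both points agree since [M] is Hausdorff. *)
Lemma limit_periodic x : gamma (x + T) = gamma x.
Proof.
have [T0|T0] := eqVneq T 0; first by rewrite T0 addr0.
pose z : R * R := (0, x / T).
have ez : ell (- Q) T z = x by rewrite /ell/= mulr0 add0r mulrC divfK.
have ez' : ell (- Q) T (z + d_t R) = x + T.
  by rewrite /ell/= addr0 mulr0 add0r mulrDr mulr1 mulrC divfK.
rewrite -{1}ez' -[in RHS]ez -[LHS]/(f (z + d_t R)) -[RHS]/(f z).
have c1 := @conv_all z; have c2 := @conv_all (z + d_t R).
have c3 : (fun k => w ((s k, 0) + z)) @ \oo --> f (z + d_t R).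
  apply: cvg_trans c2; apply: near_eq_cvg.
  apply: (@filterS _ \oo _ _ _ _ (s_large 0)) => k sk.
  have [[per _] _ _] := inst; rewrite addrA per//.
  by rewrite /half_cylinder/= addr0.
exact: (cvg_unique (@manifold_hausdorff _ _ M) c3 c1).
Qed.

End SmoothConvergence.

(** * Convergent subsequences in a compact manifold *)

Section Subsequence.
Context {R : realType} {n : nat} {M : manifold R n.*2.+1}.

(** A chart at a cluster point supplies the countable neighbourhood basis [V] along which the
    indices are chosen. *)
Lemma cluster_subsequence (u : nat -> M) : compact [set: M] ->
  exists (phi : nat -> nat) (p : M), {homo phi : i j / (i < j)%N} /\ (u \o phi) @ \oo --> p.
Proof.
move=> cM; have [p [_ cp]] : [set: M] `&` cluster (u @ \oo) !=set0.
  by apply: cM; exact: filterT.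
have ap := chart_at_dom p; set a := chart_at p in ap; set x0 := Defs.coord a p.
have cx0 : cdom a x0 by exists p.
pose V (k : nat) : set M := [set q | Defs.dom a q /\ `|Defs.coord a q - x0| < k.+1%:R^-1].
have nV k : nbhs p (V k).
  have k0 : 0 < k.+1%:R^-1 :> R by rewrite invr_gt0.
  apply: filterI; first by apply: open_nbhs_nbhs; split=> //; exact: dom_open.
  have cc := Defs.coord_continuous ap.
  by apply: (cc [set z | `|z - x0| < _]); apply: open_nbhs_nbhs; split; [exact: open_dist_lt|rewrite /= subrr normr0].
have next (k N : nat) : exists i, (N <= i)%N /\ V k (u i).
  have tail : (u @ \oo) (u @` [set i | (N <= i)%N]).
    by exists N => // i Ni; exists i.
  by have [_ [[i Ni <-] Vi]] := cp _ _ tail (nV k); exists i.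
have [h Hh] := choice (fun kN : nat * nat => next kN.1 kN.2).
pose phi := fix phi k := if k is k'.+1 then h (k, (phi k').+1) else h (0%N, 0%N).
have phiV k : V k (u (phi k)) by case: k => [|k]; [case: (Hh (0%N, 0%N))|case: (Hh (k.+1, (phi k).+1))].
exists phi, p; split.
  by apply: homo_ltn; [exact: ltn_trans|move=> k; case: (Hh (k.+1, (phi k).+1))].
move=> U nU; have := param_continuous cx0; rewrite /prop_for/continuous_at /= coordK// => /(_ U nU).
move=> /nbhs_distP[d d0 Hd].
have [N HN] : exists N : nat, N.+1%:R^-1 < d.
  by have [k] := ltr_add_invr d0; rewrite add0r; exists k.
exists N => // k /= Nk; have [ak xk] := phiV k.
rewrite -(coordK ak); apply: Hd; apply: lt_trans xk _; apply: le_lt_trans HN.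
by rewrite lef_pV2 ?posrE// ler_nat.
Qed.

End Subsequence.

Theorem theorem6p4 (R : realType) (n : nat) (M : manifold R n.*2.+1)
    (lam : one_form M) (J : endo_field M)
    (triadM : contact_triad lam J) (compactM : compact [set: M])
    (w : R * R -> M)
    (w_instanton : contact_instanton lam J (@half_cylinder R) w)
    (w_energy : (dpi_sq_integral lam J (@half_cylinder R) w < +oo)%E)
    (w_bounded : bounded_differential lam J (@half_cylinder R) w)
    (T Q : R)
    (T_def : T = asymptotic_action lam J w)
    (Q_def : Q = asymptotic_charge lam w)
    (s : nat -> R) (s_infty : s @ \oo --> +oo) :
  exists (phi : nat -> nat) (w_infty : R * R -> M),
    [/\ {homo phi : i j / (i < j)%N},
        massless_instanton lam J w_infty,
        forall (K : set R) (l : nat), compact K -> K `<=` [set x | 0 <= x] ->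
          Cl_cvg l (K `*` [set: R])
            (fun k p => w (s (phi k) + p.1, p.2)) w_infty &
        exists gamma : R -> M,
          [/\ reeb_trajectory lam gamma,
              forall tau t, w_infty (tau, t) = gamma (- Q * tau + T * t) &
              T != 0 -> forall x, gamma (x + T) = gamma x]].
Proof.
have [phi [p [phi_mono wp]]] := cluster_subsequence (fun k => w (s k, 0)) compactM.
have [gamma [gamma0 rg]] := reeb_flow triadM compactM p.
have phi_ge k : (k <= phi k)%N by elim: k => // k /leq_ltn_trans; apply; exact: phi_mono.
have s_phi : (s \o phi) @ \oo --> +oo.
  apply/cvgryPge => N; move/cvgryPge : s_infty => /(_ N)[N0 _ HN].
  by exists N0 => // k /= N0k; apply: HN; exact: leq_trans (phi_ge k).
(* At [z = 0] the Reeb map takes the value [gamma 0 = p], the limit of the chosen points; from here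
   convergence spreads to the whole cylinder. *)
have conv0 : @converges_at R n M lam J w gamma (s \o phi) 0.
  rewrite /converges_at /reeb_map /ell /= !mulr0 addr0 gamma0.
  apply: cvg_trans wp; apply: near_eq_cvg; apply: nearW => k /=.
  by rewrite addr0.
have conv := converges_everywhere triadM compactM w_instanton w_bounded rg s_phi conv0.
have per := limit_periodic w_instanton s_phi conv.
exists phi, (reeb_map (gamma := gamma) (- Q) T); rewrite T_def Q_def; split=> //.
- have H := reeb_map_massless triadM rg (- asymptotic_charge lam w) per.
  exact: H.
- move=> K l _ _.
  rewrite (_ : (fun k q => _) = (fun k q => w (((s \o phi) k, 0) + q))).
    exact: (smooth_convergence triadM compactM w_instanton w_bounded rg s_phi conv).
  apply/funext => k; apply/funext => q; congr w.
  by apply: injective_projections => //=; rewrite add0r.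
- by exists gamma; split=> // tau t; rewrite /reeb_map /ell.
Qed.
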